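(* Let $s\in(\frac12,1)$ and let $V\in L^1(\mathbb{R},\langle x\rangle^{2s-1}\mathrm{d}x)\cap\mathcal{R}_{s,1}$ be real-valued. Let $v:=|V|^{1/2}$ and $u:=|V|^{1/2}\mathrm{sign}(V)$. (i) The operator $u(-\Delta)^{-\frac s2}v$ is compact on $L^2(\mathbb{R})$. Assume in addition that $u(-\Delta)^{-\frac s2}v\,\phi=-\phi$ for some $\phi\in L^2(\mathbb{R})\setminus\{0\}$, and define $\psi:=(-\Delta)^{-\frac s2}v\,\phi$. Then: (ii) $\psi\in L^2_{\mathrm{loc}}(\mathbb{R})$ and $((-\Delta)^{s/2}+V)\psi=0$ in the sense of distributions; (iii) $\langle v,\phi\rangle_{L^2}=-\int_{\mathbb{R}}V(x)\psi(x)\,\mathrm{d}x$; (iv) $\psi\in L^2(\mathbb{R})$ if and only if $\langle v,\phi\rangle_{L^2}=0$, in which case $\psi\in\mathcal{D}((-\Delta)^{s/2}+V)$.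
   Context: $\langle x\rangle:=(1+x^2)^{1/2}$. $\mathcal{R}_{s,1}$ is the class of measurable $V:\mathbb{R}\to\mathbb{C}$ with $\iint_{\mathbb{R}\times\mathbb{R}}\frac{|V(x)||V(y)|}{|x-y|^{2(1-s)}}\mathrm{d}x\,\mathrm{d}y<+\infty$. The operator $(-\Delta)^{-\frac s2}$ acts by convolution: $((-\Delta)^{-\frac s2}f)(x)=\int_{\mathbb{R}}\frac{\Lambda_s}{|x-y|^{1-s}}f(y)\,\mathrm{d}y$ with $\Lambda_s:=\frac{\Gamma(\frac{1-s}{2})}{(2\pi)^{1/2}2^{s-\frac12}\Gamma(\frac s2)}$ (i.e. Fourier multiplier $|p|^{-s}$), and $u(-\Delta)^{-\frac s2}v$ is the operator on $L^2(\mathbb{R})$ with integral kernel $u(x)\frac{\Lambda_s}{|x-y|^{1-s}}v(y)$. In (iv), $(-\Delta)^{s/2}+V$ denotes the self-adjoint operator on $L^2(\mathbb{R})$ defined as a form sum (with form domain $H^{s/2}(\mathbb{R})$), and $\mathcal{D}(\cdot)$ its operator domain. *)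

(* Defs.v *)
From HB Require Import structures.
From mathcomp Require Import all_boot all_order all_algebra.
From mathcomp Require Import complex.
From mathcomp Require Import all_classical all_reals all_analysis.

Set Implicit Arguments.
Unset Strict Implicit.
Unset Printing Implicit Defensive.

Import Order.TTheory GRing.Theory Num.Theory.
Import numFieldNormedType.Exports.
Import ComplexField.Normc.

Local Open Scope classical_set_scope.
Local Open Scope ring_scope.
Local Open Scope complex_scope.

(* Elements of L^2(R) = L^2(R; C) and of the other function spaces below are
   represented by Borel functions R -> R[i]; identities between them are stated
   almost everywhere. *)
Section Definitions.
Context {R : realType}.
Local Notation C := R[i].
Local Notation mu := (@lebesgue_measure R).
Implicit Types (s : R) (V w : R -> R) (f g h : R -> C).

Definition toC V : R -> C := fun x => (V x)%:C.

Definition cmeasurable f : Prop :=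
  measurable_fun setT (fun x => complex.Re (f x)) /\
  measurable_fun setT (fun x => complex.Im (f x)).

Definition cintegrable f : Prop :=
  mu.-integrable setT (fun x => (complex.Re (f x))%:E) /\
  mu.-integrable setT (fun x => (complex.Im (f x))%:E).

Definition cintegral f : C :=
  (\int[mu]_x complex.Re (f x))%R +i* (\int[mu]_x complex.Im (f x))%R.

Definition clocally_integrable f : Prop :=
  locally_integrable setT (fun x => complex.Re (f x)) /\
  locally_integrable setT (fun x => complex.Im (f x)).

Definition japanese (x : R) : R := Num.sqrt (1 + x ^+ 2).

(* f \in L^1(R, w(x) dx) *)
Definition weightedL1 w f : Prop :=
  cmeasurable f /\ (\int[mu]_x (normc (f x) * w x)%:E < +oo)%E.

(* The class R_{s,1}. *)
Definition rollnik s f : Prop :=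
  cmeasurable f /\
  (\int[(mu \x mu)%E]_z
     (normc (f z.1) * normc (f z.2) / `|z.1 - z.2| `^ (2 * (1 - s)))%:E
   < +oo)%E.

Definition L2norm f : \bar R := Lnorm mu 2%:E (fun x => (normc (f x))%:E).

Definition L2 f : Prop := cmeasurable f /\ (L2norm f < +oo)%E.

Definition L2loc f : Prop :=
  cmeasurable f /\
  forall K : set R, compact K ->
    (\int[mu]_(x in K) ((normc (f x)) ^+ 2)%:E < +oo)%E.

(* The inner product is antilinear in its first argument. *)
Definition L2inner f g : C := cintegral (fun x => (f x)^*%C * g x).

Definition L2cvg (F : nat -> R -> C) f : Prop :=
  (fun n => L2norm (fun x => F n x - f x)) @ \oo --> 0%E.

Definition compact_operator (T : (R -> C) -> R -> C) : Prop :=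
  [/\ forall f, L2 f -> L2 (T f),
      forall f g, L2 f -> L2 g -> ae_eq mu setT f g ->
        ae_eq mu setT (T f) (T g),
      forall (a : C) f g, L2 f -> L2 g ->
        ae_eq mu setT (T (fun x => a * f x + g x))
                      (fun x => a * T f x + T g x) &
      forall F : nat -> R -> C, (forall n, L2 (F n)) ->
        (exists M : R, forall n, (L2norm (F n) <= M%:E)%E) ->
        exists sigma : nat -> nat, exists g,
          [/\ forall m n, (m < n)%N -> (sigma m < sigma n)%N, L2 g &
              L2cvg (fun n => T (F (sigma n))) g]].

Definition kernel_op (k : R -> R -> C) f : R -> C :=
  fun x => cintegral (fun y => k x y * f y).

(* The integral defining kernel_op k f x converges absolutely for a.e. x; the
   library's integral takes a default value where it does not. *)
Definition kernel_converges (k : R -> R -> C) f : Prop :=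
  {ae mu, forall x, cintegrable (fun y => k x y * f y)}.

Definition Gamma (z : R) : R :=
  (\int[mu]_(t in `]0, +oo[) (t `^ (z - 1) * expR (- t)))%R.

Definition Lambda s : R :=
  Gamma ((1 - s) / 2) / (Num.sqrt (2 * pi) * 2 `^ (s - 2^-1) * Gamma (s / 2)).

(* The library's convention gives riesz_kernel s x x = 0; the diagonal is a
   null set. *)
Definition riesz_kernel s (x y : R) : C :=
  (Lambda s / `|x - y| `^ (1 - s))%:C.

Definition neg_frac_lap s f : R -> C := kernel_op (riesz_kernel s) f.

Definition sqrt_abs V : R -> R := fun x => Num.sqrt `|V x|.

Definition signed_sqrt_abs V : R -> R :=
  fun x => Num.sqrt `|V x| * Num.sg (V x).

(* The integral kernel of u (-Delta)^(-s/2) v. *)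
Definition birman_schwinger_kernel s V (x y : R) : C :=
  toC (signed_sqrt_abs V) x * riesz_kernel s x y * toC (sqrt_abs V) y.

Definition birman_schwinger s V : (R -> C) -> R -> C :=
  kernel_op (birman_schwinger_kernel s V).

Definition cis (t : R) : C := cos t +i* sin t.

Definition fourier f (p : R) : C :=
  ((Num.sqrt (2 * pi))^-1)%:C * cintegral (fun x => f x * cis (- (p * x))).

Definition inv_fourier f (x : R) : C :=
  ((Num.sqrt (2 * pi))^-1)%:C * cintegral (fun p => f p * cis (p * x)).

Definition smooth (f : R -> R) : Prop :=
  forall n x, derivable (derive1n n f) x 1.

Definition test_function f : Prop :=
  [/\ smooth (fun x => complex.Re (f x)), smooth (fun x => complex.Im (f x)) &
      exists M : R, forall x, M < `|x| -> f x = 0].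

(* (-Delta)^(s/2) on test functions, as the Fourier multiplier |p|^s. *)
Definition frac_lap s f : R -> C :=
  inv_fourier (fun p => (`|p| `^ s)%:C * fourier f p).

(* ((-Delta)^(s/2) + V) f = 0 in the sense of distributions, where
   (-Delta)^(s/2) f is the distribution eta |-> \int f (-Delta)^(s/2) eta. Since
   (-Delta)^(s/2) eta = O(<x>^(-1-s)) for every test function eta, this
   distribution is defined for f in L^1(R, <x>^(-1-s) dx). *)
Definition distributional_solution s V f : Prop :=
  [/\ weightedL1 (fun x => japanese x `^ (- 1 - s)) f,
      clocally_integrable (fun x => toC V x * f x) &
      forall eta, test_function eta ->
        cintegral (fun x => f x * frac_lap s eta x) +
        cintegral (fun x => toC V x * f x * eta x) = 0].

(* The Fourier-Plancherel transform: the L^2 limit of the Fourier transforms of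
   the truncations of f to [-n, n]. *)
Definition is_fourierL2 f F : Prop :=
  L2 F /\
  L2cvg (fun n => fourier (fun x => if `|x| <= n%:R then f x else 0)) F.

(* f \in H^r(R) *)
Definition sobolev (r : R) f : Prop :=
  L2 f /\ exists F, is_fourierL2 f F /\
    (\int[mu]_p ((1 + p ^+ 2) `^ r * normc (F p) ^+ 2)%:E < +oo)%E.

(* f lies in the operator domain of the form sum (-Delta)^(s/2) + V and g is its
   image: f \in H^(s/2) and q(h, f) = <h, g> for all h in the form domain
   H^(s/2), q(h, f) = \int |p|^s conj(h^) f^ dp + \int V conj(h) f dx. *)
Definition form_sum_graph s V f g : Prop :=
  [/\ sobolev (s / 2) f, L2 g &
      forall h, sobolev (s / 2) h ->
        cintegrable (fun x => toC V x * ((h x)^*%C * f x)) /\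
        forall F H, is_fourierL2 f F -> is_fourierL2 h H ->
          cintegral (fun p => (`|p| `^ s)%:C * ((H p)^*%C * F p)) +
          cintegral (fun x => toC V x * ((h x)^*%C * f x)) = L2inner h g].

Definition form_sum_domain s V f : Prop := exists g, form_sum_graph s V f g.

End Definitions.

(* Main.v *)
From HB Require Import structures.
From mathcomp Require Import all_boot all_order all_algebra.
From mathcomp Require Import complex.
From mathcomp Require Import all_classical all_reals all_analysis.
From mathcomp Require Import measurable_realfun.
From mathcomp Require Import ring lra.
Require Import Defs.
Set Implicit Arguments.
Unset Strict Implicit.
Unset Printing Implicit Defensive.
Import Order.TTheory GRing.Theory Num.Theory.
Import numFieldNormedType.Exports.
Import ComplexField.Normc.
Local Open Scope classical_set_scope.
Local Open Scope ring_scope.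

(** Write v = |V|^(1/2) and u = v sign V. The kernel of u(-Delta)^(-s/2)v has squared modulus
    Lambda^2 |V(x)||V(y)| |x-y|^(-2(1-s)), so V being in R_(s,1) says that the operator is
    Hilbert-Schmidt (birman_schwinger_hs). Compactness follows from the sequential
    characterization: a diagonal subsequence makes the pairings with a countable family
    that approximates all rows of the kernel converge (birman_schwinger_compact).

    Let phi be in the eigenspace of -1, f = v phi and psi the Riesz potential of f. The
    weight on V makes f integrable, even against <x>^(s-1/2). The eigenvalue equation is
    u psi = - phi, whence V psi = - f (resonance_equation); part (iii) is the integral of
    this identity.

    Part (ii). The Riesz kernel is a superposition of heat kernels with the weight
    t^(s/2-1), and |p|^(-s) is the same superposition of Gaussians exp(-tp^2). Since the
    heat kernel is the transform of the Gaussian, the Riesz potential is the Fourier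
    multiplier |p|^(-s) (riesz_inv_fourier, riesz_pairing). Paired with
    (-Delta)^(s/2) eta, which decays like 1/|x| at least (frac_lap_decay), psi gives the
    integral of f eta, and this cancels the integral of V psi eta. Local square
    integrability is that of the kernel, 2(s-1) > -1.

    Part (iv), first half. The kernels centred at y and at 0 differ by a function whose
    square has integral of order |y|^(2s-1), so that psi minus the integral of f times
    the kernel at 0 is square integrable (L2_neg_frac_lap_sub). The kernel itself is not
    (riesz_not_L2), so psi is square integrable exactly if f has integral zero.

    Part (iv), second half. The transform of a square-integrable psi is |p|^(-s) f^
    (fourierL2_neg_frac_lap). The superposition of heat kernels gives the energy
    inequality: the integral of |p|^(-s)|f^|^2 is at most the double integral of
    |f(x)| |x-y|^(s-1) |f(y)| up to Lambda, which the Hilbert-Schmidt bound controls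
    (riesz_energy, birman_schwinger_energy). Hence psi lies in H^(s/2). By duality the same
    inequality makes v h square integrable for every h in H^(s/2)
    (sobolev_sqrt_abs_L2), and Parseval's identity extends to the pairing of h with f
    (form_pairing). In the quadratic form at (h, psi) the kinetic part is then the
    integral of conj(h) f and the potential part is its negative, so that psi is in
    the operator domain with image zero. *)

(** * Measurability of explicit real functions *)

Section Measurability.
Context {R : realType} {d : measure_display} {T : measurableType d}.
Implicit Types f g : T -> R.

Lemma meas_cst (c : R) : measurable_fun setT (fun _ : T => c).
Proof. exact: measurable_cst. Qed.

Lemma meas_add f g : measurable_fun setT f -> measurable_fun setT g ->
  measurable_fun setT (fun x => f x + g x).
Proof. exact: measurable_funD. Qed.

Lemma meas_opp f : measurable_fun setT f -> measurable_fun setT (fun x => - f x).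
Proof. exact: measurable_funN. Qed.

Lemma meas_mul f g : measurable_fun setT f -> measurable_fun setT g ->
  measurable_fun setT (fun x => f x * g x).
Proof. exact: measurable_funM. Qed.

Lemma meas_abs f : measurable_fun setT f -> measurable_fun setT (fun x => `|f x|).
Proof. exact: measurableT_comp. Qed.

Lemma meas_expR f : measurable_fun setT f -> measurable_fun setT (fun x => expR (f x)).
Proof. move=> mf; apply: measurableT_comp => //; exact: measurable_expR. Qed.

Lemma meas_powR (a : R) f : measurable_fun setT f ->
  measurable_fun setT (fun x => f x `^ a).
Proof.
by move=> mf; apply: (measurableT_comp (f := fun y : R => y `^ a)).
Qed.

Lemma meas_pow (n : nat) f : measurable_fun setT f ->
  measurable_fun setT (fun x => f x ^+ n).
Proof. exact: measurable_funX. Qed.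

Lemma meas_continuous (h : R -> R) f : continuous h -> measurable_fun setT f ->
  measurable_fun setT (fun x => h (f x)).
Proof.
move=> ch mf; apply: (measurableT_comp (f := h)) => //.
exact: continuous_measurable_fun.
Qed.

Lemma meas_cos f : measurable_fun setT f -> measurable_fun setT (fun x => cos (f x)).
Proof. by apply: meas_continuous; exact: continuous_cos. Qed.

Lemma meas_sin f : measurable_fun setT f -> measurable_fun setT (fun x => sin (f x)).
Proof. by apply: meas_continuous; exact: continuous_sin. Qed.

Lemma meas_sqrt f : measurable_fun setT f ->
  measurable_fun setT (fun x => Num.sqrt (f x)).
Proof. by apply: meas_continuous; exact: sqrt_continuous. Qed.

Lemma meas_inv f : measurable_fun setT f -> measurable_fun setT (fun x => (f x)^-1).
Proof.
move=> mf.
have -> : (fun x => (f x)^-1) = (fun x => f x * (`|f x| `^ (-1)) ^+ 2).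
  apply/funext => x; rewrite powRN powRr1// exprVn real_normK ?num_real//.
  have [->|fx0] := eqVneq (f x) 0; first by rewrite invr0 mul0r.
  by rewrite expr2 invfM mulrA divff// mul1r.
by apply: meas_mul => //; apply: meas_pow; apply: meas_powR; exact: meas_abs.
Qed.

Lemma meas_ltr f g : measurable_fun setT f -> measurable_fun setT g ->
  measurable_fun setT (fun x => f x < g x).
Proof. exact: measurable_fun_ltr. Qed.

Lemma meas_ler f g : measurable_fun setT f -> measurable_fun setT g ->
  measurable_fun setT (fun x => f x <= g x).
Proof. exact: measurable_fun_ler. Qed.

Lemma meas_if (b : T -> bool) f g : measurable_fun setT b ->
  measurable_fun setT f -> measurable_fun setT g ->
  measurable_fun setT (fun x => if b x then f x else g x).
Proof. exact: measurable_fun_ifT. Qed.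

Lemma meas_and (b c : T -> bool) : measurable_fun setT b ->
  measurable_fun setT c -> measurable_fun setT (fun x => b x && c x).
Proof. exact: measurable_and. Qed.

Lemma meas_EFin f : measurable_fun setT f -> measurable_fun setT (fun x => (f x)%:E).
Proof. by move=> mf; apply/measurable_EFinP. Qed.

End Measurability.

Ltac meas := repeat first
 [ assumption
 | exact: measurable_id | exact: measurable_fst | exact: measurable_snd
 | lazymatch goal with
   | |- measurable_fun _ (fun _ => ?c) => exact: measurable_cst
   | |- measurable_fun _ (fun x => EFin (@?f x)) => apply: (@meas_EFin _ _ _ f)
   | |- measurable_fun _ (fun x => @?f x + @?g x) => apply: (@meas_add _ _ _ f g)
   | |- measurable_fun _ (fun x => - @?f x) => apply: (@meas_opp _ _ _ f)
   | |- measurable_fun _ (fun x => @?f x * @?g x) => apply: (@meas_mul _ _ _ f g)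
   | |- measurable_fun _ (fun x => (@?f x)^-1) => apply: (@meas_inv _ _ _ f)
   | |- measurable_fun _ (fun x => `|@?f x|) => apply: (@meas_abs _ _ _ f)
   | |- measurable_fun _ (fun x => expR (@?f x)) => apply: (@meas_expR _ _ _ f)
   | |- measurable_fun _ (fun x => (@?f x) `^ ?a) => apply: (@meas_powR _ _ _ a f)
   | |- measurable_fun _ (fun x => (@?f x) ^+ ?a) => apply: (@meas_pow _ _ _ a f)
   | |- measurable_fun _ (fun x => cos (@?f x)) => apply: (@meas_cos _ _ _ f)
   | |- measurable_fun _ (fun x => sin (@?f x)) => apply: (@meas_sin _ _ _ f)
   | |- measurable_fun _ (fun x => Num.sqrt (@?f x)) => apply: (@meas_sqrt _ _ _ f)
   | |- measurable_fun _ (fun x => @?f x < @?g x) => apply: (@meas_ltr _ _ _ f g)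
   | |- measurable_fun _ (fun x => @?f x <= @?g x) => apply: (@meas_ler _ _ _ f g)
   | |- measurable_fun _ (fun x => @?f x && @?g x) => apply: (@meas_and _ _ f g)
   | |- measurable_fun _ (fun x => if _ then _ else _) => apply: meas_if
   | H : measurable_fun setT ?h |- measurable_fun _ (fun x => ?h (@?e x)) =>
       apply: (measurableT_comp (f := h) H (g := e))
   | |- measurable_fun _ (fun _ => _) => fail
   | |- measurable_fun ?D ?f => change (measurable_fun D (fun x => f x))
   end ].

(** * Affine changes of variable *)

Section ChangeOfVariable.
Context {R : realType}.
Local Notation mu := (@lebesgue_measure R).
Implicit Types f : R -> \bar R.

Let aff (a b : R) : R -> measurableTypeR R := fun x => a * x + b.

Let meas_aff a b : measurable_fun setT (aff a b).
Proof. by rewrite /aff; meas. Qed.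

Let pushaff a b : {measure set (measurableTypeR R) -> \bar R} :=
  measure_function_pushforward__canonical__measure_function_Measure mu (meas_aff a b).

Let lebesgue_measure_aff (a : {nonneg R}) b (A : set R) : 0 < a%:num ->
  measurable A -> mu A = mscale a (pushaff a%:num b) A.
Proof.
move=> a0 mA; apply: lebesgue_measure_unique mA => // _ [[c e]] _ <-.
change (mu `]c, e] = (a%:num%:E * mu (aff a%:num b @^-1` `]c, e]))%E).
have -> : aff a%:num b @^-1` `]c, e]%classic = `](c - b) / a%:num, (e - b) / a%:num]%classic.
  apply/seteqP; split => x /=; rewrite !in_itv/= /aff => /andP[h1 h2]; apply/andP.
  - by rewrite ltr_pdivrMr// ler_pdivlMr// ltrBlDr lerBrDr mulrC.
  - by move: h1 h2; rewrite ltr_pdivrMr// ler_pdivlMr// ltrBlDr lerBrDr mulrC.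
rewrite !lebesgue_measure_itv/= !lte_fin ltr_pM2r ?invr_gt0// ltrD2r.
case: ifPn => // ce; last by rewrite mule0.
rewrite -!EFinB -EFinM; congr EFin.
by rewrite -mulrBl mulrCA divff ?gt_eqF// mulr1; ring.
Qed.

Lemma ge0_integral_affine (a b : R) f : 0 < a ->
  measurable_fun setT f -> (forall x, 0 <= f x)%E ->
  (a%:E * \int[mu]_x f (a * x + b)%R = \int[mu]_x f x)%E.
Proof.
move=> a0 mf f0.
transitivity (\int[mscale (NngNum (ltW a0)) (pushaff a b)]_x f x)%E; last first.
  apply: eq_measure_integral => A mA _ /=.
  exact/esym/(@lebesgue_measure_aff (NngNum (ltW a0))).
rewrite (@ge0_integral_mscale _ _ _ (pushaff a b))//=; congr (_ * _)%E.
have := @ge0_integral_pushforward _ _ (measurableTypeR R) (measurableTypeR R) R (aff a b) (meas_aff a b) mu setT f measurableT mf.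
by rewrite preimage_setT => ->.
Qed.

Lemma ge0_integral_shift (b : R) f :
  measurable_fun setT f -> (forall x, 0 <= f x)%E ->
  (\int[mu]_x f (x + b)%R = \int[mu]_x f x)%E.
Proof.
move=> mf f0; have := ge0_integral_affine b ltr01 mf f0.
by under eq_integral do rewrite mul1r; rewrite mul1e.
Qed.

Lemma ge0_integral_opp f :
  measurable_fun setT f -> (forall x, 0 <= f x)%E ->
  (\int[mu]_x f (- x)%R = \int[mu]_x f x)%E.
Proof.
move=> mf f0.
transitivity (\int[pushforward mu (-%R : R -> measurableTypeR R)]_x f x)%E.
  have mN : measurable_fun setT (-%R : R -> measurableTypeR R).
    by apply: measurable_funN; exact: measurable_id.
  have := @ge0_integral_pushforward _ _ (measurableTypeR R) (measurableTypeR R) R _ mN mu setT f measurableT mf.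
  by rewrite preimage_setT => ->.
by apply: eq_measure_integral => A mA _; exact: lebesgue_measureN.
Qed.

End ChangeOfVariable.

(** * Elementary integrals *)

Section ElementaryIntegrals.
Context {R : realType}.
Local Notation mu := (@lebesgue_measure R).

Lemma integral_itv_if (i : interval R) (f : R -> R) :
  (\int[mu]_(x in [set` i]) (f x)%:E =
   \int[mu]_x (if x \in i then f x else 0)%:E)%E.
Proof.
rewrite integral_mkcond; apply: eq_integral => x _.
by rewrite patchE mem_setE; case: ifPn.
Qed.

Lemma is_derive_continuous (F : R -> R) (x df : R) : is_derive x 1 F df ->
  F y @[y --> x] --> F x.
Proof.
move=> dF; apply: differentiable_continuous.
by apply/derivable1_diffP; case: dF.
Qed.

Lemma FTC_segment (F f : R -> R) (a b : R) : a < b ->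
  (forall x, a <= x <= b -> is_derive x 1 F (f x)) ->
  (forall x, a <= x <= b -> f y @[y --> x] --> f x) ->
  (\int[mu]_(x in `[a, b]) (f x)%:E = (F b - F a)%:E)%E.
Proof.
move=> ab dF cf; rewrite (@continuous_FTC2 _ f F)//.
- apply: continuous_in_subspaceT => x; rewrite inE/= in_itv/= => h.
  exact: cf.
- split.
  + move=> x; rewrite in_itv/= => /andP[ax xb].
    by case: (dF x _) => //; rewrite !ltW.
  + by apply: cvg_at_right_filter; apply: is_derive_continuous (dF a _); rewrite lexx ltW.
  + by apply: cvg_at_left_filter; apply: is_derive_continuous (dF b _); rewrite lexx ltW.
- move=> x; rewrite in_itv/= => /andP[ax xb].
  by rewrite derive1E; case: (dF x _) => //; rewrite !ltW.
Qed.

Lemma FTC_half_line (F f : R -> R) (a l : R) :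
  (forall x, a <= x -> is_derive x 1 F (f x)) ->
  (forall x, a <= x -> f y @[y --> x] --> f x) ->
  (forall x, a <= x -> 0 <= f x) -> F x @[x --> +oo] --> l ->
  (\int[mu]_(x in `[a, +oo[) (f x)%:E = (l - F a)%:E)%E.
Proof.
move=> dF cf f0 Fl; rewrite (@ge0_continuous_FTC2y _ f F a l)//.
- apply: continuous_in_subspaceT => x; rewrite inE/= in_itv/= andbT => h.
  exact: cf.
- by move=> x ax; case: (dF x (ltW ax)).
- by apply: cvg_at_right_filter; apply: is_derive_continuous (dF a _).
- move=> x; rewrite in_itv/= andbT => ax.
  by rewrite derive1E; case: (dF x (ltW ax)).
Qed.

Lemma powR_continuous_gt0 (c x : R) : 0 < x -> y `^ c @[y --> x] --> x `^ c.
Proof.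
by move=> x0; exact: (is_derive_continuous (is_derive1_powR c x0)).
Qed.

Lemma is_derive_powRd (c x : R) : c != 0 -> 0 < x ->
  is_derive x 1 (fun x : R => x `^ c / c) (x `^ (c - 1)).
Proof.
move=> c0 x0; have -> : (fun x : R => x `^ c / c) = (c^-1 \*: (@powR R ^~ c)).
  by apply/funext => y /=; rewrite mulrC.
have /= h := is_derive1_powR c x0.
apply: is_derive_eq; rewrite /GRing.scale/= mulrA mulVf// mul1r.
by [].
Qed.

Lemma integral_powR_segment (c a b : R) : c != 0 -> 0 < a -> a < b ->
  (\int[mu]_(x in `[a, b]) (x `^ (c - 1))%:E = (b `^ c / c - a `^ c / c)%:E)%E.
Proof.
move=> c0 a0 ab; apply: (FTC_segment (F := fun x => x `^ c / c)) => // x /andP[ax _].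
- by apply: is_derive_powRd => //; exact: lt_le_trans ax.
- by apply: powR_continuous_gt0; exact: lt_le_trans ax.
Qed.

Lemma powR_cvg_pinfty (a : R) : 0 < a -> x `^ (- a) @[x --> +oo] --> 0.
Proof.
move=> a0; apply/cvgr0Pnorm_lt => e e0; near=> x.
have x0 : 0 < x by near: x; exact: nbhs_pinfty_gt.
have xe : e^-1 `^ a^-1 < x by near: x; exact: nbhs_pinfty_gt.
rewrite ger0_norm ?powR_ge0// powRN invf_plt ?posrE ?powR_gt0//.
have -> : e^-1 = (e^-1 `^ a^-1) `^ a.
  by rewrite -powRrM mulVf ?gt_eqF// powRr1// invr_ge0 ltW.
by apply: gt0_ltr_powR => //; rewrite nnegrE ?powR_ge0// ltW.
Unshelve. all: end_near. Qed.

Lemma integral_powR_tail (a c : R) : 0 < a -> 0 < c ->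
  (\int[mu]_(x in `[c, +oo[) (x `^ (- a - 1))%:E = (c `^ (- a) / a)%:E)%E.
Proof.
move=> a0 c0; rewrite -[X in X%:E]opprK -mulrN -invrN -[X in X%:E]sub0r.
apply: (FTC_half_line (F := fun x => x `^ (- a) / (- a))).
- move=> x cx; apply: is_derive_powRd; first by rewrite oppr_eq0 gt_eqF.
  exact: lt_le_trans cx.
- by move=> x cx; apply: powR_continuous_gt0; exact: lt_le_trans cx.
- by move=> x _; exact: powR_ge0.
- by rewrite -[X in _ --> X](mul0r (- a)^-1); apply: cvgMl; exact: powR_cvg_pinfty.
Qed.

Lemma integral_powR_head (a u : R) : 0 < a -> 0 < u ->
  (\int[mu]_(x in `]0%R, u]) (x `^ (a - 1))%:E = (u `^ a / a)%:E)%E.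
Proof.
move=> a0 u0.
pose F (n : nat) : set R := `[u / n.+2%:R, u]%classic.
have un n : 0 < u / n.+2%:R by rewrite divr_gt0.
have -> : `]0, u]%classic = \bigcup_n F n.
  apply/seteqP; split => x /=; rewrite in_itv/=.
    move=> /andP[x0 xu]; exists (Num.truncn (u / x)) => //=.
    rewrite /F/= in_itv/= xu andbT ler_pdivrMr// mulrC -ler_pdivrMr//.
    apply: ltW; apply: lt_le_trans (truncnS_gt _) _; by rewrite ler_nat.
  by move=> [n _]; rewrite /F/= in_itv/= => /andP[h ->]; rewrite andbT (lt_le_trans (un n)).
have ndF : nondecreasing_seq F.
  move=> m n mn; rewrite /F; apply/subsetPset => x/=; rewrite !in_itv/= => /andP[h ->].
  rewrite andbT (le_trans _ h)// ler_pM2l// lef_pV2 ?posrE// ler_nat//.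
have mf : measurable_fun setT (fun x : R => (x `^ (a - 1))%:E) by meas.
have cv := @ge0_nondecreasing_set_cvg_integral _ (measurableTypeR R) _ F (fun x : R => (x `^ (a - 1))%:E) mu ndF
  (fun n => measurable_itv _) (fun n => measurable_funTS mf)
  (fun n x _ => powR_ge0 x (a - 1)).
apply: cvg_unique cv _ => //.
have -> : (fun i => \int[mu]_(x in F i) (x `^ (a - 1))%:E)%E =
  (fun i => (u `^ a / a - (u / i.+2%:R) `^ a / a)%:E).
  apply/funext => n; rewrite /F integral_powR_segment ?gt_eqF//.
  by rewrite ltr_pdivrMr// ltr_pMr// ltr1n.
apply: cvg_EFin; first exact: nearW.
rewrite -[X in _ --> X]subr0; apply: cvgB; first exact: cvg_cst.
rewrite -[X in _ --> X](mul0r a^-1); apply: cvgMl.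
have h : (fun n : nat => n.+2%:R `^ (- a) : R) @ \oo --> 0.
  apply: cvg_comp (powR_cvg_pinfty a0).
  apply/cvgryPge => A; near=> n; apply: le_trans (_ : n%:R <= _); last first.
    by rewrite ler_nat; exact: leqW.
  by near: n; have /cvgryPge := @cvgr_idn R; apply.
rewrite -[X in _ --> X](mulr0 (u `^ a)).
under eq_fun do rewrite powRM ?(ltW u0) ?invr_ge0// -powR_inv1// -powRrM mulN1r.
exact: cvgMr.
Unshelve. all: end_near. Qed.

Lemma integral_expR_tail (b c : R) : 0 < b ->
  (\int[mu]_(x in `[c, +oo[) (b * expR (- (b * x)))%:E = (expR (- (b * c)))%:E)%E.
Proof.
move=> b0; rewrite -[X in _ = X%:E]opprK -[X in _ = X%:E]sub0r.
apply: (FTC_half_line (F := fun x => - expR (- (b * x)))).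
- move=> x _; apply: is_derive_eq; rewrite /GRing.scale/=; ring.
- move=> x _; apply: cvgMr; apply: continuous_comp; last exact: continuous_expR.
  by apply: cvgN; apply: cvgMr; exact: cvg_id.
- by move=> x _; rewrite mulr_ge0 ?expR_ge0 ?ltW.
- rewrite -oppr0; apply: cvgN.
  apply: (cvg_comp (fun x : R => b * x) (fun y => expR (- y))); last exact: cvgr_expR.
  by apply: gt0_cvgMry.
Qed.

End ElementaryIntegrals.

(** * Integrals of nonnegative functions *)

Section NonnegativeIntegrals.
Context {R : realType}.
Local Notation mu := (@lebesgue_measure R).
Implicit Types f g : R -> R.

Lemma lintZ (c : R) f : 0 <= c -> measurable_fun setT f -> (forall x, 0 <= f x) ->
  (\int[mu]_x (c * f x)%:E = c%:E * \int[mu]_x (f x)%:E)%E.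
Proof.
move=> c0 mf f0; under eq_integral do rewrite EFinM.
by rewrite ge0_integralZl//; [meas | move=> x _; rewrite lee_fin].
Qed.

Lemma lintD f g : measurable_fun setT f -> measurable_fun setT g ->
  (forall x, 0 <= f x) -> (forall x, 0 <= g x) ->
  (\int[mu]_x (f x + g x)%:E = \int[mu]_x (f x)%:E + \int[mu]_x (g x)%:E)%E.
Proof.
move=> mf mg f0 g0; under eq_integral do rewrite EFinD.
by rewrite ge0_integralD//; try meas; move=> x _; rewrite lee_fin.
Qed.

Lemma le_lint f g : measurable_fun setT f -> measurable_fun setT g ->
  (forall x, 0 <= f x) -> (forall x, f x <= g x) ->
  (\int[mu]_x (f x)%:E <= \int[mu]_x (g x)%:E)%E.
Proof.
move=> mf mg f0 fg; apply: ge0_le_integral => //; try meas.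
- by move=> x _; rewrite lee_fin.
- by move=> x _; rewrite lee_fin.
Qed.

Lemma lint_ge0 f : (forall x, 0 <= f x) -> (0 <= \int[mu]_x (f x)%:E)%E.
Proof. by move=> f0; apply: integral_ge0 => x _; rewrite lee_fin. Qed.

Lemma lint_shift (b : R) f : measurable_fun setT f -> (forall x, 0 <= f x) ->
  (\int[mu]_x (f (x - b))%:E = \int[mu]_x (f x)%:E)%E.
Proof.
move=> mf f0; by rewrite -[RHS](@ge0_integral_shift _ (- b))//; meas.
Qed.

Lemma lint_reflect (b : R) f : measurable_fun setT f -> (forall x, 0 <= f x) ->
  (\int[mu]_x (f (b - x))%:E = \int[mu]_x (f x)%:E)%E.
Proof.
move=> mf f0; have f0' x : (0 <= (f (x + b))%:E)%E by rewrite lee_fin.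
have mf' : measurable_fun [set: R] (fun x => (f (x + b))%:E) by meas.
rewrite -(lint_shift (- b) mf f0); under [RHS]eq_integral do rewrite opprK.
rewrite -[RHS](ge0_integral_opp mf' f0').
by apply: eq_integral => x _; rewrite addrC.
Qed.

Lemma lint_fubini (F : R -> R -> R) :
  measurable_fun setT (fun z : R * R => F z.1 z.2) -> (forall x y, 0 <= F x y) ->
  (\int[mu]_x \int[mu]_y (F x y)%:E = \int[mu]_y \int[mu]_x (F x y)%:E)%E.
Proof.
move=> mF F0.
by apply: (@fubini_tonelli _ _ _ _ _ mu mu (fun z => (F z.1 z.2)%:E)) => [|z];
  [meas | rewrite lee_fin].
Qed.

Lemma meas_lint (F : R -> R -> R) :
  measurable_fun setT (fun z : R * R => F z.1 z.2) -> (forall x y, 0 <= F x y) ->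
  measurable_fun setT (fun x => \int[mu]_y (F x y)%:E)%E.
Proof.
move=> mF F0.
by apply: (@measurable_fun_fubini_tonelli_F _ _ _ _ _ mu (fun z => (F z.1 z.2)%:E)) => [|z];
  [meas | rewrite lee_fin].
Qed.

End NonnegativeIntegrals.

Section AlmostEverywhere.
Context {R : realType}.
Local Notation mu := (@lebesgue_measure R).
Implicit Types P Q : R -> Prop.

Lemma ae_imp P Q : {ae mu, forall x, P x} -> (forall x, P x -> Q x) ->
  {ae mu, forall x, Q x}.
Proof.
by move=> aP PQ; apply: filterS PQ _ => //; exact: (ae_filter_ringOfSetsType mu).
Qed.

Lemma ae_and P Q : {ae mu, forall x, P x} -> {ae mu, forall x, Q x} ->
  {ae mu, forall x, P x /\ Q x}.
Proof.
by move=> aP aQ; apply: filterI => //; exact: (ae_filter_ringOfSetsType mu).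
Qed.

Lemma ae_imp2 P Q (S : R -> Prop) : {ae mu, forall x, P x} -> {ae mu, forall x, Q x} ->
  (forall x, P x -> Q x -> S x) -> {ae mu, forall x, S x}.
Proof. by move=> aP aQ h; apply: ae_imp (ae_and aP aQ) _ => x []; exact: h. Qed.

Lemma ae_all P : (forall x, P x) -> {ae mu, forall x, P x}.
Proof.
by move=> h; exists set0; split => // x /=; apply; exact: h.
Qed.

Lemma ae_neq (c : R) : {ae mu, forall x, x != c}.
Proof.
exists [set c]; split => //; first exact: lebesgue_measure_set1.
by move=> u /= /negP; rewrite negbK => /eqP.
Qed.

Lemma ae_eq_lint (F G : R -> \bar R) : measurable_fun setT F -> measurable_fun setT G ->
  (forall x, 0 <= F x)%E -> (forall x, 0 <= G x)%E ->
  {ae mu, forall x, F x = G x} -> (\int[mu]_x F x = \int[mu]_x G x)%E.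
Proof.
move=> mF mG F0 G0 FG; apply: ge0_ae_eq_integral => //.
by apply: ae_imp FG _ => x -> _.
Qed.

Lemma ae_le_lint (F G : R -> \bar R) : measurable_fun setT F -> measurable_fun setT G ->
  (forall x, 0 <= F x)%E -> (forall x, 0 <= G x)%E ->
  {ae mu, forall x, F x <= G x}%E -> (\int[mu]_x F x <= \int[mu]_x G x)%E.
Proof.
move=> mF mG F0 G0 FG; apply: ae_ge0_le_integral => //.
by apply: ae_imp FG _ => x h _.
Qed.

End AlmostEverywhere.

Section GammaIntegrals.
Context {R : realType}.
Local Notation mu := (@lebesgue_measure R).

Lemma lint_powR_tail (a c : R) : 0 < a -> 0 < c ->
  (\int[mu]_x (if c <= x then x `^ (- a - 1) else 0)%:E = (c `^ (- a) / a)%:E)%E.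
Proof.
move=> a0 c0; rewrite -(integral_powR_tail a0 c0) integral_itv_if.
by apply: eq_integral => x _; rewrite in_itv/= andbT.
Qed.

Lemma lint_powR_head (a u : R) : 0 < a -> 0 < u ->
  (\int[mu]_x (if (0 < x) && (x <= u) then x `^ (a - 1) else 0)%:E =
   (u `^ a / a)%:E)%E.
Proof.
by move=> a0 u0; rewrite -(integral_powR_head a0 u0) integral_itv_if.
Qed.

Lemma lint_expR_tail (b c : R) : 0 < b ->
  (\int[mu]_x (if c <= x then b * expR (- (b * x)) else 0)%:E =
   (expR (- (b * c)))%:E)%E.
Proof.
move=> b0; rewrite -(integral_expR_tail c b0) integral_itv_if.
by apply: eq_integral => x _; rewrite in_itv/= andbT.
Qed.

Lemma lint_expR_head (b c : R) : 0 < b -> 0 < c ->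
  (\int[mu]_x (if (0 <= x) && (x <= c) then b * expR (- (b * x)) else 0)%:E =
   (1 - expR (- (b * c)))%:E)%E.
Proof.
move=> b0 c0; rewrite -(integral_itv_if `[0, c] (fun x => b * expR (- (b * x)))).
have -> : 1 - expR (- (b * c)) = - expR (- (b * c)) - - expR (- (b * 0)).
  by rewrite mulr0 oppr0 expR0; ring.
apply: (FTC_segment (F := fun x => - expR (- (b * x)))) => // x _.
- apply: is_derive_eq; rewrite /GRing.scale/=; ring.
- apply: cvgMr; apply: continuous_comp; last exact: continuous_expR.
  by apply: cvgN; apply: cvgMr; exact: cvg_id.
Qed.

(** The truncation to positive arguments makes up for the conventions of real
    powers at nonpositive bases. *)
Definition gamma_integral (z b : R) : \bar R :=
  (\int[mu]_w (if 0 < w then w `^ (z - 1) * expR (- (b * w)) else 0)%:E)%E.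

Let gf_ge0 (z b w : R) : 0 <= (if 0 < w then w `^ (z - 1) * expR (- (b * w)) else 0).
Proof. by case: ifP => // _; rewrite mulr_ge0 ?powR_ge0 ?expR_ge0. Qed.

Lemma gamma_integral_lty (z : R) : 0 < z -> z < 1 -> (gamma_integral z 1 < +oo)%E.
Proof.
move=> z0 z1.
pose h (w : R) := (if (0 < w) && (w <= 1) then w `^ (z - 1) else 0) +
   (if 1 <= w then 1 * expR (- (1 * w)) else 0).
have h1 w : 0 <= (if (0 < w) && (w <= 1) then w `^ (z - 1) else 0).
  by case: ifP => // _; rewrite powR_ge0.
have h2 w : 0 <= (if 1 <= w then 1 * expR (- (1 * w)) else 0 : R).
  by case: ifP => // _; rewrite mul1r expR_ge0.
apply: (@le_lt_trans _ _ (\int[mu]_w (h w)%:E)%E).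
  apply: le_lint => //; rewrite ?/h; try by meas.
  move=> w; rewrite /h; case: ltP => w0 /=; last by rewrite addr_ge0.
  case: (leP w 1) => w1.
    apply: (@le_trans _ _ (w `^ (z - 1))); last by rewrite lerDl.
    by rewrite ger_pMr ?powR_gt0// mul1r -[leRHS]expR0 ler_expR oppr_le0 ltW.
  rewrite (ltW w1) add0r !mul1r ger_pMl ?expR_gt0//.
  by rewrite -[leRHS](powRr0 w); apply: ler_powR; rewrite ?subr_le0 ltW.
rewrite lintD//; try by meas.
by rewrite lint_powR_head// lint_expR_tail// -EFinD ltry.
Qed.

Lemma GammaE (z : R) : 0 < z -> z < 1 -> gamma_integral z 1 = (Gamma z)%:E.
Proof.
move=> z0 z1; rewrite /Gamma /Rintegral integral_itv_if.
rewrite fineK.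
  by apply: eq_integral => x _; rewrite in_itv/= andbT mul1r.
rewrite ge0_fin_numE; last first.
  apply: lint_ge0 => x; rewrite in_itv/= andbT; case: ifP => // _.
  by rewrite mulr_ge0 ?powR_ge0 ?expR_ge0.
have := gamma_integral_lty z0 z1; congr (_ < _)%E.
by apply: eq_integral => x _; rewrite in_itv/= andbT mul1r.
Qed.

Lemma Gamma_gt0 (z : R) : 0 < z -> z < 1 -> 0 < Gamma z.
Proof.
move=> z0 z1; rewrite -lte_fin -GammaE//.
apply: (@lt_le_trans _ _ (\int[mu]_w (expR (- 1) *
   (if (0 < w) && (w <= 1)%R then w `^ (z - 1) else 0))%:E)%E).
  rewrite lintZ ?expR_ge0//; last 2 first.
    by meas.
    by move=> w; case: ifP => // _; rewrite powR_ge0.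
  by rewrite lint_powR_head// -EFinM lte_fin mulr_gt0 ?expR_gt0// divr_gt0 ?powR_gt0.
apply: le_lint; try by meas.
  by move=> w; rewrite mulr_ge0 ?expR_ge0//; case: ifP => // _; rewrite powR_ge0.
move=> w; case: ltP => w0 /=; last by rewrite mulr0.
case: (leP w 1) => w1; last by rewrite mulr0 mulr_ge0 ?powR_ge0 ?expR_ge0.
by rewrite mulrC ler_pM2l ?powR_gt0// ler_expR mul1r lerN2.
Qed.

Lemma gamma_integral_scale (z b : R) : 0 < b -> 0 < z -> z < 1 ->
  gamma_integral z b = (Gamma z * b `^ (- z))%:E.
Proof.
move=> b0 z0 z1; rewrite EFinM -GammaE// muleC.
pose f (w : R) : \bar R := (if 0 < w then w `^ (z - 1) * expR (- (1 * w)) else 0)%:E.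
have mf : measurable_fun setT f by rewrite /f; meas.
have f0 w : (0 <= f w)%E by rewrite lee_fin; exact: gf_ge0.
rewrite -[gamma_integral z 1](ge0_integral_affine 0 b0 mf f0).
rewrite muleA -EFinM -[X in _ * X]powRr1 ?(ltW b0)// -powRD; last first.
  by rewrite (gt_eqF b0) implybT.
rewrite -ge0_integralZl//; last 2 first.
- apply: (measurableT_comp mf (g := fun x => b * x + 0)); meas.
- by rewrite lee_fin powR_ge0.
apply: eq_integral => w _; rewrite /f addr0 pmulr_rgt0//.
case: ltP => w0; last by rewrite mule0.
rewrite -EFinM; congr EFin.
rewrite mul1r powRM ?(ltW b0) ?(ltW w0)// !mulrA -powRD; last first.
  by rewrite (gt_eqF b0) implybT.
by have -> : - z + 1 + (z - 1) = 0; [ring | rewrite powRr0 mul1r].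
Qed.

(** Exchanging the roles of a variable and its inverse: both sides equal the
    double integral of [w^(a-1) b exp(-b u)] over [0 < w <= u], because
    [exp(-b/t)] is the integral of [b exp(-b u)] over [u >= 1/t]. *)
Lemma lint_inv_expR (a b : R) : 0 < b -> 0 < a ->
  (\int[mu]_t (if 0 < t then t `^ (- a - 1) * expR (- (b / t)) else 0)%:E =
   gamma_integral a b)%E.
Proof.
move=> b0 a0.
pose F (t u : R) := if (0 < t) && (t^-1 <= u) then t `^ (- a - 1) * (b * expR (- (b * u))) else 0.
pose G (u w : R) := if (0 < w) && (w <= u) then w `^ (a - 1) * (b * expR (- (b * u))) else 0.
have F0 t u : 0 <= F t u.
  by rewrite /F; case: ifP => // _; rewrite !mulr_ge0 ?powR_ge0 ?expR_ge0 ?ltW.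
have G0 t u : 0 <= G t u.
  by rewrite /G; case: ifP => // _; rewrite !mulr_ge0 ?powR_ge0 ?expR_ge0 ?ltW.
have mF : measurable_fun setT (fun z : R * R => F z.1 z.2) by rewrite /F; meas.
have mG : measurable_fun setT (fun z : R * R => G z.1 z.2) by rewrite /G; meas.
transitivity (\int[mu]_t \int[mu]_u (F t u)%:E)%E.
  apply: eq_integral => t _; rewrite /F; case: ltP => t0 /=; last by rewrite integral0.
  transitivity (\int[mu]_u (t `^ (- a - 1) *
      (if t^-1 <= u then b * expR (- (b * u)) else 0))%:E)%E; last first.
    by apply: eq_integral => u _; case: ifP => // _; rewrite mulr0.
  rewrite lintZ ?powR_ge0//; last 2 first.
    by meas.
    by move=> u; case: ifP => // _; rewrite mulr_ge0 ?expR_ge0 ?ltW.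
  by rewrite lint_expR_tail.
rewrite lint_fubini//.
transitivity (\int[mu]_u \int[mu]_w (G u w)%:E)%E.
  apply: eq_integral => u _.
  transitivity (if 0 < u then (b * expR (- (b * u)) * (u `^ a / a))%:E else 0%E).
    case: ltP => u0; last first.
      rewrite (_ : (fun _ => _) = (fun=> 0%E)) ?integral0//; apply/funext => t.
      rewrite /F; case: ltP => //= t0; rewrite leNgt (le_lt_trans u0) ?invr_gt0//.
    transitivity (\int[mu]_t (b * expR (- (b * u)) *
        (if u^-1 <= t then t `^ (- a - 1) else 0))%:E)%E.
      apply: eq_integral => t _; rewrite /F; case: (ltP 0 t) => t0 /=; last first.
        by rewrite leNgt (le_lt_trans t0) ?invr_gt0//= mulr0.
      rewrite -[X in _ = (_ * (if _ <= X then _ else _))%:E]invrK lef_pV2 ?posrE ?invr_gt0//.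
      by case: ifP => _; rewrite ?mulr0// mulrC.
    rewrite lintZ ?lint_powR_tail ?invr_gt0//; last 3 first.
      by rewrite mulr_ge0 ?expR_ge0 ?ltW.
      by meas.
      by move=> t; case: ifP => // _; rewrite powR_ge0.
    by rewrite -EFinM -powR_inv1 ?ltW// -powRrM mulN1r opprK.
  case: ltP => u0; last first.
    rewrite (_ : (fun _ => _) = (fun=> 0%E)) ?integral0//; apply/funext => w.
    by rewrite /G; case: ltP => //= w0; rewrite leNgt (le_lt_trans u0).
  transitivity (\int[mu]_w (b * expR (- (b * u)) *
      (if (0 < w) && (w <= u) then w `^ (a - 1) else 0))%:E)%E.
    rewrite lintZ ?lint_powR_head//.
      by rewrite mulr_ge0 ?expR_ge0 ?ltW.
      by meas.
      by move=> t; case: ifP => // _; rewrite powR_ge0.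
  by apply: eq_integral => w _; rewrite /G; case: ifP => _; rewrite ?mulr0// mulrC.
rewrite lint_fubini//; apply: eq_integral => w _; rewrite /G.
case: ltP => w0 /=; last by rewrite integral0.
transitivity (\int[mu]_u (w `^ (a - 1) *
    (if w <= u then b * expR (- (b * u)) else 0))%:E)%E.
  by apply: eq_integral => u _; case: ifP => // _; rewrite mulr0.
rewrite lintZ ?powR_ge0//; last 2 first.
  by meas.
  by move=> u; case: ifP => // _; rewrite mulr_ge0 ?expR_ge0 ?ltW.
by rewrite lint_expR_tail.
Qed.

(** The difference [1 - exp(-t b)] is the integral of [b exp(-b u)] over
    [0 <= u <= t]; exchanging the integrals leaves a Gamma integral. *)
Lemma lint_one_sub_expR (a b : R) : 0 < b -> 0 < a -> a < 1 ->
  (\int[mu]_t (if 0 < t then t `^ (- a - 1) * (1 - expR (- (b * t))) else 0)%:E =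
   (Gamma (1 - a) / a * b `^ a)%:E)%E.
Proof.
move=> b0 a0 a1.
pose F (t u : R) := if [&& 0 < t, 0 <= u & u <= t] then t `^ (- a - 1) * (b * expR (- (b * u))) else 0.
have F0 t u : 0 <= F t u.
  by rewrite /F; case: ifP => // _; rewrite !mulr_ge0 ?powR_ge0 ?expR_ge0 ?ltW.
have mF : measurable_fun setT (fun z : R * R => F z.1 z.2) by rewrite /F; meas.
transitivity (\int[mu]_t \int[mu]_u (F t u)%:E)%E.
  apply: eq_integral => t _; rewrite /F; case: ltP => t0 /=; last by rewrite integral0.
  transitivity (\int[mu]_u (t `^ (- a - 1) *
      (if (0 <= u) && (u <= t) then b * expR (- (b * u)) else 0))%:E)%E; last first.
    by apply: eq_integral => u _; case: ifP => // _; rewrite mulr0.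
  rewrite lintZ ?powR_ge0//; last 2 first.
    by meas.
    by move=> u; case: ifP => // _; rewrite mulr_ge0 ?expR_ge0 ?ltW.
  by rewrite lint_expR_head.
rewrite lint_fubini//.
transitivity (\int[mu]_u ((b / a) * (if 0 < u then u `^ ((1 - a) - 1) * expR (- (b * u)) else 0))%:E)%E; last first.
  rewrite lintZ ?divr_ge0 ?ltW//; last by meas.
  rewrite -/(gamma_integral (1 - a) b) gamma_integral_scale ?subr_gt0//; last by rewrite gtrBl.
  rewrite -EFinM; congr EFin.
  have -> : b `^ a = b * b `^ (- (1 - a)); last by ring.
  rewrite -{2}[b]powRr1 ?(ltW b0)// -powRD; last by rewrite (gt_eqF b0) implybT.
  by congr (_ `^ _); ring.
rewrite /=.
apply: ge0_ae_eq_integral => //.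
- by apply: (@meas_lint _ (fun u t => F t u)) => //; rewrite /F; meas.
- by meas.
- by move=> u _; apply: lint_ge0.
- by move=> u _; rewrite lee_fin; apply: mulr_ge0; [rewrite divr_ge0 ?ltW | exact: gf_ge0].
apply: (ae_imp (ae_neq 0)) => u un0 _.
case: ltP => u0; last first.
  rewrite mulr0 (_ : (fun _ => _) = (fun=> 0%E)) ?integral0//; apply/funext => t.
  have -> : F t u = 0 => //; rewrite /F.
  by rewrite (_ : 0 <= u = false) ?andbF//; apply/negbTE; rewrite -ltNge lt_neqAle un0.
transitivity (\int[mu]_t (b * expR (- (b * u)) *
    (if u <= t then t `^ (- a - 1) else 0))%:E)%E.
  apply: eq_integral => t _; rewrite /F (ltW u0) /=.
  case: (leP u t) => ut; rewrite ?andbF ?mulr0//.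
  by rewrite (lt_le_trans u0 ut)/= mulrC.
rewrite lintZ ?lint_powR_tail//; last 3 first.
  by rewrite mulr_ge0 ?expR_ge0 ?ltW.
  by meas.
  by move=> t; case: ifP => // _; rewrite powR_ge0.
by rewrite -EFinM; congr EFin; rewrite addrAC subrr add0r; ring.
Qed.

End GammaIntegrals.

(** * The Gaussian and its Fourier transform *)

Section Gaussian.
Context {R : realType}.
Local Notation mu := (@lebesgue_measure R).

Lemma integrable_dominated (f g : R -> R) : measurable_fun setT f ->
  mu.-integrable setT (EFin \o g) -> (forall x, `|f x| <= g x) ->
  mu.-integrable setT (EFin \o f).
Proof.
move=> mf ig fg; apply: le_integrable ig => //; first by apply/measurable_EFinP.
by move=> x _ /=; rewrite lee_fin (le_trans (fg x))// ler_norm.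
Qed.

Lemma integrable_lint (f : R -> R) : measurable_fun setT f -> (forall x, 0 <= f x) ->
  (\int[mu]_x (f x)%:E < +oo)%E -> mu.-integrable setT (EFin \o f).
Proof.
move=> mf f0 fi; apply/integrableP; split; first by apply/measurable_EFinP.
by under eq_integral do rewrite /= ger0_norm//.
Qed.

Lemma lint_dominated_cvg (f_ : nat -> R -> R) (f g : R -> R) :
  (forall n, measurable_fun setT (f_ n)) -> measurable_fun setT f ->
  measurable_fun setT g -> (forall x, 0 <= g x) ->
  (\int[mu]_x (g x)%:E < +oo)%E ->
  {ae mu, forall x, f_ n x @[n --> \oo] --> f x} ->
  {ae mu, forall x, forall n, `|f_ n x| <= g x} ->
  [/\ mu.-integrable setT (EFin \o f),
      (fun n => \int[mu]_x `|f_ n x - f x|%:E)%E @ \oo --> 0%E &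
      (fun n => \int[mu]_x f_ n x)%R @ \oo --> (\int[mu]_x f x)%R].
Proof.
move=> mf_ mf mg g0 gi cv dom.
have := @dominated_convergence _ (measurableTypeR R) R mu setT measurableT
  (fun n x => (f_ n x)%:E) (EFin \o f) (EFin \o g)
  (fun n => meas_EFin (mf_ n)) (meas_EFin mf).
case.
- by apply: ae_imp cv _ => x cx _; apply: cvg_EFin => //; exact: nearW.
- exact: integrable_lint.
- by apply: ae_imp dom _ => x cx n _; rewrite lee_fin.
move=> fi d0 lim; split => //.
apply: fine_cvg; rewrite fineK//; exact: integrable_fin_num.
Qed.

Lemma gauss_integral_scale (b : R) : 0 < b ->
  (\int[mu]_x (expR (- (b * x ^+ 2)))%:E = (Num.sqrt (pi / b))%:E)%E.
Proof.
move=> b0; have sb0 : 0 < Num.sqrt b by rewrite sqrtr_gt0.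
have mg : measurable_fun [set: R] (fun x : R => (expR (- x ^+ 2))%:E) by meas.
have := ge0_integral_affine 0 sb0 mg (fun x => expR_ge0 (- x ^+ 2)).
rewrite -[X in _ = X]/(\int[mu]_x (gauss_fun x)%:E)%E integralT_gauss => h.
have -> : Num.sqrt (pi / b) = (Num.sqrt b)^-1 * Num.sqrt pi.
  by rewrite sqrtrM ?pi_ge0// sqrtrV ?ltW// mulrC.
rewrite EFinM -h muleA -EFinM mulVf ?gt_eqF// mul1e.
apply: eq_integral => x _; congr (expR (- _))%:E.
by rewrite addr0 exprMn sqr_sqrtr// ltW.
Qed.

Lemma integral_derivative0 (F f : R -> R) :
  (forall x : R, is_derive x 1 F (f x)) -> continuous f ->
  mu.-integrable setT (EFin \o f) ->
  F x @[x --> +oo] --> 0 -> F x @[x --> -oo] --> 0 ->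
  (\int[mu]_x f x = 0)%R.
Proof.
move=> dF cf fi Fp Fm.
have mf : measurable_fun setT f by exact: continuous_measurable_fun.
pose g (n : nat) x := if (- n.+1%:R <= x) && (x <= n.+1%:R) then f x else 0.
have mg n : measurable_fun setT (g n) by rewrite /g; meas.
have h1 : {ae mu, forall x, g n x @[n --> \oo] --> f x}.
  apply: ae_all => x; apply: cvg_near_cst; near=> n.
  rewrite /g -ler_norml (_ : `|x| <= n.+1%:R)//.
  apply: le_trans (_ : n%:R <= _); last by rewrite ler_nat.
  by near: n; have /cvgryPge := @cvgr_idn R; apply.
have h2 : (\int[mu]_x `|f x|%:E < +oo)%E by case/integrableP: fi.
have h3 : {ae mu, forall x n, `|g n x| <= `|f x|}.
  by apply: ae_all => x n; rewrite /g; case: ifP => _; rewrite ?normr0.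
have [_ _] := lint_dominated_cvg mg mf (meas_abs mf) (fun x => normr_ge0 _) h2 h1 h3.
have -> : (fun n => \int[mu]_x g n x) = (fun n => F n.+1%:R - F (- n.+1%:R)).
  apply/funext => n /=; rewrite /Rintegral.
  have := @FTC_segment _ F f (- n.+1%:R) n.+1%:R.
  rewrite integral_itv_if => ->//.
  - by rewrite gtrN// ltr0n.
  - by move=> x _; exact: cf.
move=> h; suff h0 : (fun n => F n.+1%:R - F (- n.+1%:R)) @ \oo --> 0.
  exact: cvg_unique h h0.
rewrite -[X in _ --> X]subr0; apply: cvgB.
- have /cvg_pinftyP := Fp; apply; apply/cvgryPge => A; near=> n.
  apply: le_trans (_ : n%:R <= _); last by rewrite ler_nat.
  by near: n; have /cvgryPge := @cvgr_idn R; apply.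
- have /cvgNy_compNP/cvg_pinftyP := Fm; apply; apply/cvgryPge => A; near=> n.
  apply: le_trans (_ : n%:R <= _); last by rewrite ler_nat.
  by near: n; have /cvgryPge := @cvgr_idn R; apply.
Unshelve. all: end_near. Qed.

Let gauss_cos_integrable (x : R) :
  mu.-integrable setT (EFin \o (fun p => expR (- p ^+ 2) * cos (2 * x * p))).
Proof.
apply: (integrable_dominated _ (integrableT_gauss (R := R))); first by meas.
move=> p; rewrite normrM ger0_norm ?expR_ge0// ler_piMr ?expR_ge0//.
by rewrite ler_norml cos_geN1 cos_le1.
Qed.

Let gauss_dom_integrable :
  mu.-integrable setT (EFin \o (fun p : R => 2 * expR (- (2^-1 * p ^+ 2)))).
Proof.
apply: integrable_lint; first by meas.
  by move=> x; rewrite mulr_ge0 ?expR_ge0.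
rewrite lintZ ?gauss_integral_scale ?invr_gt0//; last by meas.
by rewrite -EFinM ltry.
Qed.

Let gauss_dom_bound (p : R) : 2 * `|p| * expR (- p ^+ 2) <= 2 * expR (- (2^-1 * p ^+ 2)).
Proof.
rewrite -mulrA ler_pM2l//.
have -> : - (2^-1 * p ^+ 2) = 2^-1 * p ^+ 2 + - p ^+ 2 by field.
rewrite expRD ler_pM2r ?expR_gt0//.
apply: le_trans (expR_ge1Dx _).
have := sqr_ge0 (`|p| - 1); rewrite sqrrB1 real_normK ?num_real//; lra.
Qed.

Let gauss_sin_derive (x p : R) : is_derive p 1
  (fun p : R => - (expR (- p ^+ 2) * sin (2 * x * p)))
  (2 * p * expR (- p ^+ 2) * sin (2 * x * p) - 2 * x * (expR (- p ^+ 2) * cos (2 * x * p))).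
Proof. by apply: is_derive_eq; rewrite /GRing.scale/=; ring. Qed.

Let gauss_bounded_cvg0 (h : R -> R) : (forall p, `|h p| <= 1) ->
  expR (- p ^+ 2) * h p @[p --> +oo] --> 0.
Proof.
move=> h1; apply/cvgr0Pnorm_lt => e e0.
have /cvgr0Pnorm_lt/(_ _ e0) := @cvg_gauss_fun R.
apply: filterS => p; apply: le_lt_trans.
by rewrite normrM ler_piMr.
Qed.

Let gauss_sin_integrable (x : R) : mu.-integrable setT
    (EFin \o (fun p => 2 * p * expR (- p ^+ 2) * sin (2 * x * p))).
Proof.
apply: (integrable_dominated _ gauss_dom_integrable); first by meas.
move=> p; apply: le_trans (gauss_dom_bound p).
have -> : 2 * `|p| * expR (- p ^+ 2) = `|2 * p * expR (- p ^+ 2)|.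
  by rewrite !normrM (ger0_norm (expR_ge0 _)) ger0_norm.
by rewrite [leLHS]normrM ler_piMr// ler_norml sin_geN1 sin_le1.
Qed.

Let gauss_ibp (x : R) :
  (\int[mu]_p (2 * p * expR (- p ^+ 2) * sin (2 * x * p)) =
   2 * x * \int[mu]_p (expR (- p ^+ 2) * cos (2 * x * p)))%R.
Proof.
have i1 := gauss_sin_integrable x.
have i2 : mu.-integrable setT
    (EFin \o (fun p => 2 * x * (expR (- p ^+ 2) * cos (2 * x * p)))).
  rewrite (_ : _ \o _ = (fun p => (2 * x)%:E * (expR (- p ^+ 2) * cos (2 * x * p))%:E)%E).
    by apply: integrableZl => //; exact: gauss_cos_integrable.
  by apply/funext => p; rewrite /= EFinM.
rewrite -(RintegralZl (2 * x) measurableT (gauss_cos_integrable x)).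
apply/eqP; rewrite -subr_eq0.
rewrite -RintegralB//; apply/eqP.
apply: (integral_derivative0 (gauss_sin_derive x)).
- by move=> p; apply: is_derive_continuous (is_derive_eq _ erefl).
- exact: (integrableB measurableT i1 i2).
- rewrite (_ : (fun _ => _) = (fun p => expR (- p ^+ 2) * - sin (2 * x * p))).
    apply: gauss_bounded_cvg0 => p; rewrite normrN ler_norml sin_geN1 sin_le1//.
  by apply/funext => p; rewrite mulrN.
- apply/cvgNy_compNP.
  rewrite (_ : _ \o _ = (fun p => expR (- p ^+ 2) * sin (2 * x * p))).
    apply: gauss_bounded_cvg0 => p; rewrite ler_norml sin_geN1 sin_le1//.
  by apply/funext => p; rewrite /= sqrrN mulrN sinN mulrN opprK.
Qed.

(** The cosine transform solves the same first order linear equation as the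
    Gaussian: differentiating under the integral produces the factor [p], which
    an integration by parts turns back into the frequency. *)
Let gauss_cos_transform (x : R) :
  (\int[mu]_p (expR (- p ^+ 2) * cos (2 * x * p)) = Num.sqrt pi * expR (- x ^+ 2))%R.
Proof.
pose f (x p : R) := expR (- p ^+ 2) * cos (2 * x * p).
pose Phi x := (\int[mu]_p f x p)%R.
have df (y p : R) : is_derive y 1 (f ^~ p) (- (2 * p * expR (- p ^+ 2) * sin (2 * y * p))).
  by apply: is_derive_eq; rewrite /GRing.scale/=; ring.
have dPhi (y : R) : is_derive y 1 Phi (- (2 * y) * Phi y).
  have I : y \in `]y - 1, y + 1[ by rewrite in_itv/= ltrDl gtrBl ltr01.
  have H1 (z : R) : `]y - 1, y + 1[%classic z -> mu.-integrable setT (EFin \o f z).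
    by move=> _; exact: gauss_cos_integrable.
  have H2 (z p : R) : `]y - 1, y + 1[%classic z -> setT p -> derivable (f ^~ p) z 1.
    by move=> _ _; case: (df z p).
  have H3 (p : R) : 0 <= 2 * expR (- (2^-1 * p ^+ 2)) by rewrite mulr_ge0 ?expR_ge0.
  have d1 (z p : R) : partial1of2 f z p = - (2 * p * expR (- p ^+ 2) * sin (2 * z * p)).
    by rewrite partial1of2E; case: (df z p).
  have H4 (z p : R) : `]y - 1, y + 1[%classic z -> setT p ->
      `|partial1of2 f z p| <= 2 * expR (- (2^-1 * p ^+ 2)).
    move=> _ _; rewrite d1; apply: le_trans (gauss_dom_bound p).
    rewrite normrN.
    have -> : 2 * `|p| * expR (- p ^+ 2) = `|2 * p * expR (- p ^+ 2)|.
      by rewrite !normrM (ger0_norm (expR_ge0 _)) ger0_norm.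
    by rewrite [leLHS]normrM ler_piMr// ler_norml sin_geN1 sin_le1.
  have D1 := @derivable_under_integral R _ (measurableTypeR R) mu f setT measurableT y _ _ I H1 H2 _ H3 gauss_dom_integrable H4.
  have D2 := @differentiation_under_integral R _ (measurableTypeR R) mu f setT measurableT y _ _ I H1 H2 _ H3 gauss_dom_integrable H4.
  apply: DeriveDef => //; rewrite -derive1E D2.
  under eq_Rintegral do rewrite d1.
  have -> : - (2 * y) * Phi y = - (\int[mu]_p (2 * p * expR (- p ^+ 2) * sin (2 * y * p)))%R.
    by rewrite gauss_ibp mulNr.
  rewrite -[RHS]mulN1r -(RintegralZl (-1) measurableT (gauss_sin_integrable y)).
  by apply: eq_Rintegral => p _; rewrite mulN1r.
have cst (y : R) : is_derive y 1 (fun x : R => Phi x * expR (x ^+ 2)) 0.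
  by apply: is_derive_eq; rewrite /GRing.scale/=; ring.
have := @is_derive_0_is_cst R (fun x => Phi x * expR (x ^+ 2)) x 0.
rewrite expr0n/= expR0 mulr1 => h.
have <- : Phi 0 = Num.sqrt pi.
  rewrite /Phi /f; under eq_Rintegral do rewrite mulr0 mul0r cos0 mulr1.
  by rewrite /Rintegral [X in fine X]integralT_gauss.
by rewrite -(h cst) -mulrA -expRD subrr expR0 mulr1.
Qed.

Lemma lint_posneg (g : R -> R) : (\int[mu]_x (g x)%:E =
    \int[mu]_x (Num.max (g x) 0)%:E - \int[mu]_x (Num.max (- g x) 0)%:E)%E.
Proof.
rewrite integralE; congr (_ - _)%E; apply: eq_integral => x _.
  by rewrite funeposE EFin_max.
by rewrite funenegE EFin_max EFinN.
Qed.

Lemma Rintegral_affine (a b : R) (f : R -> R) : 0 < a ->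
  mu.-integrable setT (EFin \o f) ->
  (a * \int[mu]_x f (a * x + b) = \int[mu]_x f x)%R.
Proof.
move=> a0 fi.
have mf : measurable_fun setT f by apply/measurable_EFinP; exact: measurable_int fi.
have sgn (h : R -> R) : measurable_fun setT h -> (forall x, 0 <= h x) ->
    (\int[mu]_x (h x)%:E < +oo)%E ->
    ((\int[mu]_x (h (a * x + b)%R)%:E)%E = (a^-1 * fine (\int[mu]_x (h x)%:E))%:E)
    /\ (\int[mu]_x (h x)%:E \is a fin_num)%E.
  move=> mh h0 hi.
  have hf : (\int[mu]_x (h x)%:E \is a fin_num)%E.
    by rewrite ge0_fin_numE// lint_ge0.
  split => //; rewrite EFinM fineK//.
  have mh' : measurable_fun [set: R] (fun x => (h x)%:E) by meas.
  rewrite -(ge0_integral_affine b a0 mh'); last by move=> x; rewrite lee_fin.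
  by rewrite muleA -EFinM mulVf ?gt_eqF// mul1e.
pose fp x := Num.max (f x) 0; pose fn x := Num.max (- f x) 0.
have mfp : measurable_fun setT fp by exact: measurable_maxr.
have mfn : measurable_fun setT fn by apply: measurable_maxr => //; meas.
have fi' : (\int[mu]_x `|f x|%:E < +oo)%E by case/integrableP: fi.
have [ep hp] := sgn fp mfp (fun x => ltac:(by rewrite /fp le_max lexx orbT)) ltac:(
  by apply: le_lt_trans fi'; apply: le_lint => //; [meas | move=> x; rewrite /fp le_max lexx orbT
    | move=> x; rewrite /fp ge_max ler_norm normr_ge0]).
have [en hn] := sgn fn mfn (fun x => ltac:(by rewrite /fn le_max lexx orbT)) ltac:(
  by apply: le_lt_trans fi'; apply: le_lint => //; [meas | move=> x; rewrite /fn le_max lexx orbT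
    | move=> x; rewrite /fn ge_max -normrN ler_norm normr_ge0]).
rewrite /Rintegral (lint_posneg f) (lint_posneg (fun x => f (a * x + b))).
rewrite [X in fine (X - _)%E]ep [X in fine (_ - X)%E]en [RHS](fineB hp hn) /=.
by rewrite mulrBr !mulrA divff ?gt_eqF// !mul1r.
Qed.

Lemma gauss_fourier_cos (b x : R) : 0 < b ->
  (\int[mu]_p (expR (- (b * p ^+ 2)) * cos (x * p)) =
   Num.sqrt (pi / b) * expR (- (x ^+ 2 / (4 * b))))%R.
Proof.
move=> b0; set sb := Num.sqrt b.
have sb0 : 0 < sb by rewrite sqrtr_gt0.
have sb2 : sb ^+ 2 = b by rewrite sqr_sqrtr ?ltW.
have := gauss_cos_transform (x / (2 * sb)).
rewrite -(Rintegral_affine 0 sb0 (gauss_cos_integrable _)) => /(congr1 (fun z => sb^-1 * z)).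
rewrite mulKf ?gt_eqF// => e.
transitivity (sb^-1 * (Num.sqrt pi * expR (- (x / (2 * sb)) ^+ 2))).
  rewrite -e; apply: eq_Rintegral => p _.
  by rewrite addr0 exprMn sb2; congr (_ * cos _); field; rewrite gt_eqF.
rewrite mulrA sqrtrM ?pi_ge0// sqrtrV ?ltW// (mulrC sb^-1); congr (_ * expR (- _)).
by rewrite -sb2; field; rewrite gt_eqF.
Qed.

End Gaussian.

Section HeatKernel.
Context {R : realType}.
Local Notation mu := (@lebesgue_measure R).

Definition heat (t z : R) : R := (4 * pi * t) `^ (- 2^-1) * expR (- (z ^+ 2 / (4 * t))).

Lemma heat_ge0 t z : 0 <= heat t z.
Proof. by rewrite /heat mulr_ge0 ?powR_ge0 ?expR_ge0. Qed.

Lemma heatC t x y : heat t (x - y) = heat t (y - x).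
Proof. by rewrite /heat -(sqrrN (x - y)) opprB. Qed.

Lemma meas_heat d (T : measurableType d) (f g : T -> R) :
  measurable_fun setT f -> measurable_fun setT g ->
  measurable_fun setT (fun x => heat (f x) (g x)).
Proof. by move=> mf mg; rewrite /heat; meas. Qed.

Let powR_half (c : R) : 0 < c -> c `^ (- 2^-1) = (Num.sqrt c)^-1.
Proof. by move=> c0; rewrite powRN powR12_sqrt// ltW. Qed.

Lemma lint_heat (t : R) : 0 < t -> (\int[mu]_z (heat t z)%:E = 1)%E.
Proof.
move=> t0; have p0 := pi_gt0 R.
rewrite lintZ ?powR_ge0//; last by meas.
under eq_integral do rewrite mulrC.
rewrite gauss_integral_scale ?invr_gt0 ?mulr_gt0// invrK -EFinM; congr EFin.
rewrite powR_half ?mulr_gt0// [pi * _]mulrCA mulrA mulVf//.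
by rewrite gt_eqF// sqrtr_gt0 !mulr_gt0.
Qed.

(** The substitution of 1/t for t turns this integral into a Gamma integral. *)
Lemma lint_powR_heat (a z : R) : 0 < a -> a < 1 -> z != 0 ->
  (\int[mu]_t (if 0 < t then t `^ (- a - 2^-1) * heat t z else 0)%:E =
   ((4 * pi) `^ (- 2^-1) * (Gamma a * (z ^+ 2 / 4) `^ (- a)))%:E)%E.
Proof.
move=> a0 a1 z0; have p0 := pi_gt0 R.
have z20 : 0 < z ^+ 2 / 4 by rewrite divr_gt0// exprn_even_gt0.
rewrite EFinM -(gamma_integral_scale z20 a0 a1) -lint_inv_expR// -lintZ ?powR_ge0//; last 2 first.
- by meas.
- by move=> t; case: ifP => // _; rewrite mulr_ge0 ?powR_ge0 ?expR_ge0.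
apply: eq_integral => t _; congr EFin; case: ltP => t0; last by rewrite mulr0.
rewrite /heat powRM ?mulr_ge0 ?ltW//.
have -> : t `^ (- a - 1) = t `^ (- a - 2^-1) * t `^ (- 2^-1).
  by rewrite -powRD ?(gt_eqF t0) ?implybT//; congr (_ `^ _); field.
have -> : z ^+ 2 / 4 / t = z ^+ 2 / (4 * t) by field; rewrite gt_eqF.
by rewrite !mulrA; congr (_ * _); rewrite -!mulrA mulrCA.
Qed.

End HeatKernel.

(** * Complex-valued measurable functions and integrals *)

Local Open Scope complex_scope.

Section ComplexNumbers.
Context {R : realType}.
Implicit Types z w : R[i].
Local Notation Re := complex.Re.
Local Notation Im := complex.Im.

Lemma ReD z w : Re (z + w) = Re z + Re w. Proof. by case: z w => [a b] [c d]. Qed.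
Lemma ImD z w : Im (z + w) = Im z + Im w. Proof. by case: z w => [a b] [c d]. Qed.
Lemma ReN z : Re (- z) = - Re z. Proof. by case: z. Qed.
Lemma ImN z : Im (- z) = - Im z. Proof. by case: z. Qed.
Lemma ReM z w : Re (z * w) = Re z * Re w - Im z * Im w.
Proof. by case: z w => [a b] [c d]. Qed.
Lemma ImM z w : Im (z * w) = Re z * Im w + Im z * Re w.
Proof. by case: z w => [a b] [c d]. Qed.
Lemma Re_conj z : Re (z^*%C) = Re z. Proof. by case: z. Qed.
Lemma Im_conj z : Im (z^*%C) = - Im z. Proof. by case: z. Qed.

Lemma normcE z : normc z = Num.sqrt (Re z ^+ 2 + Im z ^+ 2).
Proof. by case: z. Qed.

Lemma normc_sqr z : normc z ^+ 2 = Re z ^+ 2 + Im z ^+ 2.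
Proof. by rewrite normcE sqr_sqrtr// addr_ge0// sqr_ge0. Qed.

Lemma normc_ge0 z : 0 <= normc z. Proof. by rewrite normcE sqrtr_ge0. Qed.

Lemma Re_le_normc z : `|Re z| <= normc z.
Proof. by rewrite normcE -sqrtr_sqr ler_sqrt ?addr_ge0 ?sqr_ge0// lerDl sqr_ge0. Qed.

Lemma Im_le_normc z : `|Im z| <= normc z.
Proof. by rewrite normcE -sqrtr_sqr ler_sqrt ?addr_ge0 ?sqr_ge0// lerDr sqr_ge0. Qed.

Lemma normc_le_ReIm z : normc z <= `|Re z| + `|Im z|.
Proof.
rewrite -(@ler_pXn2r _ 2) ?nnegrE ?normc_ge0 ?addr_ge0// normc_sqr sqrrD !real_normK ?num_real//.
by rewrite addrAC lerDl mulrn_wge0// mulr_ge0.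
Qed.

Lemma normc_conj z : normc (z^*%C) = normc z.
Proof. by rewrite !normcE Re_conj Im_conj sqrrN. Qed.

Lemma normc_real (r : R) : normc r%:C = `|r|.
Proof. by rewrite normcE /= expr0n/= addr0 sqrtr_sqr. Qed.

Lemma normc_cis (t : R) : normc (cis t) = 1.
Proof. by rewrite normcE /= cos2Dsin2 sqrtr1. Qed.

Lemma normc_opp z : normc (- z) = normc z.
Proof. by rewrite !normcE ReN ImN !sqrrN. Qed.

Lemma normc_triangle z w : normc (z + w) <= normc z + normc w.
Proof. exact: le_normcD. Qed.

Lemma normc_eq0 z : normc z = 0 -> z = 0. Proof. exact: eq0_normc. Qed.

Lemma normc_distC z w : normc (z - w) = normc (w - z).
Proof. by rewrite -normc_opp opprB. Qed.

Lemma conj_mul z w : (z * w)^*%C = z^*%C * w^*%C. Proof. exact: rmorphM. Qed.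

Lemma mul_conj z : z^*%C * z = (normc z ^+ 2)%:C.
Proof.
by rewrite normc_sqr; case: z => a b; apply/eqP; rewrite eq_complex /=; apply/andP; split; apply/eqP; ring.
Qed.

Lemma cisD (a b : R) : cis (a + b) = cis a * cis b.
Proof.
by apply/eqP; rewrite eq_complex /= cosD sinD addrC; apply/andP; split; apply/eqP; ring.
Qed.

Lemma conj_cis (a : R) : (cis a)^*%C = cis (- a).
Proof. by apply/eqP; rewrite eq_complex /= cosN sinN !eqxx. Qed.

Lemma realCM (a b : R) : (a * b)%:C = a%:C * b%:C. Proof. exact: rmorphM. Qed.

End ComplexNumbers.

Section ComplexMeasurable.
Context {R : realType} {d : measure_display} {T : measurableType d}.
Implicit Types f g : T -> R[i].

Definition cmeas f : Prop :=
  measurable_fun setT (fun x => complex.Re (f x)) /\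
  measurable_fun setT (fun x => complex.Im (f x)).

Lemma meas_Re f : cmeas f -> measurable_fun setT (fun x => complex.Re (f x)).
Proof. by case. Qed.

Lemma meas_Im f : cmeas f -> measurable_fun setT (fun x => complex.Im (f x)).
Proof. by case. Qed.

Lemma eq_meas (h k : T -> R) : h =1 k -> measurable_fun setT k -> measurable_fun setT h.
Proof. by move=> /funext ->. Qed.

Lemma meas_normc f : cmeas f -> measurable_fun setT (fun x => normc (f x)).
Proof. by case=> mr mi; apply: (eq_meas (fun x => normcE (f x))); meas. Qed.

Lemma cmeas_cst (c : R[i]) : cmeas (fun _ => c).
Proof. by split; meas. Qed.

Lemma cmeas_add f g : cmeas f -> cmeas g -> cmeas (fun x => f x + g x).
Proof.
by move=> [fr fi] [gr gi]; split; [apply: (eq_meas (fun x => ReD (f x) (g x))) | apply: (eq_meas (fun x => ImD (f x) (g x)))]; meas.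
Qed.

Lemma cmeas_opp f : cmeas f -> cmeas (fun x => - f x).
Proof.
by move=> [fr fi]; split; [apply: (eq_meas (fun x => ReN (f x))) | apply: (eq_meas (fun x => ImN (f x)))]; meas.
Qed.

Lemma cmeas_mul f g : cmeas f -> cmeas g -> cmeas (fun x => f x * g x).
Proof.
by move=> [fr fi] [gr gi]; split; [apply: (eq_meas (fun x => ReM (f x) (g x))) | apply: (eq_meas (fun x => ImM (f x) (g x)))]; meas.
Qed.

Lemma cmeas_conj f : cmeas f -> cmeas (fun x => (f x)^*%C).
Proof.
by move=> [fr fi]; split; [apply: (eq_meas (fun x => Re_conj (f x))) | apply: (eq_meas (fun x => Im_conj (f x)))]; meas.
Qed.

Lemma cmeas_real (r : T -> R) : measurable_fun setT r -> cmeas (fun x => (r x)%:C).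
Proof. by move=> mr; split; meas. Qed.

Lemma cmeas_cis (r : T -> R) : measurable_fun setT r -> cmeas (fun x => cis (r x)).
Proof. by move=> mr; split; rewrite /cis /=; meas. Qed.

Lemma cmeas_if (b : T -> bool) f g : measurable_fun setT b -> cmeas f -> cmeas g ->
  cmeas (fun x => if b x then f x else g x).
Proof.
move=> mb [fr fi] [gr gi]; split.
  by apply: (eq_meas (fun x => fun_if (@complex.Re R) (b x) (f x) (g x))); meas.
by apply: (eq_meas (fun x => fun_if (@complex.Im R) (b x) (f x) (g x))); meas.
Qed.

End ComplexMeasurable.

Lemma cmeas_comp {R : realType} d d' (T : measurableType d) (U : measurableType d')
    (h : U -> R[i]) (e : T -> U) :
  cmeas h -> measurable_fun setT e -> cmeas (fun x => h (e x)).
Proof.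
move=> [hr hi] me; split.
- exact: (measurableT_comp hr me).
- exact: (measurableT_comp hi me).
Qed.

Ltac cmeas := repeat first
 [ assumption
 | lazymatch goal with
   | |- cmeas (fun _ => ?c) => exact: cmeas_cst
   | |- cmeas (fun x => real_complex _ (@?f x)) => apply: (@cmeas_real _ _ _ f)
   | |- cmeas (fun x => @?f x + @?g x) => apply: (@cmeas_add _ _ _ f g)
   | |- cmeas (fun x => - @?f x) => apply: (@cmeas_opp _ _ _ f)
   | |- cmeas (fun x => @?f x * @?g x) => apply: (@cmeas_mul _ _ _ f g)
   | |- cmeas (fun x => conjc (@?f x)) => apply: (@cmeas_conj _ _ _ f)
   | |- cmeas (fun x => cis (@?f x)) => apply: (@cmeas_cis _ _ _ f)
   | |- cmeas (fun x => if _ then _ else _) => apply: cmeas_if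
   | |- cmeasurable ?f => change (cmeas f)
   | H : cmeas ?h |- cmeas (fun x => ?h (@?e x)) => apply: (@cmeas_comp _ _ _ _ _ h e H)
   | H : cmeasurable ?h |- cmeas (fun x => ?h (@?e x)) => apply: (@cmeas_comp _ _ _ _ _ h e H)
   | |- measurable_fun _ (fun x => EFin (@?f x)) => apply: (@meas_EFin _ _ _ f)
   | |- measurable_fun _ (fun x => normc (@?f x)) => apply: (@meas_normc _ _ _ f)
   | |- measurable_fun _ (fun x => @?f x + @?g x) => apply: (@meas_add _ _ _ f g)
   | |- measurable_fun _ (fun x => @?f x * @?g x) => apply: (@meas_mul _ _ _ f g)
   | |- measurable_fun _ (fun x => (@?f x) `^ ?a) => apply: (@meas_powR _ _ _ a f)
   | |- measurable_fun _ (fun x => (@?f x) ^+ ?a) => apply: (@meas_pow _ _ _ a f)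
   | |- measurable_fun _ (fun x => complex.Re (@?f x)) => apply: (@meas_Re _ _ _ f)
   | |- measurable_fun _ (fun x => complex.Im (@?f x)) => apply: (@meas_Im _ _ _ f)
   | |- measurable_fun _ (fun x => heat (@?f x) (@?g x)) => apply: (@meas_heat _ _ _ f g)
   | |- measurable_fun _ (fun x => if _ then _ else _) => apply: meas_if
   | |- measurable_fun _ _ => meas
   end ].

Section ComplexIntegral.
Context {R : realType}.
Local Notation mu := (@lebesgue_measure R).
Local Notation Re := complex.Re.
Local Notation Im := complex.Im.
Implicit Types f g : R -> R[i].

Lemma lintZ_lty (c : R) (h : R -> R) : 0 <= c -> measurable_fun setT h ->
  (forall x, 0 <= h x) -> (\int[mu]_x (h x)%:E < +oo)%E ->
  (\int[mu]_x (c * h x)%:E < +oo)%E.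
Proof.
by move=> c0 mh h0 hi; rewrite lintZ//; apply: lte_mul_pinfty => //; rewrite lee_fin.
Qed.

Lemma lintD_lty (h k : R -> R) : measurable_fun setT h -> measurable_fun setT k ->
  (forall x, 0 <= h x) -> (forall x, 0 <= k x) ->
  (\int[mu]_x (h x)%:E < +oo)%E -> (\int[mu]_x (k x)%:E < +oo)%E ->
  (\int[mu]_x (h x + k x)%:E < +oo)%E.
Proof. by move=> mh mk h0 k0 hi ki; rewrite lintD//; exact: lte_add_pinfty. Qed.

Lemma cintegrableP f : cintegrable f <->
  cmeasurable f /\ (\int[mu]_x (normc (f x))%:E < +oo)%E.
Proof.
split.
- move=> [/integrableP[mr ir] /integrableP[mi ii]].
  have mf : cmeasurable f by split; apply/measurable_EFinP.
  split => //; apply: (@le_lt_trans _ _ (\int[mu]_x (`|Re (f x)| + `|Im (f x)|)%:E)%E).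
    by apply: le_lint; [cmeas | cmeas | move=> x; exact: normc_ge0 |
      move=> x; exact: normc_le_ReIm].
  by rewrite lintD//; [exact: lte_add_pinfty | cmeas | cmeas].
- move=> [mf fi]; split; apply/integrableP; split.
  + by cmeas.
  + by apply: le_lt_trans fi; apply: le_lint => //; [cmeas | cmeas | move=> x; exact: Re_le_normc].
  + by cmeas.
  + by apply: le_lt_trans fi; apply: le_lint => //; [cmeas | cmeas | move=> x; exact: Im_le_normc].
Qed.

Lemma cintegrable_meas f : cintegrable f -> cmeasurable f.
Proof. by case/cintegrableP. Qed.

Lemma cintegrable_lty f : cintegrable f -> (\int[mu]_x (normc (f x))%:E < +oo)%E.
Proof. by case/cintegrableP. Qed.

Lemma cintegrable_le f (g : R -> R) : cmeasurable f -> measurable_fun setT g ->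
  (forall x, normc (f x) <= g x) -> (\int[mu]_x (g x)%:E < +oo)%E -> cintegrable f.
Proof.
move=> mf mg fg gi; apply/cintegrableP; split => //; apply: le_lt_trans gi.
by apply: le_lint => //; [cmeas | move=> x; exact: normc_ge0].
Qed.

Lemma cintegrableD f g : cintegrable f -> cintegrable g ->
  cintegrable (fun x => f x + g x).
Proof.
move=> [fr fi] [gr gi]; split.
- rewrite (_ : (fun _ => _) = ((fun x => (Re (f x))%:E) \+ (fun x => (Re (g x))%:E))%E).
    exact: integrableD.
  by apply/funext => x; rewrite ReD.
- rewrite (_ : (fun _ => _) = ((fun x => (Im (f x))%:E) \+ (fun x => (Im (g x))%:E))%E).
    exact: integrableD.
  by apply/funext => x; rewrite ImD.
Qed.

Lemma cintegrable_bounded (h : R -> R[i]) (M : R) f : cmeasurable h ->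
  (forall x, normc (h x) <= M) -> cintegrable f -> cintegrable (fun x => h x * f x).
Proof.
move=> mh hM /cintegrableP[mf fi].
have M0 : 0 <= M by apply: le_trans (hM 0); exact: normc_ge0.
apply: (@cintegrable_le _ (fun x => M * normc (f x))); [cmeas | cmeas | |].
- by move=> x; rewrite normcM ler_wpM2r ?normc_ge0.
- by apply: lintZ_lty => //; [cmeas | move=> x; exact: normc_ge0].
Qed.

Lemma cintegrableZ (c : R[i]) f : cintegrable f -> cintegrable (fun x => c * f x).
Proof. by apply: (@cintegrable_bounded (fun=> c) (normc c)) => //; cmeas. Qed.

Lemma cintegrableN f : cintegrable f -> cintegrable (fun x => - f x).
Proof.
by move=> /(cintegrableZ (-1)); congr cintegrable; apply/funext => x; rewrite mulN1r.
Qed.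

Lemma cintegrableB f g : cintegrable f -> cintegrable g ->
  cintegrable (fun x => f x - g x).
Proof. by move=> fi gi; apply: cintegrableD => //; exact: cintegrableN. Qed.

Lemma cintegrable_conj f : cintegrable f -> cintegrable (fun x => (f x)^*%C).
Proof.
move=> /cintegrableP[mf fi]; apply/cintegrableP; split; first by cmeas.
by under eq_integral do rewrite normc_conj.
Qed.

Lemma eq_cintegral f g : (forall x, f x = g x) -> cintegral f = cintegral g.
Proof. by move=> /funext ->. Qed.

Lemma cintegralD f g : cintegrable f -> cintegrable g ->
  cintegral (fun x => f x + g x) = cintegral f + cintegral g.
Proof.
move=> [fr fi] [gr gi]; rewrite /cintegral; apply/eqP; rewrite eq_complex /=.
rewrite -RintegralD// -[X in _ && (_ == X)]RintegralD//.
by apply/andP; split; apply/eqP/eq_Rintegral => x _; rewrite ?ReD ?ImD.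
Qed.

Lemma cintegralZl (c : R[i]) f : cintegrable f ->
  cintegral (fun x => c * f x) = c * cintegral f.
Proof.
case: c => a b [fr fi]; rewrite /cintegral; apply/eqP; rewrite eq_complex /=.
have Zi (r : R) (h : R -> R) : mu.-integrable setT (fun x => (h x)%:E) ->
    mu.-integrable setT (EFin \o (fun x => r * h x)).
  by move=> hi; rewrite (_ : _ \o _ = (fun x => r%:E * (h x)%:E)%E) //; exact: integrableZl.
rewrite -!(RintegralZl _ measurableT fr) -!(RintegralZl _ measurableT fi).
rewrite -(RintegralB measurableT (Zi a _ fr) (Zi b _ fi)).
rewrite -(RintegralD measurableT (Zi a _ fi) (Zi b _ fr)).
by apply/andP; split; apply/eqP/eq_Rintegral => x _; case: (f x).
Qed.

Lemma cintegralZr (c : R[i]) f : cintegrable f ->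
  cintegral (fun x => f x * c) = cintegral f * c.
Proof.
by move=> fi; rewrite mulrC -cintegralZl//; apply: eq_cintegral => x; rewrite mulrC.
Qed.

Lemma cintegralN f : cintegrable f -> cintegral (fun x => - f x) = - cintegral f.
Proof.
by move=> fi; rewrite -mulN1r -cintegralZl//; apply: eq_cintegral => x; rewrite mulN1r.
Qed.

Lemma cintegralB f g : cintegrable f -> cintegrable g ->
  cintegral (fun x => f x - g x) = cintegral f - cintegral g.
Proof. by move=> fi gi; rewrite cintegralD ?cintegralN//; exact: cintegrableN. Qed.

Lemma cintegral_conj f : cintegrable f ->
  cintegral (fun x => (f x)^*%C) = (cintegral f)^*%C.
Proof.
move=> [fr fi]; rewrite /cintegral; apply/eqP; rewrite eq_complex /=.
apply/andP; split; apply/eqP; first by apply: eq_Rintegral => x _; rewrite Re_conj.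
rewrite -mulN1r -(RintegralZl (-1) measurableT fi).
by apply: eq_Rintegral => x _; rewrite Im_conj mulN1r.
Qed.

Lemma cintegral_real (h : R -> R) :
  cintegral (fun x => (h x)%:C) = ((\int[mu]_x h x)%R)%:C.
Proof.
by rewrite /cintegral /= /Rintegral integral0.
Qed.

Lemma cintegral0 : cintegral (fun _ : R => 0 : R[i]) = 0.
Proof. by rewrite /cintegral /= /Rintegral integral0. Qed.

Lemma ae_eq_cintegral f g : cmeasurable f -> cmeasurable g ->
  {ae mu, forall x, f x = g x} -> cintegral f = cintegral g.
Proof.
move=> mf mg fg; rewrite /cintegral /Rintegral.
congr (fine _ +i* fine _); apply: ae_eq_integral => //; try cmeas.
- by apply: ae_imp fg _ => x -> _.
- by apply: ae_imp fg _ => x -> _.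
Qed.

Lemma ae_eq_lint_normc f g : cmeasurable f -> cmeasurable g ->
  {ae mu, forall x, f x = g x} ->
  (\int[mu]_x (normc (f x))%:E = \int[mu]_x (normc (g x))%:E)%E.
Proof.
move=> mf mg fg; apply: ae_eq_integral => //; try cmeas.
by apply: ae_imp fg _ => x -> _.
Qed.

Lemma ae_eq_cintegrable f g : cmeasurable f -> cmeasurable g ->
  {ae mu, forall x, f x = g x} -> cintegrable f -> cintegrable g.
Proof.
move=> mf mg fg /cintegrableP[_ fi]; apply/cintegrableP; split => //.
by rewrite -(ae_eq_lint_normc mf mg fg).
Qed.

Lemma normc_cintegral_le f : cintegrable f ->
  ((normc (cintegral f))%:E <= \int[mu]_x (normc (f x))%:E)%E.
Proof.
move=> fi; set z := cintegral f; have [z0|zn0] := eqVneq z 0.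
  by rewrite z0 normc0 lint_ge0// => x; exact: normc_ge0.
have nz : 0 < normc z.
  rewrite lt_neqAle normc_ge0 andbT eq_sym; apply: contra zn0 => /eqP h.
  by apply/eqP/normc_eq0.
pose w := z^*%C * ((normc z)^-1)%:C.
have wz : w * z = (normc z)%:C.
  rewrite /w mulrAC mul_conj -realCM; congr (_%:C).
  by rewrite expr2 mulfK// gt_eqF.
have nw : normc w = 1.
  by rewrite normcM normc_conj normc_real ger0_norm ?invr_ge0 ?normc_ge0// divff ?gt_eqF.
have wfi := cintegrableZ w fi.
have -> : normc z = (\int[mu]_x Re (w * f x))%R.
  have : Re (w * z) = normc z by rewrite wz.
  by rewrite /z -cintegralZl.
rewrite /Rintegral fineK; last by apply: integrable_fin_num => //; case: wfi.
apply: le_trans (_ : \int[mu]_x `|Re (w * f x)|%:E <= _)%E.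
  case: wfi => /integrableP[mwf _] _.
  apply: le_integral => //.
  - by case: (cintegrableZ w fi).
  - have [ir _] := cintegrableZ w fi; exact: (integrable_abse ir).
  - by move=> x _; rewrite lee_fin ler_norm.
have mf := cintegrable_meas fi.
apply: le_lint => //; [cmeas | cmeas |].
by move=> x; rewrite (le_trans (Re_le_normc _))// normcM nw mul1r.
Qed.

End ComplexIntegral.

Section ComplexFubini.
Context {R : realType}.
Local Notation mu := (@lebesgue_measure R).
Local Notation Re := complex.Re.
Local Notation Im := complex.Im.
Implicit Types f g : R -> R[i].

Lemma lint_normc_fin (K : R -> R -> R[i]) :
  cmeas (fun z : R * R => K z.1 z.2) ->
  (\int[mu]_x \int[mu]_y (normc (K x y))%:E < +oo)%E ->
  {ae mu, forall x, cintegrable (K x)}.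
Proof.
move=> mK Ki.
have mN : measurable_fun [set: R * R] (fun z : R * R => normc (K z.1 z.2)) by cmeas.
have mI := @meas_lint R (fun x y => normc (K x y)) mN (fun x y => normc_ge0 _).
have : mu.-integrable setT (fun x => \int[mu]_y (normc (K x y))%:E)%E.
  apply/integrableP; split => //.
  rewrite (_ : (fun _ => _) = (fun x => \int[mu]_y (normc (K x y))%:E))%E//.
  by apply/funext => x; rewrite gee0_abs// lint_ge0// => y; exact: normc_ge0.
move=> /(integrable_ae measurableT) ae1; apply: ae_imp ae1 _ => x /(_ Logic.I) fx.
apply/cintegrableP; split.
  by apply: (cmeas_comp (e := fun y : R => (x, y)) mK); exact: measurable_pair1.
by rewrite -ge0_fin_numE// lint_ge0// => y; exact: normc_ge0.
Qed.

Lemma cmeas_cintegral (K : R -> R -> R[i]) : cmeas (fun z : R * R => K z.1 z.2) ->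
  cmeasurable (fun x => cintegral (K x)).
Proof.
suff H (F : R -> R -> R) : measurable_fun [set: R * R] (fun z => F z.1 z.2) ->
    measurable_fun [set: R] (fun x => \int[mu]_y F x y)%R.
  by move=> [mr mi]; split; [exact: (H (fun x y => Re (K x y))) | exact: (H (fun x y => Im (K x y)))].
move=> mF; rewrite /Rintegral.
apply: (measurableT_comp (f := fine)) => //.
rewrite (_ : (fun _ => _) = (fun x => \int[mu]_y (Num.max (F x y) 0)%:E -
    \int[mu]_y (Num.max (- F x y) 0)%:E)%E); last by apply/funext => x; exact: lint_posneg.
apply: emeasurable_funB.
  apply: (meas_lint (F := fun x y => Num.max (F x y) 0)).
    by apply: measurable_maxr => //; meas.
  by move=> x y; rewrite le_max lexx orbT.
apply: (meas_lint (F := fun x y => Num.max (- F x y) 0)).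
  by apply: measurable_maxr => //; meas.
by move=> x y; rewrite le_max lexx orbT.
Qed.

Lemma cintegrable_cintegral (K : R -> R -> R[i]) :
  cmeas (fun z : R * R => K z.1 z.2) ->
  (\int[mu]_x \int[mu]_y (normc (K x y))%:E < +oo)%E ->
  cintegrable (fun x => cintegral (K x)).
Proof.
move=> mK Ki; apply/cintegrableP; split; first exact: cmeas_cintegral.
apply: le_lt_trans (Ki); apply: ae_ge0_le_integral => //.
- by move=> x _; rewrite lee_fin normc_ge0.
- by have := cmeas_cintegral mK => m; cmeas.
- by move=> x _; apply: lint_ge0 => y; exact: normc_ge0.
- apply: (@meas_lint R (fun x y => normc (K x y))); first by cmeas.
  by move=> x y; exact: normc_ge0.
- apply: ae_imp (lint_normc_fin mK Ki) _ => x Kx _; exact: normc_cintegral_le.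
Qed.

Lemma cfubini (K : R -> R -> R[i]) :
  cmeas (fun z : R * R => K z.1 z.2) ->
  (\int[mu]_x \int[mu]_y (normc (K x y))%:E < +oo)%E ->
  cintegral (fun x => cintegral (fun y => K x y)) =
  cintegral (fun y => cintegral (fun x => K x y)).
Proof.
move=> mK Ki.
have mKs : cmeas (fun z : R * R => K z.2 z.1).
  apply: (cmeas_comp (e := fun z : R * R => (z.2, z.1)) mK).
  exact: measurable_swap.
have Ki' : (\int[mu]_y \int[mu]_x (normc (K x y))%:E < +oo)%E.
  rewrite -(lint_fubini (F := fun x y => normc (K x y)))//; first by cmeas.
  by move=> x y; exact: normc_ge0.
have H (F : R -> R -> R) : measurable_fun [set: R * R] (fun z => F z.1 z.2) ->
    (forall x y, `|F x y| <= normc (K x y)) ->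
    (\int[mu]_x (\int[mu]_y F x y) = \int[mu]_y (\int[mu]_x F x y))%R.
  move=> mF FK; pose f (z : R * R) := (F z.1 z.2)%:E.
  have mf : measurable_fun [set: R * R] f by rewrite /f; meas.
  have fi : (mu \x mu)%E.-integrable setT f.
    apply/(@integrable12ltyP _ _ (measurableTypeR R) (measurableTypeR R) R mu mu f mf); apply: le_lt_trans (Ki).
    apply: ge0_le_integral => //.
    - by move=> x _; exact: integral_ge0.
    - apply: (@meas_lint R (fun x y => `|F x y|)) => //; by meas.
    - apply: (@meas_lint R (fun x y => normc (K x y))); first by cmeas.
      by move=> x y; exact: normc_ge0.
    - move=> x _; apply: ge0_le_integral => //.
      + apply: meas_EFin; apply: meas_abs.
        by apply: (measurableT_comp (f := fun z : R * R => F z.1 z.2) mF (g := fun y : R => (x, y))); exact: measurable_pair1.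
      + apply: meas_EFin; apply: meas_normc.
        by apply: (cmeas_comp (e := fun y : R => (x, y)) mK); exact: measurable_pair1.
      + by move=> y _; rewrite lee_fin.
  have eqF : (\int[mu]_x (\int[mu]_y F x y) = fine (\int[mu]_x \int[mu]_y f (x, y)))%R.
    congr fine; apply: ae_eq_integral => //.
    + apply: meas_EFin; rewrite /Rintegral; apply: (measurableT_comp (f := fine)) => //.
      exact: (measurable_fubini_F fi).
    + exact: (measurable_fubini_F fi).
    + apply: ae_imp (ae_integrable1 fi) _ => x fx _.
      by rewrite fineK//; exact: integrable_fin_num.
  have eqG : (\int[mu]_y (\int[mu]_x F x y) = fine (\int[mu]_y \int[mu]_x f (x, y)))%R.
    congr fine; apply: ae_eq_integral => //.
    + apply: meas_EFin; rewrite /Rintegral; apply: (measurableT_comp (f := fine)) => //.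
      exact: (measurable_fubini_G fi).
    + exact: (measurable_fubini_G fi).
    + apply: ae_imp (ae_integrable2 fi) _ => x fx _.
      by rewrite fineK//; exact: integrable_fin_num.
  by rewrite eqF eqG (Fubini fi).
have eR : (\int[mu]_x (\int[mu]_y Re (K x y)) = \int[mu]_y (\int[mu]_x Re (K x y)))%R.
  by apply: (H (fun x y => Re (K x y))) => [|x y]; [cmeas | exact: Re_le_normc].
have eI : (\int[mu]_x (\int[mu]_y Im (K x y)) = \int[mu]_y (\int[mu]_x Im (K x y)))%R.
  by apply: (H (fun x y => Im (K x y))) => [|x y]; [cmeas | exact: Im_le_normc].
by apply/eqP; rewrite eq_complex; apply/andP; split; apply/eqP; [exact: eR | exact: eI].
Qed.

(** ** Dominated convergence *)

Lemma seq_le_lim (a b : nat -> R) (l l' : R) : a @ \oo --> l -> b @ \oo --> l' ->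
  (forall n, a n <= b n) -> l <= l'.
Proof.
move=> al bl ab; rewrite -(cvg_lim _ al)// -(cvg_lim _ bl)//.
apply: ler_lim; [by apply/cvg_ex; exists l | by apply/cvg_ex; exists l' | exact: nearW].
Qed.

Definition ccvg (a : nat -> R[i]) (l : R[i]) : Prop :=
  (fun n => normc (a n - l)) @ \oo --> (0 : R).

Lemma ccvg_cst (l : R[i]) : ccvg (fun=> l) l.
Proof. by rewrite /ccvg subrr normc0; exact: cvg_cst. Qed.

Lemma ccvg_unique a l l' : ccvg a l -> ccvg a l' -> l = l'.
Proof.
move=> h h'.
have h2 : (fun n => normc (a n - l) + normc (a n - l')) @ \oo --> (0 : R).
  by rewrite -[X in _ --> X](addr0 0); exact: cvgD.
apply/eqP; rewrite -subr_eq0; apply/eqP/normc_eq0/eqP.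
rewrite eq_le normc_ge0 andbT; apply: (seq_le_lim (cvg_cst _) h2) => n.
rewrite (_ : l - l' = (l - a n) + (a n - l')); last by ring.
by apply: le_trans (normc_triangle _ _) _; rewrite (normc_distC l).
Qed.

Lemma ccvg_squeeze (a : nat -> R[i]) l (b : nat -> R) :
  (forall n, normc (a n - l) <= b n) -> b @ \oo --> (0 : R) -> ccvg a l.
Proof.
move=> ab b0; apply: (squeeze_cvgr _ (cvg_cst 0) b0).
by apply: nearW => n; rewrite normc_ge0 ab.
Qed.

Lemma cdominated_cvg (f_ : nat -> R -> R[i]) (f : R -> R[i]) (g : R -> R) :
  (forall n, cmeasurable (f_ n)) -> cmeasurable f ->
  measurable_fun setT g -> (forall x, 0 <= g x) ->
  (\int[mu]_x (g x)%:E < +oo)%E ->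
  {ae mu, forall x, ccvg (f_ ^~ x) (f x)} ->
  {ae mu, forall x, forall n, normc (f_ n x) <= g x} ->
  cintegrable f /\ ccvg (fun n => cintegral (f_ n)) (cintegral f).
Proof.
move=> mf_ mf mg g0 gi cv dom.
have mh n : measurable_fun [set: R] (fun x => normc (f_ n x - f x)).
  have := mf_ n => mfn; by cmeas.
have domf : {ae mu, forall x, normc (f x) <= g x}.
  apply: ae_imp2 cv dom _ => x cx dx.
  have h : (fun n => normc (f_ n x - f x) + g x) @ \oo --> 0 + g x.
    by apply: cvgD => //; exact: cvg_cst.
  rewrite -[g x]add0r; apply: (seq_le_lim (cvg_cst _) h) => n.
  rewrite (_ : f x = (f x - f_ n x) + f_ n x); last by ring.
  by apply: le_trans (normc_triangle _ _) _; rewrite normc_distC subrK lerD2l.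
have fi : cintegrable f.
  apply/cintegrableP; split => //; apply: le_lt_trans (gi).
  apply: ae_ge0_le_integral => //.
  - by move=> x _; rewrite lee_fin normc_ge0.
  - by cmeas.
  - by move=> x _; rewrite lee_fin.
  - by cmeas.
  - by apply: ae_imp domf _ => x h _; rewrite lee_fin.
have fni n : cintegrable (f_ n).
  have := mf_ n => mfn.
  apply/cintegrableP; split => //; apply: le_lt_trans (gi).
  apply: ae_ge0_le_integral => //.
  - by move=> x _; rewrite lee_fin normc_ge0.
  - by cmeas.
  - by move=> x _; rewrite lee_fin.
  - by cmeas.
  - by apply: ae_imp dom _ => x h _; rewrite lee_fin.
split => //.
have := @lint_dominated_cvg R (fun n x => normc (f_ n x - f x)) (fun=> 0) (fun x => g x + g x).
case => //.
- by meas.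
- by move=> x; rewrite addr_ge0.
- by apply: lintD_lty.
- apply: ae_imp2 domf dom _ => x h1 h2 n; rewrite ger0_norm ?normc_ge0//.
  by apply: le_trans (normc_triangle _ _) _; rewrite normc_opp lerD.
move=> _ _; rewrite [X in _ --> X -> _](_ : _ = 0); last by rewrite /Rintegral integral0.
move=> h.
apply: ccvg_squeeze h => n.
rewrite -cintegralB// -lee_fin; apply: le_trans (normc_cintegral_le _) _.
  exact: cintegrableB.
have := cintegrableB (fni n) fi => /cintegrable_lty lty.
by rewrite /Rintegral fineK// ge0_fin_numE// lint_ge0// => x; exact: normc_ge0.
Qed.

End ComplexFubini.

(** * The Fourier transform on integrable functions *)

Section Fourier.
Context {R : realType}.
Local Notation mu := (@lebesgue_measure R).
Local Notation Re := complex.Re.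
Local Notation Im := complex.Im.
Implicit Types f g G : R -> R[i].

Lemma cintegral_lint (h : R -> R) (r : R) : measurable_fun setT h ->
  (forall x, 0 <= h x) -> (\int[mu]_x (h x)%:E = r%:E)%E ->
  cintegrable (fun x => (h x)%:C) /\ cintegral (fun x => (h x)%:C) = r%:C.
Proof.
move=> mh h0 hr; split; last by rewrite cintegral_real /Rintegral hr.
apply/cintegrableP; split; first by cmeas.
under eq_integral do rewrite normc_real ger0_norm//.
by rewrite hr ltry.
Qed.

Lemma cintegral_shift (b : R) f : cintegrable f ->
  cintegral (fun x => f (x - b)) = cintegral f.
Proof.
move=> [fr fi]; apply/eqP; rewrite eq_complex /=; apply/andP; split; apply/eqP.
- rewrite -(Rintegral_affine (- b) ltr01 fr) mul1r.
  by apply: eq_Rintegral => x _; rewrite mul1r.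
- rewrite -(Rintegral_affine (- b) ltr01 fi) mul1r.
  by apply: eq_Rintegral => x _; rewrite mul1r.
Qed.

Lemma Rintegral_opp (h : R -> R) : measurable_fun setT h ->
  (\int[mu]_x h (- x) = \int[mu]_x h x)%R.
Proof.
move=> mh; rewrite /Rintegral; congr fine.
rewrite (lint_posneg h) (lint_posneg (fun x => h (- x))); congr (_ - _)%E.
- rewrite -(lint_reflect 0 (f := fun x => Num.max (h x) 0)).
  + by apply: eq_integral => x _; rewrite sub0r.
  + by apply: measurable_maxr => //; meas.
  + by move=> x; rewrite le_max lexx orbT.
- rewrite -(lint_reflect 0 (f := fun x => Num.max (- h x) 0)).
  + by apply: eq_integral => x _; rewrite sub0r.
  + by apply: measurable_maxr => //; meas.
  + by move=> x; rewrite le_max lexx orbT.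
Qed.

Lemma cintegrable_cis (h : R -> R) f : measurable_fun setT h -> cintegrable f ->
  cintegrable (fun x => f x * cis (h x)).
Proof.
move=> mh fi; rewrite (_ : (fun _ => _) = (fun x => cis (h x) * f x)).
  by apply: (@cintegrable_bounded _ _ 1) => //; [cmeas | move=> x; rewrite normc_cis].
by apply/funext => x; rewrite mulrC.
Qed.

Lemma cintegrable_realM (h : R -> R) (M : R) f : measurable_fun setT h ->
  (forall x, `|h x| <= M) -> cintegrable f -> cintegrable (fun x => (h x)%:C * f x).
Proof.
move=> mh hM; apply: cintegrable_bounded; first by cmeas.
by move=> x; rewrite normc_real.
Qed.

Local Notation c0 := ((Num.sqrt (2 * pi))^-1).

Lemma c0_gt0 : 0 < c0 :> R.
Proof. by rewrite invr_gt0 sqrtr_gt0 mulr_gt0// pi_gt0. Qed.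

Lemma c0_sqr : c0 * c0 * (2 * pi) = 1 :> R.
Proof.
have p0 := pi_gt0 R.
rewrite -expr2 exprVn sqr_sqrtr ?mulr_ge0 ?ltW// mulVf// mulf_neq0 ?gt_eqF//.
Qed.

Lemma inv_fourierE f x : inv_fourier f x = fourier f (- x).
Proof.
rewrite /inv_fourier /fourier; congr (_ * _); apply: eq_cintegral => p.
by rewrite mulNr opprK [x * p]mulrC.
Qed.

Lemma cmeas_fourier f : cmeasurable f -> cmeasurable (fourier f).
Proof.
move=> mf; rewrite /fourier.
have := @cmeas_cintegral R (fun p x => f x * cis (- (p * x))).
move=> h; have {h} := h _ => h; have m : cmeas (fun z : R * R => f z.2 * cis (- (z.1 * z.2))).
  by cmeas.
by have := h m => h'; cmeas.
Qed.

Lemma cmeas_inv_fourier f : cmeasurable f -> cmeasurable (inv_fourier f).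
Proof.
move=> mf; rewrite (_ : inv_fourier f = (fun x => fourier f (- x))).
  by have := cmeas_fourier mf => m; cmeas.
by apply/funext => x; exact: inv_fourierE.
Qed.

Lemma normc_fourier_le f p : cintegrable f ->
  normc (fourier f p) <= c0 * fine (\int[mu]_x (normc (f x))%:E).
Proof.
move=> fi; rewrite /fourier normcM normc_real ger0_norm ?(ltW c0_gt0)//.
rewrite ler_pM2l ?c0_gt0// -lee_fin fineK.
  have m : measurable_fun [set: R] (fun x => - (p * x)) by meas.
  apply: le_trans (normc_cintegral_le (cintegrable_cis m fi)) _.
  by under eq_integral do rewrite normcM normc_cis mulr1.
rewrite ge0_fin_numE ?cintegrable_lty// lint_ge0// => x; exact: normc_ge0.
Qed.

Lemma normc_inv_fourier_le f p : cintegrable f ->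
  normc (inv_fourier f p) <= c0 * fine (\int[mu]_x (normc (f x))%:E).
Proof. by move=> fi; rewrite inv_fourierE; exact: normc_fourier_le. Qed.

Lemma conj_fourier f p : cintegrable f ->
  (fourier f p)^*%C = inv_fourier (fun x => (f x)^*%C) p.
Proof.
move=> fi; have m : measurable_fun [set: R] (fun x => - (p * x)) by meas.
rewrite /fourier conj_mul -cintegral_conj; last exact: cintegrable_cis.
congr (_ * _); first by apply/eqP; rewrite eq_complex /= oppr0 !eqxx.
by apply: eq_cintegral => x; rewrite conj_mul conj_cis opprK mulrC [p * x]mulrC mulrC.
Qed.

Lemma lint_normc_prod f g : cintegrable f -> cintegrable g ->
  (\int[mu]_x \int[mu]_y (normc (f x) * normc (g y))%:E < +oo)%E.
Proof.
move=> /cintegrableP[mf fi] /cintegrableP[mg gi].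
have gf : (\int[mu]_y (normc (g y))%:E)%E \is a fin_num.
  by rewrite ge0_fin_numE// lint_ge0// => x; exact: normc_ge0.
have -> : (\int[mu]_x \int[mu]_y (normc (f x) * normc (g y))%:E =
    \int[mu]_x (fine (\int[mu]_y (normc (g y))%:E) * normc (f x))%:E)%E.
  apply: eq_integral => x _.
  by rewrite lintZ ?normc_ge0//; [rewrite -{1}(fineK gf) -EFinM mulrC | cmeas
    | move=> y; exact: normc_ge0].
apply: lintZ_lty => //; [| cmeas | by move=> x; exact: normc_ge0].
by apply: fine_ge0; apply: lint_ge0 => y; exact: normc_ge0.
Qed.

(** Fubini applies because the kernel has modulus one. *)
Lemma cfubini_cis (e : R -> R -> R) f g :
  measurable_fun setT (fun z : R * R => e z.1 z.2) ->
  cintegrable f -> cintegrable g ->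
  cintegral (fun x => f x * cintegral (fun y => g y * cis (e x y))) =
  cintegral (fun y => g y * cintegral (fun x => f x * cis (e x y))).
Proof.
move=> me fi gi; have mf := cintegrable_meas fi; have mg := cintegrable_meas gi.
have me1 x : measurable_fun setT (fun y => e x y).
  by apply: (measurableT_comp me (g := fun y : R => (x, y))); exact: measurable_pair1.
have me2 y : measurable_fun setT (fun x => e x y).
  by apply: (measurableT_comp me (g := fun x : R => (x, y))); exact: measurable_pair2.
transitivity (cintegral (fun x => cintegral (fun y => f x * (g y * cis (e x y))))).
  by apply: eq_cintegral => x; rewrite cintegralZl//; exact: cintegrable_cis.
rewrite (cfubini (K := fun x y => f x * (g y * cis (e x y)))); last 2 first.
- by cmeas.
- apply: le_lt_trans (lint_normc_prod fi gi).
  under eq_integral do under eq_integral do rewrite !normcM normc_cis mulr1.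
  exact: lexx.
apply: eq_cintegral => y; rewrite -cintegralZl; last exact: cintegrable_cis.
by apply: eq_cintegral => x; rewrite mulrCA.
Qed.

Lemma normc_cis_transform_le (h : R -> R) f : measurable_fun setT h -> cintegrable f ->
  normc (cintegral (fun x => f x * cis (h x))) <= fine (\int[mu]_x (normc (f x))%:E).
Proof.
move=> mh fi; rewrite -lee_fin fineK.
  apply: le_trans (normc_cintegral_le (cintegrable_cis mh fi)) _.
  by under eq_integral do rewrite normcM normc_cis mulr1.
rewrite ge0_fin_numE ?cintegrable_lty// lint_ge0// => x; exact: normc_ge0.
Qed.

Let cis_transform_multiplication (c : R[i]) f G : cintegrable f -> cintegrable G ->
  cintegral (fun p => c * cintegral (fun x => f x * cis (- (p * x))) * G p) =
  cintegral (fun x => f x * (c * cintegral (fun p => G p * cis (- (x * p))))).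
Proof.
move=> fi Gi; have mf := cintegrable_meas fi; have mG := cintegrable_meas Gi.
have me : measurable_fun [set: R * R] (fun z : R * R => - (z.1 * z.2)) by meas.
have m2 (x : R) : measurable_fun [set: R] (fun p : R => - (x * p)) by meas.
have I f' g' : cintegrable f' -> cintegrable g' ->
    cintegrable (fun p => g' p * cintegral (fun x => f' x * cis (- (p * x)))).
  move=> fi' gi'; have mf' := cintegrable_meas fi'.
  have m : cmeas (fun z : R * R => f' z.2 * cis (- (z.1 * z.2))) by cmeas.
  have mc := cmeas_cintegral (K := fun p x => f' x * cis (- (p * x))) m.
  have := cintegrable_bounded mc (fun p => normc_cis_transform_le (m2 p) fi') gi'.
  by congr cintegrable; apply/funext => p; rewrite mulrC.
have E := cfubini_cis (e := fun p x => - (p * x)) me Gi fi.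
transitivity (cintegral (fun p => c * (G p * cintegral (fun x => f x * cis (- (p * x)))))).
  by apply: eq_cintegral => p; rewrite -mulrA [X in c * X]mulrC.
rewrite (cintegralZl c (I _ _ fi Gi)) E -cintegralZl.
  apply: eq_cintegral => x; rewrite mulrCA; congr (_ * (_ * _)).
  by apply: eq_cintegral => p; rewrite [p * x]mulrC.
have := I _ _ Gi fi; congr cintegrable; apply/funext => x.
by congr (_ * _); apply: eq_cintegral => p; rewrite [p * x]mulrC.
Qed.

Lemma fourier_multiplication f G : cintegrable f -> cintegrable G ->
  cintegral (fun p => fourier f p * G p) = cintegral (fun x => f x * fourier G x).
Proof. exact: cis_transform_multiplication. Qed.

Lemma inv_fourier_multiplication f G : cintegrable f -> cintegrable G ->
  cintegral (fun p => inv_fourier f p * G p) =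
  cintegral (fun x => f x * inv_fourier G x).
Proof.
Proof.
move=> fi Gi.
have fi' := cintegrable_conj fi; have Gi' := cintegrable_conj Gi.
have KK1 (z : R[i]) : (z^*^*)%C = z by case: z => a b; rewrite /= opprK.
have KK f' : (fun x : R => ((f' x)^*^*)%C) = f' by apply/funext => x; exact: KK1.
have J1 : cintegrable (fun p => fourier (fun x => (f x)^*%C) p * (G p)^*%C).
  by apply: cintegrable_bounded Gi' => [|p]; [exact: cmeas_fourier (cintegrable_meas fi')
    | exact: normc_fourier_le].
have J2 : cintegrable (fun x => (f x)^*%C * fourier (fun x => (G x)^*%C) x).
  have : cintegrable (fun x => fourier (fun x => (G x)^*%C) x * (f x)^*%C).
    by apply: cintegrable_bounded fi' => [|p]; [exact: cmeas_fourier (cintegrable_meas Gi')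
      | exact: normc_fourier_le].
  by congr cintegrable; apply/funext => x; rewrite mulrC.
have := fourier_multiplication fi' Gi' => /(congr1 (@conjc R)).
rewrite -!cintegral_conj// => h.
transitivity (cintegral (fun p => (fourier (fun x => (f x)^*%C) p * (G p)^*%C)^*%C)).
  by apply: eq_cintegral => p; rewrite conj_mul (conj_fourier _ fi') (KK f) KK1.
by rewrite h; apply: eq_cintegral => p; rewrite conj_mul (conj_fourier _ Gi') (KK G) KK1.
Qed.

(** ** The heat kernel and its transform *)

Lemma cintegral_gauss_cis (t x : R) : 0 < t ->
  cintegral (fun p => (expR (- (t * p ^+ 2)))%:C * cis (p * x)) =
  (2 * pi * heat t x)%:C.
Proof.
move=> t0; have p0 := pi_gt0 R.
have fi : cintegrable (fun p : R => (expR (- (t * p ^+ 2)))%:C).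
  by case: (cintegral_lint _ _ (gauss_integral_scale t0)) => //; meas.
apply/eqP; rewrite eq_complex /=; apply/andP; split; apply/eqP.
- transitivity (\int[mu]_p (expR (- (t * p ^+ 2)) * cos (x * p)))%R.
    by apply: eq_Rintegral => p _; rewrite /= mul0r subr0 [p * x]mulrC.
  rewrite gauss_fourier_cos// /heat mulrA; congr (_ * _).
  rewrite powRN powR12_sqrt ?mulr_ge0 ?ltW//; set a := Num.sqrt (4 * pi * t).
  have a2 : a ^+ 2 = 4 * pi * t by rewrite sqr_sqrtr// ?mulr_ge0 ?ltW.
  have -> : pi / t = (2 * pi / a) ^+ 2.
    have alg (q : R) : 0 < q -> q / t = (2 * q) ^+ 2 / (4 * q * t).
      by move=> q0; field; rewrite (gt_eqF q0) (gt_eqF t0).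
    by rewrite exprMn exprVn a2; exact: alg.
  by rewrite sqrtr_sqr ger0_norm// divr_ge0 ?sqrtr_ge0// mulr_ge0 ?ltW.
- have gi : mu.-integrable setT (EFin \o (fun p => expR (- (t * p ^+ 2)) * sin (p * x))).
    have m : measurable_fun [set: R] (fun p => p * x) by meas.
    have [_ h] := cintegrable_cis m fi.
    by move: h; congr (integrable _ _ _); apply/funext => p /=; rewrite mul0r addr0.
  have mg : measurable_fun [set: R] (fun p => expR (- (t * p ^+ 2)) * sin (p * x)) by meas.
  have := Rintegral_opp mg.
  under eq_Rintegral do rewrite sqrrN mulNr sinN mulrN -mulN1r.
  rewrite (RintegralZl (-1) measurableT gi) mulN1r => /eqP; rewrite eq_sym -subr_eq0 opprK.
  rewrite -mulr2n mulrn_eq0 /= => /eqP h; rewrite -[RHS]h.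
  by apply: eq_Rintegral => p _; rewrite /= mul0r addr0.
Qed.

End Fourier.

Section HeatFourier.
Context {R : realType}.
Local Notation mu := (@lebesgue_measure R).
Implicit Types f g G : R -> R[i].
Local Notation c0 := ((Num.sqrt (2 * pi))^-1).

Lemma c0C_sqr (z : R[i]) (h : R) : c0%:C * (c0%:C * ((2 * pi * h)%:C * z)) = h%:C * z.
Proof. by rewrite !mulrA -!realCM mulrA c0_sqr mul1r. Qed.

Lemma cintegrable_heat (t y : R) : 0 < t -> cintegrable (fun x => (heat t (x - y))%:C).
Proof.
move=> t0; have mh : measurable_fun [set: R] (fun x => heat t (x - y)) by cmeas.
have h0 x : 0 <= heat t (x - y) by exact: heat_ge0.
apply: (proj1 (cintegral_lint mh h0 (r := 1) _)).
by rewrite (lint_shift y (f := heat t)) ?lint_heat//; [cmeas | exact: heat_ge0].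
Qed.

Lemma cintegral_heat_cis (t y p : R) : 0 < t ->
  cintegral (fun x => (heat t (x - y))%:C * cis (x * p)) =
  (expR (- (t * p ^+ 2)))%:C * cis (p * y).
Proof.
move=> t0.
have gi := cintegrable_heat 0 t0.
have gi' : cintegrable (fun x => (heat t x)%:C).
  by move: gi; congr cintegrable; apply/funext => x; rewrite subr0.
have m (z : R) : measurable_fun [set: R] (fun x => (x + z) * p) by meas.
transitivity (cintegral (fun x => (heat t x)%:C * cis ((x + y) * p))).
  rewrite -(cintegral_shift y (cintegrable_cis (m y) gi')).
  by apply: eq_cintegral => x; rewrite subrK.
transitivity (cintegral (fun x => ((heat t x)%:C * cis (x * p)) * cis (p * y))).
  by apply: eq_cintegral => x; rewrite -mulrA -cisD mulrDl [y * p]mulrC.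
rewrite cintegralZr; last first.
  have m0 : measurable_fun [set: R] (fun x => x * p) by meas.
  exact: cintegrable_cis m0 gi'.
congr (_ * _).
have t4 : 0 < (4 * t)^-1 by rewrite invr_gt0 mulr_gt0.
have m0 : measurable_fun [set: R] (fun x => x * p) by meas.
have ei : cintegrable (fun x : R => (expR (- ((4 * t)^-1 * x ^+ 2)))%:C).
  by case: (cintegral_lint _ _ (gauss_integral_scale t4)) => //; meas.
transitivity (cintegral (fun x => ((4 * pi * t) `^ (- 2^-1))%:C *
   ((expR (- ((4 * t)^-1 * x ^+ 2)))%:C * cis (x * p)))).
  by apply: eq_cintegral => x; rewrite /heat realCM mulrA [x ^+ 2 / _]mulrC.
rewrite cintegralZl; last exact: cintegrable_cis m0 ei.
rewrite cintegral_gauss_cis// -realCM /heat; congr (_%:C).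
have p0 := pi_gt0 R.
have -> : p ^+ 2 / (4 * (4 * t)^-1) = t * p ^+ 2 by field; rewrite gt_eqF.
rewrite !mulrA -[RHS]mul1r; congr (_ * _).
have -> (a b q : R) : a * 2 * q * b = 2 * q * (a * b) by ring.
rewrite -powRM ?mulr_ge0 ?invr_ge0 ?mulr_ge0 ?ltW//.
have alg (q : R) : 4 * q * t * (4 * q * (4 * t)^-1) = (2 * q) ^+ 2.
  by field; rewrite gt_eqF.
rewrite alg powRN powR12_sqrt ?sqr_ge0// sqrtr_sqr ger0_norm ?mulr_ge0 ?ltW//.
by rewrite mulfV// gt_eqF// mulr_gt0.
Qed.

(** Fourier inversion regularized by a Gaussian: after exchanging the integrals the
    integral over frequencies is the transform of the Gaussian. *)
Lemma inv_fourier_gauss_fourier (t x : R) f : 0 < t -> cintegrable f ->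
  inv_fourier (fun p => (expR (- (t * p ^+ 2)))%:C * fourier f p) x =
  cintegral (fun y => (heat t (x - y))%:C * f y).
Proof.
move=> t0 fi; have mf := cintegrable_meas fi.
have ei : cintegrable (fun x : R => (expR (- (t * x ^+ 2)))%:C).
  by case: (cintegral_lint _ _ (gauss_integral_scale t0)) => //; meas.
have m0 (z : R) : measurable_fun [set: R] (fun p => p * z) by meas.
have Gi := cintegrable_cis (m0 x) ei.
have E := fourier_multiplication fi Gi.
rewrite /inv_fourier.
transitivity (c0%:C * cintegral (fun p => fourier f p * ((expR (- (t * p ^+ 2)))%:C * cis (p * x)))).
  by congr (_ * _); apply: eq_cintegral => p; rewrite mulrAC mulrC.
rewrite E.
have FG y : fourier (fun p => (expR (- (t * p ^+ 2)))%:C * cis (p * x)) y =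
    c0%:C * (2 * pi * heat t (x - y))%:C.
  rewrite /fourier; congr (_ * _); rewrite -cintegral_gauss_cis//.
  by apply: eq_cintegral => p; rewrite -mulrA -cisD; congr (_ * cis _); ring.
rewrite -cintegralZl.
  by apply: eq_cintegral => y; rewrite FG [f y * _]mulrC -(mulrA c0%:C) c0C_sqr.
have [M hM] : exists M, forall y, normc (fourier (fun p => (expR (- (t * p ^+ 2)))%:C * cis (p * x)) y) <= M.
  by eexists => y; exact: normc_fourier_le.
have := cintegrable_bounded (cmeas_fourier (cintegrable_meas Gi)) hM fi.
by congr cintegrable; apply/funext => y; rewrite mulrC.
Qed.

Lemma heat_inv_fourier (t y : R) G : 0 < t -> cintegrable G ->
  cintegral (fun x => (heat t (x - y))%:C * inv_fourier G x) =
  inv_fourier (fun p => (expR (- (t * p ^+ 2)))%:C * G p) y.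
Proof.
move=> t0 Gi; rewrite -(inv_fourier_multiplication (cintegrable_heat y t0) Gi).
transitivity (cintegral (fun p => c0%:C * ((expR (- (t * p ^+ 2)))%:C * G p * cis (p * y)))).
  apply: eq_cintegral => p; rewrite /inv_fourier cintegral_heat_cis// -!mulrA.
  by congr (_ * (_ * _)); rewrite mulrC.
rewrite cintegralZl//.
have m0 : measurable_fun [set: R] (fun p => p * y) by meas.
apply: (cintegrable_cis m0).
apply: (cintegrable_realM (M := 1)) => //; first by meas.
move=> p; rewrite ger0_norm ?expR_ge0// -[leRHS]expR0 ler_expR oppr_le0.
by rewrite mulr_ge0 ?sqr_ge0 ?ltW.
Qed.

End HeatFourier.

(** * The Riesz kernel as a superposition of heat kernels *)

Section RieszKernel.
Context {R : realType} (s : R) (s0 : 0 < s) (s1 : s < 1).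
Local Notation mu := (@lebesgue_measure R).
Implicit Types f g G : R -> R[i].

Let order_bounds : [/\ 0 < (1 - s) / 2, (1 - s) / 2 < 1, 0 < s / 2 & s / 2 < 1].
Proof. by move: s0 s1 => h0 h1; split; lra. Qed.

Definition rker (z : R) : R := Lambda s / `|z| `^ (1 - s).

Lemma Lambda_gt0 : 0 < Lambda s.
Proof.
have p0 := pi_gt0 R.
have [l1 l2 l3 l4] := order_bounds.
apply: divr_gt0; first exact: Gamma_gt0.
apply: mulr_gt0; last exact: Gamma_gt0.
by rewrite mulr_gt0 ?powR_gt0// sqrtr_gt0 mulr_gt0.
Qed.

Lemma rkerE (z : R) : rker z = Lambda s * `|z| `^ (s - 1).
Proof. by rewrite /rker -powRN opprB. Qed.

Lemma rker_ge0 z : 0 <= rker z.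
Proof. by rewrite rkerE mulr_ge0 ?powR_ge0 ?ltW// Lambda_gt0. Qed.

Lemma meas_rker : measurable_fun setT rker.
Proof. by rewrite /rker; meas. Qed.

(** Integrated over t against exp(-tp^2) this weight gives a multiple of |p|^(-s),
    and against the heat kernel the same multiple of the Riesz kernel. *)
Definition gamma_weight (t : R) : R := if 0 < t then t `^ (s / 2 - 1) else 0.

Lemma gamma_weight_ge0 t : 0 <= gamma_weight t.
Proof. by rewrite /gamma_weight; case: ifP => // _; exact: powR_ge0. Qed.

Lemma meas_gamma_weight : measurable_fun setT gamma_weight.
Proof. by rewrite /gamma_weight; meas. Qed.

Lemma powR_sqr_half (a z : R) : (z ^+ 2) `^ (a / 2) = `|z| `^ a.
Proof.
by rewrite -real_normK ?num_real// -powR_mulrn// -powRrM; congr (_ `^ _); field.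
Qed.

Lemma lint_gamma_heat (z : R) : z != 0 ->
  (\int[mu]_t (gamma_weight t * heat t z)%:E = (Gamma (s / 2) * rker z)%:E)%E.
Proof.
move=> z0; have p0 := pi_gt0 R.
have [a0 a1 a2 a3] := order_bounds.
have nz : 0 < `|z| by rewrite normr_gt0.
transitivity (\int[mu]_t (if 0 < t then t `^ (- ((1 - s) / 2) - 2^-1) * heat t z else 0)%:E)%E.
  apply: eq_integral => t _; rewrite /gamma_weight; case: ifP => _; last by rewrite mul0r.
  by congr (_ `^ _ * _)%:E; field.
rewrite lint_powR_heat//; congr EFin.
have G0 : Gamma (s / 2) != 0 by rewrite gt_eqF// Gamma_gt0.
rewrite rkerE /Lambda.
have -> : z ^+ 2 / 4 = (`|z| / 2) ^+ 2.
  by rewrite exprMn real_normK ?num_real//; congr (_ * _); rewrite expr2 -invfM; congr (_^-1); ring.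
rewrite -mulNr powR_sqr_half ger0_norm ?divr_ge0// (@powRM _ `|z| 2^-1) ?invr_ge0//.
have -> : 2^-1 `^ (- (1 - s)) = 2 `^ (1 - s) :> R.
  by rewrite -powR_inv1// -powRrM mulN1r opprK.
rewrite opprB.
have -> : (4 * pi) `^ (- 2^-1) = (Num.sqrt (2 * pi))^-1 * 2 `^ (- 2^-1) :> R.
  rewrite -powR12_sqrt ?mulr_ge0 ?ltW// -powRN -powRM ?mulr_ge0 ?ltW//.
  by congr (_ `^ _); ring.
have -> : 2 `^ (s - 2^-1) = (2 `^ (- 2^-1) * 2 `^ (1 - s))^-1 :> R.
  by rewrite -powRD ?pnatr_eq0 ?implybT// -powRN; congr (_ `^ _); field.
by field; rewrite G0 !gt_eqF ?powR_gt0 ?sqrtr_gt0 ?mulr_gt0.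
Qed.

Lemma lint_gamma_gauss (p : R) : p != 0 ->
  (\int[mu]_t (gamma_weight t * expR (- (t * p ^+ 2)))%:E =
   (Gamma (s / 2) * `|p| `^ (- s))%:E)%E.
Proof.
move=> p0; have [a0 a1 a2 a3] := order_bounds.
have p2 : 0 < p ^+ 2 by rewrite exprn_even_gt0.
rewrite -powR_sqr_half mulNr -gamma_integral_scale//.
apply: eq_integral => t _; rewrite /gamma_weight; case: ifP => _; rewrite ?mul0r//.
by rewrite [t * _]mulrC.
Qed.

(** Subordinating both the Riesz kernel and the multiplier [|p|^-s] to Gaussians
    reduces the statement to the fact that the heat semigroup is a Gaussian
    multiplier; the Gamma factors on both sides agree. *)
Lemma riesz_inv_fourier G y : cintegrable G ->
  cintegrable (fun p => (`|p| `^ (- s))%:C * G p) ->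
  (\int[mu]_x (rker (x - y) * normc (inv_fourier G x))%:E < +oo)%E ->
  cintegral (fun x => (rker (x - y))%:C * inv_fourier G x) =
  inv_fourier (fun p => (`|p| `^ (- s))%:C * G p) y.
Proof.
move=> Gi pGi fin; have mG := cintegrable_meas Gi.
have mg := cmeas_inv_fourier mG.
have hg t : 0 < t -> cintegral (fun x => (heat t (x - y))%:C * inv_fourier G x) =
    inv_fourier (fun p => (expR (- (t * p ^+ 2)))%:C * G p) y.
  by move=> t0; exact: heat_inv_fourier.
have [M hM] : exists M, forall x, normc (inv_fourier G x) <= M.
  by eexists => x; exact: normc_inv_fourier_le.
move: (inv_fourier G) mg hg hM fin => g mg hg hM fin.
have [a0 a1 a2 a3] := order_bounds.
have G0 : 0 < Gamma (s / 2) by rewrite Gamma_gt0.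
have mrk := meas_rker; have mw := meas_gamma_weight.
pose K x t : R[i] := (gamma_weight t * heat t (x - y))%:C * g x.
have mK : cmeas (fun z : R * R => K z.1 z.2).
  by rewrite /K; cmeas.
have aeK : {ae mu, forall x, (\int[mu]_t (gamma_weight t * heat t (x - y))%:E =
    (Gamma (s / 2) * rker (x - y))%:E)%E}.
  by apply: ae_imp (ae_neq y) _ => x xy; rewrite lint_gamma_heat// subr_eq0.
have wh0 x t : 0 <= gamma_weight t * heat t (x - y) by rewrite mulr_ge0 ?gamma_weight_ge0 ?heat_ge0.
have mwh x : measurable_fun [set: R] (fun t => gamma_weight t * heat t (x - y)).
  by cmeas.
have fK : (\int[mu]_x \int[mu]_t (normc (K x t))%:E < +oo)%E.
  rewrite (_ : (\int[mu]_x _)%E = (\int[mu]_x (Gamma (s / 2) * (rker (x - y) * normc (g x)))%:E)%E).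
    apply: lintZ_lty => //; [exact: ltW | cmeas |
      by move=> x; apply: mulr_ge0; [exact: rker_ge0 | exact: normc_ge0]].
  apply: ae_eq_lint.
  - apply: (meas_lint (F := fun x t => normc (K x t))); first by cmeas.
    by move=> x t; exact: normc_ge0.
  - by cmeas.
  - by move=> x; apply: lint_ge0 => t; exact: normc_ge0.
  - move=> x; rewrite lee_fin; apply: mulr_ge0; first exact: ltW.
    by apply: mulr_ge0; [exact: rker_ge0 | exact: normc_ge0].
  apply: ae_imp aeK _ => x ex.
  transitivity (\int[mu]_t (normc (g x) * (gamma_weight t * heat t (x - y)))%:E)%E.
    by apply: eq_integral => t _; rewrite /K normcM normc_real ger0_norm// mulrC.
  rewrite lintZ ?normc_ge0//.
  by rewrite ex -EFinM mulrC mulrA.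
have E1 : cintegral (fun x => cintegral (K x)) =
    (Gamma (s / 2))%:C * cintegral (fun x => (rker (x - y))%:C * g x).
  rewrite -cintegralZl; last first.
    apply/cintegrableP; split; first by cmeas.
    move: fin; congr (_ < _)%E; apply: eq_integral => x _.
    by rewrite normcM normc_real ger0_norm//; exact: rker_ge0.
  apply: ae_eq_cintegral; first exact: cmeas_cintegral.
    by cmeas.
  apply: ae_imp aeK _ => x ex.
  have [i1 i2] := cintegral_lint (mwh x) (wh0 x) ex.
  by rewrite /K cintegralZr// i2 realCM mulrA.
have E2 : cintegral (fun t => cintegral (fun x => K x t)) =
    cintegral (fun t => (gamma_weight t)%:C * inv_fourier (fun p => (expR (- (t * p ^+ 2)))%:C * G p) y).
  apply: eq_cintegral => t; rewrite /gamma_weight; case: (ltP 0 t) => t0; last first.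
    rewrite mul0r -[RHS](cintegral0 (R := R)); apply: eq_cintegral => x.
    by rewrite /K /gamma_weight ltNge t0/= !mul0r.
  rewrite -hg// -cintegralZl.
    by apply: eq_cintegral => x; rewrite /K /gamma_weight t0 realCM mulrA.
  have := cintegrable_bounded mg hM (cintegrable_heat y t0).
  by congr cintegrable; apply/funext => x; rewrite mulrC.
pose L t p : R[i] := (gamma_weight t * expR (- (t * p ^+ 2)))%:C * (G p * cis (p * y)).
have mL : cmeas (fun z : R * R => L z.1 z.2).
  by rewrite /L; cmeas.
have mLs : cmeas (fun z : R * R => L z.2 z.1).
  by rewrite /L; cmeas.
have we0 p t : 0 <= gamma_weight t * expR (- (t * p ^+ 2)).
  by rewrite mulr_ge0 ?gamma_weight_ge0 ?expR_ge0.
have mwe p : measurable_fun [set: R] (fun t => gamma_weight t * expR (- (t * p ^+ 2))).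
  by cmeas.
have fL' : (\int[mu]_p \int[mu]_t (normc (L t p))%:E < +oo)%E.
  rewrite (_ : (\int[mu]_p _)%E = (\int[mu]_p (Gamma (s / 2) * normc ((`|p| `^ (- s))%:C * G p))%:E)%E).
    have mpG := cintegrable_meas pGi.
    apply: lintZ_lty => //; [exact: ltW | cmeas | by move=> x; exact: normc_ge0 |].
    exact: cintegrable_lty pGi.
  apply: ae_eq_lint.
  - apply: (meas_lint (F := fun p t => normc (L t p))); first by cmeas.
    by move=> x t; exact: normc_ge0.
  - by cmeas.
  - by move=> x; apply: lint_ge0 => t; exact: normc_ge0.
  - by move=> x; rewrite lee_fin; apply: mulr_ge0; [exact: ltW | exact: normc_ge0].
  apply: ae_imp (ae_neq 0) _ => p pn0.
  transitivity (\int[mu]_t (normc (G p) * (gamma_weight t * expR (- (t * p ^+ 2))))%:E)%E.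
    by apply: eq_integral => t _; rewrite /L !normcM normc_cis mulr1 normc_real ger0_norm// mulrC.
  rewrite lintZ ?normc_ge0//.
  by rewrite lint_gamma_gauss// -EFinM normcM normc_real (ger0_norm (powR_ge0 _ _)) mulrC mulrA.
have fL : (\int[mu]_t \int[mu]_p (normc (L t p))%:E < +oo)%E.
  rewrite (lint_fubini (F := fun t p => normc (L t p)))//; first by cmeas.
  by move=> t p; exact: normc_ge0.
have mpc : measurable_fun [set: R] (fun p => p * y) by meas.
have E3 : cintegral (fun t => (gamma_weight t)%:C * inv_fourier (fun p => (expR (- (t * p ^+ 2)))%:C * G p) y) =
    ((Num.sqrt (2 * pi))^-1)%:C * cintegral (fun t => cintegral (L t)).
  rewrite -cintegralZl; last exact: cintegrable_cintegral.
  apply: eq_cintegral => t; rewrite /inv_fourier mulrCA; congr (_ * _).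
  have [t0|t0] := ltP 0 t; last first.
    rewrite /gamma_weight ltNge t0 mul0r -[LHS](cintegral0 (R := R)).
    by apply: eq_cintegral => p; rewrite /L /gamma_weight ltNge t0/= !mul0r.
  rewrite -cintegralZl.
    by apply: eq_cintegral => p; rewrite /L realCM !mulrA.
  apply: (cintegrable_cis mpc); apply: (cintegrable_realM (M := 1)) => //; first by meas.
  move=> p; rewrite ger0_norm ?expR_ge0// -[leRHS]expR0 ler_expR oppr_le0.
  by rewrite mulr_ge0 ?sqr_ge0 ?ltW.
have E4 : cintegral (fun p => cintegral (fun t => L t p)) =
   (Gamma (s / 2))%:C * cintegral (fun p => (`|p| `^ (- s))%:C * G p * cis (p * y)).
  rewrite -cintegralZl; last exact: cintegrable_cis.
  apply: ae_eq_cintegral; first exact: (cmeas_cintegral (K := fun p t => L t p)).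
    by cmeas.
  apply: ae_imp (ae_neq 0) _ => p pn0.
  have [i1 i2] := cintegral_lint (mwe p) (we0 p) (lint_gamma_gauss pn0).
  by rewrite /L cintegralZr// i2 realCM !mulrA.
have GC0 : (Gamma (s / 2))%:C != 0 by rewrite eq_complex /= negb_and gt_eqF.
apply: (mulfI GC0); rewrite -E1 (cfubini mK fK) E2 E3 (cfubini mL fL) E4.
by rewrite /inv_fourier mulrCA.
Qed.

End RieszKernel.

(** * Bessel's inequality and the energy of the Riesz kernel *)

Ltac nneg := repeat first
 [ assumption | exact: normc_ge0 | exact: heat_ge0 | exact: powR_ge0 | exact: expR_ge0
 | exact: sqr_ge0 | exact: normr_ge0 | exact: sqrtr_ge0 | exact: gamma_weight_ge0
 | (apply: rker_ge0; assumption) | apply: mulr_ge0 | apply: addr_ge0 | apply: divr_ge0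
 | (apply: ltW; assumption) | done | move=> ? ].

Section Energy.
Context {R : realType}.
Local Notation mu := (@lebesgue_measure R).
Implicit Types f g h G : R -> R[i].

Lemma lint_fubini3 (F : R -> R -> R -> R) :
  measurable_fun setT (fun z : (R * R) * R => F z.1.1 z.1.2 z.2) ->
  (forall t x y, 0 <= F t x y) ->
  (\int[mu]_t \int[mu]_x \int[mu]_y (F t x y)%:E =
   \int[mu]_x \int[mu]_y \int[mu]_t (F t x y)%:E)%E.
Proof.
move=> mF F0.
have mf : measurable_fun [set: R * R] (fun z : R * R => \int[mu]_y (F z.1 z.2 y)%:E)%E.
  apply: (@measurable_fun_fubini_tonelli_F _ _ (R * R)%type _ _ mu
    (fun z : (R * R) * R => (F z.1.1 z.1.2 z.2)%:E)) => [|z]; last by rewrite lee_fin.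
  exact: meas_EFin.
transitivity (\int[mu]_x \int[mu]_t \int[mu]_y (F t x y)%:E)%E.
  apply: (@fubini_tonelli _ _ _ _ _ mu mu (fun z => \int[mu]_y (F z.1 z.2 y)%:E)%E mf).
  by move=> z; exact: lint_ge0.
apply: eq_integral => x _; apply: (lint_fubini (F := fun t y => F t x y)) => //.
apply: (measurableT_comp mF (g := fun z : R * R => ((z.1, x), z.2))).
apply/measurable_fun_pairP; split; last exact: measurable_snd.
by apply/measurable_fun_pairP; split; [exact: measurable_fst | exact: measurable_cst].
Qed.

Lemma gauss_le1 (t p : R) : 0 < t -> expR (- (t * p ^+ 2)) <= 1.
Proof.
by move=> t0; rewrite -[leRHS]expR0 ler_expR oppr_le0 mulr_ge0 ?sqr_ge0 ?ltW.
Qed.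

Lemma cintegrable_gaussM (t : R) f : 0 < t -> cintegrable f ->
  cintegrable (fun p => (expR (- (t * p ^+ 2)))%:C * f p).
Proof.
move=> t0; apply: (cintegrable_realM (M := 1)); first by meas.
by move=> p; rewrite ger0_norm ?expR_ge0// gauss_le1.
Qed.

Lemma cintegrable_gauss_fourier (t : R) f : 0 < t -> cintegrable f ->
  cintegrable (fun p => (expR (- (t * p ^+ 2)))%:C * fourier f p).
Proof.
move=> t0 fi.
have ei : cintegrable (fun x : R => (expR (- (t * x ^+ 2)))%:C).
  by case: (cintegral_lint _ _ (gauss_integral_scale t0)) => //; meas.
have := cintegrable_bounded (cmeas_fourier (cintegrable_meas fi))
  (fun p => normc_fourier_le p fi) ei.
by congr cintegrable; apply/funext => p; rewrite mulrC.
Qed.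

Lemma heat_form (t : R) h f : 0 < t -> cintegrable h -> cintegrable f ->
  cintegral (fun p => (fourier h p)^*%C * ((expR (- (t * p ^+ 2)))%:C * fourier f p)) =
  cintegral (fun x => (h x)^*%C * cintegral (fun y => (heat t (x - y))%:C * f y)).
Proof.
move=> t0 hi fi.
have := inv_fourier_multiplication (cintegrable_conj hi) (cintegrable_gauss_fourier t0 fi).
move=> E; transitivity (cintegral (fun p => inv_fourier (fun x => (h x)^*%C) p *
    ((expR (- (t * p ^+ 2)))%:C * fourier f p))).
  by apply: eq_cintegral => p; rewrite conj_fourier.
by rewrite E; apply: eq_cintegral => x; rewrite inv_fourier_gauss_fourier.
Qed.

(** The left side is the value at (f, f) of the heat form; on the right the modulus
    has been taken inside the integral. *)
Lemma heat_energy (t : R) f : 0 < t -> cintegrable f ->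
  (\int[mu]_p (expR (- (t * p ^+ 2)) * normc (fourier f p) ^+ 2)%:E <=
   \int[mu]_x \int[mu]_y (normc (f x) * heat t (x - y) * normc (f y))%:E)%E.
Proof.
move=> t0 fi; have mf := cintegrable_meas fi; have mF := cmeas_fourier mf.
have [M hM] : exists M, forall p, normc (fourier f p) <= M.
  by eexists => p; exact: normc_fourier_le.
have E := heat_form t0 fi fi.
have Gi := cintegrable_gauss_fourier t0 fi.
move: (fourier f) mF M hM E Gi => F mF M hM E Gi.
have FGi : cintegrable (fun p => (F p)^*%C * ((expR (- (t * p ^+ 2)))%:C * F p)).
  apply: (cintegrable_bounded (M := M)) => //; first by cmeas.
  by move=> p; rewrite normc_conj.
have eF p : (F p)^*%C * ((expR (- (t * p ^+ 2)))%:C * F p) =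
    (expR (- (t * p ^+ 2)) * normc (F p) ^+ 2)%:C.
  by rewrite mulrCA mul_conj -realCM.
have e0 p : 0 <= expR (- (t * p ^+ 2)) * normc (F p) ^+ 2.
  by rewrite mulr_ge0 ?expR_ge0 ?sqr_ge0.
pose H x := cintegral (fun y => (heat t (x - y))%:C * f y).
have mH : cmeasurable H by apply: (cmeas_cintegral (K := fun x y => (heat t (x - y))%:C * f y)); cmeas.
have hf x : (\int[mu]_y (heat t (x - y) * normc (f y))%:E < +oo)%E.
  have hb y : heat t (x - y) <= (4 * pi * t) `^ (- 2^-1).
    rewrite /heat ler_piMr ?powR_ge0// -[leRHS]expR0 ler_expR oppr_le0.
    by rewrite divr_ge0 ?sqr_ge0 ?mulr_ge0 ?ltW.
  apply: le_lt_trans (_ : \int[mu]_y ((4 * pi * t) `^ (- 2^-1) * normc (f y))%:E < +oo)%E.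
    apply: le_lint; [cmeas | cmeas | |].
    - by move=> y; rewrite mulr_ge0 ?heat_ge0 ?normc_ge0.
    - by move=> y; rewrite ler_wpM2r ?normc_ge0.
  apply: lintZ_lty; [exact: powR_ge0 | cmeas | by move=> y; exact: normc_ge0
    | exact: cintegrable_lty].
have hfi x : cintegrable (fun y => (heat t (x - y))%:C * f y).
  apply/cintegrableP; split; first by cmeas.
  under eq_integral do rewrite normcM normc_real (ger0_norm (heat_ge0 _ _)).
  exact: hf.
have fHi : cintegrable (fun x => (f x)^*%C * H x).
  have : cintegrable (fun x => H x * (f x)^*%C).
    apply: (cintegrable_bounded (M := (4 * pi * t) `^ (- 2^-1) * fine (\int[mu]_y (normc (f y))%:E))) => //; last exact: cintegrable_conj.
    move=> x; rewrite -lee_fin EFinM fineK; last first.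
      by rewrite ge0_fin_numE ?cintegrable_lty// lint_ge0// => y; exact: normc_ge0.
    apply: le_trans (normc_cintegral_le (hfi x)) _.
    rewrite -lintZ ?powR_ge0//; [|cmeas|by move=> y; exact: normc_ge0].
    apply: le_lint; [cmeas | cmeas | by move=> y; exact: normc_ge0 |].
    move=> y; rewrite normcM normc_real (ger0_norm (heat_ge0 _ _)) ler_wpM2r ?normc_ge0//.
    rewrite /heat ler_piMr ?powR_ge0// -[leRHS]expR0 ler_expR oppr_le0.
    by rewrite divr_ge0 ?sqr_ge0 ?mulr_ge0 ?ltW.
  by congr cintegrable; apply/funext => x; rewrite mulrC.
have {}E : cintegral (fun p => (expR (- (t * p ^+ 2)) * normc (F p) ^+ 2)%:C) =
    cintegral (fun x => (f x)^*%C * H x).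
  by rewrite -E; apply: eq_cintegral => p; rewrite eF.
apply: (@le_trans _ _ (\int[mu]_x (normc ((f x)^*%C * H x))%:E)%E); last first.
  apply: ge0_le_integral => //.
  - by move=> x _; rewrite lee_fin normc_ge0.
  - by cmeas.
  - apply: (meas_lint (F := fun x y => normc (f x) * heat t (x - y) * normc (f y))); first by cmeas.
    by nneg.
  move=> x _; rewrite normcM normc_conj.
  under eq_integral do rewrite -mulrA.
  rewrite lintZ ?normc_ge0//; [|cmeas|by move=> y; rewrite mulr_ge0 ?normc_ge0 ?heat_ge0].
  rewrite EFinM lee_wpmul2l ?lee_fin ?normc_ge0//.
  apply: le_trans (normc_cintegral_le (hfi x)) _.
  by under eq_integral do rewrite normcM normc_real (ger0_norm (heat_ge0 _ _)).
apply: le_trans (normc_cintegral_le fHi); rewrite -E cintegral_real normc_real.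
have fin : (\int[mu]_p (expR (- (t * p ^+ 2)) * normc (F p) ^+ 2)%:E \is a fin_num)%E.
  rewrite ge0_fin_numE ?lint_ge0//.
  apply: le_lt_trans (cintegrable_lty FGi).
  apply: le_lint; [cmeas | cmeas | by [] |].
  by move=> p; rewrite eF normc_real ler_norm.
rewrite ger0_norm; first by rewrite /Rintegral fineK.
by apply: fine_ge0; exact: lint_ge0.
Qed.

Lemma le_limn_einf (u : nat -> \bar R) (a : \bar R) :
  (forall n, a <= u n)%E -> (a <= limn_einf u)%E.
Proof.
move=> au; rewrite /limn_einf leeNr /limn_esup /limf_esup.
apply: le_trans (_ : ereal_sup [set (\- u)%E n | n in setT] <= _)%E.
  by apply: ereal_inf_lbound; exists setT => //; exact: filterT.
by apply: ge_ereal_sup => _ [n _ <-]; rewrite leeN2.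
Qed.

Lemma limn_einf_le (u : nat -> \bar R) (a : \bar R) :
  (forall n, u n <= a)%E -> (limn_einf u <= a)%E.
Proof.
move=> ua; rewrite /limn_einf leeNl /limn_esup /limf_esup.
apply: le_ereal_inf_tmp => _ [A oA <-].
have [n An] : A !=set0 by exact: filter_ex oA.
apply: le_trans (_ : - u n <= _)%E; first by rewrite leeN2.
by apply: ereal_sup_ubound; exists n.
Qed.

Lemma lint_fatou (g_ : nat -> R -> R) (g : R -> R) (C : \bar R) :
  (forall n, measurable_fun setT (g_ n)) -> measurable_fun setT g ->
  (forall n x, 0 <= g_ n x) -> (forall x, 0 <= g x) ->
  {ae mu, forall x, g_ n x @[n --> \oo] --> g x} ->
  (forall n, \int[mu]_x (g_ n x)%:E <= C)%E -> (\int[mu]_x (g x)%:E <= C)%E.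
Proof.
move=> mg_ mg g_0 g0 cv gC.
pose F n x := (g_ n x)%:E.
have F0 n (x : R) : setT x -> (0 <= F n x)%E by rewrite lee_fin.
have := fatou mu measurableT (fun n => meas_EFin (mg_ n)) F0 => ft.
have e : (\int[mu]_x limn_einf (F^~ x) = \int[mu]_x (g x)%:E)%E.
  apply: ae_eq_lint.
  - rewrite (_ : (fun x => limn_einf (F ^~ x)) = (fun x => - limn_esup (fun n => - F n x))%E).
      apply: measurableT_comp => //; apply: measurable_fun_limn_esup => n.
      by apply: measurableT_comp => //; exact: meas_EFin.
    by apply/funext => x; rewrite /limn_einf; congr (- limn_esup _)%E.
  - exact: meas_EFin.
  - by move=> x; apply: le_limn_einf => n; rewrite lee_fin.
  - by move=> x; rewrite lee_fin.
  - apply: ae_imp cv _ => x cx.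
    have : (fun n => F n x) @ \oo --> (g x)%:E by apply: cvg_EFin => //; exact: nearW.
    by move/cvg_limn_einf_sup => [-> _].
by rewrite -e; apply: le_trans ft _; exact: limn_einf_le.
Qed.

Lemma gauss_cvg1 (p : R) : expR (- (n.+1%:R^-1 * p ^+ 2)) @[n --> \oo] --> (1 : R).
Proof.
have h : (fun n => - (n.+1%:R^-1 * p ^+ 2)) @ \oo --> - (0 * p ^+ 2).
  by apply: cvgN; apply: cvgMl; exact: cvg_harmonic.
have e : expR (- (0 * p ^+ 2)) = 1 by rewrite mul0r oppr0 expR0.
rewrite -[X in _ --> X]e; apply: continuous_cvg; [exact: continuous_expR | exact: h].
Qed.

Lemma lint_heat_mean (t : R) (k : R -> R) : 0 < t -> measurable_fun setT k ->
  (forall x, 0 <= k x) ->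
  (\int[mu]_x \int[mu]_y (heat t (x - y) * k x)%:E = \int[mu]_x (k x)%:E)%E /\
  (\int[mu]_x \int[mu]_y (heat t (x - y) * k y)%:E = \int[mu]_x (k x)%:E)%E.
Proof.
move=> t0 mk k0.
have h1 (x : R) (c : R) : 0 <= c -> (\int[mu]_y (heat t (x - y) * c)%:E = c%:E)%E.
  move=> c0; under eq_integral do rewrite mulrC.
  rewrite lintZ//; [|cmeas|by nneg].
  by rewrite (lint_reflect x (f := heat t)) ?lint_heat ?mule1//; [cmeas | nneg].
have e1 : (\int[mu]_x \int[mu]_y (heat t (x - y) * k x)%:E = \int[mu]_x (k x)%:E)%E.
  by apply: eq_integral => x _; exact: h1.
split => //; rewrite (lint_fubini (F := fun x y => heat t (x - y) * k y)); [|cmeas|by nneg].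
by rewrite -e1; apply: eq_integral => y _; apply: eq_integral => x _; rewrite heatC.
Qed.

(** Bessel's inequality: the heat energy is bounded by Schur's test, and
    increases to the energy of the transform as time tends to zero. *)
Lemma fourier_bessel f : cintegrable f ->
  (\int[mu]_p (normc (fourier f p) ^+ 2)%:E <= \int[mu]_x (normc (f x) ^+ 2)%:E)%E.
Proof.
move=> fi; have mf := cintegrable_meas fi; have mF := cmeas_fourier mf.
have bound (t : R) : 0 < t ->
    (\int[mu]_p (expR (- (t * p ^+ 2)) * normc (fourier f p) ^+ 2)%:E <=
     \int[mu]_x (normc (f x) ^+ 2)%:E)%E.
  move=> t0; apply: le_trans (heat_energy t0 fi) _.
  pose k x := 2^-1 * normc (f x) ^+ 2.
  have mk : measurable_fun [set: R] k by rewrite /k; cmeas.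
  have k0 x : 0 <= k x by rewrite /k; nneg.
  have [e1 e2] := lint_heat_mean t0 mk k0.
  apply: (@le_trans _ _ (\int[mu]_x \int[mu]_y (heat t (x - y) * k x + heat t (x - y) * k y)%:E)%E).
    apply: ge0_le_integral => //.
    - by move=> x _; apply: lint_ge0 => y; nneg.
    - by apply: (meas_lint (F := fun x y => normc (f x) * heat t (x - y) * normc (f y))); [cmeas | nneg].
    - by apply: (meas_lint (F := fun x y => heat t (x - y) * k x + heat t (x - y) * k y)); [cmeas | nneg].
    move=> x _; apply: le_lint; [cmeas | cmeas | by nneg |].
    move=> y; rewrite -mulrDr [normc _ * _]mulrC -mulrA ler_wpM2l ?heat_ge0// /k.
    by have := sqr_ge0 (normc (f x) - normc (f y)); rewrite sqrrB; lra.
  have -> : (\int[mu]_x \int[mu]_y (heat t (x - y) * k x + heat t (x - y) * k y)%:E =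
      \int[mu]_x (\int[mu]_y (heat t (x - y) * k x)%:E + \int[mu]_y (heat t (x - y) * k y)%:E))%E.
    by apply: eq_integral => x _; rewrite lintD//; [cmeas | cmeas | nneg | nneg].
  rewrite ge0_integralD//; last 4 first.
  - by move=> x _; apply: lint_ge0 => y; nneg.
  - by apply: (meas_lint (F := fun x y => heat t (x - y) * k x)); [cmeas | nneg].
  - by move=> x _; apply: lint_ge0 => y; nneg.
  - by apply: (meas_lint (F := fun x y => heat t (x - y) * k y)); [cmeas | nneg].
  rewrite e1 e2 -lintD//; apply: le_lint; [cmeas | cmeas | by nneg |].
  by move=> x; rewrite /k; lra.
apply: (@lint_fatou (fun n p => expR (- (n.+1%:R^-1 * p ^+ 2)) * normc (fourier f p) ^+ 2)).
- by move=> n; cmeas.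
- by cmeas.
- by move=> n p; nneg.
- by move=> p; nneg.
- apply: ae_all => p; rewrite -[X in _ --> X]mul1r; apply: cvgMl.
  exact: gauss_cvg1.
- by move=> n; apply: bound; rewrite invr_gt0.
Qed.

(** The Riesz energy dominates the homogeneous negative Sobolev norm: integrate the
    heat energies against the weight of the subordination. *)
Lemma riesz_energy (s : R) f : 0 < s -> s < 1 -> cintegrable f ->
  (\int[mu]_p (`|p| `^ (- s) * normc (fourier f p) ^+ 2)%:E <=
   \int[mu]_x \int[mu]_y (normc (f x) * rker s (x - y) * normc (f y))%:E)%E.
Proof.
move=> s0 s1 fi; have mf := cintegrable_meas fi; have mF := cmeas_fourier mf.
have mw := meas_gamma_weight s; have mrk := meas_rker s.
have G0 : 0 < Gamma (s / 2) by rewrite Gamma_gt0//; lra.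
rewrite -(@lee_pmul2l _ (Gamma (s / 2))%:E)//.
have hE (t : R) : 0 < t -> _ := fun t0 => heat_energy t0 fi.
move: (fourier f) mF hE => F mF hE.
rewrite -[leLHS]lintZ//; [|exact: ltW|cmeas|by nneg].
have -> : (\int[mu]_p (Gamma (s / 2) * (`|p| `^ (- s) * normc (F p) ^+ 2))%:E =
    \int[mu]_p \int[mu]_t (gamma_weight s t * expR (- (t * p ^+ 2)) * normc (F p) ^+ 2)%:E)%E.
  apply: ae_eq_lint.
  - by cmeas.
  - by apply: (meas_lint (F := fun p t => gamma_weight s t * expR (- (t * p ^+ 2)) * normc (F p) ^+ 2)); [cmeas | nneg].
  - by move=> p; rewrite lee_fin; nneg.
  - by move=> p; apply: lint_ge0 => t; nneg.
  apply: ae_imp (ae_neq 0) _ => p p0.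
  under [RHS]eq_integral do rewrite mulrC.
  rewrite lintZ; [|by nneg|cmeas|by nneg].
  by rewrite lint_gamma_gauss// -EFinM mulrA mulrC.
rewrite (lint_fubini (F := fun p t => gamma_weight s t * expR (- (t * p ^+ 2)) * normc (F p) ^+ 2)); [|cmeas|by nneg].
apply: (@le_trans _ _ (\int[mu]_t \int[mu]_x \int[mu]_y
    (gamma_weight s t * (normc (f x) * heat t (x - y) * normc (f y)))%:E)%E).
  apply: ge0_le_integral => //.
  - by move=> t _; apply: lint_ge0 => p; nneg.
  - by apply: (meas_lint (F := fun t p => gamma_weight s t * expR (- (t * p ^+ 2)) * normc (F p) ^+ 2)); [cmeas | nneg].
  - apply: (@measurable_fun_fubini_tonelli_F _ _ R _ _ mu
      (fun z : R * R => \int[mu]_y (gamma_weight s z.1 * (normc (f z.2) * heat z.1 (z.2 - y) * normc (f y)))%:E)%E).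
      apply: (@measurable_fun_fubini_tonelli_F _ _ (R * R)%type _ _ mu
        (fun z : (R * R) * R => (gamma_weight s z.1.1 * (normc (f z.1.2) * heat z.1.1 (z.1.2 - z.2) * normc (f z.2)))%:E)).
        by cmeas; apply: measurableT_comp.
      by move=> z; rewrite lee_fin; nneg.
    by move=> z; apply: lint_ge0 => y; nneg.
  move=> t _; rewrite /gamma_weight; case: (ltP 0 t) => t0; last first.
    rewrite (_ : (fun _ => _) = (fun=> 0%E)) ?integral0; last by apply/funext => p; rewrite !mul0r.
    by apply: integral_ge0 => x _; apply: lint_ge0 => y; rewrite mul0r.
  under eq_integral do rewrite -mulrA.
  rewrite lintZ; [|by nneg|cmeas|by nneg].
  have eI : (\int[mu]_x \int[mu]_y (t `^ (s / 2 - 1) * (normc (f x) * heat t (x - y) * normc (f y)))%:E =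
     (t `^ (s / 2 - 1))%:E * \int[mu]_x \int[mu]_y (normc (f x) * heat t (x - y) * normc (f y))%:E)%E.
    rewrite -ge0_integralZl//.
    - by apply: eq_integral => x _; rewrite lintZ//; [nneg | cmeas | nneg].
    - by apply: (meas_lint (F := fun x y => normc (f x) * heat t (x - y) * normc (f y))); [cmeas | nneg].
    - by move=> x _; apply: lint_ge0 => y; nneg.
    - by rewrite lee_fin; nneg.
  by rewrite eI lee_wpmul2l ?lee_fin ?powR_ge0//; exact: hE.
rewrite (lint_fubini3 (F := fun t x y => gamma_weight s t * (normc (f x) * heat t (x - y) * normc (f y)))); last first.
- by nneg.
- by cmeas; apply: measurableT_comp.
have eI x : (\int[mu]_y \int[mu]_t (gamma_weight s t * (normc (f x) * heat t (x - y) * normc (f y)))%:E =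
    (Gamma (s / 2))%:E * \int[mu]_y (normc (f x) * rker s (x - y) * normc (f y))%:E)%E.
  rewrite -lintZ; [|exact: ltW|cmeas|by nneg].
  apply: ae_eq_lint.
  - by apply: (meas_lint (F := fun y t => gamma_weight s t * (normc (f x) * heat t (x - y) * normc (f y)))); [cmeas | nneg].
  - by cmeas.
  - by move=> y; apply: lint_ge0 => t; nneg.
  - by move=> y; rewrite lee_fin; nneg.
  apply: ae_imp (ae_neq x) _ => y yx.
  have xy0 : x - y != 0 by rewrite subr_eq0 eq_sym.
  transitivity (\int[mu]_t ((normc (f x) * normc (f y)) * (gamma_weight s t * heat t (x - y)))%:E)%E.
    by apply: eq_integral => t _; congr (_%:E); ring.
  rewrite lintZ; [|by nneg|cmeas|by nneg].
  by rewrite lint_gamma_heat// -EFinM; congr (_%:E); ring.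
under eq_integral do rewrite eI.
rewrite ge0_integralZl ?lee_fin ?(ltW G0)//.
- by apply: (meas_lint (F := fun x y => normc (f x) * rker s (x - y) * normc (f y))); [cmeas | nneg].
- by move=> x _; apply: lint_ge0 => y; nneg.
Qed.

End Energy.

(** * Square-integrable functions *)

Section SquareIntegrable.
Context {R : realType}.
Local Notation mu := (@lebesgue_measure R).
Implicit Types f g h : R -> R[i].

Definition L2sqr f : \bar R := (\int[mu]_x (normc (f x) ^+ 2)%:E)%E.

Lemma poweR_sqr (x : \bar R) : (0 <= x)%E -> (x `^ 2 = x * x)%E.
Proof.
case: x => [r||]// r0; first by rewrite poweR_EFin powR_mulrn// expr2 EFinM.
by rewrite poweRyr// mulyy.
Qed.

Lemma L2sqr_ge0 f : (0 <= L2sqr f)%E.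
Proof. by apply: lint_ge0 => x; exact: sqr_ge0. Qed.

Lemma L2norm_sqr f : (L2norm f `^ 2 = L2sqr f)%E.
Proof.
rewrite /L2norm powR_Lnorm//; apply: eq_integral => x _.
by rewrite abse_EFin ger0_norm ?normc_ge0// poweR_EFin powR_mulrn ?normc_ge0.
Qed.

Lemma L2P f : L2 f <-> cmeasurable f /\ (L2sqr f < +oo)%E.
Proof.
rewrite /L2 -L2norm_sqr; split => -[mf fi]; split => //; first exact: poweR_lty.
exact: lty_poweRy fi.
Qed.

Lemma L2_meas f : L2 f -> cmeasurable f.
Proof. by case. Qed.

Lemma L2_lty f : L2 f -> (L2sqr f < +oo)%E.
Proof. by case/L2P. Qed.

Lemma L2_fin f : L2 f -> L2sqr f \is a fin_num.
Proof. by move=> /L2_lty fi; rewrite ge0_fin_numE// L2sqr_ge0. Qed.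

Lemma L2sqr_le f (M : R) : (L2norm f <= M%:E)%E -> (L2sqr f <= (M ^+ 2)%:E)%E.
Proof.
move=> fM; have f0 : (0 <= L2norm f)%E by exact: Lnorm_ge0.
have M0 : 0 <= M by rewrite -lee_fin (le_trans f0).
rewrite -L2norm_sqr -(powR_mulrn 2 M0) -poweR_EFin.
by apply: gt0_ler_poweR => //; rewrite in_itv /= leey andbT// lee_fin.
Qed.

Lemma L2cvgP F f :
  L2cvg F f <-> (fun n => L2sqr (fun x => F n x - f x)) @ \oo --> 0%E.
Proof.
rewrite /L2cvg; set u := (fun n => L2norm _).
have -> : (fun n => L2sqr (fun x => F n x - f x)) = (fun n => (u n `^ 2)%E).
  by apply/funext => n; rewrite L2norm_sqr.
have u0 n : (0 <= u n)%E by exact: Lnorm_ge0.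
have fin n : (u n `^ 2 \is a fin_num)%E = (u n \is a fin_num).
  rewrite !ge0_fin_numE ?poweR_ge0//; apply/idP/idP; last exact: poweR_lty.
  exact: lty_poweRy.
have fineE n : fine (u n `^ 2)%E = fine (u n) ^+ 2.
  by rewrite fine_poweR powR_mulrn// fine_ge0.
split => /fine_cvgP[uf uc]; apply/fine_cvgP; split.
- by apply: filterS uf => n; rewrite fin.
- rewrite (_ : _ \o _ = (fun n => fine (u n) * fine (u n))).
    by rewrite -(mul0r 0); exact: cvgM.
  by apply/funext => n /=; rewrite fineE expr2.
- by apply: filterS uf => n; rewrite fin.
- rewrite (_ : _ \o _ = Num.sqrt \o (fine \o (fun n => (u n `^ 2)%E))).
    rewrite -[X in _ --> X]sqrtr0; apply: continuous_cvg => //.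
    exact: sqrt_continuous.
  by apply/funext => n /=; rewrite fineE sqrtr_sqr ger0_norm// fine_ge0.
Qed.

Lemma lint_cauchy_schwarz (f g : R -> R) :
  measurable_fun setT f -> measurable_fun setT g ->
  (forall x, 0 <= f x) -> (forall x, 0 <= g x) ->
  ((\int[mu]_x (f x * g x)%:E) * (\int[mu]_x (f x * g x)%:E) <=
   (\int[mu]_x (f x ^+ 2)%:E) * (\int[mu]_x (g x ^+ 2)%:E))%E.
Proof.
move=> mf mg f0 g0.
have : (Lnorm mu 1%E (EFin \o (f \* g)%R) <=
   Lnorm mu 2%:E (EFin \o f) * Lnorm mu 2%:E (EFin \o g))%E.
  by apply: hoelder => //; lra.
have -> : Lnorm mu 1%E (EFin \o (f \* g)%R) = (\int[mu]_x (f x * g x)%:E)%E.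
  by rewrite Lnorm1; apply: eq_integral => x _; rewrite /= ger0_norm ?mulr_ge0.
have E (k : R -> R) : (forall x, 0 <= k x) -> (Lnorm mu 2%:E (EFin \o k) * Lnorm mu 2%:E (EFin \o k) =
    \int[mu]_x (k x ^+ 2)%:E)%E.
  move=> k0; rewrite -poweR_sqr ?Lnorm_ge0// powR_Lnorm//.
  by apply: eq_integral => x _; rewrite /= ger0_norm// powR_mulrn.
move=> h; rewrite -(E f f0) -(E g g0) muleACA; apply: lee_pmul => //.
- by apply: lint_ge0 => x; rewrite mulr_ge0.
- by apply: lint_ge0 => x; rewrite mulr_ge0.
Qed.

Lemma lint_mulL2_le f g : cmeasurable f -> cmeasurable g ->
  (\int[mu]_x (normc (f x) * normc (g x))%:E <= L2sqr f + L2sqr g)%E.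
Proof.
move=> mf mg; rewrite /L2sqr -lintD; [|cmeas|cmeas|nneg|nneg].
apply: le_lint; [cmeas | cmeas | nneg |] => x.
have := sqr_ge0 (normc (f x) - normc (g x)); rewrite sqrrB.
by move: (sqr_ge0 (normc (f x))) (sqr_ge0 (normc (g x))); lra.
Qed.

Lemma cintegrableM_L2 f g : L2 f -> L2 g -> cintegrable (fun x => f x * g x).
Proof.
move=> /L2P[mf fi] /L2P[mg gi]; apply/cintegrableP; split; first by cmeas.
under eq_integral do rewrite normcM.
by apply: le_lt_trans (lint_mulL2_le mf mg) _; rewrite lte_add_pinfty.
Qed.

Lemma L2sqr_conj f : L2sqr (fun x => (f x)^*%C) = L2sqr f.
Proof. by apply: eq_integral => x _; rewrite normc_conj. Qed.

Lemma L2_conj f : L2 f -> L2 (fun x => (f x)^*%C).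
Proof. by move=> /L2P[mf fi]; apply/L2P; rewrite L2sqr_conj; split => //; cmeas. Qed.

Lemma L2sqrD_le f g : cmeasurable f -> cmeasurable g ->
  (L2sqr (fun x => (f x + g x)%R) <= 2%:E * (L2sqr f + L2sqr g))%E.
Proof.
move=> mf mg; rewrite /L2sqr -lintD; [|cmeas|cmeas|nneg|nneg].
rewrite -lintZ//; [|cmeas|nneg].
apply: le_lint; [cmeas | cmeas | nneg |] => x.
have h : normc (f x + g x) ^+ 2 <= (normc (f x) + normc (g x)) ^+ 2.
  by rewrite ler_sqr ?nnegrE ?normc_triangle ?normc_ge0// addr_ge0 ?normc_ge0.
apply: le_trans h _; rewrite sqrrD.
by have := sqr_ge0 (normc (f x) - normc (g x)); rewrite sqrrB; lra.
Qed.

Lemma L2D f g : L2 f -> L2 g -> L2 (fun x => f x + g x).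
Proof.
move=> /L2P[mf fi] /L2P[mg gi]; apply/L2P; split; first by cmeas.
apply: le_lt_trans (L2sqrD_le mf mg) _.
by apply: lte_mul_pinfty => //; rewrite lte_add_pinfty.
Qed.

Lemma L2N f : L2 f -> L2 (fun x => - f x).
Proof.
move=> /L2P[mf fi]; apply/L2P; split; first by cmeas.
by rewrite /L2sqr; under eq_integral do rewrite normc_opp.
Qed.

Lemma L2B f g : L2 f -> L2 g -> L2 (fun x => f x - g x).
Proof. by move=> fi /L2N; exact: L2D. Qed.

Lemma L2_le f g : cmeasurable f -> L2 g -> (forall x, normc (f x) <= normc (g x)) -> L2 f.
Proof.
move=> mf /L2P[mg gi] fg; apply/L2P; split => //; apply: le_lt_trans gi.
apply: le_lint; [cmeas | cmeas | nneg |] => x.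
by rewrite ler_sqr ?nnegrE ?normc_ge0.
Qed.

Lemma L2_ae_eq f g : cmeasurable g -> {ae mu, forall x, f x = g x} -> L2 f -> L2 g.
Proof.
move=> mg fg /L2P[mf fi]; apply/L2P; split => //; apply: le_lt_trans fi.
apply: ae_le_lint; [cmeas | cmeas | | | ].
- by move=> x; rewrite lee_fin; nneg.
- by move=> x; rewrite lee_fin; nneg.
- by apply: ae_imp fg _ => x ->.
Qed.

Lemma L2_pairing_le f g : L2 f -> L2 g ->
  normc (cintegral (fun x => f x * g x)) ^+ 2 <= fine (L2sqr f) * fine (L2sqr g).
Proof.
move=> fL2 gL2; have mf := L2_meas fL2; have mg := L2_meas gL2.
rewrite -lee_fin [(fine _ * _)%:E]EFinM !fineK ?L2_fin// expr2 EFinM.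
have h := normc_cintegral_le (cintegrableM_L2 fL2 gL2).
apply: le_trans (_ : ((\int[mu]_x (normc (f x * g x))%:E) *
    (\int[mu]_x (normc (f x * g x))%:E) <= _)%E).
  by apply: lee_pmul => //; rewrite lee_fin normc_ge0.
under eq_integral do rewrite normcM.
by apply: lint_cauchy_schwarz; [cmeas | cmeas | nneg | nneg].
Qed.

Lemma L2_pairing_cvg0 (F : nat -> R -> R[i]) g :
  (forall n, cmeasurable (F n)) -> L2 g -> (fun n => L2sqr (F n)) @ \oo --> 0%E ->
  ccvg (fun n => cintegral (fun x => F n x * g x)) 0.
Proof.
move=> mF gL2 /fine_cvgP[fin cv]; pose B := fine (L2sqr g).
have B0 : 0 <= B by rewrite fine_ge0// L2sqr_ge0.
have cv' : (fun n => Num.sqrt (fine (L2sqr (F n)) * B)) @ \oo --> (0 : R).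
  rewrite -[X in _ --> X]sqrtr0 -[X in Num.sqrt X](mul0r B).
  by apply: continuous_cvg; [exact: sqrt_continuous | exact: cvgMl].
apply: (squeeze_cvgr _ (cvg_cst 0) cv'); apply: filterS fin => n Ff.
rewrite normc_ge0 subr0 andTb.
have Fi : L2 (F n) by apply/L2P; split => //; rewrite -ge0_fin_numE ?L2sqr_ge0.
rewrite -ler_sqr ?nnegrE ?normc_ge0 ?sqrtr_ge0// [Num.sqrt (fine _ * _) ^+ 2]sqr_sqrtr.
  exact: L2_pairing_le.
by rewrite mulr_ge0// fine_ge0// L2sqr_ge0.
Qed.

End SquareIntegrable.

(** * The heat kernel as an approximate identity *)

Section ApproximateIdentity.
Context {R : realType}.
Local Notation mu := (@lebesgue_measure R).
Local Notation Re := complex.Re.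
Local Notation Im := complex.Im.
Implicit Types f g h c : R -> R[i].

Lemma ccvgMl (z : R[i]) (a : nat -> R[i]) l : ccvg a l -> ccvg (fun n => z * a n) (z * l).
Proof.
rewrite /ccvg => al.
have -> : (fun n => normc (z * a n - z * l)) = (fun n => normc z * normc (a n - l)).
  by apply/funext => n; rewrite -mulrBr normcM.
by rewrite -[X in _ --> X](mulr0 (normc z)); exact: cvgMr.
Qed.

Lemma heat_scaling (t w : R) : 0 < t -> Num.sqrt t * heat t (Num.sqrt t * w) = heat 1 w.
Proof.
move=> t0; have p0 := pi_gt0 R.
rewrite /heat mulr1 exprMn sqr_sqrtr ?ltW// powRM ?mulr_ge0 ?ltW//.
rewrite -powR12_sqrt ?ltW// mulrA [t `^ _ * _]mulrC -[_ * _ * t `^ 2^-1]mulrA -powRD; last first.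
  by apply/implyP => _; rewrite gt_eqF.
rewrite addNr powRr0 mulr1; congr (_ * expR (- _)).
by field; rewrite gt_eqF.
Qed.

Lemma lint_heat_scaling (t x : R) (d : R -> R) : 0 < t -> measurable_fun setT d ->
  (forall y, 0 <= d y) ->
  (\int[mu]_y (heat t (x - y) * d y)%:E =
   \int[mu]_w (heat 1 w * d (x - Num.sqrt t * w))%:E)%E.
Proof.
move=> t0 md d0; have r0 : 0 < Num.sqrt t by rewrite sqrtr_gt0.
transitivity (\int[mu]_z (heat t z * d (x - z))%:E)%E.
  rewrite -(lint_reflect x); [|cmeas|nneg].
  by apply: eq_integral => y _; rewrite opprB addrCA subrr addr0.
rewrite -(ge0_integral_affine 0 r0 (f := fun z => (heat t z * d (x - z))%:E)); last 2 first.
- by cmeas.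
- by move=> z; rewrite lee_fin; nneg.
under eq_integral do rewrite addr0.
rewrite -lintZ; [|exact: ltW|cmeas|nneg].
by apply: eq_integral => w _; rewrite mulrA heat_scaling.
Qed.

Lemma cintegrable_heatM (t x M : R) f : 0 < t -> cmeasurable f ->
  (forall y, normc (f y) <= M) -> cintegrable (fun y => (heat t (x - y))%:C * f y).
Proof.
move=> t0 mf fM.
have hi : cintegrable (fun y : R => (heat t (x - y))%:C).
  have [] := cintegral_lint (h := fun y => heat t (x - y)) (r := 1); [cmeas | nneg | | by []].
  by rewrite (lint_reflect x (f := heat t)) ?lint_heat//; [cmeas | nneg].
have := cintegrable_bounded mf fM hi.
by congr cintegrable; apply/funext => y; rewrite mulrC.
Qed.

(** Rescaling space by the square root of time fixes the Gaussian and contracts the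
    argument of c to the point x. *)
Lemma heat_average_cvg (M x : R) c : cmeasurable c -> (forall y, normc (c y) <= M) ->
  normc (c y - c x) @[y --> x] --> (0 : R) ->
  ccvg (fun n => cintegral (fun y => (heat n.+1%:R^-1 (x - y))%:C * c y)) (c x).
Proof.
move=> mc cM cx; pose d (y : R) : R := normc (c y - c x).
have md : measurable_fun [set: R] d by rewrite /d; cmeas.
have d0 y : 0 <= d y by nneg.
have M0 : 0 <= M by apply: le_trans (normc_ge0 _) (cM 0).
have dM y : d y <= 2 * M.
  apply: le_trans (normc_triangle _ _) _; rewrite normc_opp.
  by have := cM y; have := cM x; lra.
pose u n := (\int[mu]_w (heat 1 w * d (x - Num.sqrt n.+1%:R^-1 * w)))%R.
have t0 n : 0 < n.+1%:R^-1 :> R by rewrite invr_gt0.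
have bnd w n : `|heat 1 w * d (x - Num.sqrt n.+1%:R^-1 * w)| <= 2 * M * heat 1 w.
  rewrite (ger0_norm (mulr_ge0 (heat_ge0 1 w) (d0 _))) [leRHS]mulrC.
  exact: ler_wpM2l (heat_ge0 1 w) _ _ (dM _).
have hM : (\int[mu]_w (2 * M * heat 1 w)%:E < +oo)%E.
  by rewrite lintZ ?lint_heat ?mule1 ?ltry ?mulr_ge0//; [cmeas | nneg].
have ucv : u @ \oo --> (0 : R).
  have [|||||||_ _] := @lint_dominated_cvg R (fun n w => heat 1 w * d (x - Num.sqrt n.+1%:R^-1 * w))
      (fun=> 0) (fun w => 2 * M * heat 1 w).
  - by move=> n; cmeas.
  - by meas.
  - by cmeas.
  - by move=> w; nneg.
  - exact: hM.
  - apply: ae_all => w; rewrite -[X in _ --> X](mulr0 (heat 1 w)); apply: cvgMr.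
    have sq : (fun n => x - Num.sqrt (n.+1%:R^-1) * w) @ \oo --> x.
      have e : x - Num.sqrt 0 * w = x by rewrite sqrtr0 mul0r subr0.
      rewrite -[X in _ --> X]e.
      apply: cvgB; first exact: cvg_cst.
      apply: cvgMl; apply: continuous_cvg; [exact: sqrt_continuous | exact: cvg_harmonic].
    exact: (@cvg_comp _ _ _ (fun n : nat => x - Num.sqrt (n.+1%:R^-1) * w) d _ _ _ sq cx).
  - by apply: ae_all.
  by rewrite [X in _ --> X](_ : _ = 0)// /Rintegral integral0.
apply: ccvg_squeeze ucv => n.
have hi := cintegrable_heatM x (t0 n) mc cM.
have [hi1 h1] := @cintegral_lint R (fun y => heat n.+1%:R^-1 (x - y)) 1 ltac:(cmeas) ltac:(nneg)
  ltac:(by rewrite (lint_reflect x (f := heat _)) ?lint_heat//; [cmeas | nneg]).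
have -> : cintegral (fun y => (heat n.+1%:R^-1 (x - y))%:C * c y) - c x =
    cintegral (fun y => (heat n.+1%:R^-1 (x - y))%:C * (c y - c x)).
  transitivity (cintegral (fun y => (heat n.+1%:R^-1 (x - y))%:C * c y -
      (heat n.+1%:R^-1 (x - y))%:C * c x)); last by apply: eq_cintegral => y; rewrite mulrBr.
  rewrite cintegralB//; last first.
    by have := cintegrableZ (c x) hi1; congr cintegrable; apply/funext => y; rewrite mulrC.
  by rewrite cintegralZr// h1 mul1r.
have di : cintegrable (fun y => (heat n.+1%:R^-1 (x - y))%:C * (c y - c x)).
  have mcx : cmeasurable (fun y => c y - c x) by cmeas.
  exact: (cintegrable_heatM x (t0 n) mcx dM).
rewrite -lee_fin; apply: le_trans (normc_cintegral_le di) _.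
under eq_integral do rewrite normcM normc_real (ger0_norm (heat_ge0 _ _)).
rewrite (lint_heat_scaling x (t0 n) md d0) /u /Rintegral fineK//.
rewrite ge0_fin_numE; last by apply: lint_ge0 => w; nneg.
apply: le_lt_trans hM; apply: le_lint; [cmeas | cmeas | nneg |].
by move=> w; have := bnd w n; rewrite (ger0_norm (mulr_ge0 (heat_ge0 1 w) (d0 _))).
Qed.

Lemma normc_heat_average_le (t x M : R) c : 0 < t -> cmeasurable c ->
  (forall y, normc (c y) <= M) ->
  normc (cintegral (fun y => (heat t (x - y))%:C * c y)) <= M.
Proof.
move=> t0 mc cM; have M0 : 0 <= M by apply: le_trans (normc_ge0 _) (cM 0).
rewrite -lee_fin; apply: le_trans (normc_cintegral_le (cintegrable_heatM x t0 mc cM)) _.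
apply: (@le_trans _ _ (\int[mu]_y (M * heat t (x - y))%:E)%E).
  apply: le_lint; [cmeas | cmeas | nneg |] => y.
  by rewrite normcM normc_real (ger0_norm (heat_ge0 _ _)) mulrC ler_wpM2r ?heat_ge0.
rewrite lintZ//; [|cmeas|nneg].
by rewrite (lint_reflect x (f := heat t)) ?lint_heat ?mule1//; [cmeas | nneg].
Qed.

Definition heat_pairing (t : R) h g :=
  cintegral (fun x => h x * cintegral (fun y => (heat t (x - y))%:C * g y)).

Lemma cintegrable_heat_pairing (t M : R) h g : 0 < t -> cintegrable h -> cmeasurable g ->
  (forall y, normc (g y) <= M) ->
  cintegrable (fun x => h x * cintegral (fun y => (heat t (x - y))%:C * g y)).
Proof.
move=> t0 hi mg gM.
have mH : cmeasurable (fun x => cintegral (fun y => (heat t (x - y))%:C * g y)).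
  by apply: (cmeas_cintegral (K := fun x y => (heat t (x - y))%:C * g y)); cmeas.
have := cintegrable_bounded mH (fun x => normc_heat_average_le x t0 mg gM) hi.
by congr cintegrable; apply/funext => x; rewrite mulrC.
Qed.

Lemma normc_pairing_le (M : R) h g : 0 <= M -> cintegrable h -> cmeasurable g ->
  (forall x, normc (g x) <= M) ->
  normc (cintegral (fun x => h x * g x)) <= M * fine (\int[mu]_x (normc (h x))%:E).
Proof.
move=> M0 hi mg gM; have mh := cintegrable_meas hi.
have hgi : cintegrable (fun x => h x * g x).
  have := cintegrable_bounded mg gM hi.
  by congr cintegrable; apply/funext => x; rewrite mulrC.
rewrite -lee_fin EFinM fineK; last first.
  by rewrite ge0_fin_numE ?cintegrable_lty// lint_ge0// => x; exact: normc_ge0.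
apply: le_trans (normc_cintegral_le hgi) _.
rewrite -lintZ//; [|cmeas|nneg].
apply: le_lint; [cmeas | cmeas | nneg |] => x.
by rewrite normcM mulrC ler_wpM2r ?normc_ge0.
Qed.

Lemma heat_pairing_sym (t M : R) h g : 0 < t -> cintegrable h -> cintegrable g ->
  (forall y, normc (g y) <= M) -> (forall y, normc (h y) <= M) ->
  heat_pairing t h g = heat_pairing t g h.
Proof.
move=> t0 hi gi gM hM; have mh := cintegrable_meas hi; have mg := cintegrable_meas gi.
have M0 : 0 <= M by apply: le_trans (normc_ge0 _) (gM 0).
rewrite /heat_pairing.
transitivity (cintegral (fun x => cintegral (fun y => (heat t (x - y))%:C * (h x * g y)))).
  apply: eq_cintegral => x; rewrite -cintegralZl; last exact: cintegrable_heatM gM.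
  by apply: eq_cintegral => y; rewrite mulrCA.
rewrite (cfubini (K := fun x y => (heat t (x - y))%:C * (h x * g y))).
- apply: eq_cintegral => y; rewrite -cintegralZl; last exact: cintegrable_heatM hM.
  by apply: eq_cintegral => x; rewrite heatC [RHS]mulrCA [h x * _]mulrC.
- by cmeas.
apply: (@le_lt_trans _ _ (\int[mu]_x (M * normc (h x))%:E)%E); last first.
  by apply: lintZ_lty; [done | cmeas | nneg | exact: cintegrable_lty].
apply: ge0_le_integral => //.
- by move=> x _; apply: lint_ge0 => y; nneg.
- by apply: (meas_lint (F := fun x y => normc ((heat t (x - y))%:C * (h x * g y)))); [cmeas | nneg].
- by cmeas.
move=> x _; apply: (@le_trans _ _ (\int[mu]_y (M * normc (h x) * heat t (x - y))%:E)%E).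
  apply: le_lint; [cmeas | cmeas | nneg |] => y.
  rewrite !normcM normc_real (ger0_norm (heat_ge0 _ _)) mulrC ler_wpM2r ?heat_ge0//.
  by rewrite mulrC ler_wpM2r ?normc_ge0.
rewrite lintZ//; [|nneg|cmeas|nneg].
by rewrite (lint_reflect x (f := heat t)) ?lint_heat ?mule1//; [cmeas | nneg].
Qed.

Lemma heat_pairing_cvg_continuous (M : R) h c : cintegrable h -> cmeasurable c ->
  (forall y, normc (c y) <= M) ->
  {ae mu, forall x, normc (c y - c x) @[y --> x] --> (0 : R)} ->
  ccvg (fun n => heat_pairing n.+1%:R^-1 h c) (cintegral (fun x => h x * c x)).
Proof.
move=> hi mc cM cc; have mh := cintegrable_meas hi.
have t0 n : 0 < n.+1%:R^-1 :> R by rewrite invr_gt0.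
have M0 : 0 <= M by apply: le_trans (normc_ge0 _) (cM 0).
have mH n : cmeasurable (fun x => cintegral (fun y => (heat n.+1%:R^-1 (x - y))%:C * c y)).
  by apply: (cmeas_cintegral (K := fun x y => (heat n.+1%:R^-1 (x - y))%:C * c y)); cmeas.
apply: (cdominated_cvg (g := fun x => M * normc (h x)) _ _ _ _ _ _ _).2.
- by move=> n; exact: cmeas_mul mh (mH n).
- by cmeas.
- by cmeas.
- by nneg.
- by apply: lintZ_lty; [done | cmeas | nneg | exact: cintegrable_lty].
- apply: ae_imp cc _ => x cx; have := heat_average_cvg mc cM cx.
  exact: ccvgMl.
- apply: ae_all => x n; rewrite normcM mulrC ler_wpM2r ?normc_ge0//.
  exact: normc_heat_average_le.
Qed.

(** The approximant is continuous on [-m, m] and zero outside, so that it has the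
    support of h; its jumps at the two endpoints are a null set. *)
Lemma approx_continuous_real (m e : R) (h : R -> R) : 0 < m -> 0 < e ->
  measurable_fun setT h -> (\int[mu]_x `|h x|%:E < +oo)%E ->
  (forall x, m < `|x| -> h x = 0) ->
  exists (c : R -> R) (M : R), [/\ measurable_fun setT c, forall x, `|c x| <= M,
    forall x, m < `|x| -> c x = 0,
    {ae mu, forall x, {for x, continuous c}} &
    (\int[mu]_x `|h x - c x|%:E <= e%:E)%E].
Proof.
move=> m0 e0 mh hi h0.
pose E : set R := `[- m, m]%classic.
have mE : measurable E by exact: measurable_itv.
have Efin : (mu E < +oo)%E by rewrite /E lebesgue_measure_itv /= lte_fin; case: ifP => _; rewrite ?ltry// -EFinB ltry.
have hE : mu.-integrable E (EFin \o h).
  apply: (integrableS measurableT) => //; apply/integrableP; split; first exact: meas_EFin.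
  exact: hi.
have [g_ [gc gi gcv]] := approximation_continuous_integrable mE Efin hE.
have /fine_cvgP[gfin /cvgr0Pnorm_le/(_ e e0) gle] := gcv.
have [n [nf ne]] := filter_ex (filterI gfin gle).
pose c x := if `|x| <= m then g_ n x else 0.
have mg : measurable_fun [set: R] (g_ n) by exact: continuous_measurable_fun.
have mc : measurable_fun [set: R] c by rewrite /c; meas.
have xE (x : R) : (`|x| <= m) = (x \in `[- m, m]) by rewrite ler_norml in_itv.
have [M hM] : exists M, forall x, `|x| <= m -> `|g_ n x| <= M.
  have [||z zE zmax] := @EVT_max R (fun x => `|g_ n x|) (- m) m; first by lra.
    by apply: continuous_subspaceT => x; apply: continuous_comp; [exact: gc | exact: norm_continuous].
  by exists `|g_ n z| => x; rewrite xE => /zmax.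
exists c, (Num.max M 0); split => //.
- move=> x; rewrite /c; case: ifP => xm; last by rewrite normr0 le_max lexx orbT.
  by rewrite le_max hM.
- by move=> x xm; rewrite /c leNgt xm.
- apply: ae_imp2 (ae_neq m) (ae_neq (- m)) _ => x xm xm'.
  have [lt|gt] := ltP `|x| m.
    have near : \near x, g_ n x = c x.
      have : \forall y \near x, `|y| < m.
        exact: (@cvgr_lt R R (nbhs x) _ (fun y => `|y|) _ (@norm_continuous R R x) m lt).
      by apply: filterS => y ym; rewrite /c ltW.
    have cx : c x = g_ n x by rewrite /c ltW.
    by rewrite /prop_for /continuous_at cx; apply: cvg_trans (near_eq_cvg near) (gc n x).
  have gt' : m < `|x|.
    rewrite lt_neqAle gt andbT; apply/eqP => E'.
    have [x0|x0] := leP 0 x; move: xm xm'; rewrite E'.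
      by rewrite ger0_norm// eqxx.
    by rewrite ltr0_norm// opprK eqxx.
  have near : \near x, (fun=> 0 : R) x = c x.
    have : \forall y \near x, m < `|y|.
      exact: (@cvgr_gt R R (nbhs x) _ (fun y => `|y|) _ (@norm_continuous R R x) m gt').
    by apply: filterS => y ym; rewrite /c leNgt ym.
  have cx : c x = 0 by rewrite /c leNgt gt'.
  by rewrite /prop_for /continuous_at cx; apply: cvg_trans (near_eq_cvg near) (cvg_cst _).
- have -> : (\int[mu]_x `|h x - c x|%:E = \int[mu]_(x in E) `|(h x - g_ n x)%:E|)%E.
    rewrite [RHS]integral_mkcond; apply: eq_integral => x _; rewrite patchE.
    case: ifPn => xE'.
      by rewrite /c xE; move: xE'; rewrite inE /E /= => ->.
    have xm : m < `|x|.
      by rewrite ltNge xE; apply: contraNN xE' => xE'; rewrite inE.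
    by rewrite h0// /c leNgt xm subr0 normr0.
  rewrite -(fineK nf) lee_fin; apply: le_trans ne; exact: ler_norm.
Qed.

(** Split h into a bounded almost everywhere continuous part, where heat averages
    converge pointwise, and a remainder of small L^1 norm; symmetry of the heat kernel
    lets the averages fall on the continuous part. *)
Lemma heat_pairing_cvg (m M : R) h g : 0 < m -> cintegrable h ->
  (forall x, m < `|x| -> h x = 0) -> cintegrable g -> (forall x, normc (g x) <= M) ->
  ccvg (fun n => heat_pairing n.+1%:R^-1 h g) (cintegral (fun x => h x * g x)).
Proof.
move=> m0 hi h0 gi gM; have mh := cintegrable_meas hi; have mg := cintegrable_meas gi.
have M0 : 0 <= M by apply: le_trans (normc_ge0 _) (gM 0).
have t0 n : 0 < n.+1%:R^-1 :> R by rewrite invr_gt0.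
rewrite /ccvg; apply/cvgr0Pnorm_le => e e0.
pose d := e / (8 * (M + 1)).
have d0 : 0 < d by rewrite /d divr_gt0// mulr_gt0//; lra.
have lty (k : R -> R) : (forall x, `|k x| <= normc (h x)) -> measurable_fun setT k ->
    (\int[mu]_x `|k x|%:E < +oo)%E.
  move=> kh mk; apply: le_lt_trans (cintegrable_lty hi).
  by apply: le_lint; [meas | cmeas | nneg |].
have [c1 [M1 [mc1 c1M c10 c1c h1]]] := approx_continuous_real (h := fun x => Re (h x)) m0 d0
  ltac:(cmeas) (lty (fun x => Re (h x)) ltac:(move=> x; exact: Re_le_normc) ltac:(cmeas))
  ltac:(by move=> x /h0 ->).
have [c2 [M2 [mc2 c2M c20 c2c h2]]] := approx_continuous_real (h := fun x => Im (h x)) m0 d0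
  ltac:(cmeas) (lty (fun x => Im (h x)) ltac:(move=> x; exact: Im_le_normc) ltac:(cmeas))
  ltac:(by move=> x /h0 ->).
pose c x : R[i] := c1 x +i* c2 x.
have mc : cmeasurable c by split.
pose hc x := h x - c x.
have mhc : cmeasurable hc by rewrite /hc; cmeas.
have hc2 : (\int[mu]_x (normc (hc x))%:E <= (2 * d)%:E)%E.
  apply: (@le_trans _ _ (\int[mu]_x (`|Re (h x) - c1 x| + `|Im (h x) - c2 x|)%:E)%E).
    apply: le_lint; [cmeas | cmeas | nneg |] => x.
    by apply: le_trans (normc_le_ReIm _) _; rewrite /hc ReD ImD ReN ImN.
  rewrite lintD; [|cmeas|cmeas|nneg|nneg].
  by rewrite mulrDl mul1r EFinD; exact: leeD.
have hci : cintegrable hc.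
  by apply/cintegrableP; split => //; apply: le_lt_trans hc2 _; rewrite ltry.
have ci : cintegrable c.
  have := cintegrableB hi hci; congr cintegrable; apply/funext => x.
  by rewrite /hc opprB addrC subrK.
have cK x : normc (c x) <= M1 + M2 + M.
  apply: le_trans (normc_le_ReIm _) _.
  by apply: ler_wpDr => //; apply: lerD; [exact: c1M | exact: c2M].
have gK x : normc (g x) <= M1 + M2 + M.
  apply: le_trans (gM x) _; rewrite lerDr.
  by rewrite addr_ge0//; [apply: le_trans (c1M 0) | apply: le_trans (c2M 0)].
have cc : {ae mu, forall x, normc (c y - c x) @[y --> x] --> (0 : R)}.
  apply: ae_imp2 c1c c2c _ => x k1 k2.
  have l1 : (`|c1 y - c1 x| + `|c2 y - c2 x|) @[y --> x] --> (0 : R).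
    rewrite -[X in _ --> X](addr0 0); apply: cvgD.
      by apply/norm_cvg0P/subr_cvg0; exact: k1.
    by apply/norm_cvg0P/subr_cvg0; exact: k2.
  apply: (squeeze_cvgr _ (cvg_cst 0) l1); apply: nearW => y.
  rewrite normc_ge0 andTb; apply: le_trans (normc_le_ReIm _) _.
  by rewrite ReD ImD ReN ImN.
have cv := heat_pairing_cvg_continuous gi mc cK cc.
have e2 : 0 < e / 2 by rewrite divr_gt0.
move: cv; rewrite /ccvg => /cvgr0Pnorm_le/(_ _ e2); apply: filterS => n le.
have B3 : normc (cintegral (fun x => hc x * g x)) <= M * (2 * d).
  apply: le_trans (normc_pairing_le M0 hci mg gM) _; rewrite ler_wpM2l//.
  by rewrite -lee_fin fineK// ge0_fin_numE ?cintegrable_lty// lint_ge0// => x; exact: normc_ge0.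
have mG : cmeasurable (fun x => cintegral (fun y => (heat n.+1%:R^-1 (x - y))%:C * g y)).
  by apply: (cmeas_cintegral (K := fun x y => (heat n.+1%:R^-1 (x - y))%:C * g y)); cmeas.
have B1 : normc (heat_pairing n.+1%:R^-1 hc g) <= M * (2 * d).
  apply: le_trans (normc_pairing_le M0 hci mG _) _.
    by move=> x; exact: normc_heat_average_le.
  rewrite ler_wpM2l//.
  by rewrite -lee_fin fineK// ge0_fin_numE ?cintegrable_lty// lint_ge0// => x; exact: normc_ge0.
have hgi k : cintegrable k -> cintegrable (fun x => k x * g x).
  move=> ki; have := cintegrable_bounded mg gM ki.
  by congr cintegrable; apply/funext => x; rewrite mulrC.
have E1 : heat_pairing n.+1%:R^-1 h g = heat_pairing n.+1%:R^-1 hc g + heat_pairing n.+1%:R^-1 g c.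
  rewrite -(heat_pairing_sym (t0 n) ci gi gK cK) /heat_pairing -cintegralD.
  - by apply: eq_cintegral => x; rewrite -mulrDl /hc subrK.
  - exact: cintegrable_heat_pairing gM.
  - exact: cintegrable_heat_pairing gM.
have E2 : cintegral (fun x => h x * g x) =
    cintegral (fun x => hc x * g x) + cintegral (fun x => g x * c x).
  transitivity (cintegral (fun x => hc x * g x) + cintegral (fun x => c x * g x)).
    rewrite -cintegralD//; [|exact: hgi|exact: hgi].
    by apply: eq_cintegral => x; rewrite -mulrDl /hc subrK.
  by congr (_ + _); apply: eq_cintegral => x; rewrite mulrC.
rewrite ger0_norm; last exact: normc_ge0.
move: le; rewrite ger0_norm; last exact: normc_ge0.
rewrite E1 E2 opprD addrACA => le.
apply: le_trans (normc_triangle _ _) _.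
apply: le_trans (lerD (normc_triangle _ _) le) _.
rewrite normc_opp; apply: (@le_trans _ _ (M * (2 * d) + M * (2 * d) + e / 2)).
  by rewrite lerD2r lerD.
have -> : M * (2 * d) + M * (2 * d) = M / (M + 1) * (e / 2).
  by rewrite /d; field; lra.
have : M / (M + 1) <= 1 by rewrite ler_pdivrMr ?mul1r; lra.
by move=> hM; have := ler_wpM2r (ltW e2) hM; lra.
Qed.

End ApproximateIdentity.

(** * The Fourier-Plancherel transform *)

Section Plancherel.
Context {R : realType}.
Local Notation mu := (@lebesgue_measure R).
Implicit Types f g h H F G : R -> R[i].

Lemma L2_fourier f : cintegrable f -> L2 f -> L2 (fourier f).
Proof.
move=> fi fL2; apply/L2P; split; first exact: cmeas_fourier (cintegrable_meas fi).
exact: le_lt_trans (fourier_bessel fi) (L2_lty fL2).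
Qed.

Lemma L2_bounded (M : R) g : cintegrable g -> (forall x, normc (g x) <= M) -> L2 g.
Proof.
move=> gi gM; have mg := cintegrable_meas gi; apply/L2P; split => //.
have M0 : 0 <= M by apply: le_trans (normc_ge0 _) (gM 0).
apply: (@le_lt_trans _ _ (\int[mu]_x (M * normc (g x))%:E)%E).
  apply: le_lint; [cmeas | cmeas | nneg |] => x.
  by rewrite expr2 ler_wpM2r ?normc_ge0.
by apply: lintZ_lty; [done | cmeas | nneg | exact: cintegrable_lty].
Qed.

(** Both sides of the heat regularized pairing have a limit as time tends to
    zero: on the frequency side by dominated convergence, on the space side by the
    approximation of the identity. *)
Lemma parseval_bounded (m M : R) h g : 0 < m -> cintegrable h -> L2 h ->
  (forall x, m < `|x| -> h x = 0) -> cintegrable g -> (forall x, normc (g x) <= M) ->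
  cintegral (fun p => (fourier h p)^*%C * fourier g p) =
  cintegral (fun x => (h x)^*%C * g x).
Proof.
move=> m0 hi hL2 h0 gi gM; have gL2 := L2_bounded gi gM.
have t0 n : 0 < n.+1%:R^-1 :> R by rewrite invr_gt0.
have cv1 : ccvg (fun n => heat_pairing n.+1%:R^-1 (fun x => (h x)^*%C) g)
    (cintegral (fun x => (h x)^*%C * g x)).
  apply: (heat_pairing_cvg m0 _ _ gi gM); first exact: cintegrable_conj.
  by move=> x /h0 ->; rewrite conjc0.
apply: ccvg_unique cv1.
have -> : (fun n => heat_pairing n.+1%:R^-1 (fun x => (h x)^*%C) g) =
    (fun n => cintegral (fun p => (fourier h p)^*%C *
      ((expR (- (n.+1%:R^-1 * p ^+ 2)))%:C * fourier g p))).
  by apply/funext => n; rewrite heat_form.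
have HL2 := L2_fourier hi hL2; have GL2 := L2_fourier gi gL2.
move: (fourier h) (fourier g) HL2 GL2 => H G HL2 GL2.
have mH := L2_meas HL2; have mG := L2_meas GL2.
apply: (cdominated_cvg (g := fun p => normc (H p) * normc (G p)) _ _ _ _ _ _ _).2.
- by move=> n; cmeas.
- by cmeas.
- by cmeas.
- by nneg.
- apply: le_lt_trans (lint_mulL2_le mH mG) _.
  by rewrite lte_add_pinfty// L2_lty.
- apply: ae_all => p; apply: ccvgMl.
  have e n : normc ((expR (- (n.+1%:R^-1 * p ^+ 2)))%:C * G p - G p) <=
      (1 - expR (- (n.+1%:R^-1 * p ^+ 2))) * normc (G p).
    rewrite -[X in _ - X]mul1r -mulrBl normcM ler_wpM2r ?normc_ge0//.
    rewrite (_ : _%:C - 1 = (expR (- (n.+1%:R^-1 * p ^+ 2)) - 1)%:C); last by rewrite rmorphB.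
    rewrite normc_real distrC ger0_norm// subr_ge0.
    exact: gauss_le1.
  apply: (ccvg_squeeze e).
  rewrite -[X in _ --> X](mul0r (normc (G p))); apply: cvgMl.
  by rewrite -[X in _ --> X](subrr 1); apply: cvgB; [exact: cvg_cst | exact: gauss_cvg1].
- apply: ae_all => p n; rewrite !normcM normc_conj ler_wpM2l ?normc_ge0//.
  by rewrite normc_real ger0_norm ?expR_ge0// ler_piMl ?normc_ge0// gauss_le1.
Qed.

Definition trunc n f : R -> R[i] := fun x => if `|x| <= n%:R then f x else 0.

Lemma meas_trunc n f : cmeasurable f -> cmeasurable (trunc n f).
Proof. by move=> mf; rewrite /trunc; cmeas. Qed.

Lemma normc_trunc_le n f x : normc (trunc n f x) <= normc (f x).
Proof. by rewrite /trunc; case: ifP => // _; rewrite normc0 normc_ge0. Qed.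

Lemma L2_trunc n f : L2 f -> L2 (trunc n f).
Proof.
move=> fL2; apply: (L2_le _ fL2); first exact: meas_trunc (L2_meas fL2).
exact: normc_trunc_le.
Qed.

Lemma lint_itv1 (n : R) : (\int[mu]_x (if `|x| <= n then 1 else 0)%:E < +oo)%E.
Proof.
have -> : (\int[mu]_x (if (`|(x : R)| <= n)%R then 1 else 0)%:E = mu `[(- n)%R, n]%classic)%E.
  rewrite -[`[(- n)%R, n]%classic]setIT -integral_indic//; apply: eq_integral => x _.
  rewrite indicE; congr (_%:E); rewrite ler_norml.
  have -> : (x \in `[- n, n]%classic) = (- n <= x <= n).
    by apply/idP/idP; rewrite inE /= in_itv.
  by case: ifP.
by rewrite lebesgue_measure_itv /= lte_fin; case: ifP => _; rewrite ?ltry// -EFinB ltry.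
Qed.

Lemma cintegrable_trunc n f : L2 f -> cintegrable (trunc n f).
Proof.
move=> /L2P[mf fi].
apply: (cintegrable_le (g := fun x => (if `|x| <= n%:R then 1 else 0) + normc (f x) ^+ 2)).
- exact: meas_trunc.
- by cmeas.
- move=> x; rewrite /trunc; case: ifP => _; last by rewrite normc0 add0r sqr_ge0.
  by have := sqr_ge0 (normc (f x) - 2^-1); rewrite sqrrB; lra.
apply: lintD_lty; [cmeas | cmeas | | nneg | exact: lint_itv1 | exact: fi].
by move=> x; case: ifP.
Qed.

Lemma trunc_out n f x : n%:R < `|x| -> trunc n f x = 0.
Proof. by rewrite /trunc ltNge => /negbTE ->. Qed.

Lemma trunc_cvg f (x : R) : (fun n => normc (trunc n f x - f x)) @ \oo --> (0 : R).
Proof.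
apply: cvg_near_cst; near=> n; rewrite /trunc ifT ?subrr ?normc0//.
by near: n; exact: nbhs_infty_ger.
Unshelve. all: by end_near.
Qed.

Lemma L2_trunc_cvg f : L2 f ->
  (fun n => L2sqr (fun x => trunc n f x - f x)) @ \oo --> 0%E.
Proof.
move=> fL2; have /L2P[mf fi] := fL2.
have [|||||||_ + _] := @lint_dominated_cvg R (fun n x => normc (trunc n f x - f x) ^+ 2) (fun=> 0)
    (fun x => normc (f x) ^+ 2).
- by move=> n; have := meas_trunc n mf => mt; cmeas.
- by meas.
- by cmeas.
- by nneg.
- exact: fi.
- apply: ae_all => x; rewrite -[X in _ --> X](mul0r 0).
  under eq_fun do rewrite expr2.
  by apply: cvgM; exact: trunc_cvg.
- apply: ae_all => x n; rewrite ger0_norm ?sqr_ge0// /trunc; case: ifP => _.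
    by rewrite subrr normc0 expr0n sqr_ge0.
  by rewrite sub0r normc_opp.
move=> cv.
rewrite (_ : (fun n => L2sqr _) =
    (fun n => \int[mu]_x `|normc (trunc n f x - f x) ^+ 2 - 0|%:E)%E); first exact: cv.
apply/funext => n; apply: eq_integral => x _.
by rewrite subr0 ger0_norm ?sqr_ge0.
Qed.

Lemma is_fourierL2_cvg h H : is_fourierL2 h H ->
  (fun n => L2sqr (fun p => fourier (trunc n h) p - H p)) @ \oo --> 0%E.
Proof. by case=> _ /L2cvgP. Qed.

Lemma ccvg_eq_lim (a b : nat -> R[i]) l k : ccvg a l -> ccvg b k ->
  (forall n, a n = b n) -> l = k.
Proof. by move=> al bk /funext e; apply: ccvg_unique al _; rewrite e. Qed.

Lemma L2_pairing_cvg (A : nat -> R -> R[i]) a G :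
  (forall n, L2 (A n)) -> L2 a -> L2 G ->
  (fun n => L2sqr (fun x => A n x - a x)) @ \oo --> 0%E ->
  ccvg (fun n => cintegral (fun x => A n x * G x)) (cintegral (fun x => a x * G x)).
Proof.
move=> AL aL GL cv.
have := L2_pairing_cvg0 (fun n => cmeas_add (L2_meas (AL n)) (cmeas_opp (L2_meas aL))) GL cv.
rewrite /ccvg => h.
rewrite (_ : (fun n => normc (cintegral (fun x => A n x * G x) - _)) =
    (fun n => normc (cintegral (fun x => (A n x - a x) * G x) - 0))); first exact: h.
apply/funext => n; rewrite subr0 -cintegralB; [|exact: cintegrableM_L2|exact: cintegrableM_L2].
by congr normc; apply: eq_cintegral => x; rewrite mulrBl.
Qed.

Lemma L2sqr_conjB f g : L2sqr (fun x => (f x)^*%C - (g x)^*%C) = L2sqr (fun x => f x - g x).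
Proof.
rewrite -[RHS]L2sqr_conj; apply: eq_integral => x _; congr (normc _ ^+ 2)%:E.
by rewrite rmorphB.
Qed.

(** Parseval's identity for the truncations of h, whose limits are h and H. *)
Lemma plancherel_pairing (M : R) h H g : L2 h -> is_fourierL2 h H ->
  cintegrable g -> (forall x, normc (g x) <= M) ->
  cintegral (fun p => (H p)^*%C * fourier g p) = cintegral (fun x => (h x)^*%C * g x).
Proof.
move=> hL HF gi gM; have gL := L2_bounded gi gM; have HL : L2 H by case: HF.
have tL n := L2_fourier (cintegrable_trunc n hL) (L2_trunc n hL).
have c1 : ccvg (fun n => cintegral (fun p => (fourier (trunc n h) p)^*%C * fourier g p))
    (cintegral (fun p => (H p)^*%C * fourier g p)).
  apply: L2_pairing_cvg => //.
  - by move=> n; exact: L2_conj.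
  - exact: L2_conj.
  - exact: L2_fourier.
  - by under eq_fun do rewrite L2sqr_conjB; exact: is_fourierL2_cvg.
have c2 : ccvg (fun n => cintegral (fun x => (trunc n h x)^*%C * g x))
    (cintegral (fun x => (h x)^*%C * g x)).
  apply: L2_pairing_cvg => //.
  - by move=> n; apply: L2_conj; exact: L2_trunc.
  - exact: L2_conj.
  - by under eq_fun do rewrite L2sqr_conjB; exact: L2_trunc_cvg.
apply: ccvg_eq_lim c1 c2 _ => n; apply: (@parseval_bounded (n%:R + 1) M) => //.
- exact: cintegrable_trunc.
- exact: L2_trunc.
- by move=> x xn; apply: trunc_out; apply: lt_trans xn; rewrite ltrDl.
Qed.

Lemma plancherel_multiplication f F g : L2 f -> is_fourierL2 f F ->
  cintegrable g -> L2 g ->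
  cintegral (fun p => F p * g p) = cintegral (fun x => f x * fourier g x).
Proof.
move=> fL FF gi gL; have FL : L2 F by case: FF.
have tL n := L2_fourier (cintegrable_trunc n fL) (L2_trunc n fL).
have c1 : ccvg (fun n => cintegral (fun p => fourier (trunc n f) p * g p))
    (cintegral (fun p => F p * g p)).
  by apply: L2_pairing_cvg => //; exact: is_fourierL2_cvg.
have c2 : ccvg (fun n => cintegral (fun x => trunc n f x * fourier g x))
    (cintegral (fun x => f x * fourier g x)).
  apply: L2_pairing_cvg => //; [|exact: L2_fourier|exact: L2_trunc_cvg].
  by move=> n; exact: L2_trunc.
apply: ccvg_eq_lim c1 c2 _ => n; apply: fourier_multiplication => //; exact: cintegrable_trunc.
Qed.
Local Notation Re := complex.Re.
Local Notation Im := complex.Im.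

Lemma summable_ae (d : nat -> R -> R) (b : nat -> R) (B : R) :
  (forall k, measurable_fun setT (d k)) -> (forall k x, 0 <= d k x) ->
  (forall k, \int[mu]_x (d k x)%:E <= (b k)%:E)%E ->
  (forall n, \sum_(0 <= k < n) b k <= B) ->
  exists A : R -> bool, [/\ measurable_fun setT A, {ae mu, forall x, A x} &
    forall x, A x -> cvgn (series (fun k => d k x))].
Proof.
move=> md d0 db bB; pose T x := (\sum_(0 <= k <oo) (d k x)%:E)%E.
have mT : measurable_fun [set: R] T.
  by apply: ge0_emeasurable_sum => [k x _ _|k _]; [rewrite lee_fin | exact: meas_EFin].
have T0 x : (0 <= T x)%E by apply: nneseries_ge0 => k _ _; rewrite lee_fin.
have Ti : (\int[mu]_x T x <= B%:E)%E.
  rewrite /T integral_nneseries//; last 2 first.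
  - by move=> k; exact: (meas_EFin (md k)).
  - by move=> k x _; rewrite lee_fin.
  apply: lime_le.
    by apply: is_cvg_nneseries => k _ _; apply: lint_ge0.
  apply: nearW => n; apply: le_trans (_ : (\sum_(0 <= k < n) (b k)%:E <= _)%E); last first.
    by rewrite sumEFin lee_fin.
  by apply: lee_sum => k _; exact: db.
exists (fun x => (T x < +oo)%E); split.
- exact: measurable_fun_lte.
- have : mu.-integrable setT T.
    apply/integrableP; split => //.
    rewrite (_ : (fun _ => _) = T); last by apply/funext => x; rewrite gee0_abs.
    by apply: le_lt_trans Ti _; rewrite ltry.
  move=> /(integrable_ae measurableT) ae1; apply: ae_imp ae1 _ => x /(_ Logic.I) fx.
  by rewrite -ge0_fin_numE.
- move=> x Tx; have fT : T x \is a fin_num by rewrite ge0_fin_numE.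
  apply: nondecreasing_is_cvgn.
    apply/nondecreasing_seqP => n; rewrite seriesSr/=; exact: ler_wpDr.
  exists (fine (T x)) => _ [n _ <-]; rewrite -lee_fin fineK// /series /= -sumEFin.
  by apply: nneseries_lim_ge => k _ _; rewrite lee_fin.
Qed.

Lemma quadratic_bound (c a : R) : 0 < c -> a <= c^-1 + c * a ^+ 2.
Proof.
move=> c0; rewrite -subr_ge0.
have -> : c^-1 + c * a ^+ 2 - a = c^-1 * ((c * a - 2^-1) ^+ 2 + 3 / 4).
  by field; rewrite gt_eqF.
apply: mulr_ge0; first by rewrite invr_ge0 ltW.
by apply: addr_ge0; [exact: sqr_ge0 | lra].
Qed.

Lemma subseq_small (e : nat -> R) (b : nat -> R) : e @ \oo --> (0 : R) ->
  (forall k, 0 < b k) ->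
  exists sigma : nat -> nat, [/\ forall k, (k <= sigma k)%N,
    forall k, (sigma k <= sigma k.+1)%N & forall k, e (sigma k) <= b k].
Proof.
move=> e0 b0.
have next N k : exists n, (N <= n)%N && (e n <= b k).
  have /cvgr0Pnorm_le/(_ _ (b0 k)) h := e0.
  have [n [Nn en]] := filter_ex (filterI (nbhs_infty_ge N) h).
  by exists n; apply/andP; split => //; apply: le_trans en; exact: ler_norm.
pose sigma := fix sigma k := match k with
  | 0 => ex_minn (next 0 0)%N | k'.+1 => ex_minn (next (maxn k'.+1 (sigma k')) k) end.
have s0 : sigma 0%N = ex_minn (next 0 0)%N by [].
have sS k : sigma k.+1 = ex_minn (next (maxn k.+1 (sigma k)) k.+1) by [].
exists sigma; split.
- case=> // k; rewrite sS; case: ex_minnP => n /andP[h _] _.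
  by apply: leq_trans h; rewrite leq_maxl.
- move=> k; rewrite sS; case: ex_minnP => n /andP[h _] _.
  by apply: leq_trans h; rewrite leq_maxr.
- by case=> [|k]; rewrite ?s0 ?sS; case: ex_minnP => n /andP[_ h] _.
Qed.

(** Completeness of the space of square-integrable functions: along a rapidly
    Cauchy subsequence the increments are summable almost everywhere, since
    |a| <= 1/c + c|a|^2; Fatou's lemma then controls the whole sequence. *)
Lemma L2_complete (F : nat -> R -> R[i]) (e : nat -> R) :
  (forall n, L2 (F n)) -> e @ \oo --> (0 : R) ->
  (forall m n, (m <= n)%N -> L2sqr (fun x => (F n x - F m x)%R) <= (e m)%:E)%E ->
  exists G, L2 G /\ (fun n => L2sqr (fun x => F n x - G x)) @ \oo --> 0%E.
Proof.
move=> FL e0 Fe.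
have [sigma [sk sm es]] := subseq_small (b := fun k => 4^-1 ^+ k) e0
  ltac:(by move=> k; rewrite exprn_gt0).
have smon m n : (m <= n)%N -> (sigma m <= sigma n)%N.
  by move=> mn; exact: (homo_leq (leqnn) leq_trans sm).
have mF n := L2_meas (FL n).
pose D k x := F (sigma k.+1) x - F (sigma k) x.
have mD k : cmeasurable (D k) by rewrite /D; have := mF (sigma k.+1); have := mF (sigma k); move=> ? ?; cmeas.
pose d k x := 2 ^+ k * normc (D k x) ^+ 2.
have md k : measurable_fun [set: R] (d k) by have := mD k => ?; rewrite /d; cmeas.
have d0 k x : 0 <= d k x.
  by apply: mulr_ge0; [exact: exprn_ge0 | exact: sqr_ge0].
have [|||A [mA aeA cA]] := @summable_ae d (fun k => 2^-1 ^+ k) 2 md.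
- exact: d0.
- move=> k; have := mD k => ?; rewrite /d lintZ; [|by rewrite exprn_ge0|cmeas|nneg].
  apply: le_trans (_ : (2 ^+ k)%:E * (e (sigma k))%:E <= _)%E.
    by rewrite lee_wpmul2l ?lee_fin ?exprn_ge0//; apply: Fe.
  rewrite -EFinM lee_fin; apply: (@le_trans _ _ (2 ^+ k * 4^-1 ^+ k)).
    by rewrite ler_wpM2l ?exprn_ge0.
  by rewrite -exprMn; have -> : 2 * 4^-1 = 2^-1 :> R by field.
- elim=> [|n IH]; first by rewrite big_nil.
  rewrite big_nat_recl//=; under eq_bigr do rewrite exprS.
  by rewrite -mulr_sumr; move: IH; rewrite expr0; lra.
have cvRI (P : R[i] -> R) : (forall z, `|P z| <= normc z) ->
    (forall z w, P (z - w) = P z - P w) ->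
    forall x, A x -> cvgn (fun k => P (F (sigma k) x)).
  move=> Pn PB x Ax.
  have h1 : cvgn (series (fun k => P (D k x))).
    apply: normed_cvg.
    apply: (@series_le_cvg _ _ (fun k => 2^-1 ^+ k + d k x)) => [k|k|k|].
    - exact: normr_ge0.
    - by apply: addr_ge0; [exact: exprn_ge0 | exact: d0].
    - apply: le_trans (Pn _) _; rewrite /d exprVn.
      by apply: quadratic_bound; rewrite exprn_gt0.
    - apply: is_cvg_seriesD; last exact: cA.
      have : `|2^-1 : R| < 1 by rewrite ger0_norm ?invr_ge0//; lra.
      have e2 : geometric 1 2^-1 = GRing.exp (2^-1 : R) by apply/funext => k; rewrite /= mul1r.
      by rewrite -e2; exact: is_cvg_geometric_series.
  rewrite (_ : (fun k => P (F (sigma k) x)) = (fun k => P (F (sigma 0%N) x) + series (fun k => P (D k x)) k)).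
    by apply: is_cvgD => //; exact: is_cvg_cst.
  apply/funext => k; rewrite (eq_sum_telescope (fun k => P (F (sigma k) x)) k).
  congr (_ + _); congr (series _ _); apply/funext => j.
  by rewrite /telescope /D PB.
pose gr x := limn (fun k => if A x then Re (F (sigma k) x) else 0).
pose gi x := limn (fun k => if A x then Im (F (sigma k) x) else 0).
have cvr x : (fun k => if A x then Re (F (sigma k) x) else 0) @ \oo --> gr x.
  rewrite /gr; case: (boolP (A x)) => Ax; last exact: is_cvg_cst.
  have ReB (z w : R[i]) : Re (z - w) = Re z - Re w by rewrite ReD ReN.
  refine (cvRI (@complex.Re R) (@Re_le_normc R) ReB x Ax).
have cvi x : (fun k => if A x then Im (F (sigma k) x) else 0) @ \oo --> gi x.
  rewrite /gi; case: (boolP (A x)) => Ax; last exact: is_cvg_cst.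
  have ImB (z w : R[i]) : Im (z - w) = Im z - Im w by rewrite ImD ImN.
  refine (cvRI (@complex.Im R) (@Im_le_normc R) ImB x Ax).
pose G x := gr x +i* gi x.
have mG : cmeasurable G.
  split.
  - apply: (measurable_fun_cvg (h := fun k x => if A x then Re (F (sigma k) x) else 0)) => [k|x _]; last exact: cvr.
    by have := mF (sigma k) => ?; apply: meas_if; [| cmeas | cmeas].
  - apply: (measurable_fun_cvg (h := fun k x => if A x then Im (F (sigma k) x) else 0)) => [k|x _]; last exact: cvi.
    by have := mF (sigma k) => ?; apply: meas_if; [| cmeas | cmeas].
have bound n : (L2sqr (fun x => (G x - F n x)%R) <= (e n)%:E)%E.
  apply: (lint_fatou (g_ := fun k x => normc (F (sigma (k + n)%N) x - F n x) ^+ 2)).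
  - by move=> k; have := mF (sigma (k + n)%N); have := mF n => ? ?; cmeas.
  - by have := mF n => ?; cmeas.
  - by move=> k x; exact: sqr_ge0.
  - by move=> x; exact: sqr_ge0.
  - apply: ae_imp aeA _ => x Ax; rewrite normc_sqr.
    under eq_fun do rewrite normc_sqr ReD ImD ReN ImN.
    rewrite ReD ImD ReN ImN.
    have c1 := cvr x; have c2 := cvi x; rewrite Ax in c1 c2.
    have s1 : (fun k => Re (F (sigma (k + n)%N) x)) @ \oo --> Re (G x).
      by move: c1; rewrite -(cvg_shiftn n).
    have s2 : (fun k => Im (F (sigma (k + n)%N) x)) @ \oo --> Im (G x).
      by move: c2; rewrite -(cvg_shiftn n).
    by apply: cvgD; under eq_fun do rewrite expr2; rewrite expr2; apply: cvgM; apply: cvgB => //; exact: cvg_cst.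
  - move=> k; apply: Fe; apply: leq_trans (leq_addl k n) (sk _).
have GL : L2 G.
  have h : L2 (fun x => G x - F 0%N x).
    by apply/L2P; split; [have := mF 0%N => ?; cmeas | apply: le_lt_trans (bound _) _; rewrite ltry].
  by have := L2D h (FL 0%N); congr L2; apply/funext => x; rewrite subrK.
exists G; split => //.
apply: (@squeeze_cvge _ _ _ _ (fun=> 0%E) _ (fun n => (e n)%:E)).
- apply: nearW => n; rewrite L2sqr_ge0 /=; apply: le_trans (bound n).
  by apply: le_lint; [have := mF n => ?; cmeas | have := mF n => ?; cmeas | nneg | move=> x; rewrite normc_distC].
- exact: cvg_cst.
- by apply: cvg_EFin => //; exact: nearW.
Qed.

(** The transforms of the truncations form a Cauchy sequence by Bessel's inequality. *)
Lemma fourierL2_exists f : L2 f -> exists F, is_fourierL2 f F.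
Proof.
move=> fL; have /fine_cvgP[fin cv] := L2_trunc_cvg fL.
have tL n := L2_fourier (cintegrable_trunc n fL) (L2_trunc n fL).
have [|G [GL Gc]] := L2_complete (F := fun n => fourier (trunc n f)) tL cv.
  move=> m n mn; rewrite /= fineK; last by apply: L2_fin; apply: L2B => //; exact: L2_trunc.
  have tmi := cintegrable_trunc m fL; have tni := cintegrable_trunc n fL.
  have mf := L2_meas fL; have mtm := meas_trunc m mf; have mtn := meas_trunc n mf.
  have -> : (fun x => fourier (trunc n f) x - fourier (trunc m f) x) =
      fourier (fun x => trunc n f x - trunc m f x).
    apply/funext => p; rewrite /fourier -mulrBr -cintegralB.
    - by congr (_ * _); apply: eq_cintegral => x; rewrite mulrBl.
    - by apply: cintegrable_cis => //; meas.
    - by apply: cintegrable_cis => //; meas.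
  apply: le_trans (fourier_bessel (cintegrableB tni tmi)) _.
  apply: le_lint; [cmeas | cmeas | nneg |] => x.
  rewrite ler_sqr ?nnegrE ?normc_ge0// /trunc.
  have [xm|xm] := leP `|x| m%:R.
    by rewrite (le_trans xm) ?ler_nat// subrr normc0 normc_ge0.
  rewrite subr0 sub0r normc_opp; case: ifP => _ //.
  by rewrite normc0 normc_ge0.
by exists G; split => //; apply/L2cvgP.
Qed.

End Plancherel.

(** * Estimates for the Riesz kernel *)

Section PowerEstimates.
Context {R : realType}.
Local Notation mu := (@lebesgue_measure R).

Lemma powR_antitone (r x y : R) : r <= 0 -> 0 < x -> x <= y -> y `^ r <= x `^ r.
Proof.
move=> r0 x0 xy; have y0 : 0 < y by exact: lt_le_trans xy.
rewrite -[r]opprK !(powRN _ (- r)) lef_pV2 ?posrE ?powR_gt0//.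
by apply: ge0_ler_powR => //; rewrite ?nnegrE ?oppr_ge0//; exact: ltW.
Qed.

Lemma powR_le1 (r x : R) : r <= 0 -> 1 <= x -> x `^ r <= 1.
Proof. by move=> r0 x1; have := powR_antitone r0 ltr01 x1; rewrite powR1. Qed.

Lemma powR_ge1 (r x : R) : r <= 0 -> 0 < x -> x <= 1 -> 1 <= x `^ r.
Proof. by move=> r0 x0 x1; have := powR_antitone r0 x0 x1; rewrite powR1. Qed.

Lemma powR_pred (r x : R) : 0 < x -> x `^ (r - 1) = x `^ r / x.
Proof.
move=> x0; rewrite powRD; last by apply/implyP => _; rewrite gt_eqF.
by rewrite powRN powRr1// ltW.
Qed.

Lemma lint_even (f : R -> R) : measurable_fun setT f -> (forall x, 0 <= f x) ->
  (\int[mu]_x (f `|x|)%:E = 2%:E * \int[mu]_x (if 0 < x then f x else 0)%:E)%E.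
Proof.
move=> mf f0; pose g x := if 0 < x then f x else 0.
have mg : measurable_fun [set: R] g by rewrite /g; meas.
have g0 x : 0 <= g x by rewrite /g; case: ifP.
transitivity (\int[mu]_x (g x + g (0 - x))%:E)%E.
  apply: ae_eq_lint; [by cmeas; apply: measurableT_comp; meas | by cmeas | by move=> x; rewrite lee_fin | |].
    by move=> x; rewrite lee_fin addr_ge0.
  apply: ae_imp (ae_neq 0) _ => x x0; rewrite /g sub0r oppr_gt0.
  have [xp|xn|xE] := ltgtP 0 x; last by rewrite xE eqxx in x0.
    by rewrite gtr0_norm// addr0.
  by rewrite ltr0_norm// add0r.
rewrite lintD//; last by cmeas.
by rewrite lint_reflect// -mule2n -mule_natl.
Qed.

(** A majorant of Riesz kernels and of their differences, whose singularity and
    decay have different exponents. *)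
Definition two_powers (u p q c z : R) : R := if `|z| <= u then `|z| `^ p else c * `|z| `^ q.

Lemma two_powers_ge0 (u p q c z : R) : 0 <= c -> 0 <= two_powers u p q c z.
Proof. by move=> c0; rewrite /two_powers; case: ifP => _; rewrite ?mulr_ge0 ?powR_ge0. Qed.

Lemma meas_two_powers (u p q c : R) : measurable_fun setT (two_powers u p q c).
Proof. by rewrite /two_powers; meas. Qed.

Lemma lint_two_powers (u a b c : R) : 0 < u -> 0 < a -> 0 < b -> 0 <= c ->
  (\int[mu]_z (two_powers u (a - 1) (- b - 1) c z)%:E =
   (2 * (u `^ a / a + c * (u `^ (- b) / b)))%:E)%E.
Proof.
move=> u0 a0 b0 c0.
pose f z := if z <= u then z `^ (a - 1) else c * z `^ (- b - 1).
pose g z : R := if (0 < z) && (z <= u) then z `^ (a - 1) else 0.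
pose h z : R := if u <= z then z `^ (- b - 1) else 0.
have mf : measurable_fun [set: R] f by rewrite /f; meas.
have mg : measurable_fun [set: R] g by rewrite /g; meas.
have mh : measurable_fun [set: R] h by rewrite /h; meas.
have f0 z : 0 <= f z by rewrite /f; case: ifP => _; rewrite ?mulr_ge0 ?powR_ge0.
have g0 z : 0 <= g z by rewrite /g; case: ifP => _; rewrite ?powR_ge0.
have h0 z : 0 <= h z by rewrite /h; case: ifP => _; rewrite ?powR_ge0.
rewrite -[LHS]/(\int[mu]_z (f `|z|)%:E)%E lint_even//.
have -> : (\int[mu]_x (if 0%R < x then f x else 0)%:E = \int[mu]_x (g x + c * h x)%:E)%E.
  apply: ae_eq_lint; [by cmeas | by cmeas | | |].
  - by move=> z; rewrite lee_fin; case: ifP.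
  - by move=> z; rewrite lee_fin addr_ge0 ?mulr_ge0.
  - apply: ae_imp (ae_neq u) _ => z zu; rewrite /f /g /h.
    have [z0|z0] := ltP 0 z; last first.
      by rewrite (lt_geF (le_lt_trans z0 u0)) /= mulr0 addr0.
    have [zu'|uz] := leP z u; last by rewrite (ltW uz) /= add0r.
    have lt : z < u by rewrite lt_neqAle zu.
    by rewrite (lt_geF lt) /= mulr0 addr0.
rewrite lintD//; [|cmeas|by move=> z; rewrite mulr_ge0].
by rewrite lintZ// lint_powR_head// lint_powR_tail// -EFinM -EFinD -EFinM.
Qed.

Lemma lint_shift_le (y C : R) (f : R -> R) : measurable_fun setT f -> (forall x, 0 <= f x) ->
  (\int[mu]_x (f x)%:E <= C%:E)%E -> (\int[mu]_x (f (x - y) + f x)%:E <= (2 * C)%:E)%E.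
Proof.
move=> mf f0 fC; rewrite lintD//; last by cmeas; apply: measurableT_comp; meas.
rewrite lint_shift// (_ : 2 * C = C + C) ?EFinD; last by ring.
exact: leeD.
Qed.

End PowerEstimates.

Section RieszEstimates.
Context {R : realType} (s : R) (hs : 2^-1 < s < 1).
Local Notation mu := (@lebesgue_measure R).
Implicit Types f g G : R -> R[i].

Let s0 : 0 < s. Proof. by case/andP: hs => h _; lra. Qed.
Let s1 : s < 1. Proof. by case/andP: hs. Qed.
Let s2 : 0 < 2 * s - 1. Proof. by case/andP: hs => h _; lra. Qed.

Lemma riesz_decay_pointwise (x y : R) : x != 0 -> x != y ->
  `|x - y| `^ (s - 1) / (1 + `|x|) <=
  two_powers 1 (s - 1) (- (1 - s) - 1) 1 (x - y) + two_powers 1 (s - 1) (- (1 - s) - 1) 1 x.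
Proof.
move: s0 s1 => h0 h1 x0 xy.
have b0 : 0 < `|x| by rewrite normr_gt0.
have a0 : 0 < `|x - y| by rewrite normr_gt0 subr_eq0.
have -> : - (1 - s) - 1 = s - 1 - 1 by ring.
have r1 : s - 1 <= 0 by lra.
have r2 : s - 1 - 1 <= 0 by lra.
rewrite /two_powers !mul1r; move: `|x - y| `|x| a0 b0 => a b a0 b0.
have b1 : 0 < 1 + b by lra.
have [a1|a1] := leP a 1.
  apply: ler_wpDr; first by case: ifP => _; exact: powR_ge0.
  by rewrite ler_pdivrMr// ler_peMr ?powR_ge0//; lra.
have [ab|ba] := leP a (1 + b).
  apply: ler_wpDr; first by case: ifP => _; exact: powR_ge0.
  by rewrite (powR_pred (s - 1))// ler_wpM2l ?powR_ge0// lef_pV2.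
apply: ler_wpDl; first exact: powR_ge0.
apply: (@le_trans _ _ ((1 + b) `^ (s - 1 - 1))).
  rewrite (powR_pred (s - 1))// ler_wpM2r//; first by rewrite invr_ge0 ltW.
  by apply: powR_antitone => //; exact: ltW.
case: ifP => b1'; last by apply: powR_antitone => //; lra.
apply: (@le_trans _ _ 1); first by apply: powR_le1 => //; lra.
exact: powR_ge1.
Qed.

(** The decay 1/(1+|x|) at infinity makes the Riesz kernel integrable, uniformly in
    the position of its singularity. *)
Lemma riesz_decay_bound : exists C : R, 0 <= C /\
  forall y, (\int[mu]_x (rker s (x - y) / (1 + `|x|))%:E <= C%:E)%E.
Proof.
have h := lint_two_powers (u := 1) (a := s) (b := 1 - s) (c := 1).
move: s0 s1 => h0 h1.
have L0 := ltW (Lambda_gt0 h0 h1).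
pose C := 2 * (1 `^ s / s + 1 * (1 `^ (- (1 - s)) / (1 - s))) : R.
have hC : (\int[mu]_z (two_powers 1 (s - 1) (- (1 - s) - 1) 1 z)%:E <= C%:E)%E.
  by rewrite h// subr_gt0.
have C0 : 0 <= C.
  by rewrite -lee_fin; apply: le_trans hC; apply: lint_ge0 => z; exact: two_powers_ge0.
exists (Lambda s * (2 * C)); split; first by nneg.
move=> y; have mt := meas_two_powers 1 (s - 1) (- (1 - s) - 1) (1 : R).
have t0 z : 0 <= two_powers 1 (s - 1) (- (1 - s) - 1) 1 z :> R by exact: two_powers_ge0.
have mts : measurable_fun [set: R] (fun x => two_powers 1 (s - 1) (- (1 - s) - 1) 1 (x - y) : R).
  by apply: (measurableT_comp mt); meas.
rewrite EFinM; apply: le_trans (lee_wpmul2l _ (lint_shift_le y mt t0 hC)); last by rewrite lee_fin.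
rewrite -lintZ//; [|by cmeas|by move=> x; rewrite addr_ge0].
apply: ae_le_lint.
- by cmeas; rewrite /rker; meas.
- by cmeas.
- by move=> x; rewrite lee_fin divr_ge0 ?rker_ge0// addr_ge0.
- by move=> x; rewrite lee_fin mulr_ge0// addr_ge0.
- apply: ae_imp2 (ae_neq 0) (ae_neq y) _ => x x0 xy.
  by rewrite lee_fin rkerE -mulrA ler_wpM2l// riesz_decay_pointwise.
Qed.

Lemma powR_sqr (a z : R) : (z `^ a) ^+ 2 = z `^ (2 * a).
Proof. by rewrite -powR_mulrn ?powR_ge0// -powRrM mulrC. Qed.

(** The square of the kernel is integrable at its singularity: 2(s - 1) > -1. *)
Lemma riesz_local_bound (M : R) : 0 <= M -> exists C : R, 0 <= C /\
  forall y, (\int[mu]_x (if (`|x| <= M)%R then rker s (x - y) ^+ 2 else 0)%:E <= C%:E)%E.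
Proof.
move=> M0; move: s0 s1 s2 => h0 h1 h2.
have hC := @lint_two_powers R 1 (2 * s - 1) 1 0 ltr01 h2 ltr01 (lexx 0).
have fI := @lint_itv1 R M.
set I := (\int[mu]_x _)%E in fI.
have I0 : (0 <= I)%E by apply: lint_ge0 => x; case: ifP.
have Ifin : I \is a fin_num by rewrite ge0_fin_numE.
pose C := 2 * (1 `^ (2 * s - 1) / (2 * s - 1) + 0 * (1 `^ (- 1) / 1)) : R.
have C0 : 0 <= C.
  by rewrite -lee_fin -hC; apply: lint_ge0 => z; exact: two_powers_ge0.
exists (Lambda s ^+ 2 * (C + fine I)); split.
  by rewrite mulr_ge0 ?sqr_ge0// addr_ge0// fine_ge0.
move=> y; have mt := meas_two_powers 1 (2 * s - 1 - 1) (- 1 - 1) (0 : R).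
have t0 z : 0 <= two_powers 1 (2 * s - 1 - 1) (- 1 - 1) 0 z :> R by exact: two_powers_ge0.
have mts : measurable_fun [set: R] (fun x => two_powers 1 (2 * s - 1 - 1) (- 1 - 1) 0 (x - y) : R).
  by apply: (measurableT_comp mt); meas.
rewrite EFinM EFinD fineK// -hC -(lint_shift y) // /I -lintD//; [|by cmeas|by move=> x; case: ifP].
rewrite -lintZ ?sqr_ge0//; [|by cmeas|by move=> x; rewrite addr_ge0//; case: ifP].
apply: le_lint.
- by rewrite /rker; cmeas.
- by cmeas.
- by move=> x; case: ifP => // _; exact: sqr_ge0.
move=> x; case: ifP => xM; last by rewrite addr0 mulr_ge0 ?sqr_ge0.
rewrite rkerE exprMn ler_wpM2l ?sqr_ge0// powR_sqr.
have -> : 2 * (s - 1) = 2 * s - 1 - 1 by ring.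
rewrite /two_powers; case: ifP => z1; first by rewrite lerDl.
by rewrite mul0r add0r; apply: powR_le1; [lra | move/negbT: z1; rewrite -ltNge => /ltW].
Qed.

(** Within |y| of one of the two singularities the squares are simply added. Elsewhere the
    mean value estimate gains a factor |y| over the distance, which improves the decay. *)
Lemma riesz_difference_pointwise (x y : R) : x != 0 -> x != y -> y != 0 ->
  (`|x - y| `^ (s - 1) - `|x| `^ (s - 1)) ^+ 2 <=
  two_powers (2 * `|y|) (2 * s - 1 - 1) (- (3 - 2 * s) - 1) (y ^+ 2) (x - y) +
  two_powers (2 * `|y|) (2 * s - 1 - 1) (- (3 - 2 * s) - 1) (y ^+ 2) x.
Proof.
move: s0 s1 => h0 h1 x0 xy y0.
have b0 : 0 < `|x| by rewrite normr_gt0.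
have a0 : 0 < `|x - y| by rewrite normr_gt0 subr_eq0.
have d0 : 0 < `|y| by rewrite normr_gt0.
have ab : `|x - y| <= `|x| + `|y| by exact: ler_normB.
have ba : `|x| <= `|x - y| + `|y| by have := ler_normD (x - y) y; rewrite subrK.
rewrite -(real_normK (num_real y)).
have -> : 2 * s - 1 - 1 = 2 * (s - 1) by ring.
have -> : - (3 - 2 * s) - 1 = 2 * (s - 1 - 1) by ring.
have r1 : s - 1 <= 0 by lra.
have r2 : s - 1 - 1 <= 0 by lra.
rewrite /two_powers -!powR_sqr; move: `|x - y| `|x| `|y| a0 b0 d0 ab ba => a b d a0 b0 d0 ab ba.
have sq (p q : R) : 0 <= p -> 0 <= q -> (p - q) ^+ 2 <= p ^+ 2 + q ^+ 2.
  by move=> p0 q0; have := mulr_ge0 p0 q0; rewrite sqrrB; lra.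
have [ad|da] := ltP a d.
  by rewrite !ifT; [apply: sq; exact: powR_ge0 | lra | lra].
have [bd|db] := ltP b d.
  by rewrite !ifT; [apply: sq; exact: powR_ge0 | lra | lra].
(* The mean value estimate: q^(s-1) = p^(s-1) (p/q)^(1-s) with (p/q)^(1-s) >= p/q. *)
have key (p q : R) : 0 < p -> p <= q -> q <= p + d ->
    (p `^ (s - 1) - q `^ (s - 1)) ^+ 2 <= d ^+ 2 * (p `^ (s - 1 - 1)) ^+ 2.
  move=> p0 pq qpd; have q0 : 0 < q by exact: lt_le_trans pq.
  rewrite -exprMn ler_sqr ?nnegrE ?subr_ge0 ?mulr_ge0 ?powR_ge0 ?(ltW d0)//; last exact: powR_antitone.
  have qp1 : p / q <= 1 by rewrite ler_pdivrMr ?mul1r.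
  have pq0 : 0 < p / q by rewrite divr_gt0.
  have e1 : q `^ (s - 1) = p `^ (s - 1) * (p / q) `^ (1 - s).
    rewrite -[X in X `^ (s - 1)](_ : p * (p / q)^-1 = q); last by field; rewrite !gt_eqF.
    rewrite powRM ?invr_ge0 ?ltW//; congr (_ * _).
    by rewrite -powR_inv1 ?ltW// -powRrM; congr (_ `^ _); ring.
  have le1 : p / q <= (p / q) `^ (1 - s).
    have pq1 : 0 < p / q <= 1 by rewrite pq0.
    have s1' : 1 - s <= 1 by lra.
    by have := ger_powR pq1 s1'; rewrite powRr1// ltW.
  rewrite e1 -{1}[p `^ (s - 1)]mulr1 -mulrBr (powR_pred (s - 1))//.
  apply: (@le_trans _ _ (p `^ (s - 1) * (1 - p / q))).
    by rewrite ler_wpM2l ?powR_ge0//; lra.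
  rewrite mulrCA ler_wpM2l ?powR_ge0// ler_pdivlMr// mulrBl mul1r.
  have : p / q * p = p - (q - p) * (p / q) by field; rewrite gt_eqF.
  move=> ->; have : (q - p) * (p / q) <= (q - p) * 1 by rewrite ler_wpM2l// subr_ge0.
  by rewrite mulr1 => ?; lra.
have tail (z : R) : 0 < z -> d <= z ->
    d ^+ 2 * (z `^ (s - 1 - 1)) ^+ 2 <=
    if z <= 2 * d then (z `^ (s - 1)) ^+ 2 else d ^+ 2 * (z `^ (s - 1 - 1)) ^+ 2.
  move=> z0 dz; case: ifP => // _; rewrite -exprMn ler_sqr ?nnegrE ?mulr_ge0 ?powR_ge0 ?(ltW d0)//.
  by rewrite (powR_pred (s - 1))// mulrCA ger_pMr ?powR_gt0// ler_pdivrMr ?mul1r.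
have pos (z : R) : 0 <= if z <= 2 * d then (z `^ (s - 1)) ^+ 2 else d ^+ 2 * (z `^ (s - 1 - 1)) ^+ 2.
  by case: ifP => _; [exact: sqr_ge0 | exact: mulr_ge0 (sqr_ge0 _) (sqr_ge0 _)].
have [le|/ltW le] := leP a b.
  by apply: ler_wpDr => //; apply: le_trans (tail _ a0 da); exact: key.
apply: ler_wpDl => //; apply: le_trans (tail _ b0 db).
by rewrite -sqrrN opprB; exact: key.
Qed.

Lemma riesz_difference_bound : exists C : R, 0 <= C /\
  forall y, (\int[mu]_x ((rker s (x - y) - rker s x) ^+ 2)%:E <= (C * `|y| `^ (2 * s - 1))%:E)%E.
Proof.
move: s0 s1 s2 => h0 h1 h2; have s3 : 0 < 3 - 2 * s by lra.
pose C := Lambda s ^+ 2 * (2 * (2 * (2 `^ (2 * s - 1) / (2 * s - 1) + 2 `^ (- (3 - 2 * s)) / (3 - 2 * s)))).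
have C0 : 0 <= C.
  apply: mulr_ge0; first exact: sqr_ge0.
  apply: mulr_ge0 => //; apply: mulr_ge0 => //.
  by apply: addr_ge0; apply: divr_ge0; [exact: powR_ge0 | exact: ltW | exact: powR_ge0 | exact: ltW].
exists C; split => // y.
have [->|y0] := eqVneq y 0.
  under eq_integral do rewrite subr0 subrr expr0n /=.
  by rewrite integral0 lee_fin mulr_ge0 ?powR_ge0.
have d0 : 0 < `|y| by rewrite normr_gt0.
have u0 : 0 < 2 * `|y| by rewrite mulr_gt0.
pose t := two_powers (2 * `|y|) (2 * s - 1 - 1) (- (3 - 2 * s) - 1) (y ^+ 2).
have mt : measurable_fun [set: R] t by exact: meas_two_powers.
have t0 z : 0 <= t z by apply: two_powers_ge0; exact: sqr_ge0.
have mts : measurable_fun [set: R] (fun x => t (x - y)) by apply: (measurableT_comp mt); meas.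
pose K := 2 * ((2 * `|y|) `^ (2 * s - 1) / (2 * s - 1) +
   y ^+ 2 * ((2 * `|y|) `^ (- (3 - 2 * s)) / (3 - 2 * s))).
have hK : (\int[mu]_z (t z)%:E <= K%:E)%E.
  by rewrite /t lint_two_powers// sqr_ge0.
have -> : C * `|y| `^ (2 * s - 1) = Lambda s ^+ 2 * (2 * K).
  rewrite /C /K !powRM ?(ltW d0)//.
  have -> : y ^+ 2 * (2 `^ (- (3 - 2 * s)) * `|y| `^ (- (3 - 2 * s)) / (3 - 2 * s)) =
     2 `^ (- (3 - 2 * s)) / (3 - 2 * s) * (y ^+ 2 * `|y| `^ (- (3 - 2 * s))) by ring.
  rewrite -(real_normK (num_real y)) -(powR_mulrn 2 (ltW d0)) -powRD; last first.
    by apply/implyP => _; rewrite gt_eqF.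
  have -> : 2%:R + - (3 - 2 * s) = 2 * s - 1 by ring.
  by rewrite [_ * _ / (2 * s - 1)]mulrAC -mulrDl !mulrA.
rewrite EFinM; apply: le_trans (lee_wpmul2l _ (lint_shift_le y mt t0 hK)); last by rewrite lee_fin sqr_ge0.
rewrite -lintZ ?sqr_ge0//; [|by cmeas|by move=> x; rewrite addr_ge0].
apply: ae_le_lint.
- by rewrite /rker; cmeas.
- by cmeas.
- by move=> x; rewrite lee_fin sqr_ge0.
- by move=> x; rewrite lee_fin mulr_ge0 ?sqr_ge0// addr_ge0.
- apply: ae_imp2 (ae_neq 0) (ae_neq y) _ => x x0 xy.
  by rewrite lee_fin !rkerE -mulrBr exprMn ler_wpM2l ?sqr_ge0// riesz_difference_pointwise.
Qed.

(** The tail of the square, |x|^(2s-2), has an exponent above -1. *)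
Lemma riesz_not_L2 : (\int[mu]_x (rker s x ^+ 2)%:E = +oo)%E.
Proof.
move: s0 s1 s2 => h0 h1 h2; have L0 := Lambda_gt0 h0 h1.
apply/eqP; rewrite eq_le leey /=.
suff H (A : R) : 0 < A -> (A%:E <= \int[mu]_x (rker s x ^+ 2)%:E)%E.
  have [//|fin] := eqVneq (\int[mu]_x (rker s x ^+ 2)%:E)%E +oo%E; first by move=> ->.
  have I0 : (0 <= \int[mu]_x (rker s x ^+ 2)%:E)%E by apply: lint_ge0 => x; exact: sqr_ge0.
  have If : (\int[mu]_x (rker s x ^+ 2)%:E)%E \is a fin_num by rewrite ge0_fin_numE// ltey.
  have := H (fine (\int[mu]_x (rker s x ^+ 2)%:E)%E + 1).
  rewrite EFinD fineK// ltr_wpDl ?fine_ge0// => /(_ isT).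
  by rewrite -[leRHS]adde0 leeD2lE// lee_fin ler10.
move=> A0.
pose n := 1 + (1 + A * (2 * s - 1) / Lambda s ^+ 2) `^ (2 * s - 1)^-1.
have B1 : 1 <= 1 + A * (2 * s - 1) / Lambda s ^+ 2.
  by rewrite lerDl divr_ge0 ?sqr_ge0// mulr_ge0 ?ltW.
have n1 : 1 < n by rewrite /n ltrDl powR_gt0//; lra.
have nb : 1 + A * (2 * s - 1) / Lambda s ^+ 2 <= n `^ (2 * s - 1).
  apply: (@le_trans _ _ (((1 + A * (2 * s - 1) / Lambda s ^+ 2) `^ (2 * s - 1)^-1) `^ (2 * s - 1))).
    by rewrite -powRrM mulVf ?gt_eqF// powRr1//; lra.
  apply: ge0_ler_powR; rewrite ?nnegrE ?(ltW h2) ?powR_ge0//.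
    by rewrite addr_ge0 ?powR_ge0.
  by rewrite /n lerDr.
have seg := @integral_powR_segment R (2 * s - 1) 1 n ltac:(by rewrite gt_eqF) ltr01 n1.
rewrite integral_itv_if in seg.
apply: (@le_trans _ _ (\int[mu]_x (Lambda s ^+ 2 * (if x \in `[1%R, n] then x `^ (2 * s - 1 - 1) else 0))%:E)%E).
  have mI : measurable_fun [set: R] (fun x => if x \in `[1%R, n] then x `^ (2 * s - 1 - 1) else 0).
    rewrite (_ : (fun _ => _) = (fun x => if (1 <= x) && (x <= n) then x `^ (2 * s - 1 - 1) else 0)).
      by meas.
    by apply/funext => x; rewrite in_itv.
  rewrite lintZ ?sqr_ge0//; last by move=> x; case: ifP => // _; exact: powR_ge0.
  rewrite seg -EFinM lee_fin powR1 mulrC -ler_pdivrMr ?exprn_gt0//.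
  by rewrite -mulrBl ler_pdivlMr// mulrAC; lra.
apply: le_lint.
- rewrite (_ : (fun _ => _) = (fun x => Lambda s ^+ 2 * (if (1 <= x) && (x <= n) then x `^ (2 * s - 1 - 1) else 0))).
    by meas.
  by apply/funext => x; rewrite in_itv.
- by rewrite /rker; cmeas.
- by move=> x; case: ifP => _; rewrite ?mulr0// mulr_ge0 ?sqr_ge0 ?powR_ge0.
move=> x; rewrite in_itv /=; case: ifP => [/andP[x1 _]|_]; last by rewrite mulr0 sqr_ge0.
rewrite rkerE [leRHS]exprMn powR_sqr ger0_norm; last by apply: le_trans x1.
by have -> : 2 * (s - 1) = 2 * s - 1 - 1 by ring.
Qed.

(** Cauchy-Schwarz against a weight, followed by Tonelli: an integral operator whose
    columns have square norms at most B omega^2 is controlled on the space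
    weighted by omega. *)
Lemma lint_schur (k : R -> R -> R) (w omega : R -> R) (B : R) :
  measurable_fun setT (fun z : R * R => k z.1 z.2) -> (forall x y, 0 <= k x y) ->
  measurable_fun setT w -> (forall y, 0 <= w y) ->
  measurable_fun setT omega -> (forall y, 0 < omega y) -> 0 <= B ->
  (forall y, \int[mu]_x (k x y ^+ 2)%:E <= (B * omega y ^+ 2)%:E)%E ->
  (\int[mu]_x ((\int[mu]_y (k x y * w y)%:E) * (\int[mu]_y (k x y * w y)%:E)) <=
   B%:E * (\int[mu]_y (omega y * w y)%:E) * (\int[mu]_y (omega y * w y)%:E))%E.
Proof.
move=> mk k0 mw w0 mo o0 B0 kB; set W := (\int[mu]_y (omega y * w y)%:E)%E.
have W0 : (0 <= W)%E by apply: lint_ge0 => y; rewrite mulr_ge0// ltW.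
pose F x y := k x y ^+ 2 / omega y * w y.
have o0' y : 0 <= omega y by exact: ltW.
have mF : measurable_fun [set: R * R] (fun z : R * R => F z.1 z.2).
  by rewrite /F; meas.
have F0 x y : 0 <= F x y by rewrite /F; apply: mulr_ge0 => //; apply: divr_ge0 => //; exact: sqr_ge0.
have mkx x : measurable_fun [set: R] (k x).
  by apply: (measurableT_comp mk (g := fun y : R => (x, y))); exact: measurable_pair1.
have mky y : measurable_fun [set: R] (k ^~ y).
  by apply: (measurableT_comp mk (g := fun x : R => (x, y))); exact: measurable_pair2.
have pw x : ((\int[mu]_y (k x y * w y)%:E) * (\int[mu]_y (k x y * w y)%:E) <=
    W * \int[mu]_y (F x y)%:E)%E.
  pose a y := k x y * Num.sqrt (w y / omega y).
  pose b y := Num.sqrt (omega y * w y).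
  have e1 y : k x y * w y = a y * b y.
    rewrite /a /b -mulrA -sqrtrM ?divr_ge0//.
    have -> : w y / omega y * (omega y * w y) = w y ^+ 2 by field; rewrite gt_eqF.
    by rewrite sqrtr_sqr ger0_norm.
  have := mkx x => mkx'.
  under eq_integral do rewrite e1.
  rewrite muleC; apply: le_trans (lint_cauchy_schwarz (f := a) (g := b) _ _ _ _) _.
  - by rewrite /a; meas.
  - by rewrite /b; meas.
  - by move=> y; rewrite /a mulr_ge0// sqrtr_ge0.
  - by move=> y; rewrite /b sqrtr_ge0.
  - rewrite le_eqVlt; apply/orP; left; apply/eqP; congr (_ * _)%E.
    + apply: eq_integral => y _; rewrite /a /F exprMn sqr_sqrtr ?divr_ge0//.
      by congr (_%:E); ring.
    + by apply: eq_integral => y _; rewrite /b sqr_sqrtr// mulr_ge0.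
have mI := meas_lint mF F0.
have mL : measurable_fun [set: R] (fun x => (\int[mu]_y (k x y * w y)%:E)%E).
  apply: (meas_lint (F := fun x y => k x y * w y)); last by move=> x y; rewrite mulr_ge0.
  by meas.
apply: (@le_trans _ _ (\int[mu]_x (W * \int[mu]_y (F x y)%:E))%E).
  apply: ge0_le_integral => //.
  - by move=> x _; apply: mule_ge0; apply: lint_ge0 => y; rewrite mulr_ge0.
  - exact: emeasurable_funM.
  - exact: emeasurable_funM.
rewrite ge0_integralZl//; last by move=> x _; exact: lint_ge0.
rewrite muleC lee_wpmul2r// lint_fubini//.
apply: (@le_trans _ _ (\int[mu]_y (B * (omega y * w y))%:E)%E).
  apply: ge0_le_integral => //.
  - by move=> y _; exact: lint_ge0.
  - apply: (meas_lint (F := fun y x => F x y)) => //.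
    by apply: (measurableT_comp mF (g := fun z : R * R => (z.2, z.1))); exact: measurable_swap.
  - by meas.
  move=> y _; have := mky y => mky'.
  apply: (@le_trans _ _ ((w y / omega y)%:E * (B * omega y ^+ 2)%:E)%E); last first.
    by rewrite -EFinM lee_fin le_eqVlt; apply/orP; left; apply/eqP; field; rewrite gt_eqF.
  have -> : (\int[mu]_x (F x y)%:E = \int[mu]_x ((w y / omega y) * k x y ^+ 2)%:E)%E.
    by apply: eq_integral => x _; rewrite /F; congr (_%:E); ring.
  rewrite lintZ ?divr_ge0//; [|by meas|by move=> x; exact: sqr_ge0].
  by rewrite lee_wpmul2l// lee_fin divr_ge0.
by rewrite lintZ//; [meas | move=> y; rewrite mulr_ge0].
Qed.

Lemma normc_cintegral_sqr_le g : cmeasurable g ->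
  ((normc (cintegral g) ^+ 2)%:E <=
   (\int[mu]_x (normc (g x))%:E) * (\int[mu]_x (normc (g x))%:E))%E.
Proof.
move=> mg; have I0 : (0 <= \int[mu]_x (normc (g x))%:E)%E by apply: lint_ge0; nneg.
have [fin|inf] := ltP (\int[mu]_x (normc (g x))%:E)%E +oo%E.
  rewrite expr2 EFinM; have gi : cintegrable g by apply/cintegrableP.
  by apply: lee_pmul; rewrite ?lee_fin ?normc_ge0//; exact: normc_cintegral_le.
by move: inf; rewrite leye_eq => /eqP ->; rewrite mulyy leey.
Qed.

Lemma L2sqr_kernel_le (k : R -> R -> R) (K : R -> R -> R[i]) f (omega : R -> R) (B : R) :
  cmeas (fun z : R * R => K z.1 z.2) ->
  measurable_fun setT (fun z : R * R => k z.1 z.2) ->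
  (forall x y, normc (K x y) <= k x y) ->
  cmeasurable f -> measurable_fun setT omega -> (forall y, 0 < omega y) -> 0 <= B ->
  (forall y, \int[mu]_x (k x y ^+ 2)%:E <= (B * omega y ^+ 2)%:E)%E ->
  (\int[mu]_y (omega y * normc (f y))%:E < +oo)%E ->
  L2 (fun x => cintegral (fun y => K x y * f y)).
Proof.
move=> mK mk Kk mf mo o0 B0 kB Wfin.
have k0 x y : 0 <= k x y by apply: le_trans (Kk x y); exact: normc_ge0.
have mKf : cmeas (fun z : R * R => K z.1 z.2 * f z.2) by cmeas.
have mKx x : cmeasurable (fun y => K x y * f y).
  by apply: (cmeas_comp (e := fun y : R => (x, y)) mKf); exact: measurable_pair1.
have mkx x : measurable_fun [set: R] (k x).
  by apply: (measurableT_comp mk (g := fun y : R => (x, y))); exact: measurable_pair1.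
apply/L2P; split; first by apply: (cmeas_cintegral (K := fun x y => K x y * f y)).
have W0 : (0 <= \int[mu]_y (omega y * normc (f y))%:E)%E.
  by apply: lint_ge0 => y; rewrite mulr_ge0 ?normc_ge0// ltW.
have mnf : measurable_fun [set: R] (fun y => normc (f y)) by cmeas.
apply: le_lt_trans (_ : B%:E * (\int[mu]_y (omega y * normc (f y))%:E) *
   (\int[mu]_y (omega y * normc (f y))%:E) < +oo)%E; last first.
  have fin : (\int[mu]_y (omega y * normc (f y))%:E)%E \is a fin_num by rewrite ge0_fin_numE.
  by rewrite -(fineK fin) -!EFinM ltry.
apply: le_trans (lint_schur mk k0 mnf _ mo o0 B0 kB); last by nneg.
have mL : measurable_fun [set: R] (fun x => (\int[mu]_y (k x y * normc (f y))%:E)%E).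
  apply: (meas_lint (F := fun x y => k x y * normc (f y))); last by move=> x y; rewrite mulr_ge0 ?normc_ge0.
  by cmeas.
have mC : cmeasurable (fun x => cintegral (fun y => K x y * f y)).
  by apply: (cmeas_cintegral (K := fun x y => K x y * f y)).
apply: ge0_le_integral => //.
- by move=> x _; rewrite lee_fin sqr_ge0.
- exact: (meas_EFin (meas_pow 2 (meas_normc mC))).
- exact: emeasurable_funM.
move=> x _; apply: le_trans (normc_cintegral_sqr_le (mKx x)) _.
have := mkx x => mkx'; have := mKx x => mKx'.
have le : (\int[mu]_y (normc (K x y * f y))%:E <= \int[mu]_y (k x y * normc (f y))%:E)%E.
  apply: le_lint; [by cmeas | by cmeas | nneg |] => y.
  by rewrite normcM ler_wpM2r ?normc_ge0.
by apply: lee_pmul => //; apply: lint_ge0; nneg.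
Qed.

Lemma cmeas_rker_kernel : cmeas (fun z : R * R => (rker s (z.1 - z.2))%:C).
Proof. by rewrite /rker; cmeas. Qed.

Lemma cmeas_neg_frac_lap f : cmeasurable f -> cmeasurable (neg_frac_lap s f).
Proof.
move=> mf; apply: (cmeas_cintegral (K := fun x y => (rker s (x - y))%:C * f y)).
by have := cmeas_rker_kernel => h; cmeas.
Qed.

Lemma riesz_weighted_lty f : cintegrable f ->
  (\int[mu]_x \int[mu]_y (normc ((rker s (x - y) / (1 + `|x|))%:C * f y))%:E < +oo)%E.
Proof.
move=> fi; have mf := cintegrable_meas fi; have h0 := s0; have h1 := s1.
have [C [C0 hC]] := riesz_decay_bound; have mr := meas_rker s.
have rr z : 0 <= rker s z by exact: rker_ge0.
have r0 x y : 0 <= rker s (x - y) / (1 + `|x|) by rewrite divr_ge0// addr_ge0.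
have e x y : normc ((rker s (x - y) / (1 + `|x|))%:C * f y) =
    rker s (x - y) / (1 + `|x|) * normc (f y) by rewrite normcM normc_real ger0_norm.
under eq_integral do under eq_integral do rewrite e.
rewrite (lint_fubini (F := fun x y => rker s (x - y) / (1 + `|x|) * normc (f y))); last 2 first.
- by rewrite /rker; cmeas.
- by move=> x y; rewrite mulr_ge0 ?normc_ge0.
apply: (@le_lt_trans _ _ (\int[mu]_y (C * normc (f y))%:E)%E); last first.
  by apply: lintZ_lty; [done | cmeas | nneg | exact: cintegrable_lty].
apply: ge0_le_integral => //.
- by move=> y _; apply: lint_ge0 => x; rewrite mulr_ge0 ?normc_ge0.
- apply: (meas_lint (F := fun y x => rker s (x - y) / (1 + `|x|) * normc (f y))).
    by rewrite /rker; cmeas.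
  by move=> x y; rewrite mulr_ge0 ?normc_ge0.
- by cmeas.
move=> y _; under eq_integral do rewrite mulrC.
rewrite lintZ ?normc_ge0//; last by rewrite /rker; meas.
by rewrite EFinM muleC lee_wpmul2r// lee_fin normc_ge0.
Qed.

Lemma riesz_ae_cintegrable f : cintegrable f ->
  {ae mu, forall x, cintegrable (fun y => (rker s (x - y))%:C * f y)}.
Proof.
move=> fi; have mf := cintegrable_meas fi.
have := lint_normc_fin _ (riesz_weighted_lty fi) => h.
apply: ae_imp (h _) _; first by rewrite /rker; cmeas.
move=> x; move/(cintegrableZ (1 + `|x|)%:C); congr cintegrable; apply/funext => y.
rewrite mulrA -realCM; congr (_%:C * _).
by rewrite mulrC divfK// gt_eqF// ltr_pwDl.
Qed.

Lemma riesz_decay_cintegrable f : cintegrable f ->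
  cintegrable (fun x => ((1 + `|x|)^-1)%:C * neg_frac_lap s f x).
Proof.
move=> fi; have mf := cintegrable_meas fi.
have mK : cmeas (fun z : R * R => (rker s (z.1 - z.2) / (1 + `|z.1|))%:C * f z.2).
  by rewrite /rker; cmeas.
have h := cintegrable_cintegral mK (riesz_weighted_lty fi).
have mN := cmeas_neg_frac_lap mf.
apply: ae_eq_cintegrable h.
- exact: (cmeas_cintegral (K := fun x y => (rker s (x - y) / (1 + `|x|))%:C * f y)).
- by cmeas.
apply: ae_imp (riesz_ae_cintegrable fi) _ => x xi.
rewrite -cintegralZl//; apply: eq_cintegral => y.
by rewrite mulrA -realCM; congr (_%:C * _); rewrite mulrC.
Qed.

Lemma L2loc_neg_frac_lap f (M : R) : 0 <= M -> cintegrable f ->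
  L2 (fun x => if `|x| <= M then neg_frac_lap s f x else 0).
Proof.
move=> M0 fi; have mf := cintegrable_meas fi; have h0 := s0; have h1 := s1.
have [C [C0 hC]] := riesz_local_bound M0.
have rr z : 0 <= rker s z by exact: rker_ge0.
have -> : (fun x => if `|x| <= M then neg_frac_lap s f x else 0) =
    (fun x => cintegral (fun y => (if `|x| <= M then (rker s (x - y))%:C else 0) * f y)).
  apply/funext => x; case: ifP => xM //.
  by rewrite -[LHS](cintegral0 (R := R)); apply: eq_cintegral => y; rewrite mul0r.
apply: (L2sqr_kernel_le (k := fun x y => if `|x| <= M then rker s (x - y) else 0)
  (omega := fun=> 1) (B := C)) => //.
- by rewrite /rker; cmeas.
- by rewrite /rker; meas.
- by move=> x y; case: ifP => _; rewrite ?normc0// normc_real ger0_norm.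
- move=> y; rewrite expr1n mulr1; apply: le_trans (hC y).
  rewrite le_eqVlt; apply/orP; left; apply/eqP; apply: eq_integral => x _.
  by case: ifP => // _; rewrite expr0n.
- by under eq_integral do rewrite mul1r; exact: cintegrable_lty.
Qed.

(** The squared distance of two translates of the kernel grows like |y|^(2s-1) in
    their separation y, so the weight <y>^(s-1/2) makes the weighted Cauchy-Schwarz
    estimate L2sqr_kernel_le applicable. *)
Lemma L2_neg_frac_lap_sub f : cintegrable f ->
  (\int[mu]_y (japanese y `^ (s - 2^-1) * normc (f y))%:E < +oo)%E ->
  L2 (fun x => neg_frac_lap s f x - (rker s x)%:C * cintegral f).
Proof.
move=> fi fw; have mf := cintegrable_meas fi; have h0 := s0; have h1 := s1; have h2 := s2.
have [C [C0 hC]] := riesz_difference_bound.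
have mr := meas_rker s; have mN := cmeas_neg_frac_lap mf.
have mj : measurable_fun [set: R] (fun y => japanese y `^ (s - 2^-1)) by rewrite /japanese; meas.
have j1 (y : R) : 0 < japanese y by rewrite sqrtr_gt0 ltr_pwDl ?sqr_ge0.
have yj (y : R) : `|y| <= japanese y.
  by rewrite -sqrtr_sqr; apply: ler_wsqrtr; rewrite lerDr.
have h : L2 (fun x => cintegral (fun y => (rker s (x - y) - rker s x)%:C * f y)).
  apply: (L2sqr_kernel_le (k := fun x y => `|rker s (x - y) - rker s x|)
    (omega := fun y => japanese y `^ (s - 2^-1)) (B := C)) => //.
  - by rewrite /rker; cmeas.
  - by rewrite /rker; meas.
  - by move=> x y; rewrite normc_real.
  - by move=> y; rewrite powR_gt0.
  move=> y; under eq_integral do rewrite real_normK ?num_real//.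
  apply: le_trans (hC y) _; rewrite lee_fin ler_wpM2l// powR_sqr.
  have -> : 2 * (s - 2^-1) = 2 * s - 1 by field.
  by apply: ge0_ler_powR; rewrite ?nnegrE ?(ltW h2) ?(ltW (j1 _)).
apply: L2_ae_eq h; first by cmeas.
apply: ae_imp (riesz_ae_cintegrable fi) _ => x xi.
transitivity (cintegral (fun y => (rker s (x - y))%:C * f y - (rker s x)%:C * f y)).
  by apply: eq_cintegral => y; rewrite rmorphB mulrBl.
by rewrite cintegralB// ?cintegralZl//; exact: cintegrableZ.
Qed.

(** Fubini moves the Riesz kernel onto the inverse transform of G, where
    riesz_inv_fourier evaluates it; the decay of that transform makes the double
    integral absolutely convergent. *)
Lemma riesz_pairing f G (C : R) : cintegrable f -> cintegrable G ->
  cintegrable (fun p => (`|p| `^ (- s))%:C * G p) ->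
  (forall x, normc (inv_fourier G x) <= C / (1 + `|x|)) ->
  cintegrable (fun x => neg_frac_lap s f x * inv_fourier G x) /\
  cintegral (fun x => neg_frac_lap s f x * inv_fourier G x) =
  cintegral (fun y => f y * inv_fourier (fun p => (`|p| `^ (- s))%:C * G p) y).
Proof.
move=> fi Gi pGi gC; have mf := cintegrable_meas fi; have h0 := s0; have h1 := s1.
have mg := cmeas_inv_fourier (cintegrable_meas Gi).
have C0 : 0 <= C by have := le_trans (normc_ge0 _) (gC 0); rewrite normr0 addr0 divr1.
have rr z : 0 <= rker s z by exact: rker_ge0.
have mr := meas_rker s; have mN := cmeas_neg_frac_lap mf.
have [D [D0 hD]] := riesz_decay_bound.
have fin y : (\int[mu]_x (rker s (x - y) * normc (inv_fourier G x))%:E < +oo)%E.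
  move: (inv_fourier G) mg gC => g mg gC.
  apply: (@le_lt_trans _ _ (\int[mu]_x (C * (rker s (x - y) / (1 + `|x|)))%:E)%E).
    apply: le_lint; [by rewrite /rker; cmeas | by rewrite /rker; meas | nneg |] => x.
    by rewrite mulrCA ler_wpM2l.
  apply: lintZ_lty => //; first by rewrite /rker; meas.
    by move=> x; rewrite divr_ge0// addr_ge0.
  by apply: le_lt_trans (hD y) _; rewrite ltry.
have E y : cintegral (fun x => (rker s (x - y))%:C * inv_fourier G x) =
    inv_fourier (fun p => (`|p| `^ (- s))%:C * G p) y by exact: riesz_inv_fourier.
have wl := riesz_weighted_lty fi.
have di := riesz_decay_cintegrable fi.
have yi y : cintegrable (fun x => (rker s (x - y))%:C * inv_fourier G x).
  apply/cintegrableP; split; first by rewrite /rker; cmeas.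
  by under eq_integral do rewrite normcM normc_real ger0_norm//; exact: fin.
move: (inv_fourier G) mg gC E fin yi => g mg gC E fin yi.
pose K x y := (rker s (x - y))%:C * f y * g x.
have mK : cmeas (fun z : R * R => K z.1 z.2) by rewrite /K /rker; cmeas.
have Kfin : (\int[mu]_x \int[mu]_y (normc (K x y))%:E < +oo)%E.
  have nK x y : normc (K x y) <= C * normc ((rker s (x - y) / (1 + `|x|))%:C * f y).
    have r0 : 0 <= rker s (x - y) / (1 + `|x|) by rewrite divr_ge0// addr_ge0.
    rewrite /K !normcM !normc_real (ger0_norm (rr _)) (ger0_norm r0).
    have -> : C * (rker s (x - y) / (1 + `|x|) * normc (f y)) =
        rker s (x - y) * normc (f y) * (C / (1 + `|x|)) by ring.
    by apply: ler_wpM2l => //; rewrite mulr_ge0 ?normc_ge0.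
  have mI : measurable_fun [set: R] (fun x => \int[mu]_y (normc ((rker s (x - y) / (1 + `|x|))%:C * f y))%:E)%E.
    by apply: (meas_lint (F := fun x y => normc ((rker s (x - y) / (1 + `|x|))%:C * f y))); [rewrite /rker; cmeas | nneg].
  apply: (@le_lt_trans _ _ (\int[mu]_x (C%:E * \int[mu]_y (normc ((rker s (x - y) / (1 + `|x|))%:C * f y))%:E))%E).
    apply: ge0_le_integral => //.
    - by move=> x _; apply: lint_ge0; nneg.
    - by apply: (meas_lint (F := fun x y => normc (K x y))); [cmeas | nneg].
    - exact: emeasurable_funM.
    move=> x _; rewrite -lintZ//; [|by rewrite /rker; cmeas|nneg].
    by apply: le_lint; [by rewrite /K /rker; cmeas | by rewrite /rker; cmeas | nneg | move=> y; exact: nK].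
  rewrite ge0_integralZl//; last by move=> x _; apply: lint_ge0; nneg.
  by apply: lte_mul_pinfty; rewrite ?lee_fin.
have eK : {ae mu, forall x, cintegral (K x) = neg_frac_lap s f x * g x}.
  by apply: ae_imp (riesz_ae_cintegrable fi) _ => x xi; rewrite /K cintegralZr.
have mcK : cmeasurable (fun x => cintegral (K x)) by exact: (cmeas_cintegral (K := K)).
have mNg : cmeasurable (fun x => neg_frac_lap s f x * g x) by cmeas.
split; first by apply: ae_eq_cintegrable (cintegrable_cintegral mK Kfin).
rewrite -(ae_eq_cintegral mcK mNg eK) (cfubini mK Kfin).
apply: eq_cintegral => y; rewrite -E -cintegralZl//.
by apply: eq_cintegral => x; rewrite /K mulrAC mulrC mulrA.
Qed.

End RieszEstimates.

(** * Test functions *)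

Section CompactSupport.
Context {R : realType}.
Local Notation mu := (@lebesgue_measure R).

Lemma compact_support_lint (M : R) (r : R -> R) : continuous r ->
  (forall x, M < `|x| -> r x = 0) ->
  exists B : R, 0 <= B /\ (\int[mu]_x `|r x|%:E <= B%:E)%E.
Proof.
move=> cr r0; pose A : set R := `[- M, M]%classic.
have ri : mu.-integrable A (EFin \o r).
  apply: continuous_compact_integrable; first exact: segment_compact.
  by apply: continuous_subspaceT.
have I0 : (0 <= \int[mu]_(x in A) `|(r x)%:E|)%E by apply: integral_ge0.
have /integrableP[_ fin] := ri.
exists (fine (\int[mu]_(x in A) `|(r x)%:E|)%E); split; first exact: fine_ge0.
rewrite fineK ?ge0_fin_numE// [leRHS]integral_mkcond le_eqVlt; apply/orP; left; apply/eqP.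
apply: eq_integral => x _; rewrite patchE; case: ifPn => // xA.
rewrite r0 ?normr0// ltNge; apply: contraNN xA => xM.
by rewrite inE /A /= in_itv /= -ler_norml.
Qed.

Lemma derive1_out (M : R) (r : R -> R) : (forall x, M < `|x| -> r x = 0) ->
  (forall x, derivable r x 1) -> forall x, M < `|x| -> derive1 r x = 0.
Proof.
move=> r0 dr x xM; have near : \forall y \near x, r y = (fun=> 0) y.
  have : \forall y \near x, M < `|y|.
    exact: (@cvgr_gt R R (nbhs x) _ (fun y => `|y|) _ (@norm_continuous R R x) M xM).
  by apply: filterS => y; exact: r0.
by rewrite derive1E (near_eq_derive _ near) derive_cst.
Qed.

Lemma cvg0_out (M : R) (r : R -> R) : (forall x, M < `|x| -> r x = 0) ->
  r x @[x --> +oo] --> 0 /\ r x @[x --> -oo] --> 0.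
Proof.
move=> r0; split; apply: cvg_near_cst; near=> x; rewrite r0//.
- have xM : `|M| < x by near: x; exact: nbhs_pinfty_gt.
  by apply: le_lt_trans (ler_norm M) _; apply: lt_le_trans xM _; exact: ler_norm.
- have xM : x < - `|M| by near: x; exact: nbhs_ninfty_lt.
  have M0 := normr_ge0 M; have Mle := ler_norm M.
  by rewrite ltr0_norm; lra.
Unshelve. all: end_near. Qed.

Section Decay.
Variables (M : R) (r : R -> R).
Hypotheses (rs : smooth r) (r0 : forall x, M < `|x| -> r x = 0).

Let r1 := derive1 r.
Let r2 := derive1 r1.

Let dr (x : R) : is_derive x 1 r (r1 x).
Proof. by rewrite /r1 derive1E; apply: derivableP; exact: (@rs 0%N). Qed.

Let dr1 (x : R) : is_derive x 1 r1 (r2 x).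
Proof. by rewrite /r2 derive1E; apply: derivableP; exact: (@rs 1%N). Qed.

Let dr2 (x : R) : is_derive x 1 r2 (derive1 r2 x).
Proof. by rewrite [derive1 r2 x]derive1E; apply: derivableP; exact: (@rs 2%N). Qed.

Let r10 x : M < `|x| -> r1 x = 0.
Proof. by apply: derive1_out => // y; exact: (@rs 0%N). Qed.

Let r20 x : M < `|x| -> r2 x = 0.
Proof. by apply: derive1_out => // y; exact: (@rs 1%N). Qed.

Lemma smooth_continuous : continuous r.
Proof. by move=> x; apply: is_derive_continuous (dr x). Qed.

Let cr2 : continuous r2. Proof. by move=> x; apply: is_derive_continuous (dr2 x). Qed.

(** Two integrations by parts, performed at once on a primitive of
    (r'' + p^2 r) e with e a trigonometric function of frequency p. *)
Lemma trig_transform_decay (e e' : R -> R -> R) :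
  (forall p x : R, is_derive x 1 (e p) (p * e' p x)) ->
  (forall p x : R, is_derive x 1 (e' p) (- (p * e p x))) ->
  (forall p x, `|e p x| <= 1) ->
  exists C : R, 0 <= C /\ forall p, `|(\int[mu]_x (r x * e p x))%R| <= C / (1 + p ^+ 2).
Proof.
move=> de de' e1.
have [B [B0 hB]] := compact_support_lint smooth_continuous r0.
have [B2 [B20 hB2]] := compact_support_lint cr2 r20.
have ce p : continuous (e p) by move=> x; apply: is_derive_continuous (de p x).
have mce p : measurable_fun [set: R] (e p) by exact: continuous_measurable_fun.
have mr : measurable_fun [set: R] r by apply: continuous_measurable_fun; exact: smooth_continuous.
have mr2 : measurable_fun [set: R] r2 by apply: continuous_measurable_fun.
have bnd p (h : R -> R) D : measurable_fun setT h -> (\int[mu]_x `|h x|%:E <= D%:E)%E ->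
    mu.-integrable setT (EFin \o (fun x => h x * e p x)) /\
    `|(\int[mu]_x (h x * e p x))%R| <= D.
  move=> mh hD; have mep := mce p.
  have le : (\int[mu]_x `|(h x * e p x)%R|%:E <= D%:E)%E.
    apply: le_trans hD; apply: le_lint; [by meas | by meas | nneg |] => x.
    by rewrite normrM ler_piMr.
  have hi : mu.-integrable setT (EFin \o (fun x => h x * e p x)).
    apply/integrableP; split; first by apply: meas_EFin; meas.
    by apply: le_lt_trans le _; rewrite ltry.
  split=> //; rewrite -lee_fin; apply: le_trans le.
  rewrite /Rintegral -abse_EFin fineK; last exact: integrable_fin_num.
  by apply: le_abse_integral => //; apply: meas_EFin; meas.
exists (B + B2); split; first by rewrite addr_ge0.
move=> p; have [i0 b0] := bnd p r B mr hB; have [i2 b2] := bnd p r2 B2 mr2 hB2.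
pose F x := r1 x * e p x - r x * (p * e' p x).
have dF (x : R) : is_derive x 1 F (r2 x * e p x + p ^+ 2 * (r x * e p x)).
  have h1 := dr1 x; have h := dr x; have h3 := de p x; have h4 := de' p x.
  by apply: is_derive_eq; rewrite /GRing.scale/=; ring.
have F0 x : M < `|x| -> F x = 0.
  by move=> xM; rewrite /F r0// r10// !mul0r subrr.
have [Fp Fm] := cvg0_out F0.
have pi0 : mu.-integrable setT (EFin \o (fun x => p ^+ 2 * (r x * e p x))).
  rewrite (_ : _ \o _ = (fun x => (p ^+ 2)%:E * (r x * e p x)%:E)%E) //.
  exact: integrableZl.
have := integral_derivative0 dF _ _ Fp Fm.
rewrite (RintegralD measurableT i2 pi0) (RintegralZl _ measurableT i0) => E.
have {}E : (\int[mu]_x (r2 x * e p x))%R + p ^+ 2 * (\int[mu]_x (r x * e p x))%R = 0.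
  apply: E.
  - move=> x; apply: cvgD; first by apply: cvgM; [exact: cr2 | exact: ce].
    apply: cvgMr; apply: cvgM; [exact: smooth_continuous | exact: ce].
  - exact: (integrableD measurableT i2 pi0).
rewrite ler_pdivlMr ?ltr_pwDl ?sqr_ge0// mulrDr mulr1; apply: lerD => //.
rewrite -[X in _ * X](ger0_norm (sqr_ge0 p)) -normrM mulrC.
have -> : p ^+ 2 * (\int[mu]_x (r x * e p x))%R = - (\int[mu]_x (r2 x * e p x))%R.
  by apply/eqP; rewrite -addr_eq0 addrC E.
by rewrite normrN.
Qed.

Lemma cos_transform_decay : exists C : R, 0 <= C /\
  forall p, `|(\int[mu]_x (r x * cos (p * x)))%R| <= C / (1 + p ^+ 2).
Proof.
apply: (trig_transform_decay (e := fun p x => cos (p * x)) (e' := fun p x => - sin (p * x))).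
- by move=> p x; apply: is_derive_eq; rewrite /GRing.scale/=; ring.
- by move=> p x; apply: is_derive_eq; rewrite /GRing.scale/=; ring.
- by move=> p x; rewrite ler_norml cos_geN1 cos_le1.
Qed.

Lemma sin_transform_decay : exists C : R, 0 <= C /\
  forall p, `|(\int[mu]_x (r x * sin (p * x)))%R| <= C / (1 + p ^+ 2).
Proof.
apply: (trig_transform_decay (e := fun p x => sin (p * x)) (e' := fun p x => cos (p * x))).
- by move=> p x; apply: is_derive_eq; rewrite /GRing.scale/=; ring.
- by move=> p x; apply: is_derive_eq; rewrite /GRing.scale/=; ring.
- by move=> p x; rewrite ler_norml sin_geN1 sin_le1.
Qed.

End Decay.
End CompactSupport.

Section TestFunctions.
Context {R : realType}.
Local Notation mu := (@lebesgue_measure R).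
Local Notation Re := complex.Re.
Local Notation Im := complex.Im.
Variable eta : R -> R[i].
Hypothesis eta_test : test_function eta.

Lemma test_continuous : continuous (fun x => Re (eta x)) /\ continuous (fun x => Im (eta x)).
Proof.
have [sr si _] := eta_test.
by split; [exact: smooth_continuous sr | exact: smooth_continuous si].
Qed.

Lemma test_cmeas : cmeasurable eta.
Proof. by have [cr ci] := test_continuous; split; exact: continuous_measurable_fun. Qed.

Lemma test_cintegrable : cintegrable eta.
Proof.
have [sr si [M e0]] := eta_test; have [cr ci] := test_continuous.
have h (r : R -> R) : continuous r -> (forall x, M < `|x| -> r x = 0) ->
    mu.-integrable setT (fun x => (r x)%:E).
  move=> c r0; have [B [_ hB]] := compact_support_lint c r0.
  apply/integrableP; split; first by apply: meas_EFin; exact: continuous_measurable_fun.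
  by apply: le_lt_trans hB _; rewrite ltry.
by split; apply: h => // x /e0 ->.
Qed.

Lemma test_bounded : exists K : R, forall x, normc (eta x) <= K.
Proof.
have [sr si [M e0]] := eta_test; have [cr ci] := test_continuous.
have h (r : R -> R) : continuous r -> (forall x, M < `|x| -> r x = 0) ->
    exists K : R, forall x, `|r x| <= K.
  move=> c r0; have MM : - `|M| <= `|M| by rewrite -subr_ge0 opprK addr_ge0.
  have [|z zE zmax] := @EVT_max R (fun x => `|r x|) (- `|M|) `|M| MM.
    by apply: continuous_subspaceT => x; apply: continuous_comp; [exact: c | exact: norm_continuous].
  exists `|r z| => x; have [xM|xM] := leP `|x| `|M|.
    by apply: zmax; rewrite in_itv /= -ler_norml.
  by rewrite r0 ?normr0//; exact: le_lt_trans (ler_norm M) xM.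
have [K1 h1] := h _ cr ltac:(by move=> x /e0 ->).
have [K2 h2] := h _ ci ltac:(by move=> x /e0 ->).
exists (K1 + K2) => x; apply: le_trans (normc_le_ReIm _) _; exact: lerD.
Qed.

Lemma test_fourier_decay : exists C : R, 0 <= C /\
  forall p, normc (fourier eta p) <= C / (1 + p ^+ 2).
Proof.
have [sr si [M e0]] := eta_test.
have er0 x : M < `|x| -> Re (eta x) = 0 by move=> /e0 ->.
have ei0 x : M < `|x| -> Im (eta x) = 0 by move=> /e0 ->.
have [C1 [C10 h1]] := cos_transform_decay sr er0.
have [C2 [C20 h2]] := sin_transform_decay sr er0.
have [C3 [C30 h3]] := cos_transform_decay si ei0.
have [C4 [C40 h4]] := sin_transform_decay si ei0.
have c0 := ltW (@c0_gt0 R); set c := (Num.sqrt _)^-1 in c0.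
exists (c * (C1 + C2 + C3 + C4)); split.
  by rewrite mulr_ge0// !addr_ge0.
have [ri ii] := test_cintegrable; have me := test_cmeas.
have int (r e : R -> R) : mu.-integrable setT (fun x => (r x)%:E) -> measurable_fun setT e ->
    (forall x, `|e x| <= 1) -> mu.-integrable setT (EFin \o (fun x => r x * e x)).
  move=> h mE e1; apply: (integrable_dominated (g := fun x => `|r x|)).
  - have /integrableP[/measurable_EFinP mr _] := h.
    by meas.
  - exact: (integrable_abse h).
  - by move=> x; rewrite normrM ler_piMr.
move=> p; have mc : measurable_fun [set: R] (fun x => cos (p * x)) by meas.
have ms : measurable_fun [set: R] (fun x => sin (p * x)) by meas.
have cb x : `|cos (p * x)| <= 1 by rewrite ler_norml cos_geN1 cos_le1.
have sb x : `|sin (p * x)| <= 1 by rewrite ler_norml sin_geN1 sin_le1.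
have i1 := int _ _ ri mc cb; have i2 := int _ _ ri ms sb.
have i3 := int _ _ ii mc cb; have i4 := int _ _ ii ms sb.
rewrite /fourier normcM normc_real ger0_norm// -mulrA ler_wpM2l//.
apply: le_trans (normc_le_ReIm _) _; rewrite /cintegral /=.
rewrite (_ : (\int[mu]_x Re (eta x * cis (- (p * x))))%R =
  (\int[mu]_x (Re (eta x) * cos (p * x)))%R + (\int[mu]_x (Im (eta x) * sin (p * x)))%R); last first.
  rewrite -RintegralD//; apply: eq_Rintegral => x _.
  by rewrite ReM /= cosN sinN; ring.
rewrite (_ : (\int[mu]_x Im (eta x * cis (- (p * x))))%R =
  (\int[mu]_x (Im (eta x) * cos (p * x)))%R - (\int[mu]_x (Re (eta x) * sin (p * x)))%R); last first.
  rewrite -RintegralB//; apply: eq_Rintegral => x _.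
  by rewrite ImM /= cosN sinN; ring.
have := ler_normD (\int[mu]_x (Re (eta x) * cos (p * x)))%R (\int[mu]_x (Im (eta x) * sin (p * x)))%R.
have := ler_normB (\int[mu]_x (Im (eta x) * cos (p * x)))%R (\int[mu]_x (Re (eta x) * sin (p * x)))%R.
by rewrite !mulrDl; move: (h1 p) (h2 p) (h3 p) (h4 p); lra.
Qed.

Lemma powR_decay_cintegrable (r : R) : 0 <= r -> r < 1 ->
  cintegrable (fun p => (`|p| `^ r)%:C * fourier eta p).
Proof.
move=> r0 r1; have mF := cmeas_fourier test_cmeas.
have [C [C0 hC]] := test_fourier_decay.
move: (fourier eta) mF hC => F mF hC.
pose t := two_powers 1 (1 - 1) (- (1 - r) - 1) (1 : R).
have mt : measurable_fun [set: R] t by exact: meas_two_powers.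
have t0 z : 0 <= t z by exact: two_powers_ge0.
apply: (cintegrable_le (g := fun p => C * t p)).
- by cmeas.
- by meas.
- move=> p; rewrite normcM normc_real ger0_norm ?powR_ge0//.
  apply: le_trans (ler_wpM2l (powR_ge0 _ _) (hC p)) _.
  rewrite mulrCA ler_wpM2l// /t /two_powers subrr powRr0 mul1r.
  have q0 : 0 < 1 + p ^+ 2 by rewrite ltr_pwDl ?sqr_ge0.
  case: ifP => p1.
    rewrite ler_pdivrMr// mul1r; apply: (@le_trans _ _ 1); last by rewrite lerDl sqr_ge0.
    rewrite -[leRHS](_ : 1 `^ r = 1); last by rewrite powR1.
    by apply: ge0_ler_powR; rewrite ?nnegrE.
  have np : 0 < `|p| by apply: lt_trans ltr01 _; rewrite ltNge p1.
  have -> : - (1 - r) - 1 = r - 1 - 1 by ring.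
  rewrite !powR_pred// -mulrA ler_wpM2l ?powR_ge0// -invfM lef_pV2 ?posrE ?mulr_gt0//.
  by rewrite -expr2 real_normK ?num_real// lerDr.
- apply: lintZ_lty => //.
  by rewrite /t lint_two_powers ?ltry// subr_gt0.
Qed.

Lemma test_fourier_cintegrable : cintegrable (fourier eta).
Proof.
have := powR_decay_cintegrable (lexx 0) ltr01; congr cintegrable; apply/funext => p.
by rewrite powRr0 mul1r.
Qed.

Lemma test_inversion x : inv_fourier (fourier eta) x = eta x.
Proof.
have [K hK] := test_bounded; have me := test_cmeas; have ei := test_cintegrable.
have [cr ci] := test_continuous; have Fi := test_fourier_cintegrable.
have t0 n : 0 < n.+1%:R^-1 :> R by rewrite invr_gt0.
have c1 : ccvg (fun n => cintegral (fun y => (heat n.+1%:R^-1 (x - y))%:C * eta y)) (eta x).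
  apply: heat_average_cvg hK _ => //.
  have l1 : (`|Re (eta y) - Re (eta x)| + `|Im (eta y) - Im (eta x)|) @[y --> x] --> (0 : R).
    rewrite -[X in _ --> X](addr0 0); apply: cvgD; apply/norm_cvg0P/subr_cvg0.
      exact: cr.
    exact: ci.
  apply: (squeeze_cvgr _ (cvg_cst 0) l1); apply: nearW => y.
  rewrite normc_ge0 andTb; apply: le_trans (normc_le_ReIm _) _.
  by rewrite ReD ImD ReN ImN.
have c2 : ccvg (fun n => inv_fourier (fun p => (expR (- (n.+1%:R^-1 * p ^+ 2)))%:C * fourier eta p) x)
    (inv_fourier (fourier eta) x).
  move: (fourier eta) Fi => F Fi; have mF := cintegrable_meas Fi.
  apply: ccvgMl; apply: (cdominated_cvg (g := fun p => normc (F p)) _ _ _ _ _ _ _).2.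
  - by move=> n; cmeas.
  - by cmeas.
  - by cmeas.
  - by nneg.
  - exact: cintegrable_lty.
  - apply: ae_all => p; apply: (ccvg_squeeze (b := fun n => (1 - expR (- (n.+1%:R^-1 * p ^+ 2))) * normc (F p))).
      move=> n; rewrite -mulrBl normcM normc_cis mulr1 -[X in _ - X]mul1r -mulrBl normcM.
      rewrite ler_wpM2r ?normc_ge0//.
      rewrite (_ : _%:C - 1 = (expR (- (n.+1%:R^-1 * p ^+ 2)) - 1)%:C); last by rewrite rmorphB.
      rewrite normc_real distrC ger0_norm// subr_ge0.
      exact: gauss_le1.
    rewrite -[X in _ --> X](mul0r (normc (F p))); apply: cvgMl.
    by rewrite -[X in _ --> X](subrr 1); apply: cvgB; [exact: cvg_cst | exact: gauss_cvg1].
  - apply: ae_all => p n; rewrite !normcM normc_cis mulr1 normc_real ger0_norm ?expR_ge0//.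
    by rewrite ler_piMl ?normc_ge0// gauss_le1.
apply: ccvg_eq_lim c2 c1 _ => n; exact: inv_fourier_gauss_fourier.
Qed.

End TestFunctions.

Section FracLapDecay.
Context {R : realType}.
Local Notation mu := (@lebesgue_measure R).
Local Notation c0 := ((Num.sqrt (2 * pi))^-1).

(** Subordination: |p|^s is a superposition of 1 - e^(-tp^2), so away from the
    support of eta the fractional Laplacian is minus a superposition of heat
    averages, whose kernel adds up to a multiple of |x-y|^(-1-s). *)
Lemma frac_lap_decay (s : R) (eta : R -> R[i]) : 0 < s -> s < 1 -> test_function eta ->
  exists C : R, 0 <= C /\ forall x, normc (frac_lap s eta x) <= C / (1 + `|x|).
Proof.
move=> s0 s1 te; have [_ _ [M0 out]] := te; pose M := `|M0|.
have p0 := pi_gt0 R.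
have eM x : M < `|x| -> eta x = 0.
  by move=> xM; apply: out; apply: le_lt_trans (ler_norm M0) xM.
have me := test_cmeas te; have ei := test_cintegrable te.
have Fi := test_fourier_cintegrable te; have Gi := powR_decay_cintegrable te (ltW s0) s1.
have inv := test_inversion te.
have hg t x : 0 < t -> _ := fun t0 => inv_fourier_gauss_fourier x t0 ei.
have [K eK] := test_bounded te.
rewrite /frac_lap; move: (fourier eta) Fi Gi inv hg => F Fi Gi inv hg.
have mF := cintegrable_meas Fi.
have h1 : 0 < 1 - s / 2 by lra.
have h2 : 1 - s / 2 < 1 by lra.
pose c := Gamma (1 - s / 2) / (s / 2).
have cp : 0 < c by rewrite divr_gt0 ?Gamma_gt0 ?divr_gt0.
pose w (t : R) := if 0 < t then t `^ (- (s / 2) - 1) else 0.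
have mw : measurable_fun [set: R] w by rewrite /w; meas.
have w0 t : 0 <= w t by rewrite /w; case: ifP => // _; exact: powR_ge0.
pose wt (p t : R) := w t * (1 - expR (- (t * p ^+ 2))).
have wt0 p t : 0 <= wt p t.
  rewrite /wt /w; case: ltP => t0; last by rewrite mul0r.
  by apply: mulr_ge0; [exact: powR_ge0 | rewrite subr_ge0; exact: gauss_le1].
have mwt : measurable_fun [set: R * R] (fun z : R * R => wt z.1 z.2) by rewrite /wt; meas.
have mwp p : measurable_fun [set: R] (wt p) by rewrite /wt; meas.
have lwt (p : R) : p != 0 -> (\int[mu]_t (wt p t)%:E = (c * `|p| `^ s)%:E)%E.
  move=> pn; have p2 : 0 < p ^+ 2 by rewrite exprn_even_gt0.
  rewrite -(powR_sqr_half s p) -(@lint_one_sub_expR R (s / 2) (p ^+ 2)) ?divr_gt0//; last by lra.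
  by apply: eq_integral => t _; rewrite /wt /w; case: ifP => _; rewrite ?mul0r// [t * _]mulrC.
pose a := (1 + s) / 2.
pose kap := (4 * pi) `^ (- 2^-1) * Gamma a.
have a0 : 0 < a by rewrite /a; lra.
have a1 : a < 1 by rewrite /a; lra.
have kap0 : 0 <= kap by rewrite /kap mulr_ge0 ?powR_ge0// ltW// Gamma_gt0.
have lwh (z : R) : z != 0 -> (\int[mu]_t (w t * heat t z)%:E = (kap * (z ^+ 2 / 4) `^ (- a))%:E)%E.
  move=> z0; rewrite -mulrA -(lint_powR_heat a0 a1 z0); apply: eq_integral => t _.
  rewrite /w; case: ifP => _; rewrite ?mul0r//.
  by have -> : - (s / 2) - 1 = - a - 2^-1 by rewrite /a; field.
have N1 := cintegrable_lty ei; set n1 := (\int[mu]_y _)%E in N1.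
have n10 : (0 <= n1)%E by apply: lint_ge0; nneg.
have n1f : n1 \is a fin_num by rewrite ge0_fin_numE.
have c00 := ltW (@c0_gt0 R).
pose B : R := (4^-1) `^ (- s).
pose C1 := c0 * fine (\int[mu]_p (normc ((`|p| `^ s)%:C * F p))%:E) * (2 * M + 2).
pose C2 := c^-1 * (kap * fine n1 * (8 * B)).
have M00 : 0 <= M by exact: normr_ge0.
have C10 : 0 <= C1.
  rewrite /C1 !mulr_ge0//; last by clear -M00; lra.
  by apply: fine_ge0; apply: lint_ge0; nneg.
have C20 : 0 <= C2.
  apply: mulr_ge0; first by rewrite invr_ge0 ltW.
  apply: mulr_ge0; first by apply: mulr_ge0 => //; exact: fine_ge0.
  by apply: mulr_ge0 => //; exact: powR_ge0.
exists (C1 + C2); split; first exact: addr_ge0.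
move=> x; have x10 : 0 < 1 + `|x| by rewrite ltr_pwDl.
have wh1 t z : 0 <= w t * heat t z by apply: mulr_ge0; [exact: w0 | exact: heat_ge0].
have wh0 t y : 0 <= w t * heat t (x - y) * normc (eta y).
  by apply: mulr_ge0; [exact: wh1 | exact: normc_ge0].
(* Close to the support of eta the L^1 norm of the transform suffices. *)
have [xM|Mx] := ltP `|x| (2 * M + 1).
  apply: le_trans (normc_inv_fourier_le x Gi) _.
  rewrite ler_pdivlMr//; apply: ler_wpDr => //.
  apply: ler_wpM2l; last by clear -xM; lra.
  by apply: mulr_ge0 => //; apply: fine_ge0; apply: lint_ge0; nneg.
have x1 : 1 <= `|x| by clear -Mx M00; lra.
rewrite mulrDl; apply: ler_wpDl; first by rewrite divr_ge0// ltW.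
pose L p t : R[i] := (wt p t)%:C * (F p * cis (p * x)).
have mL : cmeas (fun z : R * R => L z.1 z.2) by rewrite /L; cmeas.
have eL : {ae mu, forall p, cintegrable (L p) /\ cintegral (L p) = c%:C * ((`|p| `^ s)%:C * F p * cis (p * x))}.
  apply: ae_imp (ae_neq 0) _ => p pn.
  have [i e] := cintegral_lint (mwp p) (wt0 p) (lwt p pn).
  split.
    by have := cintegrableZ (F p * cis (p * x)) i; congr cintegrable; apply/funext => t; rewrite mulrC.
  by rewrite cintegralZr// e realCM !mulrA.
have Lfin : (\int[mu]_p \int[mu]_t (normc (L p t))%:E < +oo)%E.
  apply: (@le_lt_trans _ _ (\int[mu]_p (c * normc ((`|p| `^ s)%:C * F p))%:E)%E); last first.
    by apply: lintZ_lty; [exact: ltW | cmeas | nneg | exact: cintegrable_lty].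
  apply: ae_le_lint.
  - by apply: (meas_lint (F := fun p t => normc (L p t))); [cmeas | nneg].
  - by cmeas.
  - by move=> p; apply: lint_ge0; nneg.
  - by move=> p; rewrite lee_fin mulr_ge0 ?normc_ge0// ltW.
  apply: ae_imp (ae_neq 0) _ => p pn.
  under eq_integral do rewrite /L !normcM normc_cis mulr1 normc_real (ger0_norm (wt0 _ _)) mulrC.
  rewrite lintZ ?normc_ge0// lwt// -EFinM lee_fin normcM normc_real (ger0_norm (powR_ge0 _ _)).
  by rewrite le_eqVlt; apply/orP; left; apply/eqP; ring.
have Xi := cintegrable_cintegral mL Lfin.
have mX2 : cmeas (fun z : R * R => L z.2 z.1) by rewrite /L /wt; cmeas.
have Lfin2 : (\int[mu]_t \int[mu]_p (normc (L p t))%:E < +oo)%E.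
  rewrite -(lint_fubini (F := fun p t => normc (L p t))); first exact: Lfin.
    exact: (meas_normc mL).
  by move=> p t; exact: normc_ge0.
have Lci : cintegrable (fun t => cintegral (fun p => L p t)).
  exact: (cintegrable_cintegral (K := fun t p => L p t) mX2 Lfin2).
have E : c%:C * inv_fourier (fun p => (`|p| `^ s)%:C * F p) x =
    cintegral (fun t => c0%:C * cintegral (fun p => L p t)).
  have fub := cfubini mL Lfin.
  rewrite (cintegralZl _ Lci) -fub /inv_fourier mulrCA; congr (_ * _).
  have mx : measurable_fun [set: R] (fun p : R => p * x) by meas.
  rewrite -(cintegralZl c%:C (cintegrable_cis mx Gi)).
  apply: ae_eq_cintegral; [by cmeas | exact: (cmeas_cintegral (K := L)) |].
  by apply: ae_imp eL _ => p [_ ->].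
(* eta vanishes at x, so only the heat average of eta survives in the subordination. *)
have XE t : 0 < t -> c0%:C * cintegral (fun p => L p t) =
    - ((w t)%:C * cintegral (fun y => (heat t (x - y))%:C * eta y)).
  move=> t0; rewrite -(hg _ _ t0) -[RHS]mulrN.
  have Egi := cintegrable_gaussM t0 Fi.
  have mx : measurable_fun [set: R] (fun p => p * x) by meas.
  have -> : - inv_fourier (fun p => (expR (- (t * p ^+ 2)))%:C * F p) x =
      inv_fourier F x - inv_fourier (fun p => (expR (- (t * p ^+ 2)))%:C * F p) x.
    by rewrite inv eM ?sub0r//; apply: lt_le_trans Mx; clear -M00; lra.
  rewrite /inv_fourier -mulrBr mulrCA; congr (_ * _).
  rewrite -cintegralB; [|exact: cintegrable_cis|exact: cintegrable_cis].
  rewrite -cintegralZl; last by apply: cintegrableB; exact: cintegrable_cis.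
  apply: eq_cintegral => p; rewrite /L /wt realCM -!mulrA; congr (_ * _).
  by rewrite rmorphB /= mulrBl mul1r.
have normE : normc (inv_fourier (fun p => (`|p| `^ s)%:C * F p) x) =
    c^-1 * normc (cintegral (fun t => c0%:C * cintegral (fun p => L p t))).
  rewrite -E; move: (inv_fourier _ x) => z.
  by rewrite normcM normc_real (gtr0_norm cp) mulKf// gt_eqF.
rewrite normE /C2 -[leRHS]mulrA; apply: ler_wpM2l; first by rewrite invr_ge0 ltW.
have mXt : cmeasurable (fun t => cintegral (fun p => L p t)).
  exact: cintegrable_meas Lci.
have h : cintegrable (fun t => c0%:C * cintegral (fun p => L p t)).
  exact: (cintegrableZ _ Lci).
rewrite -lee_fin; apply: le_trans (normc_cintegral_le h) _.
apply: (@le_trans _ _ (\int[mu]_t \int[mu]_y (w t * heat t (x - y) * normc (eta y))%:E)%E).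
  apply: ge0_le_integral => //.
  - by move=> t _; rewrite lee_fin normc_ge0.
  - exact: (meas_EFin (meas_normc (cmeas_mul (cmeas_cst _) mXt))).
  - apply: (meas_lint (F := fun t y => w t * heat t (x - y) * normc (eta y))); first by cmeas.
    by move=> *; exact: wh0.
  move=> t _; have [t0|t0] := ltP 0 t; last first.
    have -> : (fun p => L p t) = (fun=> 0).
      by apply/funext => p; rewrite /L /wt /w ltNge t0 /= mul0r mul0r.
    rewrite cintegral0 mulr0 normc0; apply: lint_ge0 => y.
    by move=> *; exact: wh0.
  rewrite XE// normc_opp normcM normc_real (ger0_norm (w0 _)) EFinM.
  have hM := cintegrable_heatM x t0 me eK.
  under eq_integral do rewrite -mulrA.
  rewrite lintZ//; [|cmeas|by move=> y; apply: mulr_ge0; [exact: heat_ge0 | exact: normc_ge0]].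
  rewrite lee_wpmul2l ?lee_fin//; apply: le_trans (normc_cintegral_le hM) _.
  by under eq_integral do rewrite normcM normc_real (ger0_norm (heat_ge0 _ _)).
rewrite (lint_fubini (F := fun t y => w t * heat t (x - y) * normc (eta y))); last 2 first.
- by cmeas.
- by move=> *; exact: wh0.
pose Q := kap * (x ^+ 2 / 16) `^ (- a).
have x2 : 0 < x ^+ 2 / 16.
  by rewrite divr_gt0// exprn_even_gt0// -normr_gt0; clear -x1; lra.
have Q0 : 0 <= Q by rewrite mulr_ge0 ?powR_ge0.
apply: (@le_trans _ _ (\int[mu]_y (Q * normc (eta y))%:E)%E).
  apply: ge0_le_integral => //.
  - move=> y _; apply: lint_ge0 => t.
    by move=> *; exact: wh0.
  - apply: (meas_lint (F := fun y t => w t * heat t (x - y) * normc (eta y))); first by cmeas.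
    by move=> *; exact: wh0.
  - by cmeas.
  move=> y _; have [yM|yM] := ltP M `|y|.
    rewrite eM// normc0 mulr0.
    by under eq_integral do rewrite mulr0; rewrite integral0.
  have xy : `|x| / 2 <= `|x - y|.
    have := ler_distD y x 0; rewrite !subr0 => tri.
    by clear -tri yM Mx M00; lra.
  have xyn : x - y != 0 by rewrite -normr_gt0; apply: lt_le_trans xy; clear -x1; lra.
  under eq_integral do rewrite mulrC.
  rewrite lintZ; [|exact: normc_ge0|cmeas|by move=> t; exact: wh1].
  rewrite lwh// -EFinM lee_fin mulrC ler_wpM2r ?normc_ge0// /Q ler_wpM2l//.
  apply: powR_antitone; [by rewrite oppr_le0 ltW | done |].
  have : (`|x| / 2) ^+ 2 <= `|x - y| ^+ 2.
    by rewrite ler_sqr ?nnegrE ?divr_ge0.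
  by rewrite exprMn !real_normK ?num_real//; clear; lra.
rewrite lintZ//; [|cmeas|nneg].
rewrite -/n1 -(fineK n1f) -EFinM lee_fin /Q mulrAC -[leRHS]mulrA; apply: ler_wpM2l.
  by rewrite mulr_ge0// fine_ge0.
have -> : x ^+ 2 / 16 = (`|x| / 4) ^+ 2 by rewrite exprMn real_normK ?num_real//; field.
have q0 : 0 < `|x| / 4 by clear -x1; lra.
rewrite -(powR_mulrn 2 (ltW q0)) -powRrM.
have -> : 2%:R * - a = - s - 1 by rewrite /a; field.
rewrite powR_pred// ler_pdivlMr// mulrAC ler_pdivrMr//.
have le1 : (`|x| / 4) `^ (- s) <= B.
  by apply: powR_antitone; [clear -s0; lra | clear; lra | clear -x1; lra].
apply: (@le_trans _ _ (B * (1 + `|x|))).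
  by rewrite ler_wpM2r// ltW.
rewrite -mulrA [8 * _]mulrC -!mulrA ler_wpM2l ?powR_ge0//.
by clear -x1; lra.
Qed.

End FracLapDecay.

Section Indicators.
Context {R : realType}.
Local Notation mu := (@lebesgue_measure R).
Local Notation Re := complex.Re.
Local Notation Im := complex.Im.

Definition segment_fun (a b : R) : R -> R[i] := fun p => (if (a <= p) && (p <= b) then 1 else 0)%:C.

Lemma segment_fun_cmeas a b : cmeasurable (segment_fun a b).
Proof. by rewrite /segment_fun; cmeas. Qed.

Lemma lint_segment (a b : R) :
  (\int[mu]_x (if (a <= x)%R && (x <= b)%R then 1 else 0)%:E < +oo)%E.
Proof.
apply: le_lt_trans (lint_itv1 (`|a| + `|b|)); apply: le_lint.
- by meas.
- by meas.
- by move=> x; case: ifP.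
move=> x; case: ifP => [/andP[ax xb]|_]; last by case: ifP.
have na := ler_norm (- a); rewrite normrN in na; have nb := ler_norm b.
by rewrite ifT// ler_norml; have := normr_ge0 a; have := normr_ge0 b; lra.
Qed.

Lemma segment_fun_le1 a b x : normc (segment_fun a b x) <= 1.
Proof. by rewrite /segment_fun normc_real; case: ifP => _; rewrite ?normr1 ?normr0. Qed.

Lemma segment_fun_cintegrable a b : cintegrable (segment_fun a b).
Proof.
apply: (cintegrable_le (g := fun x => if (a <= x) && (x <= b) then 1 else 0)).
- exact: segment_fun_cmeas.
- by meas.
- by move=> x; rewrite /segment_fun normc_real; case: ifP => _; rewrite ?normr1 ?normr0.
- exact: lint_segment.
Qed.

(** The length of the segment bounds the integral for small x, the primitive H / x for
    large x. *)
Lemma oscillatory_segment (a b x : R) (h H : R -> R) : a < b -> continuous h ->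
  (forall p : R, is_derive p 1 H (x * h p)) -> (forall p, `|h p| <= 1) -> (forall p, `|H p| <= 1) ->
  `|(\int[mu]_p (if (a <= p)%R && (p <= b)%R then h p else 0))%R| <= (b - a + 2) / (1 + `|x|).
Proof.
move=> ab ch dH h1 H1; set I := (\int[mu]_p _)%R.
have mh : measurable_fun [set: R] h by exact: continuous_measurable_fun.
have I1 : `|I| <= b - a.
  rewrite -lee_fin /I /Rintegral -abse_EFin fineK; last first.
    apply: integrable_fin_num => //; apply/integrableP; split; first by apply: meas_EFin; meas.
    apply: le_lt_trans (lint_segment a b); apply: le_lint; [by meas | by meas | nneg |].
    by move=> p; case: ifP => _; rewrite ?normr0.
  apply: le_trans (le_abse_integral mu measurableT _) _; first by apply: meas_EFin; meas.
  apply: (@le_trans _ _ (\int[mu]_p (if (a <= p)%R && (p <= b)%R then 1 else 0)%:E)%E).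
    apply: le_lint; [by meas | by meas | nneg |].
    by move=> p; case: ifP => _; rewrite ?normr0.
  have -> : (\int[mu]_p (if (a <= (p : R))%R && (p <= b)%R then 1 else 0)%:E = mu `[a, b]%classic)%E.
    rewrite -[`[a, b]%classic]setIT -integral_indic//; apply: eq_integral => p _.
    rewrite indicE; congr (_%:E).
    have -> : (p \in `[a, b]%classic) = (a <= p) && (p <= b).
      by apply/idP/idP; rewrite inE /= in_itv.
    by case: ifP.
  by rewrite lebesgue_measure_itv /= lte_fin ab -EFinB.
have I2 : `|x * I| <= 2.
  have seg := FTC_segment (F := H) (f := fun p => x * h p) ab (fun p _ => dH p) _.
  have {}seg := seg (fun p _ => cvgMr (ch p)).
  have -> : x * I = H b - H a.
    rewrite /I -RintegralZl//.
      rewrite /Rintegral -[RHS]/(fine (H b - H a)%:E) -seg integral_itv_if; congr fine.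
      apply: eq_integral => p _; rewrite in_itv /=; case: ifP => _ //; by rewrite mulr0.
    apply/integrableP; split; first by apply: meas_EFin; meas.
    apply: le_lt_trans (lint_segment a b); apply: le_lint; [by meas | by meas | nneg |].
    by move=> p; case: ifP => _; rewrite ?normr0.
  apply: le_trans (ler_normB _ _) _.
  by rewrite (_ : 2 = 1 + 1)//; exact: lerD.
by rewrite ler_pdivlMr ?ltr_pwDl// mulrDr mulr1 lerD// mulrC -normrM.
Qed.

Lemma fourier_segment_decay (a b : R) : a < b -> exists C : R, 0 <= C /\
  forall x, normc (fourier (segment_fun a b) x) <= C / (1 + `|x|).
Proof.
move=> ab; have c0 := ltW (@c0_gt0 R); set c := (Num.sqrt _)^-1 in c0.
exists (c * ((b - a + 2) + (b - a + 2))); split.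
  by rewrite mulr_ge0//; lra.
move=> x; rewrite /fourier normcM normc_real ger0_norm// -mulrA ler_wpM2l//.
apply: le_trans (normc_le_ReIm _) _; rewrite /cintegral /= mulrDl.
have E1 : (fun p => Re (segment_fun a b p * cis (- (x * p)))) =
    (fun p => if (a <= p) && (p <= b) then cos (- (x * p)) else 0).
  by apply/funext => p; rewrite /segment_fun; case: ifP => _; rewrite ?mul1r ?mul0r.
have E2 : (fun p => Im (segment_fun a b p * cis (- (x * p)))) =
    (fun p => if (a <= p) && (p <= b) then sin (- (x * p)) else 0).
  by apply/funext => p; rewrite /segment_fun; case: ifP => _; rewrite ?mul1r ?mul0r.
rewrite E1 E2; apply: lerD.
- apply: (oscillatory_segment (H := fun p => - sin (- (x * p)))) => //.
  + by move=> p; apply: (is_derive_continuous (df := x * sin (- (x * p)))); apply: is_derive_eq; rewrite /GRing.scale/=; ring.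
  + by move=> p; apply: is_derive_eq; rewrite /GRing.scale/=; ring.
  + by move=> p; rewrite ler_norml cos_geN1 cos_le1.
  + by move=> p; rewrite normrN ler_norml sin_geN1 sin_le1.
- apply: (oscillatory_segment (H := fun p => cos (- (x * p)))) => //.
  + by move=> p; apply: (is_derive_continuous (df := - x * cos (- (x * p)))); apply: is_derive_eq; rewrite /GRing.scale/=; ring.
  + by move=> p; apply: is_derive_eq; rewrite /GRing.scale/=; ring.
  + by move=> p; rewrite ler_norml sin_geN1 sin_le1.
  + by move=> p; rewrite ler_norml cos_geN1 cos_le1.
Qed.

Lemma cintegral_opp (f : R -> R[i]) : cmeasurable f ->
  cintegral (fun x => f (- x)) = cintegral f.
Proof.
move=> [mr mi]; rewrite /cintegral.
by rewrite (Rintegral_opp (h := fun x => Re (f x)))// (Rintegral_opp (h := fun x => Im (f x))).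
Qed.

Lemma inv_fourier_opp (g : R -> R[i]) x : cmeasurable g ->
  inv_fourier (fun p => g (- p)) x = fourier g x.
Proof.
move=> mg; rewrite /inv_fourier /fourier; congr (_ * _).
rewrite -(cintegral_opp (f := fun p => g p * cis (- (x * p)))); last by cmeas.
by apply: eq_cintegral => p; rewrite mulrN opprK [x * p]mulrC.
Qed.

(** A function whose integrals over all segments with a fixed endpoint vanish is
    zero almost everywhere, by Lebesgue's differentiation theorem. *)
Lemma ae_zero_segment (a b : R) (D : R -> R) : a < b -> measurable_fun setT D ->
  (\int[mu]_x (if (a <= x)%R && (x <= b)%R then `|D x| else 0)%:E < +oo)%E ->
  (forall c, a < c -> c < b -> (\int[mu]_x (if (a <= x)%R && (x <= c)%R then D x else 0))%R = 0) ->
  {ae mu, forall x, a < x -> x < b -> D x = 0}.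
Proof.
move=> ab mD Dfin D0; pose h x := if (a <= x) && (x <= b) then D x else 0.
have mh : measurable_fun [set: R] h by rewrite /h; meas.
have hi : mu.-integrable setT (EFin \o h).
  apply/integrableP; split; first exact: meas_EFin.
  apply: le_lt_trans Dfin; apply: le_lint; [by meas | by meas | nneg |].
  by move=> x; rewrite /h; case: ifP => _; rewrite ?normr0.
have hiy (y : R) : mu.-integrable `]-oo, y] (EFin \o h) by apply: (integrableS measurableT).
have := @FTC1Ny R h hiy.
move=> /(_ (open_integrable_locally openT hi)) => ae1.
apply: ae_imp ae1 _ => x [_ dx] ax xb.
have hx : h x = D x by rewrite /h !ltW.
rewrite -hx -dx; have near : \forall y \near x, (\int[mu]_(t in [set` `]-oo, y]]) (h t))%R = (fun=> 0) y.
  have n1 : \forall y \near x, a < y by exact: lt_nbhsr.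
  have n2 : \forall y \near x, y < b by exact: lt_nbhsl.
  apply: filterS2 n1 n2 => y ay yb.
  rewrite -(D0 y ay yb) /Rintegral; congr fine.
  rewrite integral_itv_if; apply: eq_integral => t _; congr EFin; rewrite /h in_itv /=.
  have [ty|yt] := leP t y; last by rewrite andbF.
  by rewrite andbT (le_trans ty (ltW yb)) andbT.
by rewrite derive1E (near_eq_derive _ near) derive_cst.
Qed.

End Indicators.

(** * Hilbert-Schmidt operators and compactness *)

Section Subsequences.
Context {R : realType}.

(** Tychonoff's theorem yields a cluster point of a countable family of bounded
    sequences; its neighbourhoods involve finitely many members at a time. *)
Lemma diagonal_subsequence (b : nat -> nat -> R) (B : nat -> R) :
  (forall j n, `|b j n| <= B j) ->
  exists sigma : nat -> nat, exists p : nat -> R,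
    (forall m n, (m < n)%N -> (sigma m < sigma n)%N) /\
    forall j, (fun n => b j (sigma n)) @ \oo --> p j.
Proof.
move=> bB.
have cpt := @tychonoff nat (fun=> R) (fun j => `[- B j, B j]%classic)
  (fun j => @segment_compact R (- B j) (B j)).
pose u : nat -> prod_topology (fun _ : nat => R) := fun n j => b j n.
have uF : (u @ \oo) [set f : prod_topology (fun _ : nat => R) | forall j, `[- B j, B j]%classic (f j)].
  by exists 0%N => // n _ j; have := bB j n; rewrite ler_norml /= in_itv.
have [p [_ clp]] := cpt (u @ \oo) _ uF.
have next N k : exists n, (N < n)%N && [forall j : 'I_k.+1, `|b j n - p j| < k.+1%:R^-1].
  have k0 : 0 < k.+1%:R^-1 :> R by rewrite invr_gt0.
  have nb L : nbhs p [set f : prod_topology (fun _ : nat => R) |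
      forall j, (j < L)%N -> `|f j - p j| < k.+1%:R^-1].
    elim: L => [|L IH]; first exact: (filterS _ (@filterT _ (nbhs p) _)).
    have cj : (fun f : prod_topology (fun _ : nat => R) => f L) @ p --> p L.
      exact: (@proj_continuous nat (fun=> R) L p).
    have /cvgrPdist_lt/(_ _ k0) dL := cj.
    apply: filterS2 IH dL => f fl fL j; rewrite ltnS leq_eqVlt => /orP[/eqP ->|]; last exact: fl.
    by rewrite distrC.
  have nA : (u @ \oo) (u @` [set n | (N < n)%N]).
    by exists N.+1 => // n /= Nn; exists n.
  have [f [[n /= Nn <-] h]] := clp _ _ nA (nb k.+1).
  by exists n; rewrite Nn; apply/forallP => j; apply: h.
pose sigma := fix sigma k := match k with
  | 0 => ex_minn (next 0 0)%N | k'.+1 => ex_minn (next (sigma k') k) end.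
have sS k : sigma k.+1 = ex_minn (next (sigma k) k.+1) by [].
have sl k : (sigma k < sigma k.+1)%N by rewrite sS; case: ex_minnP => n /andP[].
have sd k (j : 'I_k.+1) : `|b j (sigma k) - p j| < k.+1%:R^-1.
  case: k j => [|k] j; [rewrite /sigma | rewrite sS];
  by case: ex_minnP => n /andP[_ /forallP/(_ j)].
exists sigma, p; split.
  move=> m n; elim: n => // n IH; rewrite ltnS leq_eqVlt => /orP[/eqP ->|/IH h]; first exact: sl.
  exact: ltn_trans h (sl n).
move=> j; apply/cvgrPdist_le => e e0.
have h := @cvg_harmonic R; move/cvgr0Pnorm_le: h => /(_ _ e0) h.
near=> n; rewrite distrC.
have jn : (j < n.+1)%N by near: n; exists j.
apply: le_trans (ltW (sd n (Ordinal jn))) _.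
have : `|n.+1%:R^-1 : R| <= e by near: n; exact: h.
by apply: le_trans; exact: ler_norm.
Unshelve. all: by end_near. Qed.

Lemma cauchy_is_cvg (a : nat -> R) :
  (forall e, 0 < e -> exists N, forall n, (N <= n)%N -> `|a N - a n| <= e) -> cvgn a.
Proof.
move=> ca; apply: cauchy_cvg; apply: cauchy_exP => e /= e0.
have e2 : 0 < e / 2 by rewrite divr_gt0.
have [N hN] := ca _ e2; exists (a N); exists N => // n /= Nn.
by rewrite /ball /= (le_lt_trans (hN n Nn))// ltr_pdivrMr// ltr_pMr// ltr1n.
Qed.

End Subsequences.

Section HilbertSchmidt.
Context {R : realType}.
Local Notation mu := (@lebesgue_measure R).
Local Notation Re := complex.Re.
Local Notation Im := complex.Im.
Variable K : R -> R -> R[i].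
Hypothesis mK : cmeas (fun z : R * R => K z.1 z.2).
Hypothesis HK : (\int[mu]_x L2sqr (K x) < +oo)%E.
Implicit Types f g : R -> R[i].

Let mKx x : cmeasurable (K x).
Proof. by apply: (cmeas_comp (e := fun y : R => (x, y)) mK); exact: measurable_pair1. Qed.

Let mrow : measurable_fun setT (fun x => L2sqr (K x)).
Proof. by apply: (meas_lint (F := fun x y => normc (K x y) ^+ 2)); [cmeas | nneg]. Qed.

Let row_ae : {ae mu, forall x, L2sqr (K x) < +oo}%E.
Proof.
have : mu.-integrable setT (fun x => L2sqr (K x)).
  apply/integrableP; split => //.
  rewrite (_ : (fun _ => _) = (fun x => L2sqr (K x))); first exact: HK.
  by apply/funext => x; rewrite gee0_abs// L2sqr_ge0.
move=> /(integrable_ae measurableT) ae1; apply: ae_imp ae1 _ => x /(_ Logic.I) fx.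
by rewrite -ge0_fin_numE// L2sqr_ge0.
Qed.

Let row_L2 x : (L2sqr (K x) < +oo)%E -> L2 (K x).
Proof. by move=> h; apply/L2P. Qed.

Lemma hs_converges f : L2 f -> kernel_converges K f.
Proof. by move=> fL; apply: ae_imp row_ae _ => x /row_L2 KL; exact: cintegrableM_L2. Qed.

Let mT f : cmeasurable f -> cmeasurable (kernel_op K f).
Proof.
by move=> mf; apply: (cmeas_cintegral (K := fun x y => K x y * f y)); cmeas.
Qed.

Lemma hs_pointwise_le f x : L2 f -> (L2sqr (K x) < +oo)%E ->
  normc (kernel_op K f x) ^+ 2 <= fine (L2sqr (K x)) * fine (L2sqr f).
Proof. by move=> fL /row_L2 KL; exact: L2_pairing_le. Qed.

Let lint_row (c : R) : 0 <= c -> (\int[mu]_x (c * fine (L2sqr (K x)))%:E < +oo)%E.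
Proof.
have mr : measurable_fun [set: R] (fun x => fine (L2sqr (K x))).
  by apply: measurableT_comp => //; exact: measurable_fine.
move=> c0; apply: lintZ_lty => //; first by move=> x; rewrite fine_ge0// L2sqr_ge0.
apply: le_lt_trans HK; apply: ae_le_lint; [exact: meas_EFin | exact: mrow | | |].
- by move=> x; rewrite lee_fin fine_ge0// L2sqr_ge0.
- by move=> x; exact: L2sqr_ge0.
- by apply: ae_imp row_ae _ => x h; rewrite fineK// ge0_fin_numE// L2sqr_ge0.
Qed.

Lemma hs_L2 f : L2 f -> L2 (kernel_op K f).
Proof.
move=> fL; have mTf := mT (L2_meas fL); apply/L2P; split => //.
have f0 : 0 <= fine (L2sqr f) by rewrite fine_ge0// L2sqr_ge0.
apply: le_lt_trans (lint_row f0); apply: ae_le_lint.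
- by cmeas.
- apply: meas_EFin; apply: meas_mul; first exact: meas_cst.
  by apply: measurableT_comp => //; exact: measurable_fine.
- by move=> x; rewrite lee_fin sqr_ge0.
- by move=> x; rewrite lee_fin mulr_ge0// fine_ge0// L2sqr_ge0.
- apply: ae_imp row_ae _ => x h; rewrite lee_fin mulrC; exact: hs_pointwise_le.
Qed.

Lemma hs_ae_eq f g : L2 f -> L2 g -> ae_eq mu setT f g ->
  ae_eq mu setT (kernel_op K f) (kernel_op K g).
Proof.
move=> fL gL fg; apply: ae_all => x _; apply: ae_eq_cintegral.
- by have := mKx x; have := L2_meas fL; move=> ? ?; cmeas.
- by have := mKx x; have := L2_meas gL; move=> ? ?; cmeas.
- by apply: ae_imp fg _ => y /(_ Logic.I) ->.
Qed.

Lemma hs_linear (a : R[i]) f g : L2 f -> L2 g ->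
  ae_eq mu setT (kernel_op K (fun x => a * f x + g x))
                (fun x => a * kernel_op K f x + kernel_op K g x).
Proof.
move=> fL gL; apply: ae_imp row_ae _ => x /row_L2 KL _.
have fi := cintegrableM_L2 KL fL; have gi := cintegrableM_L2 KL gL.
rewrite /kernel_op -cintegralZl// -cintegralD//; last exact: cintegrableZ.
by apply: eq_cintegral => y; rewrite mulrDr mulrCA.
Qed.

(** Pointwise convergence of the images of a bounded sequence improves to
    convergence in mean square, the row norms of the kernel being a square-integrable
    majorant. *)
Lemma hs_cvg (F : nat -> R -> R[i]) (M : R) : (forall n, L2 (F n)) ->
  (forall n, fine (L2sqr (F n)) <= M) ->
  (forall x, (L2sqr (K x) < +oo)%E -> exists l, ccvg (fun n => kernel_op K (F n) x) l) ->
  exists g, L2 g /\ L2cvg (fun n => kernel_op K (F n)) g.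
Proof.
move=> FL FM cv; pose A x := (L2sqr (K x) < +oo)%E.
have mA : measurable_fun [set: R] A by exact: measurable_fun_lte.
have M0 : 0 <= M by apply: le_trans (FM 0%N); rewrite fine_ge0// L2sqr_ge0.
pose T n x := if A x then kernel_op K (F n) x else 0.
have mTF n : cmeasurable (kernel_op K (F n)) by exact: mT (L2_meas (FL n)).
have mTn n : cmeasurable (T n) by have := mTF n => ?; rewrite /T; apply: cmeas_if; [| cmeas | cmeas].
have cvT x : exists l, ccvg (T ^~ x) l.
  rewrite /T; have [Ax|nAx] := boolP (A x); first exact: cv.
  by exists 0; exact: ccvg_cst.
have [g hg] := choice cvT.
have rI (P : R[i] -> R) : (forall z, `|P z| <= normc z) -> (forall z w, P (z - w) = P z - P w) ->
    forall x, (fun n => P (T n x)) @ \oo --> P (g x).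
  move=> Pn PB x; apply/subr_cvg0/norm_cvg0P; apply: (squeeze_cvgr _ (cvg_cst 0) (hg x)).
  by apply: nearW => n; rewrite normr_ge0 andTb -PB; exact: Pn.
have ReB (z w : R[i]) : Re (z - w) = Re z - Re w by rewrite ReD ReN.
have ImB (z w : R[i]) : Im (z - w) = Im z - Im w by rewrite ImD ImN.
have cR := rI (@complex.Re R) (@Re_le_normc R) ReB.
have cI := rI (@complex.Im R) (@Im_le_normc R) ImB.
have mg : cmeasurable g.
  split.
  - by apply: (measurable_fun_cvg (h := fun n x => Re (T n x))) => [n|x _]; [case: (mTn n) | exact: cR].
  - by apply: (measurable_fun_cvg (h := fun n x => Im (T n x))) => [n|x _]; [case: (mTn n) | exact: cI].
have TL n : L2sqr (fun x => kernel_op K (F n) x - g x) = L2sqr (fun x => T n x - g x).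
  apply: ae_eq_lint; [by have := mTF n => ?; cmeas | by have := mTn n => ?; cmeas | | |].
  - by move=> x; rewrite lee_fin sqr_ge0.
  - by move=> x; rewrite lee_fin sqr_ge0.
  - by apply: ae_imp row_ae _ => x Ax; rewrite /T /A Ax.
have Tb n x : normc (T n x) ^+ 2 <= M * fine (L2sqr (K x)).
  have r0 : 0 <= fine (L2sqr (K x)) by rewrite fine_ge0// L2sqr_ge0.
  rewrite /T; case: ifP => Ax; last by rewrite normc0 expr0n mulr_ge0.
  apply: le_trans (hs_pointwise_le (FL n) Ax) _.
  by rewrite mulrC ler_wpM2r.
have gb x : normc (g x) ^+ 2 <= M * fine (L2sqr (K x)).
  have h : (fun n => normc (T n x) ^+ 2) @ \oo --> normc (g x) ^+ 2.
    rewrite normc_sqr; under eq_fun do rewrite normc_sqr.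
    by apply: cvgD; under eq_fun do rewrite expr2; rewrite expr2; apply: cvgM; first [exact: cR | exact: cI].
  exact: (seq_le_lim h (cvg_cst _) (fun n => Tb n x)).
have db n x : normc (T n x - g x) ^+ 2 <= 4 * M * fine (L2sqr (K x)).
  have h : normc (T n x - g x) ^+ 2 <= (normc (T n x) + normc (g x)) ^+ 2.
    rewrite ler_sqr ?nnegrE ?normc_ge0 ?addr_ge0 ?normc_ge0//.
    by apply: le_trans (normc_triangle _ _) _; rewrite normc_opp.
  apply: le_trans h _; have := sqr_ge0 (normc (T n x) - normc (g x)).
  by rewrite sqrrB sqrrD; move: (Tb n x) (gb x); lra.
have mr : measurable_fun [set: R] (fun x => fine (L2sqr (K x))).
  by apply: measurableT_comp => //; exact: measurable_fine.
have M40 : 0 <= 4 * M by rewrite mulr_ge0.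
have c2 : (fun n => L2sqr (fun x => T n x - g x)) @ \oo --> 0%E.
  have [|||||||_ + _] := @lint_dominated_cvg R (fun n x => normc (T n x - g x) ^+ 2) (fun=> 0)
      (fun x => 4 * M * fine (L2sqr (K x))).
  - by move=> n; have := mTn n => ?; cmeas.
  - by meas.
  - by apply: meas_mul => //; exact: meas_cst.
  - by move=> x; rewrite mulr_ge0// fine_ge0// L2sqr_ge0.
  - exact: lint_row.
  - apply: ae_all => x; rewrite -[X in _ --> X](mul0r 0).
    under eq_fun do rewrite expr2.
    by apply: cvgM; exact: hg.
  - by apply: ae_all => x n; rewrite ger0_norm ?sqr_ge0.
  move=> cvL.
  rewrite (_ : (fun n => L2sqr _) =
      (fun n => \int[mu]_x `|normc (T n x - g x) ^+ 2 - 0|%:E)%E); first exact: cvL.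
  apply/funext => n; apply: eq_integral => x _.
  by rewrite subr0 ger0_norm ?sqr_ge0.
exists g; split.
  apply/L2P; split => //; apply: le_lt_trans (lint_row M0).
  apply: le_lint; [by cmeas | | nneg | exact: gb].
  by apply: meas_mul => //; exact: meas_cst.
by apply/L2cvgP; under eq_fun do rewrite TL.
Qed.

End HilbertSchmidt.

Section PairingLimits.
Context {R : realType}.
Local Notation mu := (@lebesgue_measure R).
Local Notation Re := complex.Re.
Local Notation Im := complex.Im.

(** The pairings with h are uniformly close to convergent ones, hence Cauchy. *)
Lemma pairing_cvg_approx (h : R -> R[i]) (F : nat -> R -> R[i]) (M : R) : L2 h ->
  (forall n, L2 (F n)) -> (forall n, fine (L2sqr (F n)) <= M) ->
  (forall e, 0 < e -> exists k : R -> R[i], [/\ L2 k,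
     fine (L2sqr (fun y => h y - k y)) <= e &
     exists l, ccvg (fun n => cintegral (fun y => k y * F n y)) l]) ->
  exists l, ccvg (fun n => cintegral (fun y => h y * F n y)) l.
Proof.
move=> hL FL FM ap; have M0 : 0 <= M by apply: le_trans (FM 0%N); rewrite fine_ge0// L2sqr_ge0.
pose a n := cintegral (fun y => h y * F n y).
have ca e : 0 < e -> exists N, forall n, (N <= n)%N -> normc (a N - a n) <= e.
  move=> e0; have d0 : 0 < (e / 4) ^+ 2 / (M + 1).
    by rewrite divr_gt0// ?exprn_gt0 ?divr_gt0//; lra.
  have [k [kL kd [l cl]]] := ap _ d0.
  have hk n : normc (a n - cintegral (fun y => k y * F n y)) <= e / 4.
    rewrite /a -cintegralB; [|exact: cintegrableM_L2|exact: cintegrableM_L2].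
    rewrite -ler_sqr ?nnegrE ?normc_ge0 ?divr_ge0 ?(ltW e0)//.
    have -> : cintegral (fun y => h y * F n y - k y * F n y) = cintegral (fun y => (h y - k y) * F n y).
      by apply: eq_cintegral => y; rewrite mulrBl.
    apply: le_trans (L2_pairing_le (L2B hL kL) (FL n)) _.
    apply: (@le_trans _ _ ((e / 4) ^+ 2 / (M + 1) * M)).
      apply: ler_pM => //; by rewrite fine_ge0// L2sqr_ge0.
    by rewrite mulrAC ler_pdivrMr ?ler_wpM2l ?sqr_ge0//; lra.
  have e4 : 0 < e / 4 by rewrite divr_gt0.
  move: cl; rewrite /ccvg => /cvgr0Pnorm_le/(_ _ e4) [N _ hN].
  exists N => n Nn; have h1 := hN N (leqnn N); have h2 := hN n Nn.
  rewrite /= ger0_norm ?normc_ge0// in h1; rewrite /= ger0_norm ?normc_ge0// in h2.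
  have -> : a N - a n = (a N - cintegral (fun y => k y * F N y)) -
      (a n - cintegral (fun y => k y * F n y)) +
      ((cintegral (fun y => k y * F N y) - l) - (cintegral (fun y => k y * F n y) - l)) by ring.
  apply: le_trans (normc_triangle _ _) _.
  have t1 := normc_triangle (a N - cintegral (fun y => k y * F N y)) (- (a n - cintegral (fun y => k y * F n y))).
  have t2 := normc_triangle (cintegral (fun y => k y * F N y) - l) (- (cintegral (fun y => k y * F n y) - l)).
  rewrite normc_opp in t1; rewrite normc_opp in t2.
  by move: (hk N) (hk n) t1 t2 h1 h2; lra.
have cR : cvgn (fun n => Re (a n)).
  apply: cauchy_is_cvg => e /ca[N hN]; exists N => n /hN; apply: le_trans.
  by rewrite -ReN -ReD; exact: Re_le_normc.
have cI : cvgn (fun n => Im (a n)).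
  apply: cauchy_is_cvg => e /ca[N hN]; exists N => n /hN; apply: le_trans.
  by rewrite -ImN -ImD; exact: Im_le_normc.
exists (limn (fun n => Re (a n)) +i* limn (fun n => Im (a n))).
apply: (ccvg_squeeze (b := fun n => `|Re (a n) - limn (fun n => Re (a n))| +
    `|Im (a n) - limn (fun n => Im (a n))|)).
  by move=> n; apply: le_trans (normc_le_ReIm _) _; rewrite ReD ImD ReN ImN.
by rewrite -[X in _ --> X](addr0 0); apply: cvgD; apply/norm_cvg0P/subr_cvg0; [exact: cR | exact: cI].
Qed.

End PairingLimits.

Section BirmanSchwinger.
Context {R : realType} (s : R) (hs : 2^-1 < s < 1) (V : R -> R).
Local Notation mu := (@lebesgue_measure R).
Local Notation Re := complex.Re.
Local Notation Im := complex.Im.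
Hypothesis hV1 : weightedL1 (fun x => japanese x `^ (2 * s - 1)) (toC V).
Hypothesis hV2 : rollnik s (toC V).

Let s0 : 0 < s. Proof. by case/andP: hs => h _; lra. Qed.
Let s1 : s < 1. Proof. by case/andP: hs. Qed.
Let s2 : 0 < 2 * s - 1. Proof. by case/andP: hs => h _; lra. Qed.

Lemma meas_potential : measurable_fun setT V.
Proof. by case: hV1 => -[]. Qed.

Lemma meas_sqrt_abs : measurable_fun setT (sqrt_abs V).
Proof. by have := meas_potential => ?; rewrite /sqrt_abs; meas. Qed.

Lemma sqrt_abs_ge0 x : 0 <= sqrt_abs V x.
Proof. exact: sqrtr_ge0. Qed.

Lemma sqrt_abs_sqr x : sqrt_abs V x ^+ 2 = `|V x|.
Proof. by rewrite sqr_sqrtr. Qed.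

Lemma signed_sqrt_abs_norm x : `|signed_sqrt_abs V x| = sqrt_abs V x.
Proof.
rewrite /signed_sqrt_abs normrM (ger0_norm (sqrt_abs_ge0 x)) normr_sg.
by rewrite /sqrt_abs; have [->|_] := eqVneq (V x) 0; rewrite ?normr0 ?sqrtr0 ?mul0r ?mulr1.
Qed.

Lemma signed_sqrt_absM x : signed_sqrt_abs V x * sqrt_abs V x = V x.
Proof. by rewrite /signed_sqrt_abs mulrAC -expr2 sqrt_abs_sqr mulrC -numEsg. Qed.

Lemma japanese_ge1 (x : R) : 1 <= japanese x.
Proof. by rewrite -[leLHS]sqrtr1; apply: ler_wsqrtr; rewrite lerDl sqr_ge0. Qed.

Lemma potential_lty : (\int[mu]_x `|V x|%:E < +oo)%E.
Proof.
have mV := meas_potential; have mT : cmeasurable (toC V) by case: hV1.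
case: hV1 => _; apply: le_lt_trans.
apply: le_lint; [by meas | | nneg |].
  by rewrite /japanese; cmeas.
move=> x; rewrite normc_real ler_peMr//.
apply: (@le_trans _ _ (japanese x `^ 0)); first by rewrite powRr0.
by apply: ler_powR; [exact: japanese_ge1 | exact: ltW].
Qed.

Lemma sqrt_abs_L2 : L2 (toC (sqrt_abs V)).
Proof.
have mo := meas_sqrt_abs; apply/L2P; split; first by rewrite /toC; cmeas.
apply: le_lt_trans potential_lty; rewrite le_eqVlt; apply/orP; left; apply/eqP.
by apply: eq_integral => x _; rewrite normc_real real_normK ?num_real// sqrt_abs_sqr.
Qed.

Let K := birman_schwinger_kernel s V.

Let KE x y : K x y = (signed_sqrt_abs V x)%:C * ((rker s (x - y) * sqrt_abs V y)%:C).
Proof. by rewrite realCM mulrA. Qed.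

Let mK : cmeas (fun z : R * R => K z.1 z.2).
Proof.
have mV := meas_potential; have mo := meas_sqrt_abs.
have mu' : measurable_fun [set: R] (signed_sqrt_abs V).
  rewrite (_ : signed_sqrt_abs V = (fun x => if V x < 0 then - sqrt_abs V x else sqrt_abs V x)).
    by meas.
  apply/funext => x; rewrite /signed_sqrt_abs /sqrt_abs.
  have [h|h|->] := ltrgtP (V x) 0; last by rewrite normr0 sqrtr0 mul0r.
    by rewrite ltr0_sg// mulrN1.
  by rewrite gtr0_sg// mulr1.
rewrite (_ : (fun z => _) = (fun z : R * R => (signed_sqrt_abs V z.1)%:C * (rker s (z.1 - z.2) * sqrt_abs V z.2)%:C)).
  by rewrite /rker; cmeas.
by apply/funext => z; exact: KE.
Qed.

Let normK x y : normc (K x y) = sqrt_abs V x * (rker s (x - y) * sqrt_abs V y).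
Proof.
rewrite KE normcM !normc_real signed_sqrt_abs_norm; congr (_ * _).
by apply: ger0_norm; apply: mulr_ge0; [exact: rker_ge0 s0 s1 _ | exact: sqrt_abs_ge0].
Qed.

(** The squared modulus of the kernel is Lambda^2 |V(x)||V(y)| |x-y|^(-2(1-s)): the class
    R_(s,1) is the Hilbert-Schmidt condition. *)
Lemma birman_schwinger_hs : (\int[mu]_x L2sqr (birman_schwinger_kernel s V x) < +oo)%E.
Proof.
have mV := meas_potential; case: hV2 => _ fin.
pose f (x y : R) := `|V x| * `|V y| / `|x - y| `^ (2 * (1 - s)).
have f0 x y : 0 <= f x y by rewrite divr_ge0 ?powR_ge0// mulr_ge0.
have mf : measurable_fun [set: R * R] (fun z : R * R => f z.1 z.2).
  by rewrite /f; meas.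
have fE : (\int[(mu \x mu)%E]_z (f z.1 z.2)%:E = \int[mu]_x \int[mu]_y (f x y)%:E)%E.
  apply: (@fubini_tonelli1 _ _ _ _ _ mu mu (fun z : R * R => (f z.1 z.2)%:E)); first exact: meas_EFin.
  by move=> z; rewrite lee_fin.
have mI := meas_lint mf f0.
apply: (@le_lt_trans _ _ ((Lambda s ^+ 2)%:E * \int[mu]_x \int[mu]_y (f x y)%:E)%E); last first.
  apply: lte_mul_pinfty; rewrite ?lee_fin ?sqr_ge0// -fE.
  apply: le_lt_trans fin; rewrite le_eqVlt; apply/orP; left; apply/eqP.
  by apply: eq_integral => z _; rewrite /f !normc_real.
rewrite -ge0_integralZl//; last 2 first.
- by move=> x _; exact: lint_ge0.
- by rewrite lee_fin sqr_ge0.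
rewrite le_eqVlt; apply/orP; left; apply/eqP; apply: eq_integral => x _.
rewrite -lintZ ?sqr_ge0//; last first.
  by apply: (measurableT_comp mf (g := fun y : R => (x, y))); exact: measurable_pair1.
apply: eq_integral => y _; rewrite -/K normK /f; congr (_%:E).
have -> : (sqrt_abs V x * (rker s (x - y) * sqrt_abs V y)) ^+ 2 =
    sqrt_abs V x ^+ 2 * sqrt_abs V y ^+ 2 * rker s (x - y) ^+ 2 by ring.
rewrite !sqrt_abs_sqr /rker; move: (Lambda s) => L.
by rewrite exprMn exprVn powR_sqr; ring.
Qed.

(** Countably many rows, at the positions i/(m+1), cut off near their singularity to be
    square integrable at every position. *)
Definition truncated_row (m : nat) (i : int) : R -> R[i] := fun y =>
  ((if m.+1%:R^-1 <= `|i%:~R / m.+1%:R - y| then rker s (i%:~R / m.+1%:R - y) else 0)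
   * sqrt_abs V y)%:C.

Lemma truncated_row_meas m i : cmeasurable (truncated_row m i).
Proof. by have mo := meas_sqrt_abs; rewrite /truncated_row /rker; cmeas. Qed.

Lemma truncated_row_L2 m i : L2 (truncated_row m i).
Proof.
have mo := meas_sqrt_abs; have mt := truncated_row_meas m i.
have h0 := s0; have h1 := s1.
pose B := Lambda s * m.+1%:R^-1 `^ (s - 1).
have B0 : 0 <= B by rewrite mulr_ge0 ?powR_ge0// ltW// Lambda_gt0.
have /L2P[_ fin] := sqrt_abs_L2.
apply/L2P; split => //.
apply: (@le_lt_trans _ _ (\int[mu]_y (B ^+ 2 * normc (toC (sqrt_abs V) y) ^+ 2)%:E)%E).
  apply: le_lint; [by cmeas | by rewrite /toC; cmeas | nneg |] => y.
  rewrite /truncated_row !normc_real normrM exprMn ler_wpM2r ?sqr_ge0//.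
  rewrite ler_sqr ?nnegrE//; case: ifP => h; last by rewrite normr0.
  rewrite (ger0_norm (rker_ge0 h0 h1 _)) rkerE ler_wpM2l//; first by rewrite ltW// Lambda_gt0.
  by apply: powR_antitone => //; lra.
by apply: lintZ_lty; rewrite ?sqr_ge0//; [rewrite /toC; cmeas | nneg].
Qed.

(** A row of the kernel depends continuously on the position of its singularity.
    Where the row at q is not cut off, |x - q| <= 1/m <= |q - y|, hence
    |x - y| <= 2|q - y|: a multiple of the row at x is a majorant. *)
Lemma truncated_row_approx x : L2 (fun y => (rker s (x - y) * sqrt_abs V y)%:C) ->
  forall e, 0 < e -> exists m i,
  fine (L2sqr (fun y => (rker s (x - y) * sqrt_abs V y)%:C - truncated_row m i y)) <= e.
Proof.
move=> hL e e0; have h0 := s0; have h1 := s1; have mo := meas_sqrt_abs.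
have L0 := ltW (Lambda_gt0 h0 h1).
pose i m := Num.floor (x * m.+1%:R); pose q m : R := (i m)%:~R / m.+1%:R.
have m0 m : 0 < m.+1%:R :> R by [].
have qx m : `|x - q m| <= m.+1%:R^-1.
  have /andP[l u] := mem_rg1_floor (x * m.+1%:R).
  rewrite -/(i m) in l u; rewrite ler_norml.
  have e1 : x - q m = (x * m.+1%:R - (i m)%:~R) / m.+1%:R by rewrite /q; field; rewrite gt_eqF.
  rewrite e1 ler_pdivlMr// ler_pdivrMr// mulNr mulVf ?gt_eqF//.
  by lra.
pose h y := (rker s (x - y) * sqrt_abs V y)%:C.
pose B := 1 + 2 `^ (1 - s).
have B0 : 0 <= B by rewrite addr_ge0 ?powR_ge0.
have hb m y : y != x -> normc (h y - truncated_row m (i m) y) <= B * normc (h y).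
  move=> yx; rewrite /h /truncated_row -/(q m).
  have nh : normc (rker s (x - y) * sqrt_abs V y)%:C = rker s (x - y) * sqrt_abs V y.
    by rewrite normc_real ger0_norm// mulr_ge0 ?sqrt_abs_ge0// rker_ge0.
  apply: le_trans (normc_triangle _ _) _; rewrite normc_opp mulrDl mul1r lerD2l nh.
  rewrite normc_real normrM (ger0_norm (sqrt_abs_ge0 _)) mulrA ler_wpM2r ?sqrt_abs_ge0//.
  case: ifP => mq; last by rewrite normr0 mulr_ge0 ?powR_ge0// rker_ge0.
  rewrite (ger0_norm (rker_ge0 h0 h1 _)) !rkerE mulrCA ler_wpM2l//.
  have xy : 0 < `|x - y| by rewrite normr_gt0 subr_eq0 eq_sym.
  have q2 : `|x - y| / 2 <= `|q m - y|.
    have mq' : m.+1%:R^-1 <= `|q m - y| := mq.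
    have aux (a b c z : R) : a <= b + c -> b <= z -> z <= c -> a / 2 <= c by lra.
    exact: aux (ler_distD (q m) x y) (qx m) mq'.
  apply: le_trans (powR_antitone _ _ q2) _; [lra | by rewrite divr_gt0 |].
  rewrite powRM ?invr_ge0// mulrC -powR_inv1// -powRrM ler_wpM2r ?powR_ge0//.
  by rewrite le_eqVlt; apply/orP; left; apply/eqP; congr (_ `^ _); ring.
have mh : cmeasurable h by exact: L2_meas hL.
have mt m := truncated_row_meas m (i m).
have cv : {ae mu, forall y, (fun m => normc (h y - truncated_row m (i m) y) ^+ 2) @ \oo --> (0 : R)}.
  apply: ae_imp (ae_neq x) _ => y yx.
  have xy : 0 < `|x - y| by rewrite normr_gt0 subr_eq0 eq_sym.
  have cq : q @ \oo --> x.
    apply/cvgrPdist_le => d d0; have /cvgr0Pnorm_le/(_ _ d0) hd := @cvg_harmonic R.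
    apply: filterS hd => m hd; apply: le_trans (qx m) _; apply: le_trans hd; exact: ler_norm.
  have cqy : (fun m => `|q m - y|) @ \oo --> `|x - y|.
    by apply: cvg_norm; apply: cvgB => //; exact: cvg_cst.
  have cr : (fun m => rker s (q m - y)) @ \oo --> rker s (x - y).
    rewrite rkerE; under eq_fun do rewrite rkerE.
    apply: cvgMr; apply: (@cvg_comp _ _ _ (fun m => `|q m - y|) (fun z => z `^ (s - 1)) _ _ _ cqy).
    exact: (is_derive_continuous (is_derive1_powR (s - 1) xy)).
  have cd : (fun m => (rker s (x - y) - rker s (q m - y)) ^+ 2 * sqrt_abs V y ^+ 2) @ \oo --> (0 : R).
    have -> : 0 = (rker s (x - y) - rker s (x - y)) * (rker s (x - y) - rker s (x - y)) * sqrt_abs V y ^+ 2 by rewrite subrr !mul0r.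
    under eq_fun do rewrite [(_ - _) ^+ 2]expr2.
    by apply: cvgMl; apply: cvgM; apply: cvgB => //; exact: cvg_cst.
  apply: cvg_trans cd; apply: near_eq_cvg.
  have n2 : 0 < `|x - y| / 2 by rewrite divr_gt0.
  have /cvgr0Pnorm_le/(_ _ n2) hd := @cvg_harmonic R.
  apply: filterS hd => m; rewrite ger0_norm ?invr_ge0// => hd.
  rewrite /h /truncated_row -/(q m) ifT; last first.
    have aux (a b c z : R) : a <= b + c -> b <= z -> z <= a / 2 -> z <= c by lra.
    exact: aux (ler_distD (q m) x y) (qx m) hd.
  by rewrite -rmorphB -mulrBl normc_real normrM exprMn !real_normK ?num_real.
have B2 : 0 <= B ^+ 2 by exact: sqr_ge0.
have [|||||||_ + _] := @lint_dominated_cvg R (fun m y => normc (h y - truncated_row m (i m) y) ^+ 2) (fun=> 0)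
    (fun y => B ^+ 2 * normc (h y) ^+ 2).
- by move=> m; have := mt m => ?; cmeas.
- by meas.
- by cmeas.
- by nneg.
- by apply: lintZ_lty; [done | cmeas | nneg | exact: L2_lty hL].
- exact: cv.
- apply: ae_imp (ae_neq x) _ => y yx m; rewrite ger0_norm ?sqr_ge0// -exprMn.
  by rewrite ler_sqr ?nnegrE ?normc_ge0 ?mulr_ge0 ?normc_ge0//; exact: hb.
move=> /fine_cvgP[_ /cvgr0Pnorm_le/(_ _ e0)[N _ hN]].
exists N, (i N); have := hN N (leqnn N); apply: le_trans.
rewrite /= (_ : L2sqr _ = (\int[mu]_y `|normc (h y - truncated_row N (i N) y) ^+ 2 - 0|%:E)%E).
  exact: ler_norm.
by apply: eq_integral => y _; rewrite subr0 ger0_norm ?sqr_ge0.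
Qed.

Lemma birman_schwinger_converges f : L2 f ->
  kernel_converges (birman_schwinger_kernel s V) f.
Proof. exact: (hs_converges mK birman_schwinger_hs). Qed.

(** A bounded sequence has a subsequence whose pairings with the countably many
    truncated rows all converge; then the images converge pointwise, and hs_cvg improves
    this to convergence in mean square. *)
Lemma birman_schwinger_compact : compact_operator (birman_schwinger s V).
Proof.
split.
- by move=> f; exact: (hs_L2 mK birman_schwinger_hs).
- by move=> f g; exact: (hs_ae_eq mK).
- by move=> a f g; exact: (hs_linear mK birman_schwinger_hs).
move=> F FL [M0 FM0]; pose M := M0 ^+ 2.
have FM n : fine (L2sqr (F n)) <= M.
  by rewrite -lee_fin fineK ?L2_fin//; exact: L2sqr_le.
have M1 : 0 <= M by exact: sqr_ge0.
(* The boolean selects the real or the imaginary part of a pairing. *)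
pose J := (nat * int * bool)%type.
pose val (j : J) n : R := let z := cintegral (fun y => truncated_row j.1.1 j.1.2 y * F n y) in
  if j.2 then Re z else Im z.
pose bd (j : J) : R := Num.sqrt (fine (L2sqr (truncated_row j.1.1 j.1.2)) * M).
have vb j n : `|val j n| <= bd j.
  have h : normc (cintegral (fun y => truncated_row j.1.1 j.1.2 y * F n y)) <= bd j.
    have r0 : 0 <= fine (L2sqr (truncated_row j.1.1 j.1.2)) by rewrite fine_ge0// L2sqr_ge0.
    rewrite -ler_sqr ?nnegrE ?normc_ge0 ?sqrtr_ge0// /bd (sqr_sqrtr (mulr_ge0 r0 M1)).
    apply: le_trans (L2_pairing_le (truncated_row_L2 _ _) (FL n)) _.
    exact: ler_wpM2l.
  by rewrite /val; case: ifP => _; [apply: le_trans (Re_le_normc _) (h) | apply: le_trans (Im_le_normc _) (h)].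
pose b j n := if unpickle j is Some k then val k n else 0.
pose B j := if unpickle j is Some k then bd k else 0.
have bB j n : `|b j n| <= B j.
  by rewrite /b /B; case: (unpickle j) => [k|]; rewrite ?vb ?normr0.
have [sigma [p [sm cp]]] := diagonal_subsequence bB.
have vcv (j : J) : (fun n => val j (sigma n)) @ \oo --> p (pickle j).
  by have := cp (pickle j); rewrite /b pickleK.
exists sigma.
have [|g [gL gc]] := hs_cvg mK birman_schwinger_hs (F := fun n => F (sigma n)) (M := M)
  (fun n => FL (sigma n)) (fun n => FM (sigma n)); last by exists g.
move=> x rx; pose h y : R[i] := (rker s (x - y) * sqrt_abs V y)%:C.
have TE n : kernel_op K (F (sigma n)) x = cintegral (fun y => (signed_sqrt_abs V x)%:C * (h y * F (sigma n) y)).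
  by apply: eq_cintegral => y; rewrite KE -mulrA.
(* Where V vanishes the row of the Riesz kernel need not be square integrable. *)
have [z0|zn0] := eqVneq (sqrt_abs V x) 0.
  exists 0; rewrite (_ : (fun n => _) = (fun=> 0)); first exact: ccvg_cst.
  apply/funext => n; rewrite TE -[RHS](cintegral0 (R := R)); apply: eq_cintegral => y.
  have : signed_sqrt_abs V x = 0 by apply/eqP; rewrite -normr_eq0 signed_sqrt_abs_norm z0.
  by move=> ->; rewrite mul0r.
have o0 : 0 < sqrt_abs V x by rewrite lt_neqAle eq_sym zn0 sqrt_abs_ge0.
have mo := meas_sqrt_abs.
have mh : cmeasurable h by rewrite /h /rker; cmeas.
have hL : L2 h.
  apply/L2P; split => //.
  apply: (@le_lt_trans _ _ (\int[mu]_y ((sqrt_abs V x ^+ 2)^-1 * normc (K x y) ^+ 2)%:E)%E).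
    rewrite le_eqVlt; apply/orP; left; apply/eqP; apply: eq_integral => y _.
    rewrite normK exprMn mulKf ?expf_neq0// normc_real real_normK ?num_real//.
  apply: lintZ_lty; [by rewrite invr_ge0 sqr_ge0 | | nneg | exact: rx].
  have mKx : cmeasurable (K x).
    by apply: (cmeas_comp (e := fun y : R => (x, y)) mK); exact: measurable_pair1.
  by cmeas.
have [e e0|l cl] := pairing_cvg_approx hL (fun n => FL (sigma n)) (fun n => FM (sigma n)).
  have [m [i hi]] := truncated_row_approx hL e0.
  exists (truncated_row m i); split => //; first exact: truncated_row_L2.
  exists (p (pickle (m, i, true)) +i* p (pickle (m, i, false))).
  have c1 := vcv (m, i, true); have c2 := vcv (m, i, false).
  apply: (ccvg_squeeze (b := fun n => `|val (m, i, true) (sigma n) - p (pickle (m, i, true))| +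
    `|val (m, i, false) (sigma n) - p (pickle (m, i, false))|)).
    by move=> n; apply: le_trans (normc_le_ReIm _) _; rewrite ReD ImD ReN ImN.
  by rewrite -[X in _ --> X](addr0 0); apply: cvgD; apply/norm_cvg0P/subr_cvg0.
exists ((signed_sqrt_abs V x)%:C * l).
rewrite (_ : (fun n => _) = (fun n => (signed_sqrt_abs V x)%:C * cintegral (fun y => h y * F (sigma n) y))).
  exact: ccvgMl.
by apply/funext => n; rewrite TE cintegralZl//; exact: cintegrableM_L2.
Qed.

(** Cauchy-Schwarz for |p|^(s/2) H and |p|^(-s/2) G. *)
Lemma freq_pairing (H G : R -> R[i]) : cmeasurable H -> cmeasurable G ->
  (\int[mu]_p (`|p| `^ s * normc (H p) ^+ 2)%:E < +oo)%E ->
  (\int[mu]_p (`|p| `^ (- s) * normc (G p) ^+ 2)%:E < +oo)%E ->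
  cintegrable (fun p => (H p)^*%C * G p) /\
  normc (cintegral (fun p => (H p)^*%C * G p)) ^+ 2 <=
  fine (\int[mu]_p (`|p| `^ s * normc (H p) ^+ 2)%:E)%E *
  fine (\int[mu]_p (`|p| `^ (- s) * normc (G p) ^+ 2)%:E)%E.
Proof.
move=> mH mG E1 E2.
pose a p := `|p| `^ (s / 2) * normc (H p); pose b p := `|p| `^ (- (s / 2)) * normc (G p).
have ma : measurable_fun [set: R] a by rewrite /a; cmeas.
have mb : measurable_fun [set: R] b by rewrite /b; cmeas.
have a0 p : 0 <= a p by rewrite mulr_ge0 ?powR_ge0 ?normc_ge0.
have b0 p : 0 <= b p by rewrite mulr_ge0 ?powR_ge0 ?normc_ge0.
have ea p : a p ^+ 2 = `|p| `^ s * normc (H p) ^+ 2.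
  by rewrite /a exprMn powR_sqr; congr (_ `^ _ * _); field.
have eb p : b p ^+ 2 = `|p| `^ (- s) * normc (G p) ^+ 2.
  by rewrite /b exprMn powR_sqr; congr (_ `^ _ * _); field.
have ab : (\int[mu]_p (normc ((H p)^*%C * G p))%:E = \int[mu]_p (a p * b p)%:E)%E.
  apply: ae_eq_lint; [by cmeas | by cmeas | | |].
  - by move=> p; rewrite lee_fin normc_ge0.
  - by move=> p; rewrite lee_fin mulr_ge0.
  - apply: ae_imp (ae_neq 0) _ => p p0; rewrite normcM normc_conj /a /b; congr (_%:E).
    rewrite mulrACA -powRD; last by rewrite normr_eq0 p0 implybT.
    by rewrite subrr powRr0 mul1r.
have cs := lint_cauchy_schwarz ma mb a0 b0.
have {}cs : ((\int[mu]_p (normc ((H p)^*%C * G p))%:E) * (\int[mu]_p (normc ((H p)^*%C * G p))%:E) <=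
    (\int[mu]_p (`|p| `^ s * normc (H p) ^+ 2)%:E) * (\int[mu]_p (`|p| `^ (- s) * normc (G p) ^+ 2)%:E))%E.
  by rewrite ab; apply: le_trans cs _; under eq_integral do rewrite ea; under [X in (_ * X)%E]eq_integral do rewrite eb.
have I0 : (0 <= \int[mu]_p (normc ((H p)^*%C * G p))%:E)%E by apply: lint_ge0; nneg.
have J1 : (0 <= \int[mu]_p (`|p| `^ s * normc (H p) ^+ 2)%:E)%E.
  by apply: lint_ge0 => p; rewrite mulr_ge0 ?powR_ge0 ?sqr_ge0.
have J2 : (0 <= \int[mu]_p (`|p| `^ (- s) * normc (G p) ^+ 2)%:E)%E.
  by apply: lint_ge0 => p; rewrite mulr_ge0 ?powR_ge0 ?sqr_ge0.
have f1 : (\int[mu]_p (`|p| `^ s * normc (H p) ^+ 2)%:E)%E \is a fin_num by rewrite ge0_fin_numE.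
have f2 : (\int[mu]_p (`|p| `^ (- s) * normc (G p) ^+ 2)%:E)%E \is a fin_num by rewrite ge0_fin_numE.
have fi : cintegrable (fun p => (H p)^*%C * G p).
  apply/cintegrableP; split; first by cmeas.
  rewrite ltNge leye_eq; apply/negP => /eqP inf; move: cs.
  by rewrite inf mulyy leye_eq -(fineK f1) -(fineK f2) -EFinM.
split => //; rewrite -lee_fin [(fine _ * _)%:E]EFinM !fineK//.
apply: le_trans cs; apply: le_trans (normc_cintegral_sqr_le _) _; last exact: lexx.
exact: cintegrable_meas fi.
Qed.

Let HS := fine (\int[mu]_x L2sqr (K x))%E.

Let HS_ge0 : 0 <= HS.
Proof. by apply: fine_ge0; apply: integral_ge0 => x _; exact: L2sqr_ge0. Qed.

Let HS_fin : (\int[mu]_x L2sqr (K x))%E \is a fin_num.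
Proof.
rewrite ge0_fin_numE; first exact: birman_schwinger_hs.
by apply: integral_ge0 => x _; exact: L2sqr_ge0.
Qed.

Let mKrow : measurable_fun [set: R] (fun x => L2sqr (K x)).
Proof. by apply: (meas_lint (F := fun x y => normc (K x y) ^+ 2)); [have h := mK; cmeas | nneg]. Qed.

Lemma cintegrable_sqrt_abs_mul (k : R -> R[i]) : L2 k ->
  cintegrable (fun x => toC (sqrt_abs V) x * k x).
Proof. by move=> kL; apply: cintegrableM_L2 => //; exact: sqrt_abs_L2. Qed.

(** The Riesz energy of |V|^(1/2) k is the quadratic form of the Birman-Schwinger
    kernel, which is Hilbert-Schmidt, in absolute value. *)
Lemma birman_schwinger_energy (k : R -> R[i]) : L2 k ->
  (\int[mu]_p (`|p| `^ (- s) * normc (fourier (fun x => toC (sqrt_abs V) x * k x) p) ^+ 2)%:E <=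
   ((1 + HS) * fine (L2sqr k))%:E)%E.
Proof.
move=> kL; have mo := meas_sqrt_abs; have mk := L2_meas kL; have hK := mK.
have o0 := sqrt_abs_ge0; have r0 z := rker_ge0 s0 s1 z.
apply: le_trans (riesz_energy s0 s1 (cintegrable_sqrt_abs_mul kL)) _.
have nf x : normc (toC (sqrt_abs V) x * k x) = sqrt_abs V x * normc (k x).
  by rewrite normcM normc_real ger0_norm.
have mL : measurable_fun [set: R] (fun x => (\int[mu]_y (normc (K x y) * normc (k y))%:E)%E).
  by apply: (meas_lint (F := fun x y => normc (K x y) * normc (k y))); [cmeas | nneg].
have mKx x : cmeasurable (K x).
  by apply: (cmeas_comp (e := fun y : R => (x, y)) hK); exact: measurable_pair1.
have L0 := L2sqr_ge0 k.
have mC : measurable_fun [set: R] (fun x => (L2sqr (K x) * L2sqr k)%E).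
  by apply: emeasurable_funM; [exact: mKrow | exact: measurable_cst].
have -> : (\int[mu]_x \int[mu]_y (normc (toC (sqrt_abs V) x * k x) * rker s (x - y) * normc (toC (sqrt_abs V) y * k y))%:E
    = \int[mu]_x ((normc (k x))%:E * \int[mu]_y (normc (K x y) * normc (k y))%:E))%E.
  apply: eq_integral => x _; have := mKx x => mKx'.
  rewrite -lintZ ?normc_ge0//; [|by cmeas|nneg].
  by apply: eq_integral => y _; rewrite !nf normK; congr (_%:E); ring.
apply: (@le_trans _ _ (\int[mu]_x ((normc (k x) ^+ 2)%:E + L2sqr (K x) * L2sqr k))%E).
  apply: ae_le_lint.
  - by apply: emeasurable_funM => //; cmeas.
  - apply: emeasurable_funD; first by cmeas.
    exact: mC.
  - by move=> x; apply: mule_ge0; [rewrite lee_fin normc_ge0 | apply: lint_ge0; nneg].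
  - by move=> x; apply: adde_ge0; [rewrite lee_fin sqr_ge0 | apply: mule_ge0 => //; exact: L2sqr_ge0].
  - have ae1 : {ae mu, forall x, L2sqr (K x) < +oo}%E.
      have : mu.-integrable setT (fun x => L2sqr (K x)).
        apply/integrableP; split => //.
        rewrite (_ : (fun _ => _) = (fun x => L2sqr (K x))); first exact: birman_schwinger_hs.
        by apply/funext => x; rewrite gee0_abs// L2sqr_ge0.
      move=> /(integrable_ae measurableT) ae1; apply: ae_imp ae1 _ => x /(_ Logic.I) fx.
      by rewrite -ge0_fin_numE// L2sqr_ge0.
    apply: ae_imp ae1 _ => x Kx; have KL : L2 (K x) by apply/L2P.
    have cs := lint_cauchy_schwarz (f := fun y => normc (K x y)) (g := fun y => normc (k y))
      (meas_normc (mKx x)) (meas_normc mk) (fun y => normc_ge0 _) (fun y => normc_ge0 _).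
    rewrite -/(L2sqr (K x)) -/(L2sqr k) in cs.
    have J0 : (0 <= \int[mu]_y (normc (K x y) * normc (k y))%:E)%E by apply: lint_ge0; nneg.
    have Jf : (\int[mu]_y (normc (K x y) * normc (k y))%:E)%E \is a fin_num.
      rewrite ge0_fin_numE//; apply: le_lt_trans (lint_mulL2_le (mKx x) mk) _.
      by rewrite lte_add_pinfty// L2_lty.
    move: cs; rewrite -(fineK Jf) -(fineK (L2_fin KL)) -(fineK (L2_fin kL)) -!EFinM -EFinD !lee_fin.
    have aux (J P n : R) : J * J <= P -> n * J <= n ^+ 2 + P.
      move=> hP; have := sqr_ge0 (n - J); rewrite sqrrB.
      by have := sqr_ge0 n; have := sqr_ge0 J; lra.
    exact: aux.
rewrite ge0_integralD//; last 3 first.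
- by move=> x _; rewrite lee_fin sqr_ge0.
- by cmeas.
- by move=> x _; apply: mule_ge0 => //; exact: L2sqr_ge0.
rewrite ge0_integralZr//; last by move=> x _; exact: L2sqr_ge0.
rewrite -/(L2sqr k) mulrDl mul1r EFinD EFinM fineK ?L2_fin//.
by rewrite /HS fineK.
Qed.

Lemma fourierL2_unique (h H H' : R -> R[i]) : L2 h -> is_fourierL2 h H -> is_fourierL2 h H' ->
  {ae mu, forall p, H p = H' p}.
Proof.
move=> hL hH hH'; have HL : L2 H by case: hH.
have HL' : L2 H' by case: hH'.
have mH := L2_meas HL; have mH' := L2_meas HL'.
have tL n := L2_fourier (cintegrable_trunc n hL) (L2_trunc n hL).
have c1 := is_fourierL2_cvg hH; have c2 := is_fourierL2_cvg hH'.
have z : L2sqr (fun p => H p - H' p) = 0%E.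
  apply/eqP; rewrite eq_le L2sqr_ge0 andbT.
  have c3 : (fun n => 2%:E * (L2sqr (fun p => (fourier (trunc n h) p - H' p)%R) +
      L2sqr (fun p => (fourier (trunc n h) p - H p)%R)))%E @ \oo --> 0%E.
    rewrite -(mule0 2%:E); apply: cvgeZl => //.
    by rewrite -[X in _ --> X](adde0 0%E); apply: cvgeD.
  apply: (cvge_to_ge c3); apply: nearW => n; move: (fourier (trunc n h)) (tL n) => a aL.
  have ma := L2_meas aL.
  have -> : L2sqr (fun p => a p - H p) = L2sqr (fun p => - (a p - H p)).
    by apply: eq_integral => p _; rewrite normc_opp.
  rewrite (_ : (fun p => H p - H' p) = (fun p => (a p - H' p) + - (a p - H p))).
    by apply: L2sqrD_le; cmeas.
  by apply/funext => p; rewrite [in RHS]opprB [RHS]addrC addrA subrK.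
have mD : measurable_fun [set: R] (fun p => (normc (H p - H' p) ^+ 2)%:E) by cmeas.
have := (ae_eq_integral_abs mu measurableT mD).1 => ae0.
apply: ae_imp (ae0 _) _.
  rewrite -[RHS]z; apply: eq_integral => p _; rewrite gee0_abs// lee_fin; exact: sqr_ge0.
move=> p /(_ Logic.I) [] /eqP; rewrite sqrf_eq0 => /eqP/normc_eq0 /eqP.
by rewrite subr_eq0 => /eqP.
Qed.

Lemma frequency_energy_lty (h H : R -> R[i]) : sobolev (s / 2) h -> is_fourierL2 h H ->
  (\int[mu]_p (`|p| `^ s * normc (H p) ^+ 2)%:E < +oo)%E.
Proof.
move=> [hL [H0 [hH0 fin]]] hH; apply: le_lt_trans fin.
have mH : cmeasurable H by apply: L2_meas; case: hH.
have mH0 : cmeasurable H0 by apply: L2_meas; case: hH0.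
apply: ae_le_lint; [by cmeas | by cmeas | | |].
- by move=> p; rewrite lee_fin mulr_ge0 ?powR_ge0 ?sqr_ge0.
- by move=> p; rewrite lee_fin mulr_ge0 ?powR_ge0 ?sqr_ge0.
apply: ae_imp (fourierL2_unique hL hH hH0) _ => p ->; rewrite lee_fin.
apply: ler_wpM2r; first exact: sqr_ge0.
rewrite -powR_sqr_half; apply: ge0_ler_powR.
- by have := s0; lra.
- by rewrite nnegrE sqr_ge0.
- by rewrite nnegrE addr_ge0 ?sqr_ge0.
- by rewrite lerDr.
Qed.

(** Localized copies of a square-integrable function times |V|^(1/2): bounded and
    compactly supported, so that Parseval's identity applies to them. *)
Definition cutoff (k : R -> R[i]) (n : nat) : R -> R[i] := fun x =>
  if (`|x| <= n%:R) && ((normc (k x) <= n%:R) && (sqrt_abs V x <= n%:R)) then k x else 0.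

Lemma cutoff_meas k n : cmeasurable k -> cmeasurable (cutoff k n).
Proof. by move=> mk; have mo := meas_sqrt_abs; rewrite /cutoff; cmeas. Qed.

Lemma cutoff_le k n x : normc (cutoff k n x) <= normc (k x).
Proof. by rewrite /cutoff; case: ifP => // _; rewrite normc0 normc_ge0. Qed.

Lemma cutoff_eq k x : \forall n \near \oo, cutoff k n x = k x.
Proof.
near=> n; rewrite /cutoff ifT//.
have n1 : `|x| <= n%:R by near: n; exact: nbhs_infty_ger.
have n2 : normc (k x) <= n%:R by near: n; exact: nbhs_infty_ger.
have n3 : sqrt_abs V x <= n%:R by near: n; exact: nbhs_infty_ger.
by rewrite n1 n2 n3.
Unshelve. all: by end_near. Qed.

Lemma cutoff_mul_bounded k n x : normc (toC (sqrt_abs V) x * cutoff k n x) <= n%:R * n%:R.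
Proof.
rewrite normcM normc_real (ger0_norm (sqrt_abs_ge0 x)) /cutoff.
case: ifP => [/and3P[_ h1 h2]|_]; last by rewrite normc0 mulr0 mulr_ge0.
by apply: ler_pM => //; [exact: sqrt_abs_ge0 | exact: normc_ge0].
Qed.

Lemma cutoff_L2 k n : L2 k -> L2 (cutoff k n).
Proof.
by move=> kL; apply: (L2_le _ kL (cutoff_le k n)); exact: cutoff_meas (L2_meas kL).
Qed.

(** Membership in the form domain makes |V|^(1/2) h square integrable: testing h
    against |V| h on bounded regions and passing to frequencies bounds the local
    integrals of |V||h|^2 by their own square roots. *)
Lemma sobolev_sqrt_abs_L2 (h : R -> R[i]) : sobolev (s / 2) h ->
  L2 (fun x => toC (sqrt_abs V) x * h x).
Proof.
move=> hs2; have hL : L2 h by case: hs2.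
have [H hH] := fourierL2_exists hL.
have mH : cmeasurable H by apply: L2_meas; case: hH.
have E1 := frequency_energy_lty hs2 hH.
have mh := L2_meas hL; have mo := meas_sqrt_abs.
pose E := fine (\int[mu]_p (`|p| `^ s * normc (H p) ^+ 2)%:E)%E.
have E0 : 0 <= E by apply: fine_ge0; apply: lint_ge0 => p; rewrite mulr_ge0 ?powR_ge0 ?sqr_ge0.
have mt n := cutoff_meas n mh.
pose k n x := toC (sqrt_abs V) x * cutoff h n x.
have ktr n x : normc (k n x) <= n%:R * normc (trunc n h x).
  rewrite normcM normc_real (ger0_norm (sqrt_abs_ge0 x)) /cutoff /trunc.
  have [xn|xn] := boolP (`|x| <= n%:R); last by rewrite andFb !normc0 !mulr0.
  rewrite andTb.
  case: ifP => [/andP[h1 h2]|_]; last by rewrite normc0 mulr0 mulr_ge0 ?normc_ge0.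
  by apply: ler_wpM2r; [exact: normc_ge0 | exact: h2].
have kL n : L2 (k n).
  have tL := L2_trunc n hL; have mtr := L2_meas tL.
  apply/L2P; split; first by rewrite /k /toC; have := mt n => ?; cmeas.
  apply: (@le_lt_trans _ _ (\int[mu]_x (n%:R ^+ 2 * normc (trunc n h x) ^+ 2)%:E)%E).
    apply: le_lint; [by rewrite /k /toC; have := mt n => ?; cmeas | by cmeas | nneg |] => x.
    by rewrite -exprMn ler_sqr ?nnegrE ?mulr_ge0 ?normc_ge0.
  by apply: lintZ_lty; [exact: sqr_ge0 | cmeas | nneg | exact: L2_lty].
pose g n x := toC (sqrt_abs V) x * k n x.
have gi n : cintegrable (g n) by exact: cintegrable_sqrt_abs_mul.
have gM n x : normc (g n x) <= n%:R * (n%:R * n%:R).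
  rewrite /g /k normcM normc_real (ger0_norm (sqrt_abs_ge0 x)) /cutoff.
  case: ifP => [/and3P[_ h1 h2]|_]; last by rewrite mulr0 normc0 mulr0 !mulr_ge0.
  rewrite normcM normc_real (ger0_norm (sqrt_abs_ge0 x)).
  apply: ler_pM => //; [exact: sqrt_abs_ge0 | by rewrite mulr_ge0 ?normc_ge0 ?sqrt_abs_ge0 |].
  by apply: ler_pM => //; [exact: sqrt_abs_ge0 | exact: normc_ge0].
(* Pairing h with |V| h cut off gives the square integral of k n, while the two energies
   bound its square by a multiple of itself. *)
have bound n : fine (L2sqr (k n)) <= E * (1 + HS).
  have e2 := birman_schwinger_energy (kL n).
  have e2fin : (\int[mu]_p (`|p| `^ (- s) * normc (fourier (g n) p) ^+ 2)%:E < +oo)%E.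
    by apply: le_lt_trans e2 _; rewrite ltry.
  have mG := cmeas_fourier (cintegrable_meas (gi n)).
  have [_ cs] := freq_pairing mH mG E1 e2fin.
  rewrite (plancherel_pairing hL hH (gi n) (gM n)) in cs.
  have I0 : 0 <= fine (L2sqr (k n)) by rewrite fine_ge0// L2sqr_ge0.
  have eI : cintegral (fun x => (h x)^*%C * g n x) = (fine (L2sqr (k n)))%:C.
    rewrite /L2sqr -[fine _]/(\int[mu]_x (normc (k n x) ^+ 2))%R -cintegral_real.
    apply: eq_cintegral => x; rewrite /g /k /cutoff; case: ifP => _; last first.
      by rewrite !mulr0 normc0 expr0n.
    rewrite normcM exprMn normc_real realCM -mul_conj real_normK ?num_real// expr2 realCM /toC.
    ring.
  rewrite eI normc_real (ger0_norm I0) in cs.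
  have {}cs : fine (L2sqr (k n)) ^+ 2 <= E * ((1 + HS) * fine (L2sqr (k n))).
    apply: le_trans cs _; rewrite ler_wpM2l// -lee_fin fineK// ge0_fin_numE//.
    by apply: lint_ge0 => p; rewrite mulr_ge0 ?powR_ge0 ?sqr_ge0.
  have [z|nz] := eqVneq (fine (L2sqr (k n))) 0.
    by rewrite z mulr_ge0// addr_ge0.
  have p0 : 0 < fine (L2sqr (k n)) by rewrite lt_neqAle eq_sym nz.
  by rewrite -(ler_pM2r p0) -expr2 -mulrA.
have mvh : cmeasurable (fun x => toC (sqrt_abs V) x * h x) by rewrite /toC; cmeas.
apply/L2P; split => //.
apply: (@le_lt_trans _ _ (E * (1 + HS))%:E); last by rewrite ltry.
apply: (lint_fatou (g_ := fun n x => normc (k n x) ^+ 2)).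
- by move=> n; have := L2_meas (kL n) => ?; cmeas.
- by cmeas.
- by nneg.
- by nneg.
- apply: ae_all => x; apply: cvg_near_cst.
  by apply: filterS (cutoff_eq h x) => n e; rewrite /k e.
- by move=> n; have := bound n; rewrite -lee_fin fineK ?L2_fin.
Qed.

Lemma cutoff_cvg (k : R -> R[i]) : L2 k ->
  (fun n => L2sqr (fun x => cutoff k n x - k x)) @ \oo --> 0%E.
Proof.
move=> kL; have /L2P[mk ki] := kL.
have [|||||||_ + _] := @lint_dominated_cvg R (fun n x => normc (cutoff k n x - k x) ^+ 2) (fun=> 0)
    (fun x => normc (k x) ^+ 2).
- by move=> n; have := cutoff_meas n mk => mt; cmeas.
- by meas.
- by cmeas.
- by nneg.
- exact: ki.
- apply: ae_all => x; apply: cvg_near_cst; apply: filterS (cutoff_eq k x) => n ->.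
  by rewrite subrr normc0 expr0n.
- apply: ae_all => x n; rewrite ger0_norm ?sqr_ge0// /cutoff; case: ifP => _.
    by rewrite subrr normc0 expr0n sqr_ge0.
  by rewrite sub0r normc_opp.
move=> cv.
rewrite (_ : (fun n => L2sqr _) =
    (fun n => \int[mu]_x `|normc (cutoff k n x - k x) ^+ 2 - 0|%:E)%E); first exact: cv.
apply/funext => n; apply: eq_integral => x _.
by rewrite subr0 ger0_norm ?sqr_ge0.
Qed.

(** Parseval's identity between the form domain and |V|^(1/2) L^2, by density of
    the bounded compactly supported functions. *)
Lemma form_pairing (h H k : R -> R[i]) : sobolev (s / 2) h -> is_fourierL2 h H -> L2 k ->
  let f := fun x => toC (sqrt_abs V) x * k x in
  cintegrable (fun x => (h x)^*%C * f x) /\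
  cintegral (fun p => (H p)^*%C * fourier f p) = cintegral (fun x => (h x)^*%C * f x).
Proof.
move=> hS hH kL f; have hL : L2 h by case: hS.
have vhL := sobolev_sqrt_abs_L2 hS.
have HL : L2 H by case: hH.
have mH := L2_meas HL; have mh := L2_meas hL; have mk := L2_meas kL; have mo := meas_sqrt_abs.
have E1 := frequency_energy_lty hS hH.
have mf : cmeasurable f by rewrite /f /toC; cmeas.
have fi : cintegrable f := cintegrable_sqrt_abs_mul kL.
have e x : (h x)^*%C * f x = (toC (sqrt_abs V) x * h x)^*%C * k x.
  by rewrite /f /toC conj_mul conjc_real mulrCA mulrA.
have hfi : cintegrable (fun x => (h x)^*%C * f x).
  have := cintegrableM_L2 (L2_conj vhL) kL.
  by congr cintegrable; apply/funext => x; rewrite e.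
split => //; pose fn n x := toC (sqrt_abs V) x * cutoff k n x.
have cL n := cutoff_L2 n kL.
have fni n : cintegrable (fn n) by exact: cintegrable_sqrt_abs_mul.
have dL n : L2 (fun x => cutoff k n x - k x) by exact: L2B.
pose E := fine (\int[mu]_p (`|p| `^ s * normc (H p) ^+ 2)%:E)%E.
have E0 : 0 <= E by apply: fine_ge0; apply: lint_ge0 => p; rewrite mulr_ge0 ?powR_ge0 ?sqr_ge0.
have fr (q : R -> R[i]) : L2 q -> cintegrable (fun p => (H p)^*%C * fourier (fun x => toC (sqrt_abs V) x * q x) p) /\
    normc (cintegral (fun p => (H p)^*%C * fourier (fun x => toC (sqrt_abs V) x * q x) p)) ^+ 2 <=
    E * ((1 + HS) * fine (L2sqr q)).
  move=> qL; have e2 := birman_schwinger_energy qL.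
  have qi := cintegrable_sqrt_abs_mul qL.
  have mG := cmeas_fourier (cintegrable_meas qi).
  have e2fin : (\int[mu]_p (`|p| `^ (- s) * normc (fourier (fun x => toC (sqrt_abs V) x * q x) p) ^+ 2)%:E < +oo)%E.
    by apply: le_lt_trans e2 _; rewrite ltry.
  have [i cs] := freq_pairing mH mG E1 e2fin; split => //.
  apply: le_trans cs _; rewrite ler_wpM2l// -lee_fin fineK// ge0_fin_numE//.
  by apply: lint_ge0 => p; rewrite mulr_ge0 ?powR_ge0 ?sqr_ge0.
have c2 : ccvg (fun n => cintegral (fun x => (h x)^*%C * fn n x)) (cintegral (fun x => (h x)^*%C * f x)).
  apply: (cdominated_cvg (g := fun x => normc ((h x)^*%C * f x)) _ _ _ _ _ _ _).2.
  - by move=> n; have := cintegrable_meas (fni n) => ?; cmeas.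
  - by cmeas.
  - by cmeas.
  - by nneg.
  - exact: cintegrable_lty hfi.
  - apply: ae_all => x; apply: ccvgMl; apply: cvg_near_cst.
    by apply: filterS (cutoff_eq k x) => n en; rewrite /fn en subrr normc0.
  - apply: ae_all => x n; rewrite !normcM; apply: ler_wpM2l; first exact: normc_ge0.
    by apply: ler_wpM2l; [exact: normc_ge0 | exact: cutoff_le].
have c1 : ccvg (fun n => cintegral (fun p => (H p)^*%C * fourier (fn n) p))
    (cintegral (fun p => (H p)^*%C * fourier f p)).
  have /fine_cvgP[_ cz] := cutoff_cvg kL.
  apply: (ccvg_squeeze (b := fun n => Num.sqrt (E * (1 + HS) * fine (L2sqr (fun x => cutoff k n x - k x))))).
    move=> n; have [i1 _] := fr _ (cL n); have [i2 _] := fr _ kL.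
    rewrite -cintegralB//.
    have -> : cintegral (fun p => (H p)^*%C * fourier (fn n) p - (H p)^*%C * fourier f p) =
        cintegral (fun p => (H p)^*%C * fourier (fun x => toC (sqrt_abs V) x * (cutoff k n x - k x)) p).
      apply: eq_cintegral => p; rewrite -mulrBr; congr (_ * _).
      have mp : measurable_fun [set: R] (fun x : R => - (p * x)) by meas.
      rewrite /fourier -mulrBr -(cintegralB (cintegrable_cis mp (fni n)) (cintegrable_cis mp fi)).
      by congr (_ * _); apply: eq_cintegral => x; rewrite -mulrBl -mulrBr.
    have [_ cs] := fr _ (dL n); have h2 := ler_wsqrtr cs.
    by rewrite sqrtr_sqr (ger0_norm (normc_ge0 _)) mulrA in h2.
  have ez : 0 = Num.sqrt (E * (1 + HS) * 0) by rewrite mulr0 sqrtr0.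
  rewrite [X in _ --> X]ez; apply: continuous_cvg; first exact: sqrt_continuous.
  exact: cvgMr.
apply: ccvg_eq_lim c1 c2 _ => n.
exact: (plancherel_pairing hL hH (fni n) (cutoff_mul_bounded k n)).
Qed.

(** Both sides pair alike with indicators of segments away from the origin, where
    |p|^(-s) is bounded: the multiplication formula for the Plancherel transform moves
    the pairing to position space, and riesz_pairing moves it back. *)
Lemma fourierL2_neg_frac_lap (f F : R -> R[i]) : cintegrable f -> L2 (neg_frac_lap s f) ->
  is_fourierL2 (neg_frac_lap s f) F ->
  {ae mu, forall p, F p = (`|p| `^ (- s))%:C * fourier f p}.
Proof.
move=> fi pL hF; have FL : L2 F by case: hF.
have mF := L2_meas FL; have mf := cintegrable_meas fi; have mff := cmeas_fourier mf.
pose D p := F p - (`|p| `^ (- s))%:C * fourier f p.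
have mD : cmeasurable D.
  by rewrite /D; move: (fourier f) mff => G mG; cmeas.
have key (a b : R) : a < b -> (0 < a) || (b < 0) ->
    cintegrable (fun p => D p * segment_fun a b p) /\
    cintegral (fun p => D p * segment_fun a b p) = 0.
  move=> ab away; pose d := Num.min `|a| `|b|.
  have d0 : 0 < d.
    rewrite lt_min !normr_gt0; case/orP: away => h.
      by rewrite (gt_eqF h) (gt_eqF (lt_trans h ab)).
    by rewrite (lt_eqF h) (lt_eqF (lt_trans ab h)).
  have dp p : a <= p <= b -> d <= `|p|.
    move=> /andP[ap pb]; rewrite ge_min; case/orP: away => h.
      by rewrite (gtr0_norm h) ger0_norm ?ap// (le_trans (ltW h)).
    by rewrite (ltr0_norm h) (ler0_norm (le_trans pb (ltW h))) lerN2 pb orbT.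
  have gi := segment_fun_cintegrable a b; have gb := segment_fun_le1 a b.
  have gL := L2_bounded gi gb.
  have wb (g : R -> R[i]) : cintegrable g -> (forall p, `|p| < d -> g p = 0) ->
      cintegrable (fun p => (`|p| `^ (- s))%:C * g p).
    move=> hg g0; pose w (p : R) : R := if d <= `|p| then `|p| `^ (- s) else 0.
    have mw : measurable_fun [set: R] w.
      rewrite /w; apply: meas_if; [by meas | by meas | exact: measurable_cst].
    have wM p : `|w p| <= d `^ (- s).
      rewrite /w; case: ifP => pd; last by rewrite normr0 powR_ge0.
      by rewrite (ger0_norm (powR_ge0 _ _)); apply: powR_antitone => //; rewrite oppr_le0 ltW// s0.
    have := cintegrable_realM mw wM hg; congr cintegrable; apply/funext => p; rewrite /w.
    by case: leP => // /g0 ->; rewrite !mulr0.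
  have gz p : `|p| < d -> segment_fun a b p = 0.
    move=> pd; rewrite /segment_fun; case: ifP => // /dp; by rewrite leNgt pd.
  pose G p := segment_fun a b (- p).
  have mg := segment_fun_cmeas a b.
  have Gi : cintegrable G.
    have [l1 l2] := (cintegrable_meas gi, cintegrable_lty gi).
    apply/cintegrableP; split; first by rewrite /G; cmeas.
    rewrite (_ : (\int[mu]_p (normc (G p))%:E)%E = (\int[mu]_p (normc (segment_fun a b p))%:E)%E)//.
    rewrite -(lint_reflect 0 (f := fun p => normc (segment_fun a b p))); [|by cmeas|by nneg].
    by apply: eq_integral => p _; rewrite sub0r.
  have Gz p : `|p| < d -> G p = 0 by rewrite -normrN; exact: gz.
  have [C [C0 hC]] := fourier_segment_decay ab.
  have GC x : normc (inv_fourier G x) <= C / (1 + `|x|) by rewrite inv_fourier_opp.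
  have wGi := wb _ Gi Gz; have wgi := wb _ gi gz.
  have [pi1 pe] := riesz_pairing hs fi Gi wGi GC.
  have e1 := plancherel_multiplication pL hF gi gL.
  have e2 : cintegral (fun p => F p * segment_fun a b p) =
      cintegral (fun p => fourier f p * ((`|p| `^ (- s))%:C * segment_fun a b p)).
    rewrite e1; transitivity (cintegral (fun x => neg_frac_lap s f x * inv_fourier G x)).
      by apply: eq_cintegral => x; rewrite inv_fourier_opp.
    rewrite pe; transitivity (cintegral (fun y => f y *
        fourier (fun p => (`|p| `^ (- s))%:C * segment_fun a b p) y)); last first.
      exact/esym/fourier_multiplication.
    apply: eq_cintegral => y; congr (_ * _).
    rewrite -(inv_fourier_opp (g := fun p => (`|p| `^ (- s))%:C * segment_fun a b p)); last by cmeas.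
    by apply: (congr1 (fun g => inv_fourier g y)); apply/funext => p; rewrite (normrN p).
  have i1 : cintegrable (fun p => F p * segment_fun a b p) by exact: cintegrableM_L2.
  have i2 : cintegrable (fun p => fourier f p * ((`|p| `^ (- s))%:C * segment_fun a b p)).
    exact: (cintegrable_bounded mff (fun p => normc_fourier_le p fi) wgi).
  have eD : (fun p => D p * segment_fun a b p) = (fun p => F p * segment_fun a b p -
      fourier f p * ((`|p| `^ (- s))%:C * segment_fun a b p)).
    have aux (u w z v : R[i]) : (u - w * z) * v = u * v - z * (w * v) by ring.
    by apply/funext => p; exact: aux.
  rewrite eD; split; first exact: cintegrableB.
  by rewrite (cintegralB i1 i2) e2; exact: subrr.
have part (P : R[i] -> R) : (P = @complex.Re R) \/ (P = @complex.Im R) ->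
    forall a b : R, a < b -> (0 < a) || (b < 0) -> {ae mu, forall p, a < p -> p < b -> P (D p) = 0}.
  move=> hP a b ab away.
  have mP : measurable_fun [set: R] (fun p => P (D p)) by case: hP => ->; cmeas.
  have eP c p : P (D p * segment_fun a c p) = if (a <= p) && (p <= c) then P (D p) else 0.
    by rewrite /segment_fun; case: ifP => _; rewrite ?mulr1 ?mulr0//; case: hP => ->.
  apply: (ae_zero_segment ab mP).
    have [/cintegrable_lty Di _] := key a b ab away.
    apply: le_lt_trans Di; have mg := segment_fun_cmeas a b.
    apply: le_lint; [by meas | by cmeas | nneg; case: ifP => // |] => p.
    rewrite -[X in X <= _](_ : `|P (D p * segment_fun a b p)| = _).
      by case: hP => ->; [exact: Re_le_normc | exact: Im_le_normc].
    by rewrite eP; case: ifP => _; rewrite ?normr0.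
  move=> c ac cb.
  have [_ z] := key a c ac ltac:(by case/orP: away => h; rewrite ?h// (lt_trans cb h) orbT).
  rewrite (_ : (\int[mu]_p (if (a <= p)%R && (p <= c)%R then P (D p) else 0))%R =
     P (cintegral (fun p => D p * segment_fun a c p))).
    by rewrite z; case: hP => ->.
  case: hP => hP; rewrite hP /cintegral /=; apply: eq_Rintegral => p _; rewrite -hP eP//.
have all (n : nat) : {ae mu, forall p, (n.+1%:R^-1 < `|p| < n.+1%:R) -> D p = 0}.
  have [->|n0] := eqVneq n 0%N.
    by apply: ae_all => p /andP[h1 h2]; move: (lt_trans h1 h2); rewrite invr1 ltxx.
  have n1 : 1 < n.+1%:R :> R by rewrite ltr1n ltnS lt0n.
  have ab : n.+1%:R^-1 < n.+1%:R :> R by apply: (lt_trans _ n1); rewrite invf_lt1 ?ltr0n.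
  have ab' : - n.+1%:R < - n.+1%:R^-1 :> R by rewrite ltrN2.
  have pp : 0 < n.+1%:R^-1 :> R by rewrite invr_gt0.
  have a1 := part _ (or_introl erefl) _ _ ab ltac:(by rewrite pp).
  have a2 := part _ (or_intror erefl) _ _ ab ltac:(by rewrite pp).
  have a3 := part _ (or_introl erefl) _ _ ab' ltac:(by rewrite [- _ < 0]oppr_lt0 pp orbT).
  have a4 := part _ (or_intror erefl) _ _ ab' ltac:(by rewrite [- _ < 0]oppr_lt0 pp orbT).
  apply: ae_imp2 (ae_and a1 a2) (ae_and a3 a4) _ => p [h1 h2] [h3 h4] /andP[l u].
  have [p0|p0] := leP 0 p.
    rewrite ger0_norm// in l u.
    by move: (h1 l u) (h2 l u); case: (D p) => x y /= -> ->.
  rewrite ltr0_norm// in l u.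
  have l' : p < - n.+1%:R^-1 by rewrite ltrNr.
  have u' : - n.+1%:R < p by rewrite ltrNl.
  by move: (h3 u' l') (h4 u' l'); case: (D p) => x y /= -> ->.
apply: ae_imp2 (ae_foralln all) (ae_neq 0) _ => p h p0.
have pn : 0 < `|p| by rewrite normr_gt0.
have : D p = 0.
  have [n hn] : exists n : nat, `|p| + `|p|^-1 < n.+1%:R.
    exists (Num.truncn (`|p| + `|p|^-1)); rewrite truncnS_gt//.
  have ip : 0 < `|p|^-1 by rewrite invr_gt0.
  apply: (h n); apply/andP; split; last by apply: le_lt_trans hn; rewrite lerDl ltW.
  rewrite invf_plt ?posrE//; apply: le_lt_trans hn; by rewrite lerDr ltW.
by rewrite /D => /eqP; rewrite subr_eq0 => /eqP.
Qed.

(** * Zero-energy resonances *)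

Section Resonance.
Variable phi : R -> R[i].
Hypothesis phiL : L2 phi.
Hypothesis phiE : ae_eq mu setT (birman_schwinger s V phi) (fun x => - phi x).

Let f := fun x : R => toC (sqrt_abs V) x * phi x.
Let psi := neg_frac_lap s f.

Let fi : cintegrable f.
Proof. exact: cintegrable_sqrt_abs_mul. Qed.

Let mf : cmeasurable f.
Proof. exact: cintegrable_meas fi. Qed.

Let mpsi : cmeasurable psi.
Proof. exact: cmeas_neg_frac_lap. Qed.

Let mVpsi : cmeasurable (fun x => toC V x * psi x).
Proof. by have mV := meas_potential; have h := mpsi; rewrite /toC; cmeas. Qed.

(** The weight of |V| is exactly what pays for the weight of |V|^(1/2) phi:
    <x>^(s-1/2) |V|^(1/2) |phi| <= <x>^(2s-1) |V| + |phi|^2. *)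
Lemma resonance_weight_lty :
  (\int[mu]_y (japanese y `^ (s - 2^-1) * normc (f y))%:E < +oo)%E.
Proof.
have [mV fin] := hV1; have h := mf; have mp := L2_meas phiL; have phif := L2_lty phiL.
have mj : measurable_fun [set: R] (@japanese R) by rewrite /japanese; meas.
apply: le_lt_trans (lintD_lty _ _ _ _ fin phif).
- apply: le_lint; [by cmeas | by cmeas | by nneg |] => x.
  rewrite /f normcM !normc_real (ger0_norm (sqrt_abs_ge0 x)) -sqrt_abs_sqr.
  have -> : 2 * s - 1 = 2 * (s - 2^-1) by field.
  rewrite -powR_sqr.
  have aux (a b c : R) : a * (b * c) <= b ^+ 2 * a ^+ 2 + c ^+ 2.
    have := sqr_ge0 (a * b - c); have := sqr_ge0 (a * b); have := sqr_ge0 c.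
    rewrite sqrrB exprMn; nra.
  exact: aux.
- by cmeas.
- by cmeas.
- by nneg.
- by nneg.
Qed.

(** The eigenvalue equation reads u psi = - phi; multiply it by |V|^(1/2). *)
Lemma resonance_equation : {ae mu, forall x, toC V x * psi x = - f x}.
Proof.
apply: ae_imp2 (riesz_ae_cintegrable hs fi) phiE _ => x ci ex.
have e : birman_schwinger s V phi x = toC (signed_sqrt_abs V) x * psi x.
  rewrite /psi /birman_schwinger /neg_frac_lap /kernel_op -(cintegralZl _ ci).
  by apply: eq_cintegral => y; rewrite /birman_schwinger_kernel /f -!mulrA.
have uv : toC V x = (sqrt_abs V x)%:C * toC (signed_sqrt_abs V) x.
  by rewrite /toC -realCM mulrC signed_sqrt_absM.
by rewrite uv -mulrA -e (ex Logic.I) mulrN.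
Qed.

Lemma potential_resonance_cintegrable : cintegrable (fun x => toC V x * psi x).
Proof.
apply: (ae_eq_cintegrable _ mVpsi _ (cintegrableN fi)).
  by have h := mf; cmeas.
by apply: ae_imp resonance_equation _ => x ->.
Qed.

Lemma resonance_moment :
  L2inner (toC (sqrt_abs V)) phi = - cintegral (fun x => toC V x * psi x).
Proof.
have -> : L2inner (toC (sqrt_abs V)) phi = cintegral f.
  by apply: eq_cintegral => x; rewrite /f /toC conjc_real.
rewrite (ae_eq_cintegral mVpsi _ resonance_equation); last by have h := mf; cmeas.
by rewrite cintegralN// opprK.
Qed.

Lemma resonance_L2loc : L2loc psi.
Proof.
split; first exact: mpsi.
move=> A cA; have [M0 [_ hM]] := compact_bounded cA.
pose M := Num.max 0 (M0 + 1).
have AM x : A x -> `|x| <= M.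
  by move=> Ax; apply: (hM M) => //; rewrite lt_max ltrDl ltr01 orbT.
have M_ge0 : 0 <= M by rewrite le_max lexx.
have /L2P[mt tfin] := L2loc_neg_frac_lap hs M_ge0 fi.
have mA : measurable A by apply: closed_measurable; exact: compact_closed cA.
apply: le_lt_trans tfin; rewrite /L2sqr.
move: mt; rewrite -/psi; set g := (fun x : R => if `|x| <= M then psi x else 0) => mg.
have -> : (\int[mu]_(x in A) (normc (psi x) ^+ 2)%:E = \int[mu]_(x in A) (normc (g x) ^+ 2)%:E)%E.
  by apply: eq_integral => x /set_mem /AM e; rewrite /g e.
by apply: ge0_subset_integral => //; [cmeas | move=> x _; rewrite lee_fin sqr_ge0].
Qed.

Lemma japanese_decay (x : R) : japanese x `^ (- 1 - s) <= 2 * (1 + `|x|)^-1.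
Proof.
have j1 := japanese_ge1 x; have j0 : 0 < japanese x by exact: lt_le_trans ltr01 j1.
have xj : `|x| <= japanese x by rewrite -sqrtr_sqr; apply: ler_wsqrtr; rewrite lerDr.
apply: (@le_trans _ _ (japanese x `^ (- 1))).
  by apply: ler_powR => //; rewrite lerBlDr lerDl ltW// s0.
rewrite (powR_inv1 (ltW j0)) ler_pdivlMr; last by rewrite ltr_pwDl.
by rewrite mulrC ler_pdivrMr//; move: xj j1; lra.
Qed.

Lemma resonance_weightedL1 : weightedL1 (fun x => japanese x `^ (- 1 - s)) psi.
Proof.
have h := mpsi; split=> //.
have mj : measurable_fun [set: R] (@japanese R) by rewrite /japanese; meas.
have dc := riesz_decay_cintegrable hs fi; have md := cintegrable_meas dc.
have := lintZ_lty (ler0n _ 2) (meas_normc md) (fun x => normc_ge0 _) (cintegrable_lty dc).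
apply: le_lt_trans; apply: le_lint; [by cmeas | by cmeas | by nneg |] => x.
rewrite normcM normc_real ger0_norm ?invr_ge0 ?addr_ge0// mulrA [leRHS]mulrC.
by apply: ler_wpM2l; [exact: normc_ge0 | exact: japanese_decay].
Qed.

Lemma powR_cancel (p : R) (z : R[i]) : p != 0 ->
  (`|p| `^ (- s))%:C * ((`|p| `^ s)%:C * z) = z.
Proof.
move=> p0; rewrite mulrA -realCM -powRD; last by rewrite normr_eq0 p0 implybT.
by rewrite addNr powRr0 mul1r.
Qed.

(** Moving the Riesz potential onto the test function undoes its fractional
    Laplacian, so that psi pairs with (-Delta)^(s/2) eta as f does with eta. *)
Lemma riesz_frac_lap_pairing eta : test_function eta ->
  cintegral (fun x => psi x * frac_lap s eta x) = cintegral (fun x => f x * eta x).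
Proof.
move=> te; pose G p := (`|p| `^ s)%:C * fourier eta p.
have Fi := test_fourier_cintegrable te; have mF := cintegrable_meas Fi.
have Gi : cintegrable G by apply: powR_decay_cintegrable => //; rewrite ?s1// ltW// s0.
have mG := cintegrable_meas Gi.
have mpG : cmeasurable (fun p => (`|p| `^ (- s))%:C * G p) by cmeas.
have pG : {ae mu, forall p, (`|p| `^ (- s))%:C * G p = fourier eta p}.
  by apply: ae_imp (ae_neq 0) _ => p p0; exact: powR_cancel.
have pGi : cintegrable (fun p => (`|p| `^ (- s))%:C * G p).
  by apply: (ae_eq_cintegrable mF mpG _ Fi); apply: ae_imp pG _ => p ->.
have [C [_ hC]] := frac_lap_decay s0 s1 te.
have [_ ->] := riesz_pairing hs fi Gi pGi hC.
apply: eq_cintegral => y; congr (_ * _); rewrite -(test_inversion te y) /inv_fourier.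
congr (_ * _); apply: ae_eq_cintegral; [|by cmeas|].
  by apply: cmeas_mul => //; apply: cmeas_cis; meas.
by apply: ae_imp pG _ => p ->.
Qed.

Lemma resonance_distributional : distributional_solution s V psi.
Proof.
split; first exact: resonance_weightedL1.
  by have [ir ii] := potential_resonance_cintegrable; split; apply: open_integrable_locally => //; exact: openT.
move=> eta te; rewrite riesz_frac_lap_pairing//.
have me := test_cmeas te; have h := mf; have h' := mVpsi; have [B hB] := test_bounded te.
have fei : cintegrable (fun x => f x * eta x).
  have := cintegrable_bounded me hB fi; congr cintegrable.
  by apply/funext => x; rewrite mulrC.
rewrite (@ae_eq_cintegral _ (fun x => toC V x * psi x * eta x) (fun x => - (f x * eta x))).
- by rewrite cintegralN// subrr.
- exact: cmeas_mul.
- by cmeas.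
- by apply: ae_imp resonance_equation _ => x ->; rewrite mulNr.
Qed.

(** Far away psi is the total mass of f times the Riesz kernel, up to a square
    integrable error, and the Riesz kernel is not square integrable. *)
Lemma resonance_L2 : L2 psi <-> L2inner (toC (sqrt_abs V)) phi = 0.
Proof.
have -> : L2inner (toC (sqrt_abs V)) phi = cintegral f.
  by apply: eq_cintegral => x; rewrite /f /toC conjc_real.
have d := L2_neg_frac_lap_sub hs fi resonance_weight_lty.
split=> [pL | f0]; last first.
  move: d; rewrite f0; congr L2; apply/funext => x; by rewrite mulr0 subr0.
apply: normc_eq0; apply/eqP; apply/negPn/negP => I0.
have := L2_lty (L2B pL d).
have -> : (fun x => psi x - (psi x - (rker s x)%:C * cintegral f)) =
    (fun x => (rker s x)%:C * cintegral f) by apply/funext => x; rewrite opprB addrC subrK.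
have I2 : 0 < normc (cintegral f) ^+ 2.
  by rewrite exprn_gt0// lt_neqAle eq_sym I0 normc_ge0.
have -> : L2sqr (fun x => (rker s x)%:C * cintegral f) =
    (\int[mu]_x (normc (cintegral f) ^+ 2 * rker s x ^+ 2)%:E)%E.
  apply: eq_integral => x _; rewrite normcM normc_real exprMn mulrC.
  by rewrite real_normK ?num_real.
have mr := meas_rker s.
rewrite lintZ; [|exact: ltW|by meas|by nneg].
by rewrite (riesz_not_L2 hs) gt0_muley.
Qed.

Lemma sobolev_weight_le (p : R) : (1 + p ^+ 2) `^ (s / 2) <= 2 + 2 * `|p| `^ s.
Proof.
have h0 := s0; have h1 := s1.
have two : (2 : R) `^ (s / 2) <= 2.
  by rewrite -[leRHS]powRr1//; apply: ler_powR; [rewrite ler1n | lra].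
have s20 : 0 <= s / 2 by rewrite divr_ge0// ltW.
have q0 := powR_ge0 `|p| s; have p2 : 0 <= p ^+ 2 := sqr_ge0 p.
have [pl|pl] := leP `|p| 1.
  apply: (@le_trans _ _ (2 `^ (s / 2))); last by move: two q0; lra.
  apply: ge0_ler_powR => //; rewrite ?nnegrE ?addr_ge0//.
  by rewrite -real_normK ?num_real//; have := exprn_ile1 2 (normr_ge0 p) pl; lra.
apply: (@le_trans _ _ ((2 * `|p| ^+ 2) `^ (s / 2))).
  apply: ge0_ler_powR => //; rewrite ?nnegrE ?addr_ge0 ?sqr_ge0// ?mulr_ge0 ?sqr_ge0//.
  by rewrite -real_normK ?num_real//; have := exprn_ege1 2 (ltW pl); lra.
rewrite powRM ?sqr_ge0// -[`|p| ^+ 2]powR_mulrn// -powRrM.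
have -> : 2%:R * (s / 2) = s by field.
by move: two q0; nra.
Qed.

(** The frequency energy |p|^s |psi^|^2 equals |p|^(-s) |f^|^2, which is integrable
    by birman_schwinger_energy. *)
Lemma resonance_sobolev : L2 psi -> sobolev (s / 2) psi.
Proof.
move=> pL; split=> //; have [F hF] := fourierL2_exists pL; exists F; split=> //.
have FL : L2 F by case: hF.
have mF := L2_meas FL; have mff := cmeas_fourier mf.
have E1 := L2_lty FL; have E2 := le_lt_trans (birman_schwinger_energy phiL) (ltry _).
have eF := fourierL2_neg_frac_lap fi pL hF.
rewrite -/f in E2; move: mff eF E2; generalize (fourier f) => Z mZ eF E2.
have m1 : measurable_fun [set: R] (fun p => normc (F p) ^+ 2) by cmeas.
have m2 : measurable_fun [set: R] (fun p => `|p| `^ (- s) * normc (Z p) ^+ 2) by cmeas.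
have n1 p : 0 <= normc (F p) ^+ 2 by exact: sqr_ge0.
have n2 p : 0 <= `|p| `^ (- s) * normc (Z p) ^+ 2 by rewrite mulr_ge0 ?powR_ge0 ?sqr_ge0.
have mm1 : measurable_fun [set: R] (fun p => 2 * normc (F p) ^+ 2) by meas.
have mm2 : measurable_fun [set: R] (fun p => 2 * (`|p| `^ (- s) * normc (Z p) ^+ 2)) by meas.
have nn1 p : 0 <= 2 * normc (F p) ^+ 2 by rewrite mulr_ge0.
have nn2 p : 0 <= 2 * (`|p| `^ (- s) * normc (Z p) ^+ 2) by rewrite mulr_ge0.
apply: le_lt_trans (lintD_lty mm1 mm2 nn1 nn2 (lintZ_lty (ler0n _ 2) m1 n1 E1)
  (lintZ_lty (ler0n _ 2) m2 n2 E2)).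
apply: ae_le_lint; [by cmeas | by apply: meas_EFin; meas | | |].
- by move=> p; rewrite lee_fin mulr_ge0 ?powR_ge0 ?sqr_ge0.
- by move=> p; rewrite lee_fin addr_ge0.
apply: ae_imp2 eF (ae_neq 0) _ => p Fp p0; rewrite lee_fin.
have -> : `|p| `^ (- s) * normc (Z p) ^+ 2 = `|p| `^ s * normc (F p) ^+ 2.
  rewrite Fp normcM normc_real (ger0_norm (powR_ge0 _ _)) exprMn powR_sqr [RHS]mulrA.
  rewrite -powRD; last by rewrite normr_eq0 p0 implybT.
  by congr (_ `^ _ * _); ring.
by rewrite mulrA -mulrDl ler_wpM2r// sobolev_weight_le.
Qed.

(** On the frequency side |p|^s psi^ = f^, and in position V psi = - f: the two
    halves of the quadratic form cancel against every h of the form domain. *)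
Lemma resonance_form_domain : L2 psi -> form_sum_domain s V psi.
Proof.
move=> pL; exists (fun=> 0); split; first exact: resonance_sobolev.
  apply/L2P; split; first exact: cmeas_cst.
  by rewrite /L2sqr; under eq_integral do rewrite normc0 expr0n; rewrite integral0.
move=> h hS; have hL : L2 h by case: hS.
have mh := L2_meas hL; have m1 := mf; have m2 := mpsi; have mV := meas_potential.
have [H0 hH0] := fourierL2_exists hL; have [hfi _] := form_pairing hS hH0 phiL.
rewrite -/f in hfi.
have mVh : cmeasurable (fun x => toC V x * ((h x)^*%C * psi x)) by rewrite /toC; cmeas.
have mhf : cmeasurable (fun x => - ((h x)^*%C * f x)) by cmeas.
have ae1 : {ae mu, forall x, toC V x * ((h x)^*%C * psi x) = - ((h x)^*%C * f x)}.
  by apply: ae_imp resonance_equation _ => x e; rewrite mulrCA e mulrN.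
split.
  by apply: (ae_eq_cintegrable mhf mVh _ (cintegrableN hfi)); apply: ae_imp ae1 _ => x ->.
move=> F H hF hH; have [_ he] := form_pairing hS hH phiL; rewrite -/f in he.
have mF : cmeasurable F by apply: L2_meas; case: hF.
have mH : cmeasurable H by apply: L2_meas; case: hH.
have mff := cmeas_fourier mf; have eF := fourierL2_neg_frac_lap fi pL hF.
have -> : cintegral (fun p => (`|p| `^ s)%:C * ((H p)^*%C * F p)) = cintegral (fun x => (h x)^*%C * f x).
  rewrite -he; apply: ae_eq_cintegral; [by cmeas | by apply: cmeas_mul => //; cmeas |].
  apply: ae_imp2 eF (ae_neq 0) _ => p Fp p0; rewrite Fp mulrCA; congr (_ * _).
  by rewrite mulrCA powR_cancel.
rewrite (ae_eq_cintegral mVh mhf ae1) cintegralN// subrr /L2inner.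
by rewrite -[LHS](@cintegral0 R); apply: eq_cintegral => x; rewrite mulr0.
Qed.

End Resonance.
End BirmanSchwinger.

Theorem theorem3p2 (R : realType) (s : R) (V : R -> R)
    (hs : 2^-1 < s < 1)
    (hV1 : weightedL1 (fun x => japanese x `^ (2 * s - 1)) (toC V))
    (hV2 : rollnik s (toC V)) :
  ((forall f : R -> R[i], L2 f ->
      kernel_converges (birman_schwinger_kernel s V) f) /\
   compact_operator (birman_schwinger s V)) /\
  (forall phi : R -> R[i],
     L2 phi ->
     ~ ae_eq (@lebesgue_measure R) setT phi (fun=> 0) ->
     ae_eq (@lebesgue_measure R) setT
       (birman_schwinger s V phi) (fun x => - phi x) ->
     let vphi := fun x : R => toC (sqrt_abs V) x * phi x in
     let psi := neg_frac_lap s vphi in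
     [/\ kernel_converges (riesz_kernel s) vphi,
         L2loc psi /\ distributional_solution s V psi,
         cintegrable (fun x => toC V x * psi x) /\
         L2inner (toC (sqrt_abs V)) phi =
           - cintegral (fun x => toC V x * psi x) &
         (L2 psi <-> L2inner (toC (sqrt_abs V)) phi = 0) /\
         (L2 psi -> form_sum_domain s V psi)]).
Proof.
split; first by split; [exact: birman_schwinger_converges | exact: birman_schwinger_compact].
move=> phi phiL _ phiE; split; [|split|split|split].
- have h := riesz_ae_cintegrable hs (cintegrable_sqrt_abs_mul hs hV1 phiL).
  by apply: ae_imp h _ => x; exact: id.
- exact: (resonance_L2loc hs hV1 phiL).
- exact: (resonance_distributional hs hV1 phiL phiE).
- exact: (potential_resonance_cintegrable hs hV1 phiL phiE).
- exact: (resonance_moment hs hV1 phiL phiE).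
- exact: (resonance_L2 hs hV1 phiL).
- exact: (resonance_form_domain hs hV1 hV2 phiL phiE).
Qed.
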